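(* Consider the problem $-\varepsilon\Delta u-bu_x+cu=f$ in $\Omega=(0,1)^2$, $u=0$ on $\partial\Omega$, with data as in the context. Assume that its solution $u$ satisfies the decomposition assumption (D) of the context with $k=3$. Let $u^h\in V^h$ be the Galerkin finite element solution with bilinear elements on the DL mesh, and let $u^I\in V^h$ be the bilinear nodal interpolant of $u$. Then there is a constant $C$ independent of $\varepsilon$ and $h$ such that $$\|u^I-u^h\|_\varepsilon\le C\,h^2|\ln\varepsilon|^{1/2}\qquad\text{and}\qquad h^2|\ln\varepsilon|^{1/2}\le C\,\frac1M|\ln\varepsilon|^{5/2},$$ where $M$ is the total number of mesh points.
   Context: **Problem.** $\Omega=(0,1)^2$; $b\in W^{1,\infty}(\Omega)$, $c\in L^\infty(\Omega)$, $b\ge\beta>0$ and $c\ge0$ on $\bar\Omega$, $c+\frac12 b_x\ge\gamma>0$ on $\Omega$, with $\beta,\gamma$ constants; $f\in L^2(\Omega)$. The parameter satisfies $0<\varepsilon\ll1$, i.e. $0<\varepsilon\le\varepsilon_0$ for a sufficiently small fixed $\varepsilon_0\in(0,1)$ independent of $h$. The functions $b,c$ do not depend on $\varepsilon$. **Assumption (D) with integer $k$.** $u=v+w_1+w_2+w_{12}$, where, with some $\delta>0$, with $E(y)=e^{-y\delta/\sqrt\varepsilon}+e^{-(1-y)\delta/\sqrt\varepsilon}$, and with constants $C$ independent of $\varepsilon$, for all $x,y\in[0,1]$ and $0\le i+j\le k$: $|\partial_x^i\partial_y^jv|\le C$, $|\partial_x^i\partial_y^jw_1|\le C\varepsilon^{-i}e^{-\beta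 x/\varepsilon}$, $|\partial_x^i\partial_y^jw_2|\le C\varepsilon^{-j/2}E(y)$, $|\partial_x^i\partial_y^jw_{12}|\le C\varepsilon^{-(i+j/2)}e^{-\beta x/\varepsilon}E(y)$; and for $0\le i+j\le k+1$, in $L^2(\Omega)$: $\|\partial_x^i\partial_y^jv\|_{0}\le C$, $\|\partial_x^i\partial_y^jw_1\|_{0}\le C\varepsilon^{-i-1/2}$, $\|\partial_x^i\partial_y^jw_2\|_{0}\le C\varepsilon^{-j/2+1/4}$, $\|\partial_x^i\partial_y^jw_{12}\|_{0}\le C\varepsilon^{-i-j/2+1/4}$. **DL (Duran–Lombardi) mesh.** Let $0<h<1$. In $x$: $x_0=0$; $x_i=ih\varepsilon$ for $1\le i\le\lceil1/h\rceil$; $x_{i+1}=x_i+hx_i$ for $\lceil1/h\rceil\le i\le M_x-2$; $x_{M_x}=1$, where $M_x$ is such that $x_{M_x-1}<1\le(1+h)x_{M_x-1}$. In $y$: $y_0=0$; $y_j=jh\sqrt\varepsilon$ for $1\le j\le\lceil1/h\rceil$; $y_{j+1}=y_j+hy_j$ for $\lceil1/h\rceil\le j\le M_y-2$; $y_{M_y}=1/2$, where $y_{M_y-1}<\frac12\le(1+h)y_{M_y-1}$; and $y_{M_y+j}=1-y_{M_y-j}$, $1\le j\le M_y$. The last interval $(x_{M_x-1},1)$ is assumed not too small compared with the previous one (its length is at least a fixed positive constant times that of the previous one); otherwise the node $x_{M_x-1}$ is removed. The same convention is used in $y$ at $1/2$, symmetrically. The mesh is the tensor product, consisting of rectangles $[x_{i-1},x_i]\times[y_{j-1},y_j]$;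 $M$ is the total number of mesh points. $V^h\subset H_0^1(\Omega)$ is the space of continuous piecewise bilinear functions on the mesh vanishing on $\partial\Omega$. **Galerkin FEM.** $a_G(w,v)=\varepsilon(\nabla w,\nabla v)+(-bw_x+cw,v)$ with the $L^2(\Omega)$ inner product; $u^h\in V^h$ satisfies $a_G(u^h,v^h)=(f,v^h)$ for all $v^h\in V^h$. **Norm.** $\|v\|_\varepsilon^2=\varepsilon\|\nabla v\|_{0,\Omega}^2+\|v\|_{0,\Omega}^2$, with $\|\cdot\|_{0,\Omega}$ the $L^2(\Omega)$ norm. *)

(* Defs.v *)
From HB Require Import structures.
From mathcomp Require Import all_boot all_order all_algebra.
From mathcomp Require Import all_classical all_reals all_analysis.

Set Implicit Arguments.
Unset Strict Implicit.
Unset Printing Implicit Defensive.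

Import Order.TTheory GRing.Theory Num.Theory.
Import numFieldNormedType.Exports.

Local Open Scope classical_set_scope.
Local Open Scope ring_scope.

Section Domain.
Variable R : realType.

Definition Omega : set (R * R) := `]0, 1[ `*` `]0, 1[.
Definition Omegabar : set (R * R) := `[0, 1] `*` `[0, 1].
Definition bdOmega : set (R * R) := Omegabar `\` Omega.

Definition leb2 := (@lebesgue_measure R \x @lebesgue_measure R)%E.

(* Classical first-order partial derivatives.  They are total functions, with
   an arbitrary value where the derivative does not exist; this is a null set
   for piecewise bilinear functions, whose weak gradient is the almost
   everywhere defined classical one. *)
Definition dx (w : R * R -> R) (p : R * R) : R :=
  derive1 (fun t : R => w (t, p.2)) p.1.
Definition dy (w : R * R -> R) (p : R * R) : R :=
  derive1 (fun t : R => w (p.1, t)) p.2.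

Definition in_Lp (q : \bar R) (g : R * R -> R) : Prop :=
  measurable_fun Omega g /\ finite_norm leb2 q (g \_ Omega).

Definition L2norm (g : R * R -> R) : \bar R :=
  ('N[leb2]_2%:E [EFin \o (g \_ Omega)])%E.

(* The pairing on Omega; a genuine (finite) integral whenever g1 * g2 is
   integrable, which is the case in all its uses below. *)
Definition inner (g1 g2 : R * R -> R) : R :=
  \int[leb2]_(p in Omega) (g1 p * g2 p).

(* C^1 functions with compact support in Omega.  A function g is a weak
   derivative of order alpha when the integration by parts formula holds
   against all test functions of class C^|alpha|, as in Gilbarg-Trudinger;
   only first-order weak derivatives are used, higher ones being iterated. *)
Definition test_fun (phi : R * R -> R) : Prop :=
  [/\ forall p : R * R, derivable (fun t : R => phi (t, p.2)) p.1 1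
                     /\ derivable (fun t : R => phi (p.1, t)) p.2 1,
      continuous phi, continuous (dx phi), continuous (dy phi)
    & exists2 K : set (R * R), compact K /\ K `<=` Omega
        & forall p, ~ K p -> phi p = 0].

Definition weak_dx (f g : R * R -> R) : Prop :=
  forall phi, test_fun phi -> inner f (dx phi) = - inner g phi.
Definition weak_dy (f g : R * R -> R) : Prop :=
  forall phi, test_fun phi -> inner f (dy phi) = - inner g phi.

(* b in W^{1,oo}(Omega), with weak partial derivatives b_x and b_y. *)
Definition in_W1oo (b b_x b_y : R * R -> R) : Prop :=
  [/\ in_Lp +oo%E b, in_Lp +oo%E b_x, in_Lp +oo%E b_y,
      weak_dx b b_x & weak_dy b b_y].

Definition ae_Omega (P : R * R -> Prop) : Prop :=
  {ae leb2, forall p, Omega p -> P p}.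

End Domain.

Arguments Omega {R}.
Arguments Omegabar {R}.
Arguments bdOmega {R}.

Section Decomposition.
Variable R : realType.

(* F i j is the derivative d_x^i d_y^j of F 0 0, where F 0 0 is of class C^k
   on the closed square (derivatives in the open square which extend
   continuously to the closed one) and belongs to H^{k+1}(Omega), the
   derivatives of order k+1 being weak ones. *)
Definition jet (k : nat) (F : nat -> nat -> R * R -> R) : Prop :=
  [/\ forall i j, (i + j <= k)%N -> {within Omegabar, continuous (F i j)},
      forall i j, (i + j < k)%N -> forall p, Omega p ->
        is_derive p.1 1 (fun t : R => F i j (t, p.2)) (F i.+1 j p)
        /\ is_derive p.2 1 (fun t : R => F i j (p.1, t)) (F i j.+1 p),
      forall i j, (i + j = k.+1)%N -> in_Lp 2%:E (F i j)
    & forall i j, (i + j = k)%N ->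
        weak_dx (F i j) (F i.+1 j) /\ weak_dy (F i j) (F i j.+1)].

(* Bound i j p bounds the derivative pointwise, up to the constant C, and
   L2bound i j bounds its L^2 norm. *)
Definition component (k : nat) (C : R) (F : nat -> nat -> R * R -> R)
    (bound : nat -> nat -> R * R -> R) (L2bound : nat -> nat -> R) : Prop :=
  [/\ jet k F,
      forall i j, (i + j <= k)%N -> forall p, Omegabar p ->
        `|F i j p| <= C * bound i j p
    & forall i j, (i + j <= k.+1)%N ->
        (L2norm (F i j) <= (C * L2bound i j)%:E)%E].

Definition layerE (delta eps y : R) : R :=
  expR (- (y * delta / Num.sqrt eps))
  + expR (- ((1 - y) * delta / Num.sqrt eps)).

Definition decomposition (k : nat) (beta delta C eps : R) (u : R * R -> R)
    : Prop :=
  exists V W1 W2 W12 : nat -> nat -> R * R -> R,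
  [/\ forall p, Omegabar p ->
        u p = V 0%N 0%N p + W1 0%N 0%N p + W2 0%N 0%N p + W12 0%N 0%N p,
      component k C V (fun _ _ _ => 1) (fun _ _ => 1),
      component k C W1
        (fun i _ p => eps `^ (- i%:R) * expR (- (beta * p.1 / eps)))
        (fun i _ => eps `^ (- i%:R - 1 / 2)),
      component k C W2
        (fun _ j p => eps `^ (- (j%:R / 2)) * layerE delta eps p.2)
        (fun _ j => eps `^ (- (j%:R / 2) + 1 / 4))
    & component k C W12
        (fun i j p => eps `^ (- (i%:R + j%:R / 2))
                      * expR (- (beta * p.1 / eps)) * layerE delta eps p.2)
        (fun i j => eps `^ (- i%:R - j%:R / 2 + 1 / 4))].

End Decomposition.

Section Mesh.
Variable R : realType.

Definition dl_K (h : R) : nat := `|Num.ceil (1 / h)|%N.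

(* Scale s is eps in the x direction and sqrt eps in the y direction. *)
Fixpoint dl_node (h s : R) (i : nat) : R :=
  if i is i'.+1 then
    if (i <= dl_K h)%N then i%:R * h * s
    else dl_node h s i' + h * dl_node h s i'
  else 0.

(* m is the index of the node placed at the end point L of the graded mesh;
   the recursion is used up to the node m - 1, which is at least the last node
   dl_K h of its uniform part. *)
Definition dl_index (h s L : R) (m : nat) : Prop :=
  [/\ (dl_K h <= m.-1)%N, (0 < m)%N,
      dl_node h s m.-1 < L & L <= (1 + h) * dl_node h s m.-1].

(* The last node m - 1 before L is dropped when the last interval is shorter
   than rho times the previous one. *)
Definition dl_kept (h s L rho : R) (m : nat) : nat :=
  if rho * (dl_node h s m.-1 - dl_node h s m.-2) <= L - dl_node h s m.-1
  then m else m.-1.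

Definition dl_graded (h s L rho : R) (m : nat) : seq R :=
  rcons (mkseq (dl_node h s) (dl_kept h s L rho m)) L.

Definition dl_x (h eps rho : R) (m : nat) : seq R :=
  dl_graded h eps 1 rho m.

(* behead removes 1/2, so that it occurs only once. *)
Definition dl_y (h eps rho : R) (m : nat) : seq R :=
  let Y := dl_graded h (Num.sqrt eps) (1 / 2) rho m in
  Y ++ [seq 1 - t | t <- behead (rev Y)].

Definition cell (X Y : seq R) (i j : nat) : set (R * R) :=
  `[X`_i, X`_i.+1] `*` `[Y`_j, Y`_j.+1].

(* The space V^h on the mesh with nodes X times Y. *)
Definition Vh (X Y : seq R) (w : R * R -> R) : Prop :=
  [/\ {within Omegabar, continuous w},
      forall i j, (i.+1 < size X)%N -> (j.+1 < size Y)%N ->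
        exists a0 a1 a2 a3 : R, forall p, cell X Y i j p ->
          w p = a0 + a1 * p.1 + a2 * p.2 + a3 * (p.1 * p.2)
    & forall p, bdOmega p -> w p = 0].

Definition interpolant (X Y : seq R) (u uI : R * R -> R) : Prop :=
  Vh X Y uI /\ forall x y, x \in X -> y \in Y -> uI (x, y) = u (x, y).

End Mesh.

Section Problem.
Variable R : realType.

Definition laplacian (u : R * R -> R) (p : R * R) : R :=
  dx (dx u) p + dy (dy u) p.

(* As u is required to have the regularity given by the decomposition, the
   equation is stated with classical derivatives, almost everywhere since c
   and f are only defined almost everywhere. *)
Definition solution (eps : R) (b c f u : R * R -> R) : Prop :=
  ae_Omega (fun p => - eps * laplacian u p - b p * dx u p + c p * u p = f p)
  /\ forall p, bdOmega p -> u p = 0.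

Definition aG (eps : R) (b c w v : R * R -> R) : R :=
  eps * (inner (dx w) (dx v) + inner (dy w) (dy v))
  + inner (fun p => - b p * dx w p + c p * w p) v.

Definition galerkin (eps : R) (b c f : R * R -> R) (X Y : seq R)
    (uh : R * R -> R) : Prop :=
  Vh X Y uh /\ forall v, Vh X Y v -> aG eps b c uh v = inner f v.

Definition energy_norm (eps : R) (w : R * R -> R) : \bar R :=
  ((eps%:E * (L2norm (dx w) ^+ 2 + L2norm (dy w) ^+ 2) + L2norm w ^+ 2)
     `^ (1 / 2))%E.

End Problem.

(* Main.v *)
Require Import Defs.
From HB Require Import structures.
From mathcomp Require Import all_boot all_order all_algebra.
From mathcomp Require Import all_classical all_reals all_analysis.
From mathcomp Require Import measurable_realfun ess_sup_inf zify ring lra.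
Import Order.TTheory GRing.Theory Num.Theory.
Import numFieldNormedType.Exports.
Local Open Scope classical_set_scope.
Local Open Scope ring_scope.

(* Let eta = u^I - u, chi = u^I - u^h.  Since b is almost everywhere of the form
   B(x,y) = d(y) + \int_0^x b_x (du Bois-Reymond), integration by parts on lines
   gives \int B Psi = - \int b_x Phi whenever Psi is the piecewise x-derivative of
   a continuous Phi vanishing at x = 0 and x = 1.  With Phi = chi^2 / 2 this yields
   coercivity, so it suffices to bound a(eta, chi) by C h^2 times the energy norm
   of chi.

   Write u = S + L, S = v + w_2, L = w_1 + w_12.  Only the convection term of S is
   delicate.  On a cell (a, a + H) the error of linear interpolation of S in x is
   S_xx (x - a)(a + H - x) / 2 + O(H^3); removing a primitive that vanishes at the
   ends of the cell leaves H^2 S_xx chi_x / 12.  As H is close to h x outside the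
   layer, H^2 may be replaced by h^2 x^2, and the resulting term is integrated by
   parts over the whole line.  The replacement fails in the last cell only, where
   it leaves J(chi) of the form h^2 \int k(y) chi(., y) dy with an average in x over
   that cell.  For h <= eps the term J is bounded by chi_x directly; for eps < h the
   part of k due to w_2 has L^2 norm O(eps^(1/4)) and is treated by a trace
   inequality.  For the part of k due to v, test with a trial function psi which
   increases linearly to the last interior node, then drops linearly to 0, times
   the interpolant of k cut off near y = 0, 1: psi_x reproduces J(chi) up to
   C h^2 ||chi||, while a(chi, psi) = a(eta, psi) is itself O(h^2).  Hence
   ||chi||^2 <= C h^2 (h^2 + ||chi||).

   No logarithm is lost in this bound; |ln eps|^(1/2) >= 1 for small eps.  The
   second estimate counts nodes: a graded mesh with ratio 1 + h starting at s has
   O(|ln s| / h) of them. *)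

Set Implicit Arguments.
Unset Strict Implicit.
Unset Printing Implicit Defensive.

(** * Bounded measurable functions *)

(** The obstacle is convection: the energy norm controls phi_x only with the factor eps^(1/2), so
    moving the derivative onto the test function and using that u^I - u is O(h^2) would cost
    eps^(-1/2). For L this is affordable, since on the graded mesh its interpolation error is at
    most a multiple of h^2 exp(- beta x / (8 eps)), a weight of L^2 norm O(eps^(1/2)). For S nothing
    decays and the gain must come from cancellation: an inverse inequality bounds H phi_x by phi, so
    terms H^3 phi_x are harmless, and only the cell mean H^2 S_xx / 12 has to be moved off phi_x
    once more. That requires a smooth substitute for H^2, which the last column lacks because the
    mesh does not tie its width to h x. A trace bound of J loses eps^(-1/4), which only w_2 can pay
    for; hence the duality argument for v. There no smallness of chi is needed, because J already
    carries h^2. Diffusion is harmless by the tensor structure: the difference between the x-slope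
    of u and u_x has zero mean in x on each cell, where phi_x is constant. *)

Section BoundedMeasurable.
Context d (T : measurableType d) (R : realType).
Implicit Types (D : set T) (f g : T -> R).

(** A class closed under ring operations and integrable on sets of finite measure; integrability
    conditions thus become syntactic closure, decided by [bmt]. *)
Definition bmeas D f :=
  measurable_fun D f /\ exists M : R, forall x, D x -> `|f x| <= M.

Lemma bmeas_cst D (k : R) : bmeas D (fun _ => k).
Proof. by split; [exact: measurable_cst | exists `|k|]. Qed.

Lemma bmeasD D f g : bmeas D f -> bmeas D g -> bmeas D (fun x => f x + g x).
Proof.
move=> [mf [A hA]] [mg [B hB]]; split; first exact: measurable_funD.
exists (A + B) => x Dx; rewrite (le_trans (ler_normD _ _))//.
by apply: lerD; [exact: hA|exact: hB].
Qed.

Lemma bmeasM D f g : bmeas D f -> bmeas D g -> bmeas D (fun x => f x * g x).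
Proof.
move=> [mf [A hA]] [mg [B hB]]; split; first exact: measurable_funM.
exists (A * B) => x Dx; rewrite normrM.
by apply: ler_pM => //; [exact: hA|exact: hB].
Qed.

Lemma bmeasN D f : bmeas D f -> bmeas D (fun x => - f x).
Proof.
move=> [mf [A hA]]; split; first exact: measurableT_comp.
by exists A => x Dx; rewrite normrN hA.
Qed.

Lemma bmeasB D f g : bmeas D f -> bmeas D g -> bmeas D (fun x => f x - g x).
Proof. by move=> bf bg; apply: bmeasD => //; exact: bmeasN. Qed.

Lemma bmeas_norm D f : bmeas D f -> bmeas D (fun x => `|f x|).
Proof.
move=> [mf [A hA]]; split; first exact: measurableT_comp.
by exists A => x Dx; rewrite normr_id hA.
Qed.

Lemma bmeasX D f n : bmeas D f -> bmeas D (fun x => f x ^+ n).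
Proof.
move=> bf; elim: n => [|n IH]; first exact: bmeas_cst.
have -> : (fun x => f x ^+ n.+1) = (fun x => f x * f x ^+ n).
  by apply/funext => x; rewrite exprS.
exact: bmeasM.
Qed.

Lemma bmeas_eq D f g : (forall x, D x -> f x = g x) -> bmeas D f -> bmeas D g.
Proof.
move=> fg [mf [A hA]]; split.
  by apply: eq_measurable_fun mf => x /set_mem Dx; rewrite fg.
by exists A => x Dx; rewrite -fg// hA.
Qed.

Context (mu : {measure set T -> \bar R}) (D : set T).
Hypotheses (mD : measurable D) (fD : (mu D < +oo)%E).

Lemma bmeas_integrable f : bmeas D f -> mu.-integrable D (EFin \o f).
Proof.
move=> [mf [A hA]]; apply: measurable_bounded_integrable => //.
exists A; split; first exact: num_real.
by move=> M AM x Dx; apply: le_trans (ltW AM); exact: hA.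
Qed.

Lemma bint_add f g : bmeas D f -> bmeas D g ->
  \int[mu]_(x in D) (f x + g x) = \int[mu]_(x in D) f x + \int[mu]_(x in D) g x.
Proof. by move=> bf bg; rewrite RintegralD//; exact: bmeas_integrable. Qed.

Lemma bint_sub f g : bmeas D f -> bmeas D g ->
  \int[mu]_(x in D) (f x - g x) = \int[mu]_(x in D) f x - \int[mu]_(x in D) g x.
Proof. by move=> bf bg; rewrite RintegralB//; exact: bmeas_integrable. Qed.

Lemma bint_scale k f : bmeas D f ->
  \int[mu]_(x in D) (k * f x) = k * \int[mu]_(x in D) f x.
Proof. by move=> bf; rewrite RintegralZl//; exact: bmeas_integrable. Qed.

Lemma bint_le f g : bmeas D f -> bmeas D g -> (forall x, D x -> f x <= g x) ->
  \int[mu]_(x in D) f x <= \int[mu]_(x in D) g x.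
Proof. by move=> bf bg fg; apply: le_Rintegral => //; exact: bmeas_integrable. Qed.

Lemma bint_abs f : bmeas D f ->
  `|\int[mu]_(x in D) f x| <= \int[mu]_(x in D) `|f x|.
Proof. by move=> bf; apply: le_normr_Rintegral => //; exact: bmeas_integrable. Qed.

Definition nrm f := Num.sqrt (\int[mu]_(x in D) (f x ^+ 2)).

Lemma nrm_ge0 f : 0 <= nrm f. Proof. exact: sqrtr_ge0. Qed.

Lemma nrm_sqr f : nrm f ^+ 2 = \int[mu]_(x in D) (f x ^+ 2).
Proof. by rewrite sqr_sqrtr// Rintegral_ge0// => x _; rewrite sqr_ge0. Qed.

(** The integral of (s f + t g)^2 is nonnegative for all s and t. The choices (P, - A^2) and (- B^2,
    P) give the claim when A or B is nonzero, and (- P, 1) forces P = 0 when both vanish. *)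
Lemma bint_cauchy_schwarz f g : bmeas D f -> bmeas D g ->
  `|\int[mu]_(x in D) (f x * g x)| <= nrm f * nrm g.
Proof.
move=> bf bg.
set P := \int[mu]_(x in D) _; set A := nrm f; set B := nrm g.
have A0 : 0 <= A by exact: nrm_ge0.
have B0 : 0 <= B by exact: nrm_ge0.
have quad (s t : R) : 0 <= s ^+ 2 * A ^+ 2 + 2 * (s * t) * P + t ^+ 2 * B ^+ 2.
  rewrite !nrm_sqr /P -!bint_scale//; do ?exact: bmeasX; do ?exact: bmeasM.
  have b1 : bmeas D (fun x => s ^+ 2 * f x ^+ 2).
    by apply: bmeasM; [exact: bmeas_cst|exact: bmeasX].
  have b2 : bmeas D (fun x => 2 * (s * t) * (f x * g x)).
    by apply: bmeasM; [exact: bmeas_cst|exact: bmeasM].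
  have b3 : bmeas D (fun x => t ^+ 2 * g x ^+ 2).
    by apply: bmeasM; [exact: bmeas_cst|exact: bmeasX].
  rewrite -bint_add// -bint_add//; last exact: bmeasD.
  apply: Rintegral_ge0 => x Dx.
  rewrite (_ : _ + _ = (s * f x + t * g x) ^+ 2) ?sqr_ge0//; ring.
rewrite -ler_sqr ?nnegrE ?mulr_ge0// real_normK ?num_real// exprMn.
have [A00|An0] := eqVneq A 0; last first.
  have := quad P (- A ^+ 2).
  have -> : P ^+ 2 * A ^+ 2 + 2 * (P * - A ^+ 2) * P + (- A ^+ 2) ^+ 2 * B ^+ 2
     = A ^+ 2 * (A ^+ 2 * B ^+ 2 - P ^+ 2) by ring.
  by rewrite pmulr_rge0 ?exprn_gt0 ?lt0r ?An0// subr_ge0.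
have [B00|Bn0] := eqVneq B 0; last first.
  have := quad (- B ^+ 2) P.
  have -> : (- B ^+ 2) ^+ 2 * A ^+ 2 + 2 * ((- B ^+ 2) * P) * P + P ^+ 2 * B ^+ 2
     = B ^+ 2 * (A ^+ 2 * B ^+ 2 - P ^+ 2) by ring.
  by rewrite pmulr_rge0 ?exprn_gt0 ?lt0r ?Bn0// subr_ge0.
have := quad (- P) 1; rewrite A00 B00; nra.
Qed.

End BoundedMeasurable.

(** * Integrals of functions that agree off a null set *)

Section NullSets.
Context d (T : measurableType d) (R : realType).
Context (mu : {measure set T -> \bar R}).
Import HBNNSimple.
Local Open Scope ereal_scope.

(* The functions need not be measurable: this is applied to derivatives which
   are arbitrary on the exceptional set. *)
Lemma integral_null_le (N : set T) (f g : T -> \bar R) :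
  measurable N -> mu N = 0 ->
  (forall x, 0 <= f x) -> (forall x, 0 <= g x) ->
  (forall x, ~ N x -> f x <= g x) ->
  \int[mu]_x f x <= \int[mu]_x g x.
Proof.
move=> mN N0 f0 g0 fg.
rewrite !ge0_integralTE//.
apply: ge_ereal_sup => _ [h hf <-].
have mC : measurable (~` N) by exact: measurableC.
(* Cutting the simple function [h] to the complement of [N] keeps its integral and makes it a
   minorant of [g] everywhere. *)
pose h' := proj_nnsfun h mC.
apply: (@le_trans _ _ (sintegral mu h')).
  rewrite -!integralT_nnsfun.
  rewrite le_eqVlt; apply/orP; left; apply/eqP; apply: ae_eq_integral => //.
  - exact/measurable_EFinP.
  - exact/measurable_EFinP.
  - exists N; split => // x /=; apply: contra_notP => Nx _.
    by rewrite /= mindicE mem_set// mulr1.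
apply: ereal_sup_ubound; exists h' => //= x.
rewrite mindicE; have [Nx|Nx] := pselect (N x).
  by rewrite memNset ?mulr0//= => /(_ Nx).
by rewrite mem_set// mulr1 (le_trans (hf x))// fg.
Qed.

Lemma ge0_integral_null_eq (N : set T) (f g : T -> \bar R) :
  measurable N -> mu N = 0 ->
  (forall x, 0 <= f x) -> (forall x, 0 <= g x) ->
  (forall x, ~ N x -> f x = g x) ->
  \int[mu]_x f x = \int[mu]_x g x.
Proof.
move=> mN N0 f0 g0 fg; apply/eqP; rewrite eq_le; apply/andP; split;
  by apply: (integral_null_le mN N0) => // x /fg ->.
Qed.

Lemma integral_null_eq (N : set T) (f g : T -> \bar R) :
  measurable N -> mu N = 0 -> (forall x, ~ N x -> f x = g x) ->
  \int[mu]_x f x = \int[mu]_x g x.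
Proof.
move=> mN N0 fg; rewrite integralE [RHS]integralE.
congr (_ - _); apply: (ge0_integral_null_eq mN N0) => // x /fg fgx.
  by rewrite !funeposE fgx.
by rewrite !funenegE fgx.
Qed.

(** This is what allows the coefficients and the classical derivatives, controlled only almost
    everywhere, to be replaced by bounded representatives inside an integral. *)
Lemma Rintegral_ae_eq (D : set T) (f g : T -> R) :
  {ae mu, forall x, D x -> f x = g x} ->
  (\int[mu]_(x in D) f x = \int[mu]_(x in D) g x)%R.
Proof.
move=> [N [mN N0 sub]]; rewrite /Rintegral; congr fine.
rewrite integral_mkcond [RHS]integral_mkcond.
apply: (integral_null_eq mN N0) => x Nx.
rewrite !patchE; case: ifPn => // /set_mem Dx; congr EFin.
by have := contra_not (sub x) Nx => /contrapT /(_ Dx).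
Qed.

End NullSets.

Section PlaneMeasurable.
Context (R : realType).
Notation mu := (@lebesgue_measure R).

(** An open set is the union of the countably many rational boxes that it contains, so it lies in
    the product sigma-algebra. *)
Lemma open_measurable2 (U : set (R * R)) : open U -> measurable U.
Proof.
move=> oU.
pose box (q : rat * rat * (rat * rat)) : set (R * R) :=
  `]ratr q.1.1, ratr q.1.2[ `*` `]ratr q.2.1, ratr q.2.2[.
have -> : U = \bigcup_(q in [set q | box q `<=` U]) box q.
  apply/seteqP; split => [[x y] Uxy|p [q /= qU]]; last exact: qU.
  have /nbhs_ballP [e /= e0 be] : nbhs (x, y) U by exact: open_nbhs_nbhs.
  have [q1 /[!in_itv]/= /andP[q1a q1b]] : exists q, ratr q \in `]x - e, x[.
    by apply: rat_in_itvoo; rewrite ltrBlDr ltrDl.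
  have [q2 /[!in_itv]/= /andP[q2a q2b]] : exists q, ratr q \in `]x, x + e[.
    by apply: rat_in_itvoo; rewrite ltrDl.
  have [q3 /[!in_itv]/= /andP[q3a q3b]] : exists q, ratr q \in `]y - e, y[.
    by apply: rat_in_itvoo; rewrite ltrBlDr ltrDl.
  have [q4 /[!in_itv]/= /andP[q4a q4b]] : exists q, ratr q \in `]y, y + e[.
    by apply: rat_in_itvoo; rewrite ltrDl.
  exists ((q1, q2), (q3, q4)) => /=.
    move=> [s t] [] /=; rewrite /box /= !in_itv/= => /andP[s1 s2] /andP[t1 t2].
    apply: be; split; rewrite /ball/= ltr_norml; apply/andP; split; lra.
  by rewrite /box; split; rewrite /= in_itv/= ?q1b ?q3b ?q2a ?q4a.
rewrite bigcup_mkcond; apply: countable_bigcupT_measurable => [|q]; first exact: countableP.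
by case: ifP => // _; exact: measurableX.
Qed.

Lemma continuous_measurable2 (f : R * R -> R) D : measurable D ->
  continuous f -> measurable_fun D f.
Proof.
move=> mD cf; apply: measurable_funTS.
apply: (measurability _ (RGenOInfty.measurableE R)) => //.
move=> _ [_ [a ->] <-]; rewrite setTI; apply: open_measurable2.
by apply: open_comp => [x _|]; [exact: cf|exact: interval_open].
Qed.

End PlaneMeasurable.

(** * Integration over the unit square *)

Section Lines.
Context (R : realType).
Notation T1 := (measurableTypeR R).
Notation T2 := (measurableTypeR R * measurableTypeR R)%type.
Notation mu := (@lebesgue_measure R).
Notation U := (`]0, 1[%classic : set R).
Implicit Types (f g : R * R -> R).

(** The same function as [leb2], typed as a measure on the product sigma-algebra so that the theory
    of integration applies to it. *)
Definition lebm2 : {measure set T2 -> \bar R} := @leb2 R.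
Notation leb2 := lebm2.

Definition bm (f : R * R -> R) := @bmeas _ T2 R Omega f.
Definition bm1 (f : R -> R) := @bmeas _ T1 R U f.

Lemma in_Omega (x y : R) : Omega (x, y) <-> (0 < x < 1 /\ 0 < y < 1).
Proof. by rewrite /Omega /= !in_itv. Qed.

Lemma mOmega : measurable (Omega : set T2).
Proof. exact: measurableX. Qed.

Lemma leb_unit : mu U = 1%E.
Proof. by rewrite lebesgue_measure_itv/= lte01 sube0. Qed.

Lemma leb2_Omega : leb2 Omega = 1%E.
Proof.
transitivity (mu U * mu U)%E; last by rewrite leb_unit mule1.
rewrite /lebm2 /Defs.leb2 /Omega; exact: product_measure1E.
Qed.

Lemma fU : (mu U < +oo)%E. Proof. by rewrite leb_unit ltry. Qed.
Lemma fOmega : (leb2 Omega < +oo)%E. Proof. by rewrite leb2_Omega ltry. Qed.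

Lemma bmeas_lineX f y : U y -> bm f -> bm1 (fun x => f (x, y)).
Proof.
move=> Uy [mf [M hM]]; split; last by exists M => x Ux; apply: hM.
move: mf => /(@measurable_restrictT _ _ _ _ _ _ mOmega).
move=> mf; apply/(measurable_restrictT _ (measurable_itv _ : measurable (U : set T1))).
rewrite (_ : _ \_ _ = (fun x => (f \_ Omega) (x, y))); last first.
  apply/funext => x; rewrite !patchE; congr (if _ then _ else _).
  by apply/idP/idP; rewrite !inE => // -[].
exact: measurable_fun_pair1.
Qed.

Lemma bmeas_lineY f x : U x -> bm f -> bm1 (fun y => f (x, y)).
Proof.
move=> Ux [mf [M hM]]; split; last by exists M => y Uy; apply: hM.
move: mf => /(@measurable_restrictT _ _ _ _ _ _ mOmega).
move=> mf; apply/(measurable_restrictT _ (measurable_itv _ : measurable (U : set T1))).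
rewrite (_ : _ \_ _ = (fun y => (f \_ Omega) (x, y))); last first.
  apply/funext => y; rewrite !patchE; congr (if _ then _ else _).
  by apply/idP/idP; rewrite !inE => // -[].
exact: measurable_fun_pair2.
Qed.

Lemma restr_integrable f : bm f ->
  leb2.-integrable setT (EFin \o (f \_ Omega)).
Proof.
move=> bf; have := bmeas_integrable mOmega fOmega bf.
move=> /(integrable_mkcond _ mOmega).1.
by rewrite restrict_EFin.
Qed.

Lemma EFin_bint d (T : measurableType d) (m : {measure set T -> \bar R}) D (f : T -> R) :
  measurable D -> (m D < +oo)%E -> bmeas D f ->
  (\int[m]_(x in D) (f x)%:E = (\int[m]_(x in D) f x)%R%:E)%E.
Proof.
move=> mD fD bf; rewrite /Rintegral fineK//.
exact/integrable_fin_num/bmeas_integrable.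
Qed.

Lemma fubiniX f : bm f ->
  (\int[leb2]_(p in Omega) (f p)%:E =
   \int[mu]_(y in U) (\int[mu]_(x in U) f (x, y))%R%:E)%E.
Proof.
move=> bf; rewrite integral_mkcond restrict_EFin.
rewrite -(integral21_prod_meas1 (restr_integrable bf)) [RHS]integral_mkcond.
apply: eq_integral => y _; rewrite /fubini_G !patchE; case: ifPn.
  move=> /set_mem Uy; rewrite -EFin_bint//; last 2 first.
  - exact: fU.
  - exact: bmeas_lineX.
  rewrite [RHS]integral_mkcond; apply: eq_integral => x _.
  rewrite /= !patchE; case: ifPn => [/set_mem [Ux _]|nU]; first by rewrite mem_set.
  by rewrite memNset// => Ux; move: nU; rewrite mem_set.
move=> nU; rewrite integral0_eq// => x _ /=; rewrite patchE memNset//.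
by move=> [_ /= Uy]; move: nU; rewrite mem_set.
Qed.

Lemma fubiniY f : bm f ->
  (\int[leb2]_(p in Omega) (f p)%:E =
   \int[mu]_(x in U) (\int[mu]_(y in U) f (x, y))%R%:E)%E.
Proof.
move=> bf; rewrite integral_mkcond restrict_EFin.
rewrite -(integral12_prod_meas1 (restr_integrable bf)) [RHS]integral_mkcond.
apply: eq_integral => x _; rewrite /fubini_F !patchE; case: ifPn.
  move=> /set_mem Ux; rewrite -EFin_bint//; last 2 first.
  - exact: fU.
  - exact: bmeas_lineY.
  rewrite [RHS]integral_mkcond; apply: eq_integral => y _.
  rewrite /= !patchE; case: ifPn => [/set_mem [_ Uy]|nU]; first by rewrite mem_set.
  by rewrite memNset// => Uy; move: nU; rewrite mem_set.
move=> nU; rewrite integral0_eq// => y _ /=; rewrite patchE memNset//.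
by move=> [Ux _]; move: nU; rewrite mem_set.
Qed.

Definition I2 f := \int[leb2]_(p in Omega) f p.
Definition I1 (f : R -> R) := \int[mu]_(x in U) f x.

Lemma I2_eq0_linesX f : bm f ->
  (forall y, U y -> I1 (fun x => f (x, y)) = 0) -> I2 f = 0.
Proof.
move=> bf f0; rewrite /I2/Rintegral fubiniX// integral0_eq// => y Uy.
by have := f0 y Uy; rewrite /I1 => ->.
Qed.

Lemma I2_eq0_linesY f : bm f ->
  (forall x, U x -> I1 (fun y => f (x, y)) = 0) -> I2 f = 0.
Proof.
move=> bf f0; rewrite /I2/Rintegral fubiniY// integral0_eq// => x Ux.
by have := f0 x Ux; rewrite /I1 => ->.
Qed.

Lemma bmeas_I1X f : bm f -> bm1 (fun y => I1 (fun x => f (x, y))).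
Proof.
move=> bf; have [mf [M hM]] := bf; split; last first.
  exists M => y Uy; rewrite /I1.
  have bl := bmeas_lineX Uy bf.
  rewrite (le_trans (bint_abs _ _ bl))//; first exact: fU.
  rewrite (le_trans (bint_le (g := fun _ => M) _ _ _ _ _))//.
  - exact: fU.
  - exact: bmeas_norm.
  - exact: bmeas_cst.
  - by move=> x Ux; apply: hM.
  - by rewrite Rintegral_cst//= leb_unit/= mulr1.
apply/measurable_EFinP.
have := measurable_fubini_G (restr_integrable bf).
move=> /(@measurable_funTS _ _ _ _ U); apply: eq_measurable_fun => y /set_mem Uy.
rewrite /= /I1 -EFin_bint//; last 2 first.
- exact: fU.
- exact: bmeas_lineX.
rewrite /fubini_G [RHS]integral_mkcond; apply: eq_integral => x _.
rewrite /= !patchE; case: ifPn => [/set_mem [Ux _]|nU]; first by rewrite mem_set.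
by rewrite memNset// => Ux; move: nU; rewrite mem_set.
Qed.

Lemma bmeas_of_lineY (g : R -> R) : bm1 g -> bm (fun p : R * R => g p.2).
Proof.
move=> [mg [M hM]]; split; last by exists M => -[x y] [/= _ Uy]; exact: hM.
move: mg => /(@measurable_restrictT _ _ _ _ _ _ (measurable_itv _ : measurable (U : set T1))) mg.
apply: (eq_measurable_fun ((g \_ U) \o snd : T2 -> R)) => [[x y] /set_mem [/= _ Uy]|].
  by rewrite patchE mem_set.
by apply: measurable_funTS; apply: measurableT_comp.
Qed.

Lemma bmeas_of_lineX (g : R -> R) : bm1 g -> bm (fun p : R * R => g p.1).
Proof.
move=> [mg [M hM]]; split; last by exists M => -[x y] [/= Ux _]; exact: hM.
move: mg => /(@measurable_restrictT _ _ _ _ _ _ (measurable_itv _ : measurable (U : set T1))) mg.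
apply: (eq_measurable_fun ((g \_ U) \o fst : T2 -> R)) => [[x y] /set_mem [/= Ux _]|].
  by rewrite patchE mem_set.
by apply: measurable_funTS; apply: measurableT_comp.
Qed.

End Lines.

Ltac bmt := repeat first [assumption | exact: bmeas_cst | apply: bmeasX | apply: bmeas_norm
  | apply: bmeasB | apply: bmeasD | apply: bmeasN | apply: bmeasM].

(** * Piecewise primitives on a mesh *)

Section Primitives.
Context (R : realType).
Notation mu := (@lebesgue_measure R).
Notation T1 := (measurableTypeR R).
Notation U := (`]0, 1[%classic : set R).
Implicit Types (f g F G Phi Psi : R -> R).

(** Continuity is asked on the whole line and differentiability only inside the cell: such pairs are
    closed under sums and products, and [nice_ftc] holds without one-sided conditions. *)
Definition nice (a b : R) f g :=
  [/\ continuous f, continuous g & forall x, a < x < b -> is_derive x 1 f (g x)].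

Lemma nice_cst a b (k : R) : nice a b (fun _ => k) (fun _ => 0).
Proof. by split=> [x|x|x _]; [exact: cvg_cst|exact: cvg_cst|exact: is_derive_cst]. Qed.

Lemma nice_id a b : nice a b (fun x => x) (fun _ => 1).
Proof. by split=> [x|x|x _]; [exact: cvg_id|exact: cvg_cst|exact: is_derive_id]. Qed.

Lemma niceD a b f g F G : nice a b f g -> nice a b F G ->
  nice a b (fun x => f x + F x) (fun x => g x + G x).
Proof.
move=> [cf cg d] [cF cG D]; split=> [x|x|x xab].
- by apply: cvgD; [exact: cf|exact: cF].
- by apply: cvgD; [exact: cg|exact: cG].
- have := d x xab; have := D x xab => dF df; exact: is_deriveD.
Qed.

Lemma niceN a b f g : nice a b f g -> nice a b (fun x => - f x) (fun x => - g x).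
Proof.
move=> [cf cg d]; split=> [x|x|x xab].
- by apply: cvgN; exact: cf.
- by apply: cvgN; exact: cg.
- have := d x xab => df; exact: is_deriveN.
Qed.

Lemma niceB a b f g F G : nice a b f g -> nice a b F G ->
  nice a b (fun x => f x - F x) (fun x => g x - G x).
Proof. by move=> nf nF; apply: niceD => //; exact: niceN. Qed.

Lemma niceM a b f g F G : nice a b f g -> nice a b F G ->
  nice a b (fun x => f x * F x) (fun x => f x * G x + F x * g x).
Proof.
move=> [cf cg d] [cF cG D]; split=> [x|x|x xab].
- by apply: cvgM; [exact: cf|exact: cF].
- by apply: cvgD; apply: cvgM; [exact: cf|exact: cG|exact: cF|exact: cg].
- have := d x xab; have := D x xab => dF df.
  exact: (@is_deriveM _ _ f F x 1 (g x) (G x)).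
Qed.

Lemma nice_eq a b f g F G : (forall x, F x = f x) -> (forall x, G x = g x) ->
  nice a b f g -> nice a b F G.
Proof. by move=> /funext -> /funext ->. Qed.

Lemma nice_sub a b a' b' f g : a <= a' -> b' <= b -> nice a b f g -> nice a' b' f g.
Proof.
move=> aa bb [cf cg d]; split=> // x /andP[ax xb]; apply: d.
by rewrite (le_lt_trans aa)//= (lt_le_trans xb).
Qed.

Lemma nice_ftc a b f g : a < b -> nice a b f g ->
  \int[mu]_(x in `]a, b[) g x = f b - f a.
Proof.
move=> ab [cf cg d].
have cgw : {within `[a, b], continuous g} by exact: continuous_subspaceT.
have ig : mu.-integrable `[a, b] (EFin \o g).
  by apply: continuous_compact_integrable => //; exact: segment_compact.
have ig' : mu.-integrable `[a, b[ (EFin \o g).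
  by apply: integrableS ig => //; apply: subset_itv; rewrite bnd_simp.
rewrite Rintegral_itv_obnd_cbnd; last first.
  by apply: integrableS ig => //; apply: subset_itv; rewrite bnd_simp.
rewrite Rintegral_itv_bndo_bndc// /Rintegral (@continuous_FTC2 _ g f)//.
- split => [x /[!in_itv]/= xab||].
  + by have := d x xab => -[].
  + by apply: cvg_at_right_filter; exact: cf.
  + by apply: cvg_at_left_filter; exact: cf.
- move=> x /[!in_itv]/= xab; have := d x xab => -[_ <-].
  by rewrite derive1E.
Qed.

Definition mesh n (x_ : nat -> R) :=
  [/\ (0 < n)%N, x_ 0%N = 0, x_ n = 1 & forall i, (i < n)%N -> x_ i < x_ i.+1].

(* Phi is continuous and piecewise C^1 on the mesh, with derivative Psi and
   nodal values v. *)
Definition pw n (x_ : nat -> R) Phi Psi (v : nat -> R) :=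
  forall i, (i < n)%N -> exists f g,
    [/\ nice (x_ i) (x_ i.+1) f g, f (x_ i) = v i, f (x_ i.+1) = v i.+1,
        forall x, x_ i <= x < x_ i.+1 -> Phi x = f x
      & forall x, x_ i < x < x_ i.+1 -> Psi x = g x].

Lemma mesh_le n x_ : mesh n x_ ->
  forall i j, (i <= j)%N -> (j <= n)%N -> x_ i <= x_ j.
Proof.
move=> [_ _ _ inc] i j ij jn; rewrite -(subnKC ij).
have : (i + (j - i) <= n)%N by rewrite subnKC.
elim: (j - i)%N => [|k IH]; first by rewrite addn0.
rewrite addnS => kn; apply: le_trans (IH (ltnW kn)) _.
exact/ltW/inc.
Qed.

Lemma mesh_01 n x_ i : mesh n x_ -> (i <= n)%N -> 0 <= x_ i <= 1.
Proof.
move=> m ile; have [n0 x0 x1 _] := m.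
by rewrite -{1}x0 -x1 !(mesh_le m).
Qed.

Lemma mesh_cell n x_ x : mesh n x_ -> 0 <= x < 1 ->
  exists2 i, (i < n)%N & x_ i <= x < x_ i.+1.
Proof.
move=> [n0 x0 x1 inc] /andP[x_ge0 xlt1].
have : exists k, (k <= n)%N && (x < x_ k) by exists n; rewrite leqnn x1.
move=> ex; case: (ex_minnP ex) => -[|k] /andP[kn xk] mink.
  by move: xk; rewrite x0 ltNge x_ge0.
exists k => //; rewrite xk andbT leNgt; apply/negP => xk'.
by have := mink k; rewrite (ltnW kn) xk' ltnn => /(_ isT).
Qed.

Lemma sub_bm1 a b f : 0 <= a -> b <= 1 -> bm1 f ->
  mu.-integrable `]a, b[ (EFin \o f).
Proof.
move=> a0 b1 bf.
have mU : measurable (U : set T1) by exact: measurable_itv.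
apply: integrableS (bmeas_integrable mU (fU R) bf) => //.
by apply: subset_itv; rewrite bnd_simp.
Qed.

Lemma itv_split a c b f : 0 <= a -> a <= c -> c <= b -> b <= 1 -> bm1 f ->
  \int[mu]_(x in `]a, b[) f x =
  \int[mu]_(x in `]a, c[) f x + \int[mu]_(x in `]c, b[) f x.
Proof.
move=> a0 ac cb b1 bf.
have [->|cb'] := eqVneq c b; first by rewrite [in X in _ + X]set_itv_ge ?bnd_simp ?ltxx// Rintegral_set0 addr0.
have cltb : c < b by rewrite lt_neqAle cb'.
have iab := sub_bm1 a0 b1 bf.
have iac : mu.-integrable `]a, c[ (EFin \o f) by apply: sub_bm1 => //; exact: le_trans b1.
rewrite [X in X + _]Rintegral_itv_bndo_bndc//.
rewrite -(@Rintegral_itvB _ f (BRight a) (BLeft b) c)//; first by rewrite addrC subrK.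
Qed.

(** Neighbouring cells share the nodal values [v], so the fundamental theorem of calculus, summed
    over the cells, telescopes. *)
Lemma pw_int n x_ Phi Psi v : mesh n x_ -> bm1 Psi -> pw n x_ Phi Psi v ->
  (forall s, U s -> \int[mu]_(x in `]0, s[) Psi x = Phi s - v 0%N) /\
  I1 Psi = v n - v 0%N.
Proof.
move=> m bP pwP; have [n0 x0 x1 inc] := m.
have cell i s : (i < n)%N -> x_ i <= s -> s <= x_ i.+1 -> forall f g,
  nice (x_ i) (x_ i.+1) f g -> (forall x, x_ i < x < x_ i.+1 -> Psi x = g x) ->
  \int[mu]_(x in `]x_ i, s[) Psi x = f s - f (x_ i).
  move=> ilt is_ si f g nf Pg.
  have [->|ne] := eqVneq s (x_ i).
    by rewrite set_itv_ge ?bnd_simp ?ltxx// Rintegral_set0 subrr.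
  have ilts : x_ i < s by rewrite lt_neqAle eq_sym ne.
  rewrite -(nice_ftc ilts (nice_sub (lexx _) si nf)); apply: eq_Rintegral => x.
  rewrite inE/= in_itv/= => /andP[ix xs]; apply: Pg.
  by rewrite ix (lt_le_trans xs).
have node k : (k <= n)%N -> \int[mu]_(x in `]0, x_ k[) Psi x = v k - v 0%N.
  elim: k => [_|k IH kn].
    by rewrite x0 set_itv_ge ?bnd_simp ?ltxx// Rintegral_set0 subrr.
  have kn' := ltnW kn.
  have [f [g [nf fk fk1 _ Pg]]] := pwP k kn.
  rewrite (@itv_split 0 (x_ k))//; last 3 first.
  - by case/andP: (mesh_01 m kn').
  - exact/ltW/inc.
  - by case/andP: (mesh_01 m kn).
  rewrite IH// (cell _ _ kn _ _ f g)//; last exact/ltW/inc.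
  by rewrite fk fk1 addrC addrA subrK.
split=> [s|]; last by rewrite /I1 -{1}x1 node.
rewrite /= in_itv/= => /andP[s0 s1].
have [|k kn /andP[ks sk]] := mesh_cell (x := s) m; first by rewrite ltW.
have [f [g [nf fk fk1 Pf Pg]]] := pwP k kn.
rewrite (@itv_split 0 (x_ k))//; last 2 first.
- by case/andP: (mesh_01 m (ltnW kn)).
- exact: ltW.
rewrite node ?(ltnW kn)// (cell _ _ kn _ (ltW sk) f g)// (Pf s) ?ks// fk.
by rewrite addrC addrA subrK.
Qed.

Lemma pw_tail n x_ Phi Psi v : mesh n x_ -> bm1 Psi -> pw n x_ Phi Psi v ->
  forall s, U s -> I1 (fun x => (s < x)%R%:R * Psi x) = v n - Phi s.
Proof.
move=> m bP pwP s Us; have [hs h1] := pw_int m bP pwP.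
have /andP[s0 s1] : 0 < s < 1 by move: Us; rewrite /= in_itv.
have split := @itv_split 0 s 1 Psi (lexx _) (ltW s0) (ltW s1) (lexx _) bP.
have -> : I1 (fun x => (s < x)%R%:R * Psi x) = \int[mu]_(x in `]s, 1[) Psi x.
  have -> : `]s, 1[%classic = U `&` `]s, +oo[%classic.
    apply/seteqP; split=> x /=; rewrite !in_itv/= ?andbT.
      by move=> /andP[sx x1]; rewrite x1 (lt_trans s0 sx).
    by move=> [/andP[x0 ->] ->].
  rewrite Rintegral_mkcondr; apply: eq_Rintegral => x _.
  rewrite patchE /=; case: ifPn; rewrite ?inE ?notin_setE /= in_itv/= andbT.
    by move=> ->; rewrite mul1r.
  by move=> /negP/negbTE ->; rewrite mul0r.
move: h1; rewrite /I1 split hs//; lra.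
Qed.

End Primitives.

Section ByParts.
Context (R : realType).
Notation mu := (@lebesgue_measure R).
Notation T1 := (measurableTypeR R).
Notation T2 := (measurableTypeR R * measurableTypeR R)%type.
Notation U := (`]0, 1[%classic : set R).
Notation leb2 := (lebm2 R).
Implicit Types (f g beta : R * R -> R).

Lemma mU1 : measurable (U : set T1). Proof. exact: measurable_itv. Qed.

Lemma I2D f g : bm f -> bm g -> I2 (fun p => f p + g p) = I2 f + I2 g.
Proof. exact: (bint_add (@mOmega R) (@fOmega R)). Qed.
Lemma I2B f g : bm f -> bm g -> I2 (fun p => f p - g p) = I2 f - I2 g.
Proof. exact: (bint_sub (@mOmega R) (@fOmega R)). Qed.
Lemma I2Z k f : bm f -> I2 (fun p => k * f p) = k * I2 f.
Proof. exact: (bint_scale (@mOmega R) (@fOmega R)). Qed.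

Lemma I2_le f g : bm f -> bm g -> (forall p, Omega p -> f p <= g p) -> I2 f <= I2 g.
Proof. exact: (bint_le (@mOmega R) (@fOmega R)). Qed.
Lemma I2_abs f : bm f -> `|I2 f| <= I2 (fun p => `|f p|).
Proof. exact: (bint_abs (@mOmega R) (@fOmega R)). Qed.
Lemma I2_eq f g : (forall p, Omega p -> f p = g p) -> I2 f = I2 g.
Proof. by move=> fg; apply: eq_Rintegral => p /set_mem /fg. Qed.

Lemma I1D (f g : R -> R) : bm1 f -> bm1 g -> I1 (fun p => f p + g p) = I1 f + I1 g.
Proof. exact: (bint_add mU1 (@fU R)). Qed.

Lemma I1Z k (f : R -> R) : bm1 f -> I1 (fun p => k * f p) = k * I1 f.
Proof. exact: (bint_scale mU1 (@fU R)). Qed.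
Lemma I1_eq (f g : R -> R) : (forall p, U p -> f p = g p) -> I1 f = I1 g.
Proof. by move=> fg; apply: eq_Rintegral => p /set_mem /fg. Qed.
Lemma I1_abs (f : R -> R) : bm1 f -> `|I1 f| <= I1 (fun p => `|f p|).
Proof. exact: (bint_abs mU1 (@fU R)). Qed.
Lemma I1_le (f g : R -> R) : bm1 f -> bm1 g -> (forall p, U p -> f p <= g p) -> I1 f <= I1 g.
Proof. exact: (bint_le mU1 (@fU R)). Qed.

Lemma I1_cst k : I1 (fun _ : R => k) = k.
Proof.
transitivity (k * fine (mu U)); last by rewrite leb_unit mulr1.
exact: (Rintegral_cst mu mU1).
Qed.

Lemma I2_cst k : I2 (fun _ : R * R => k) = k.
Proof.
transitivity (k * fine (leb2 Omega)); last by rewrite leb2_Omega mulr1.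
exact: (Rintegral_cst leb2 (@mOmega R)).
Qed.

Lemma I1_bound (f : R -> R) M : bm1 f -> (forall x, U x -> `|f x| <= M) -> `|I1 f| <= M.
Proof.
move=> bf fM; rewrite (le_trans (I1_abs bf))// -[leRHS]I1_cst.
by apply: I1_le => //; [exact: bmeas_norm|exact: bmeas_cst].
Qed.

Lemma I2_fubiniX f : bm f -> I2 f = I1 (fun y => I1 (fun x => f (x, y))).
Proof. by move=> bf; rewrite /I2/Rintegral fubiniX. Qed.

Lemma I2_fubiniY f : bm f -> I2 f = I1 (fun x => I1 (fun y => f (x, y))).
Proof. by move=> bf; rewrite /I2/Rintegral fubiniY. Qed.

Lemma I2_dct (f_ : nat -> R * R -> R) f M :
  (forall n, bm (f_ n)) -> (forall n p, Omega p -> `|f_ n p| <= M) ->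
  (forall p, Omega p -> \forall n \near \oo, f_ n p = f p) ->
  bm f /\ I2 (f_ n) @[n --> \oo] --> I2 f.
Proof.
move=> bf fM f_f.
have fM' p : Omega p -> `|f p| <= M.
  move=> Op; have [N _ hN] := f_f p Op.
  by have <- := hN N (leqnn N); exact: fM.
have cvf p : Omega p -> f_ n p @[n --> \oo] --> f p.
  by move=> Op; apply: cvg_near_cst; exact: f_f.
have mf : measurable_fun (Omega : set T2) f.
  by apply: (measurable_fun_cvg (h := f_)) => // n; have [] := bf n.
have bmf : bm f by split=> //; exists M.
split=> //.
have iM : leb2.-integrable Omega (EFin \o (fun _ => M)).
  by apply: (bmeas_integrable (@mOmega R) (@fOmega R)); exact: bmeas_cst.
have [] := @dominated_convergence _ _ _ leb2 Omega (@mOmega R)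
  (fun n => EFin \o f_ n) (EFin \o f) (EFin \o (fun _ => M)) => //.
- by move=> n; apply/measurable_EFinP; have [] := bf n.
- exact/measurable_EFinP.
- apply: aeW => p Op; apply: cvg_near_cst.
  by apply: filterS (f_f p Op) => n /= ->.
- by apply: aeW => p n Op; rewrite lee_fin fM.
move=> _ _ cvI; apply: fine_cvg.
have E := EFin_bint (@mOmega R) (@fOmega R) bmf.
by rewrite /= in cvI *; rewrite -E.
Qed.

(** The primitive in x vanishing at x = 0. The indicator keeps the domain of integration fixed,
    which suits Fubini. *)
Definition primX beta (p : R * R) := I1 (fun s => (s < p.1)%R%:R * beta (s, p.2)).

Lemma bm_lt2 : bm (fun p : R * R => (p.2 < p.1)%R%:R).
Proof.
split; last by exists 1 => p _; case: (_ < _); rewrite ?normr1 ?normr0 ?ler01.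
rewrite (_ : (fun _ => _) = (fun p : R * R => if p.2 < p.1 then 1 else 0)); last first.
  by apply/funext => p; case: (_ < _).
apply: measurable_funTS; apply: measurable_fun_ifT => //.
by apply: (@measurable_fun_ltr _ T2 R setT snd fst).
Qed.

Lemma bm_lt1 (c : R) : bm1 (fun s => (s < c)%R%:R).
Proof.
split; last by exists 1 => p _; case: (_ < _); rewrite ?normr1 ?normr0 ?ler01.
rewrite (_ : (fun _ => _) = (fun p : R => if p < c then 1 else 0)); last first.
  by apply/funext => p; case: (_ < _).
apply: measurable_funTS; apply: measurable_fun_ifT => //.
by apply: (@measurable_fun_ltr _ T1 R setT).
Qed.

Lemma bm_primX beta : bm beta -> bm (primX beta).
Proof.
move=> bb; have [mb [M hM]] := bb.
have bl y x : U y -> bm1 (fun s => (s < x)%R%:R * beta (s, y)).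
  by move=> Uy; apply: bmeasM; [exact: bm_lt1|exact: (bmeas_lineX Uy bb)].
have [[x0 y0] O0] : exists p : R * R, Omega p.
  by exists (1/2, 1/2); split; rewrite /= in_itv/=; apply/andP; split; lra.
have M0 : 0 <= M by rewrite (le_trans _ (hM _ O0)).
split; last first.
  exists M => -[x y] [/= Ux Uy]; apply: I1_bound; first exact: bl.
  move=> s Us; rewrite normrM; case: (_ < _); rewrite ?normr1 ?normr0 ?mul0r//.
  by rewrite mul1r hM.
(* Measurability in the parameter comes from Tonelli, which asks for a nonnegative integrand: [beta]
   is shifted by its bound [M], and the shift contributes only the measurable function [M * x]. *)
pose H (q : T2 * T1) : \bar R :=
  (if (q.2 < q.1.1)%R then ((fun p => beta p + M) \_ Omega) (q.2, q.1.2) else 0)%:E.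
have mH : measurable_fun setT H.
  apply/measurable_EFinP; apply: measurable_fun_ifT => //.
  - apply: (@measurable_fun_ltr _ (T2 * T1)%type R setT) => //.
    exact: measurableT_comp.
  - apply: measurableT_comp.
      apply/(measurable_restrictT _ (@mOmega R)).
      by apply: measurable_funD => //; exact: measurable_cst.
    by apply: measurable_fun_pair => //; exact: measurableT_comp.
have H0 q : (0 <= H q)%E.
  rewrite lee_fin; case: ifP => // _; rewrite patchE; case: ifPn => // /set_mem Oq.
  by have := hM _ Oq; rewrite ler_norml => /andP[]; lra.
have mF := @measurable_fun_fubini_tonelli_F _ _ _ _ _ mu _ mH H0.
have E p : Omega p -> primX beta p = fine (fubini_F mu H p) - M * I1 (fun s => (s < p.1)%R%:R).
  case: p => x y [/= Ux Uy].
  have b1 := bl y x Uy.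
  have b2 := bm_lt1 x.
  rewrite /primX /= -I1Z// /fubini_F /=.
  have -> : fine (\int[mu]_s H ((x, y), s)) = I1 (fun s => (s < x)%R%:R * beta (s, y) + M * (s < x)%R%:R).
    rewrite /I1 /Rintegral [in RHS]integral_mkcond; congr fine; apply: eq_integral => s _.
    rewrite /H /= !patchE; case: (boolP (s \in U)) => [/set_mem Us|nUs].
      by rewrite mem_set//; case: (s < x); rewrite ?mul1r ?mul0r ?mulr1 ?mulr0 ?addr0.
    rewrite memNset; first by case: ifP.
    by move=> [/= Us _]; move: nUs; rewrite mem_set.
  rewrite I1D//; last by apply: bmeasM => //; exact: bmeas_cst.
  by rewrite addrK.
apply: (eq_measurable_fun (fun p => fine (fubini_F mu H p) - M * I1 (fun s => (s < p.1)%R%:R))).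
  by move=> p /set_mem Op; rewrite E.
apply: measurable_funB.
  by apply: measurable_funTS; apply: measurableT_comp.
apply: (eq_measurable_fun (fun p => M * p.1)).
  move=> [x y] /set_mem [/= Ux _]; congr (_ * _).
  move: Ux; rewrite /= in_itv/= => /andP[x_0 x_1].
  rewrite /I1; have -> : \int[mu]_(s in U) (s < x)%R%:R = \int[mu]_(s in `]0, x[) 1.
    have -> : `]0, x[%classic = U `&` `]-oo, x[%classic.
      apply/seteqP; split=> s /=; rewrite !in_itv/=.
        by move=> /andP[-> sx]; rewrite sx (lt_trans sx).
      by move=> [/andP[-> _] ->].
    rewrite Rintegral_mkcondr; apply: eq_Rintegral => s _.
    rewrite patchE /=; case: ifPn; rewrite ?inE ?notin_setE /= in_itv/=.
      by move=> ->.
    by move=> /negP/negbTE ->.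
  rewrite Rintegral_cst//= lebesgue_measure_itv/= lte_fin x_0 mul1r.
  by rewrite -EFinB/= subr0.
by apply: measurable_funTS; apply: measurable_funM => //; exact: measurable_cst.
Qed.

(** No product rule is available because [beta] is merely bounded. Instead, [d] is constant on a
    line where [Psi] has integral 0, and exchanging the order of integration turns [primX beta]
    times [Psi] into [beta (s)] times the integral of [Psi] over x > s, which is - [Phi (s)]. *)
Lemma by_parts n x_ (d : R -> R) beta (Phi Psi : R * R -> R) (v : R -> nat -> R) :
  mesh n x_ -> bm1 d -> bm beta -> bm Phi -> bm Psi ->
  (forall y, U y -> pw n x_ (fun x => Phi (x, y)) (fun x => Psi (x, y)) (v y)) ->
  (forall y, U y -> v y 0%N = 0 /\ v y n = 0) ->
  I2 (fun p => (d p.2 + primX beta p) * Psi p) = - I2 (fun p => beta p * Phi p).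
Proof.
move=> m bd bb bPhi bPsi pwP v0.
have bd2 := bmeas_of_lineY bd.
have bB := bm_primX bb.
have bdB : bm (fun p => d p.2 + primX beta p) by exact: bmeasD.
have b1 : bm (fun p => (d p.2 + primX beta p) * Psi p) by exact: bmeasM.
have b2 : bm (fun p => beta p * Phi p) by exact: bmeasM.
apply/eqP; rewrite -addr_eq0 -I2D//; apply/eqP/I2_eq0_linesX; first exact: bmeasD.
move=> y Uy; have [vy0 vyn] := v0 y Uy.
have lP := bmeas_lineX Uy bPsi; have lF := bmeas_lineX Uy bPhi.
have lb := bmeas_lineX Uy bb; have lB := bmeas_lineX Uy bB.
have [_ IP] := pw_int m lP (pwP y Uy).
have tl := pw_tail m lP (pwP y Uy).
rewrite vy0 vyn in IP tl.
have lBP : bm1 (fun x => primX beta (x, y) * Psi (x, y)) by exact: bmeasM.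
have ldP : bm1 (fun x => d y * Psi (x, y)).
  by apply: bmeasM => //; exact: bmeas_cst.
have lbF : bm1 (fun x => beta (x, y) * Phi (x, y)) by exact: bmeasM.
transitivity (I1 (fun x => d y * Psi (x, y) + primX beta (x, y) * Psi (x, y) +
   beta (x, y) * Phi (x, y))).
  by apply: I1_eq => x _ /=; rewrite mulrDl.
rewrite I1D//; last exact: bmeasD.
rewrite I1D// I1Z// IP subrr mulr0 add0r.
(* For fixed y the variables (x, s) again range over the unit square, so the two Fubini lemmas of
   the plane perform the exchange. *)
pose F (q : R * R) := (q.2 < q.1)%R%:R * beta (q.2, y) * Psi (q.1, y).
have bF : bm F.
  apply: bmeasM; last exact: (bmeas_of_lineX lP).
  by apply: bmeasM; [exact: bm_lt2|exact: (bmeas_of_lineY lb)].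
have -> : I1 (fun x => primX beta (x, y) * Psi (x, y)) = I2 F.
  rewrite I2_fubiniY//; apply: I1_eq => x Ux.
  rewrite /primX /= mulrC -I1Z; last by apply: bmeasM; [exact: bm_lt1|].
  by apply: I1_eq => s _; rewrite /F/= mulrC.
rewrite I2_fubiniX// -I1D//; last first.
  apply: (@bmeas_eq _ _ _ _ (fun s => - (beta (s, y) * Phi (s, y)))).
    move=> s Us; rewrite /F/=.
    transitivity (I1 (fun x => beta (s, y) * ((s < x)%R%:R * Psi (x, y)))).
      rewrite I1Z ?tl//; first by ring.
      apply: bmeasM => //.
      exact: (bmeas_lineX (f := fun q => (q.2 < q.1)%R%:R) Us bm_lt2).
    by apply: I1_eq => x _; ring.
  exact: bmeasN.
rewrite -[RHS](I1_cst 0); apply: I1_eq => s Us.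
have -> : I1 (fun x => F (x, s)) = I1 (fun x => beta (s, y) * ((s < x)%R%:R * Psi (x, y))).
  by apply: I1_eq => x _; rewrite /F/=; ring.
rewrite I1Z ?tl//; first by ring.
apply: bmeasM => //.
exact: (bmeas_lineX (f := fun q => (q.2 < q.1)%R%:R) Us bm_lt2).
Qed.

Lemma I2_pw0 n x_ (Phi Psi : R * R -> R) (v : R -> nat -> R) :
  mesh n x_ -> bm Psi ->
  (forall y, U y -> pw n x_ (fun x => Phi (x, y)) (fun x => Psi (x, y)) (v y)) ->
  (forall y, U y -> v y 0%N = 0 /\ v y n = 0) -> I2 Psi = 0.
Proof.
move=> m bP pwP v0; apply: I2_eq0_linesX => // y Uy.
have [_ ->] := pw_int m (bmeas_lineX Uy bP) (pwP y Uy).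
by have [-> ->] := v0 y Uy; rewrite subrr.
Qed.

Lemma I2_pw0Y n y_ (Phi Psi : R * R -> R) (v : R -> nat -> R) :
  mesh n y_ -> bm Psi ->
  (forall x, U x -> pw n y_ (fun y => Phi (x, y)) (fun y => Psi (x, y)) (v x)) ->
  (forall x, U x -> v x 0%N = 0 /\ v x n = 0) -> I2 Psi = 0.
Proof.
move=> m bP pwP v0; apply: I2_eq0_linesY => // x Ux.
have [_ ->] := pw_int m (bmeas_lineY Ux bP) (pwP x Ux).
by have [-> ->] := v0 x Ux; rewrite subrr.
Qed.

End ByParts.

(** * A function is a primitive of its weak derivative *)

Section Uniqueness.
Context (R : realType).
Notation T1 := (measurableTypeR R).
Notation T2 := (measurableTypeR R * measurableTypeR R)%type.
Notation leb2 := (lebm2 R).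
Implicit Types (f g Z : R * R -> R).

Lemma bm_indic (A : set T2) : measurable A -> bm (\1_A : R * R -> R).
Proof.
move=> mA; split; first by apply: measurable_funTS; exact: measurable_indic.
by exists 1 => p _; rewrite indicE; case: (_ \in _); rewrite ?normr1 ?normr0.
Qed.

Definition quadrant (q : R * R) : set T2 := `]q.1, +oo[ `*` `]q.2, +oo[.

(** A half-plane is the union of countably many quadrants whose other corner coordinate tends to
    minus infinity, and half-planes generate the product sigma-algebra. Quadrants are stable under
    intersection, as Dynkin's lemma requires. *)
Lemma quadrant_gen : (@measurable _ T2) = <<s range quadrant >>.
Proof.
have sG q : <<s range quadrant >> (quadrant q) by apply: sub_sigma_algebra; exists q.
rewrite eqEsubset; split; last first.
  apply: smallest_sub; first exact: sigma_algebra_measurable.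
  by move=> _ [q _ <-]; apply: measurableX; exact: measurable_itv.
rewrite measurable_prod_measurableType.
apply: smallest_sub; first exact: smallest_sigma_algebra.
have bor (A : set T1) : measurable A -> (@RGenOInfty.G R).-sigma.-measurable A.
  by rewrite -RGenOInfty.measurableE.
have sig := smallest_sigma_algebra [set: T2] (range quadrant).
have [s0 sC sU] := sig.
have hX (A : set T1) : measurable A -> <<s range quadrant >> (A `*` [set: T1]).
  move=> /bor; apply: (@smallest_sub _ _ _ [set A | <<s range quadrant >> (A `*` [set: T1])]).
    split=> /=.
    - by rewrite set0X.
    - move=> B hB; rewrite (_ : _ `*` _ = setT `\` (B `*` setT)); first exact: sC.
      by apply/seteqP; split=> [[x y] /= [[_ nB] _]|[x y] /= [_ nB]];
        split=> //; [case|split=> // xB; apply: nB].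
    - move=> F hF; rewrite (_ : _ `*` _ = \bigcup_k (F k `*` setT)); first exact: sU.
      apply/seteqP; split=> [[x y] /= [[k _ Fk] _]|[x y] /= [k _ [Fk _]]]; first by exists k.
      by split=> //; exists k.
  move=> _ [a ->] /=.
  rewrite (_ : _ `*` _ = \bigcup_k quadrant (a, - k%:R)); first exact: sU.
  apply/seteqP; split=> [[x y] /= [ax _]|[x y] /= [k _ []]]; last by [].
  exists (Num.truncn `|y|).+1 => //; split=> //=; rewrite in_itv/= andbT.
  rewrite ltrNl (le_lt_trans (ler_norm _))// normrN.
  exact: truncnS_gt.
have hY (A : set T1) : measurable A -> <<s range quadrant >> ([set: T1] `*` A).
  move=> /bor; apply: (@smallest_sub _ _ _ [set A | <<s range quadrant >> ([set: T1] `*` A)]).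
    split=> /=.
    - by rewrite setX0.
    - move=> B hB; rewrite (_ : _ `*` _ = setT `\` (setT `*` B)); first exact: sC.
      by apply/seteqP; split=> [[x y] /= [_ [_ nB]]|[x y] /= [_ nB]];
        split=> //; [case|split=> // xB; apply: nB].
    - move=> F hF; rewrite (_ : _ `*` _ = \bigcup_k (setT `*` F k)); first exact: sU.
      apply/seteqP; split=> [[x y] /= [_ [k _ Fk]]|[x y] /= [k _ [_ Fk]]]; first by exists k.
      by split=> //; exists k.
  move=> _ [a ->] /=.
  rewrite (_ : _ `*` _ = \bigcup_k quadrant (- k%:R, a)); first exact: sU.
  apply/seteqP; split=> [[x y] /= [_ ay]|[x y] /= [k _ []]]; last by [].
  exists (Num.truncn `|x|).+1 => //; split=> //=; rewrite in_itv/= andbT.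
  rewrite ltrNl (le_lt_trans (ler_norm _))// normrN.
  exact: truncnS_gt.
move=> _ [A mA [B mB <-]].
rewrite (_ : A `*` B = (A `*` setT) `&` (setT `*` B)); last first.
  by rewrite -setXI setIT setTI.
exact: (@measurableI _ (g_sigma_algebraType (range quadrant)) _ _ (hX _ mA) (hY _ mB)).
Qed.

(** Dynkin's lemma extends the vanishing from quadrants to all measurable sets; the set where [Z] is
    nonnegative then shows that the integral of [|Z|] is 0. *)
Lemma bm_ae_eq0 Z : bm Z -> (forall q, I2 (fun p => Z p * \1_(quadrant q) p) = 0) ->
  ae_Omega (fun p => Z p = 0).
Proof.
move=> bZ hq.
have IT : I2 Z = 0.
  rewrite -(hq (0, 0)); apply: I2_eq => -[x y] [/=]; rewrite !in_itv/= => /andP[x0 _] /andP[y0 _].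
  by rewrite indicE mem_set ?mulr1//; split; rewrite /= in_itv/= ?x0 ?y0.
have hA (A : set T2) : measurable A -> I2 (fun p => Z p * \1_A p) = 0.
  move=> mA0; apply: (@dynkin_induction _ T2 (range quadrant)
    (fun A => I2 (fun p => Z p * \1_A p) = 0) quadrant_gen _ _ _ _ _ A);
    last by rewrite -quadrant_gen.
  - move=> _ _ [[a b] _ <-] [[a' b'] _ <-].
    exists (Num.max a a', Num.max b b') => //; rewrite /quadrant -setXI /=.
    by congr (_ `*` _); apply/seteqP; split=> x /=; rewrite !in_itv/= !andbT gt_max => /andP.
  - by rewrite -[RHS]IT; apply: I2_eq => p _; rewrite indicE mem_set// mulr1.
  - by move=> _ [q _ <-]; exact: hq.
  - move=> A1 mA IA; rewrite -[RHS](subr0 0) -{1}IT -{1}IA -I2B//; last first.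
      by apply: bmeasM => //; exact: bm_indic.
    by apply: I2_eq => p _; rewrite indicE in_setC indicE; case: (_ \in A1); rewrite /=; ring.
  - move=> F mF tF IF.
    have [M hM] := bZ.2.
    have bF k : bm (fun p => Z p * \1_(F k) p) by apply: bmeasM => //; exact: bm_indic.
    have bS n : bm (fun p => \sum_(k < n) Z p * \1_(F k) p).
      elim: n => [|n IH].
        by under eq_fun do rewrite big_ord0; exact: bmeas_cst.
      under eq_fun do rewrite big_ord_recr/=.
      by apply: bmeasD; [exact: IH|exact: bF].
    have S1 p j : F j p -> forall n, \sum_(k < n) Z p * \1_(F k) p = if (j < n)%N then Z p else 0.
      move=> Fj; elim=> [|n IH]; first by rewrite big_ord0.
      rewrite big_ord_recr/= IH [in RHS]ltnS [in RHS]leq_eqVlt indicE.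
      have [jn|jn] := eqVneq j n; first by rewrite -jn ltnn mem_set// mulr1 add0r.
      rewrite memNset ?mulr0 ?addr0// => Fn; move/eqP: jn; apply.
      by apply: (tF j n) => //; exists p.
    have S0 p : (~ exists j, F j p) -> forall n, \sum_(k < n) Z p * \1_(F k) p = 0.
      move=> nF n; apply: big1 => k _; rewrite indicE memNset ?mulr0// => Fk.
      by apply: nF; exists k.
    have [] := @I2_dct _ (fun n p => \sum_(k < n) Z p * \1_(F k) p)
        (fun p => Z p * \1_(\bigcup_k F k) p) M bS.
    + move=> n p Op; have [[j Fj]|nF] := pselect (exists j, F j p).
        rewrite (S1 _ _ Fj); case: ifP => _; rewrite ?normr0 ?hM//.
        by rewrite (le_trans _ (hM _ Op)).
      by rewrite S0// normr0 (le_trans _ (hM _ Op)).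
    + move=> p Op; have [[j Fj]|nF] := pselect (exists j, F j p).
        exists j.+1 => // n /= jn; rewrite (S1 _ _ Fj) jn indicE mem_set ?mulr1//.
        by exists j.
      exists 0%N => // n _; rewrite S0// indicE memNset ?mulr0// => -[k _ Fk].
      by apply: nF; exists k.
    move=> _ cv.
    have E n : I2 (fun p => \sum_(k < n) Z p * \1_(F k) p) = 0.
      elim: n => [|n IH]; first by under I2_eq do rewrite big_ord0; exact: I2_cst.
      rewrite (I2_eq (g := fun p => (\sum_(k < n) Z p * \1_(F k) p) + Z p * \1_(F n) p)).
        by rewrite I2D// IH IF addr0.
      by move=> p _; rewrite big_ord_recr.
    move: cv; under eq_fun do rewrite E.
    by move=> /cvg_lim <-//; exact: lim_cst.
have mZ : measurable_fun (Omega : set T2) Z := bZ.1.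
pose P := Omega `&` Z @^-1` `[0, +oo[.
have mP : measurable P by apply: (mZ (@mOmega R)); exact: measurable_itv.
have Iabs : I2 (fun p => `|Z p|) = 0.
  transitivity (I2 (fun p => 2 * (Z p * \1_P p) - Z p)).
    apply: I2_eq => p Op; rewrite indicE; case: (boolP (p \in P)).
      by move=> /set_mem [_ /=]; rewrite in_itv/= andbT => Z0; rewrite ger0_norm//; ring.
    rewrite notin_setE => nP; rewrite ltr0_norm; first by rewrite !mulr0 sub0r.
    by rewrite ltNge; apply/negP => Z0; apply: nP; split=> //=; rewrite in_itv/= Z0.
  have b1 : bm (fun p => Z p * \1_P p) by apply: bmeasM => //; exact: bm_indic.
  rewrite I2B//; last by apply: bmeasM => //; exact: bmeas_cst.
  by rewrite I2Z// hA// IT mulr0 subr0.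
have : (\int[leb2]_(p in Omega) `|(EFin \o Z) p| = 0)%E.
  have -> : (\int[leb2]_(p in Omega) `|(EFin \o Z) p| = \int[leb2]_(p in Omega) (`|Z p|)%:E)%E by [].
  rewrite (EFin_bint (@mOmega R) (@fOmega R)) ?Iabs//; last exact: bmeas_norm.
  by congr EFin.
move=> /(ae_eq_integral_abs _ (@mOmega R) ((measurable_EFinP _ _).2 mZ)).
by apply: filterS => p /= h Op; have [] := h Op.
Qed.

End Uniqueness.

(** * Quadratic splines as test functions of class C^1 *)

Section TestFunctions.
Context (R : realType).
Implicit Types (t a c e : R) (l : seq (R * R)).

Lemma is_derive_remainder (f : R -> R) t k :
  (forall del, 0 < del -> exists2 r, 0 < r & forall s, `|s - t| < r ->
    `|f s - f t - k * (s - t)| <= del * `|s - t|) -> is_derive t 1 f k.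
Proof.
move=> hf.
have cv : h^-1 *: ((f \o shift t) (h *: 1) - f t) @[h --> 0^'] --> k.
  apply/cvgrPdist_le => del del0; have [r r0 hr] := hf del del0.
  near=> h.
  have h0 : h != 0 by near: h; exact: nbhs_dnbhs_neq.
  have hltr : `|h| < r by near: h; exact: dnbhs0_lt.
  have := hr (h + t); rewrite addrK => /(_ hltr) H.
  rewrite /= /GRing.scale /= mulr1.
  have -> : k - h^-1 * (f (h + t) - f t) = - (h^-1 * (f (h + t) - f t - k * h)).
    by field.
  rewrite normrN normrM normfV ler_pdivrMl ?normr_gt0// mulrC.
  by rewrite mulrC (le_trans H)// mulrC.
split; last exact: cvg_lim.
by apply/cvg_ex; exists k.
Unshelve. all: by end_near. Qed.

Definition ramp t := Num.max t 0.
Definition sqramp t := ramp t ^+ 2 / 2.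

Lemma ramp_pos t : 0 <= t -> ramp t = t.
Proof. by move=> t0; rewrite /ramp max_l. Qed.

Lemma ramp_neg t : t <= 0 -> ramp t = 0.
Proof. by move=> t0; rewrite /ramp max_r. Qed.

Lemma ramp_continuous : continuous ramp.
Proof.
by move=> t; apply: (@continuous_max _ _ id (fun=> 0)); [exact: cvg_id|exact: cvg_cst].
Qed.

Lemma sqramp_is_derive t : is_derive t 1 sqramp (ramp t).
Proof.
apply: is_derive_remainder => del del0; exists del => // s sdel.
have H : `|sqramp s - sqramp t - ramp t * (s - t)| <= `|s - t| ^+ 2.
  rewrite real_normK ?num_real// /sqramp.
  have [s0|s0] := leP 0 s; have [t0|t0] := leP 0 t.
  - have t2 := sqr_ge0 (s - t).
    by rewrite (ramp_pos s0) (ramp_pos t0) ler_norml; apply/andP; split; nra.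
  - have st : 0 <= s * (- t) by rewrite mulr_ge0// oppr_ge0 ltW.
    have t2 := sqr_ge0 t; have s2 := sqr_ge0 s.
    rewrite (ramp_pos s0) (ramp_neg (ltW t0)) ler_norml; apply/andP; split; nra.
  - have st : 0 <= t * (- s) by rewrite mulr_ge0// oppr_ge0 ltW.
    have t2 := sqr_ge0 t; have s2 := sqr_ge0 s.
    rewrite (ramp_neg (ltW s0)) (ramp_pos t0) ler_norml; apply/andP; split; nra.
  - have t2 := sqr_ge0 (s - t).
    by rewrite (ramp_neg (ltW s0)) (ramp_neg (ltW t0)) ler_norml; apply/andP; split; nra.
by rewrite (le_trans H)// expr2 ler_wpM2r// ltW.
Qed.

(** Quadratic splines of class C^1, coded by pairs (coefficient, knot); [dcomb] is the derivative.
    They suffice since only one continuous derivative is asked of test functions. *)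
Definition comb l t := \sum_(q <- l) q.1 * sqramp (t - q.2).
Definition dcomb l t := \sum_(q <- l) q.1 * ramp (t - q.2).

Lemma comb_cons q l t : comb (q :: l) t = q.1 * sqramp (t - q.2) + comb l t.
Proof. by rewrite /comb big_cons. Qed.

Lemma dcomb_cons q l t : dcomb (q :: l) t = q.1 * ramp (t - q.2) + dcomb l t.
Proof. by rewrite /dcomb big_cons. Qed.

Lemma comb_nil t : comb [::] t = 0. Proof. by rewrite /comb big_nil. Qed.
Lemma dcomb_nil t : dcomb [::] t = 0. Proof. by rewrite /dcomb big_nil. Qed.

Lemma comb_cat l l' t : comb (l ++ l') t = comb l t + comb l' t.
Proof. by rewrite /comb big_cat. Qed.
Lemma dcomb_cat l l' t : dcomb (l ++ l') t = dcomb l t + dcomb l' t.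
Proof. by rewrite /dcomb big_cat. Qed.

Definition scl (k : R) l := [seq (k * q.1, q.2) | q <- l].

Lemma comb_scl k l t : comb (scl k l) t = k * comb l t.
Proof. by rewrite /comb big_map mulr_sumr; apply: eq_bigr => q _; rewrite mulrA. Qed.
Lemma dcomb_scl k l t : dcomb (scl k l) t = k * dcomb l t.
Proof. by rewrite /dcomb big_map mulr_sumr; apply: eq_bigr => q _; rewrite mulrA. Qed.

Lemma comb_is_derive l t : is_derive t 1 (comb l) (dcomb l t).
Proof.
elim: l => [|q l IH].
  rewrite dcomb_nil (_ : comb [::] = fun=> 0); first exact: is_derive_cst.
  by apply/funext => s; rewrite comb_nil.
rewrite dcomb_cons (_ : comb (q :: l) = (fun s => q.1 * sqramp (s - q.2)) + comb l); last first.
  by apply/funext => s; rewrite comb_cons.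
apply: is_deriveD.
have ds : is_derive (t - q.2) 1 sqramp (ramp (t - q.2)) by exact: sqramp_is_derive.
have dq : is_derive t 1 (fun s => s - q.2) (1 : R).
  by rewrite -[X in is_derive _ _ _ X]subr0; exact: is_deriveB.
have D := @is_derive1_comp _ sqramp (fun s => s - q.2) t _ _ ds dq.
have -> : q.1 * ramp (t - q.2) = q.1 *: (ramp (t - q.2) * 1) by rewrite mulr1.
exact: (@is_deriveZ _ _ _ (sqramp \o (fun s => s - q.2)) q.1 t 1).
Qed.

Lemma dcomb_continuous l : continuous (dcomb l).
Proof.
elim: l => [|q l IH].
  rewrite (_ : dcomb [::] = fun=> 0); first by move=> t; exact: cvg_cst.
  by apply/funext => s; rewrite dcomb_nil.
rewrite (_ : dcomb (q :: l) = fun s => q.1 * ramp (s - q.2) + dcomb l s); last first.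
  by apply/funext => s; rewrite dcomb_cons.
move=> t; apply: cvgD; last exact: IH.
apply: cvgM; first exact: cvg_cst.
have cs : {for t, continuous (fun s => s - q.2)}.
  by apply: cvgB; [exact: cvg_id|exact: cvg_cst].
by have := continuous_comp cs (@ramp_continuous _).
Qed.

Lemma comb_continuous l : continuous (comb l).
Proof.
by move=> t; apply: differentiable_continuous; apply/derivable1_diffP; have [] := comb_is_derive l t.
Qed.

Lemma comb_test l l' e : 0 < e ->
  (forall t, t <= e -> comb l t = 0 /\ comb l' t = 0) ->
  (forall t, 1 - e <= t -> comb l t = 0 /\ comb l' t = 0) ->
  test_fun (fun p : R * R => comb l p.1 * comb l' p.2) /\
  forall p, dx (fun p : R * R => comb l p.1 * comb l' p.2) p = dcomb l p.1 * comb l' p.2.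
Proof.
move=> e0 h0 h1.
have D1 (p : R * R) : is_derive p.1 1 (fun t => comb l t * comb l' p.2) (dcomb l p.1 * comb l' p.2).
  have := comb_is_derive l p.1 => d.
  have -> : (fun t => comb l t * comb l' p.2) = (comb l' p.2 \*: comb l).
    by apply/funext => t; rewrite mulrC.
  by rewrite mulrC; exact: is_deriveZ.
have D2 (p : R * R) : is_derive p.2 1 (fun t => comb l p.1 * comb l' t) (comb l p.1 * dcomb l' p.2).
  have := comb_is_derive l' p.2 => d.
  exact: is_deriveZ.
have c1 (f g : R -> R) : continuous f -> continuous g -> continuous (fun p : R * R => f p.1 * g p.2).
  move=> cf cg p; apply: cvgM.
    by apply: (continuous_comp (f := fst)); [exact: cvg_fst|exact: cf].
  by apply: (continuous_comp (f := snd)); [exact: cvg_snd|exact: cg].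
have dxE p : dx (fun p : R * R => comb l p.1 * comb l' p.2) p = dcomb l p.1 * comb l' p.2.
  by rewrite /dx derive1E /=; have [_ ->] := D1 p.
have dyE p : dy (fun p : R * R => comb l p.1 * comb l' p.2) p = comb l p.1 * dcomb l' p.2.
  by rewrite /dy derive1E /=; have [_ ->] := D2 p.
split=> //; split.
- by move=> p; split; [have [] := D1 p|have [] := D2 p].
- by apply: c1; exact: comb_continuous.
- rewrite (_ : dx _ = fun p => dcomb l p.1 * comb l' p.2); last exact/funext.
  by apply: c1; [exact: dcomb_continuous|exact: comb_continuous].
- rewrite (_ : dy _ = fun p => comb l p.1 * dcomb l' p.2); last exact/funext.
  by apply: c1; [exact: comb_continuous|exact: dcomb_continuous].
- exists (`[e, 1 - e] `*` `[e, 1 - e]).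
    split; first by apply: compact_setX; exact: segment_compact.
    move=> [x y] [/=]; rewrite !in_itv/= => /andP[x1 x2] /andP[y1 y2].
    by apply/in_Omega; split; apply/andP; split; lra.
  move=> [x y] nK /=.
  have [xe|xe] := leP x e; first by have [-> _] := h0 x xe; rewrite mul0r.
  have [ye|ye] := leP y e; first by have [_ ->] := h0 y ye; rewrite mulr0.
  have [xe'|xe'] := leP (1 - e) x; first by have [-> _] := h1 x xe'; rewrite mul0r.
  have [ye'|ye'] := leP (1 - e) y; first by have [_ ->] := h1 y ye'; rewrite mulr0.
  by exfalso; apply: nK; split; rewrite /= in_itv/= ?(ltW xe) ?(ltW ye) ltW.
Qed.

(* The derivative of [comb (hat a c e)] is a trapezoid of height 1 supported in
   [a + e, c - e]; [comb (plateau a c e)] is a C^1 function with the same support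
   and the value 1 on [a + 3 e, c - 3 e]. *)
Definition hat a c e : seq (R * R) :=
  [:: (e^-1, a + e); (- e^-1, a + 2 * e); (- e^-1, c - 2 * e); (e^-1, c - e)].

Definition plateau a c e : seq (R * R) :=
  [:: (e ^- 2, a + e); (- (2 * e ^- 2), a + 2 * e); (e ^- 2, a + 3 * e);
      (- e ^- 2, c - 3 * e); (2 * e ^- 2, c - 2 * e); (- e ^- 2, c - e)].

Let small a c e t : 0 < e -> a + 6 * e <= c -> t <= a + e ->
  [/\ t - (a + e) <= 0, t - (a + 2 * e) <= 0, t - (a + 3 * e) <= 0 &
   [/\ t - (c - 3 * e) <= 0, t - (c - 2 * e) <= 0 & t - (c - e) <= 0]].
Proof. by move=> *; split; [lra..|split; lra]. Qed.

Let large a c e t : 0 < e -> a + 6 * e <= c -> c - e <= t ->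
  [/\ 0 <= t - (a + e), 0 <= t - (a + 2 * e), 0 <= t - (a + 3 * e) &
   [/\ 0 <= t - (c - 3 * e), 0 <= t - (c - 2 * e) & 0 <= t - (c - e)]].
Proof. by move=> *; split; [lra..|split; lra]. Qed.

Lemma hat_left a c e t : 0 < e -> a + 6 * e <= c -> t <= a + e ->
  comb (hat a c e) t = 0 /\ dcomb (hat a c e) t = 0.
Proof.
move=> e0 ac /(small e0 ac) [h1 h2 h3 [h4 h5 h6]].
rewrite /hat !comb_cons !dcomb_cons comb_nil dcomb_nil /sqramp /=.
by rewrite (ramp_neg h1) (ramp_neg h2) (ramp_neg h5) (ramp_neg h6); split; ring.
Qed.

Lemma hat_right a c e t : 0 < e -> a + 6 * e <= c -> c - e <= t ->
  comb (hat a c e) t = c - a - 3 * e /\ dcomb (hat a c e) t = 0.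
Proof.
move=> e0 ac /(large e0 ac) [h1 h2 h3 [h4 h5 h6]].
rewrite /hat !comb_cons !dcomb_cons comb_nil dcomb_nil /sqramp /=.
rewrite (ramp_pos h1) (ramp_pos h2) (ramp_pos h5) (ramp_pos h6).
by have en : e != 0 by [rewrite gt_eqF]; split; field.
Qed.

Lemma hat_mid a c e t : 0 < e -> a + 2 * e <= t -> t <= c - 2 * e ->
  dcomb (hat a c e) t = 1.
Proof.
move=> e0 ac tc.
rewrite /hat !dcomb_cons dcomb_nil /=.
rewrite !(ramp_pos (_ : 0 <= t - (a + _)))//; [|lra..].
rewrite !(ramp_neg (_ : t - (c - _) <= 0))//; [|lra..].
by have en : e != 0 by [rewrite gt_eqF]; field.
Qed.

Lemma ramp_lip s e : 0 <= e -> 0 <= ramp (s + e) - ramp s <= e.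
Proof.
move=> e0; have [s0|s0] := leP 0 s.
  by rewrite !ramp_pos; [apply/andP; split; lra|lra..].
rewrite (ramp_neg (ltW s0)); have [s1|s1] := leP 0 (s + e).
  by rewrite ramp_pos//; apply/andP; split; lra.
by rewrite (ramp_neg (ltW s1)) subrr lexx.
Qed.

Lemma hat_bound a c e t : 0 < e -> `|dcomb (hat a c e) t| <= 2.
Proof.
move=> e0; rewrite /hat !dcomb_cons dcomb_nil /=.
have /andP[p1 p2] := ramp_lip (t - (a + 2 * e)) (ltW e0).
have /andP[p3 p4] := ramp_lip (t - (c - e)) (ltW e0).
have E1 : t - (a + 2 * e) + e = t - (a + e) by ring.
have E2 : t - (c - e) + e = t - (c - 2 * e) by ring.
rewrite E1 in p1 p2; rewrite E2 in p3 p4.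
set r1 := ramp (t - (a + e)) in p1 p2 *; set r2 := ramp (t - (a + 2 * e)) in p1 p2 *.
set r3 := ramp (t - (c - 2 * e)) in p3 p4 *; set r4 := ramp (t - (c - e)) in p3 p4 *.
have -> : e^-1 * r1 + (- e^-1 * r2 + (- e^-1 * r3 + (e^-1 * r4 + 0))) =
  ((r1 - r2) + (r4 - r3)) / e by field; rewrite gt_eqF.
rewrite normrM normfV (gtr0_norm e0) ler_pdivrMr// ler_norml; apply/andP; split; lra.
Qed.

(** Divided by e^2, this second difference is a C^1 step rising from 0 to 1 on [0, 2 e]; a [plateau]
    is the difference of two such steps. *)
Lemma sqramp2 s e : 0 < e ->
  0 <= sqramp s - 2 * sqramp (s - e) + sqramp (s - 2 * e) <= e ^+ 2.
Proof.
move=> e0; rewrite /sqramp.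
have [s0|s0] := leP s 0.
  by rewrite !ramp_neg; [apply/andP; split; nra|lra..].
have [s1|s1] := leP s e.
  rewrite (ramp_pos (ltW s0)) !ramp_neg; [apply/andP; split; nra|lra..].
have [s2|s2] := leP s (2 * e).
  rewrite (ramp_pos (ltW s0)) (@ramp_pos (s - e)) ?(@ramp_neg (s - 2 * e));
    [apply/andP; split; nra|lra..].
by rewrite !ramp_pos; [apply/andP; split; nra|lra..].
Qed.

Lemma plateau_bound a c e t : 0 < e -> `|comb (plateau a c e) t| <= 1.
Proof.
move=> e0; rewrite /plateau !comb_cons comb_nil /=.
have /andP[p1 p2] := sqramp2 (t - (a + e)) e0.
have /andP[p3 p4] := sqramp2 (t - (c - 3 * e)) e0.
have E1 : t - (a + e) - e = t - (a + 2 * e) by ring.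
have E2 : t - (a + e) - 2 * e = t - (a + 3 * e) by ring.
have E3 : t - (c - 3 * e) - e = t - (c - 2 * e) by ring.
have E4 : t - (c - 3 * e) - 2 * e = t - (c - e) by ring.
rewrite E1 E2 in p1 p2; rewrite E3 E4 in p3 p4.
move: p1 p2 p3 p4; set r1 := sqramp _; set r2 := sqramp _; set r3 := sqramp _.
set r4 := sqramp _; set r5 := sqramp _; set r6 := sqramp _ => p1 p2 p3 p4.
have -> : e ^- 2 * r1 + (- (2 * e ^- 2) * r2 + (e ^- 2 * r3 +
   (- e ^- 2 * r4 + (2 * e ^- 2 * r5 + (- e ^- 2 * r6 + 0))))) =
  ((r1 - 2 * r2 + r3) - (r4 - 2 * r5 + r6)) / e ^+ 2 by field; rewrite gt_eqF.
have e2 : 0 < e ^+ 2 by rewrite exprn_gt0.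
rewrite normrM normfV (gtr0_norm e2) ler_pdivrMr// mul1r ler_norml.
by apply/andP; split; lra.
Qed.

Lemma plateau_left a c e t : 0 < e -> a + 6 * e <= c -> t <= a + e ->
  comb (plateau a c e) t = 0.
Proof.
move=> e0 ac /(small e0 ac) [h1 h2 h3 [h4 h5 h6]].
rewrite /plateau !comb_cons comb_nil /sqramp /= (ramp_neg h1) (ramp_neg h2) (ramp_neg h3).
by rewrite (ramp_neg h4) (ramp_neg h5) (ramp_neg h6); ring.
Qed.

Lemma plateau_right a c e t : 0 < e -> a + 6 * e <= c -> c - e <= t ->
  comb (plateau a c e) t = 0.
Proof.
move=> e0 ac /(large e0 ac) [h1 h2 h3 [h4 h5 h6]].
rewrite /plateau !comb_cons comb_nil /sqramp /= (ramp_pos h1) (ramp_pos h2) (ramp_pos h3).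
by rewrite (ramp_pos h4) (ramp_pos h5) (ramp_pos h6); field; rewrite gt_eqF.
Qed.

Lemma plateau_mid a c e t : 0 < e -> a + 3 * e <= t -> t <= c - 3 * e ->
  comb (plateau a c e) t = 1.
Proof.
move=> e0 ac tc; rewrite /plateau !comb_cons comb_nil /sqramp /=.
rewrite !(ramp_pos (_ : 0 <= t - (a + _)))//; [|lra..].
rewrite !(ramp_neg (_ : t - (c - _) <= 0))//; [|lra..].
by field; rewrite gt_eqF.
Qed.

Definition ind a c t : R := ((a < t) && (t < c))%:R.

Lemma hat_plateau_ind a c t : a < c -> exists2 d, 0 < d & forall e, 0 < e -> e < d ->
  dcomb (hat a c e) t = ind a c t /\ comb (plateau a c e) t = ind a c t.
Proof.
move=> ac; rewrite /ind.
have d0 : 0 < (c - a) / 6 by rewrite divr_gt0// subr_gt0.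
have [lt_at|le_ta] := ltP a t; last first.
  exists ((c - a) / 6) => // e e0 ed; have k1 : a + 6 * e <= c by lra.
  have k2 : t <= a + e by lra.
  by have [_ ->] := hat_left e0 k1 k2; rewrite (plateau_left e0 k1 k2).
have [lt_tc|le_ct] := ltP t c; last first.
  exists ((c - a) / 6) => // e e0 ed; have k1 : a + 6 * e <= c by lra.
  have k2 : c - e <= t by lra.
  by have [_ ->] := hat_right e0 k1 k2; rewrite (plateau_right e0 k1 k2).
exists (Num.min ((t - a) / 3) ((c - t) / 3)).
  by rewrite lt_min !divr_gt0// subr_gt0.
move=> e e0; rewrite lt_min => /andP[h1 h2].
by rewrite hat_mid ?plateau_mid//; lra.
Qed.

Lemma near_small (P : R -> Prop) : (exists2 d, 0 < d & forall e, 0 < e -> e < d -> P e) ->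
  \forall n \near \oo, P n.+1%:R^-1.
Proof.
move=> [d d0 h]; apply: filterS (near_infty_natSinv_lt (PosNum d0)) => n /= hn.
by apply: h => //; rewrite invr_gt0 ltr0n.
Qed.

End TestFunctions.

(** * The du Bois-Reymond argument in x *)

Section WeakPrimitive.
Context (R : realType).
Notation T1 := (measurableTypeR R).
Notation T2 := (measurableTypeR R * measurableTypeR R)%type.
Notation leb2 := (lebm2 R).
Notation U := (`]0, 1[%classic : set R).
Implicit Types (a c e f : R).

Lemma innerE (g1 g2 : R * R -> R) : inner g1 g2 = I2 (fun p => g1 p * g2 p).
Proof. by []. Qed.

Lemma ae_OmegaS (P Q : R * R -> Prop) : (forall p, Omega p -> P p -> Q p) ->
  ae_Omega P -> ae_Omega Q.
Proof.
move=> h [N [mN N0 sub]]; exists N; split=> //.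
by apply: subset_trans sub => p /= nQ hP; apply: nQ => Op; apply: h => //; exact: hP.
Qed.

Lemma ae_OmegaI (P Q : R * R -> Prop) : ae_Omega P -> ae_Omega Q ->
  ae_Omega (fun p => P p /\ Q p).
Proof.
move=> hP hQ; have : {ae leb2, forall p, (Omega p -> P p) /\ (Omega p -> Q p)}.
  exact: (filterI (F := almost_everywhere leb2)).
move=> [N [mN N0 sub]]; exists N; split=> //.
apply: subset_trans sub => p /= nQ [h1 h2]; apply: nQ => Op.
by split; [exact: h1|exact: h2].
Qed.

Lemma bm1_continuous (g : R -> R) M : continuous g -> (forall t, `|g t| <= M) -> bm1 g.
Proof.
move=> cg gM; split; last by exists M.
exact: (measurable_funTS (continuous_measurable_fun cg)).
Qed.

Lemma bm1_ind a c : bm1 (ind a c).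
Proof.
split; last by exists 1 => t _; rewrite /ind; case: (_ && _); rewrite ?normr1 ?normr0.
rewrite (_ : ind a c = \1_(`]a, c[%classic : set T1)).
  by apply: measurable_funTS; exact: measurable_indic.
apply/funext => t; rewrite /ind indicE; congr (nat_of_bool _)%:R.
by apply/idP/idP; rewrite inE /= in_itv.
Qed.

Lemma I1_ind a c : 0 <= a -> a < c -> c <= 1 -> I1 (ind a c) = c - a.
Proof.
move=> a0 ac c1.
have -> : I1 (ind a c) = \int[@lebesgue_measure R]_(x in `]a, c[) 1.
  have -> : `]a, c[%classic = U `&` `]a, c[%classic.
    apply/seteqP; split=> x /=; last by case.
    by rewrite !in_itv/= => /andP[ax xc]; split; apply/andP; split; lra.
  rewrite Rintegral_mkcondr; apply: eq_Rintegral => x _.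
  rewrite patchE /ind /=; case: ifPn; rewrite ?inE ?notin_setE /= in_itv/=.
    by move=> ->.
  by move=> /negP/negbTE ->.
rewrite Rintegral_cst//= lebesgue_measure_itv/= lte_fin ac mul1r.
by rewrite -EFinB.
Qed.

Definition tens (g k : R -> R) (p : R * R) := g p.1 * k p.2.

Lemma bm_tens g k : bm1 g -> bm1 k -> bm (tens g k).
Proof. by move=> bg bk; apply: bmeasM; [exact: bmeas_of_lineX|exact: bmeas_of_lineY]. Qed.

Section Fix.
Variables (b beta : R * R -> R).
Hypotheses (bb : bm b) (bbeta : bm beta) (wb : weak_dx b beta).

Let D p := b p - primX beta p.
Let bD : bm D. Proof. by apply: bmeasB => //; exact: bm_primX. Qed.

Let unit_mesh : mesh 1 (fun i : nat => i%:R : R).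
Proof. by split=> // -[|//] _; rewrite ltr01. Qed.

(** Both [b], by its weak derivative, and [primX beta], by [by_parts], can be integrated by parts
    against a tensor test function, with the same result. Their difference [D] is therefore
    orthogonal to x-derivatives of such functions. *)
Lemma weak_comb l l' e M : 0 < e ->
  (forall t, t <= e -> comb l t = 0 /\ comb l' t = 0) ->
  (forall t, 1 - e <= t -> comb l t = 0 /\ comb l' t = 0) ->
  (forall t, `|comb l t| <= M /\ `|dcomb l t| <= M /\ `|comb l' t| <= M) ->
  I2 (fun p => D p * tens (dcomb l) (comb l') p) = 0.
Proof.
move=> e0 h0 h1 hM.
have [tst dxE] := comb_test e0 h0 h1.
have := wb tst; rewrite !innerE => W.
have b1 : bm1 (comb l) by apply: (@bm1_continuous _ M); [exact: comb_continuous|move=> t; have [] := hM t].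
have b2 : bm1 (dcomb l) by apply: (@bm1_continuous _ M); [exact: dcomb_continuous|move=> t; have [_ []] := hM t].
have b3 : bm1 (comb l') by apply: (@bm1_continuous _ M); [exact: comb_continuous|move=> t; have [_ []] := hM t].
have bt1 := bm_tens b1 b3; have bt2 := bm_tens b2 b3.
have z : bm1 (fun _ : R => 0) by exact: bmeas_cst.
have pwH y : U y -> pw 1 (fun i : nat => i%:R : R) (fun x => tens (comb l) (comb l') (x, y))
    (fun x => tens (dcomb l) (comb l') (x, y)) (fun _ => 0).
  move=> Uy [|//] _; exists (fun x => comb l x * comb l' y), (fun x => dcomb l x * comb l' y).
  have z0 : comb l 0 = 0 by have [] := h0 0 (ltW e0).
  have z1 : comb l 1 = 0 by have [|] := h1 1 _; first lra.
  split=> //; rewrite ?z0 ?z1 ?mul0r//.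
  have N : nice (0 : R) 1 (comb l) (dcomb l).
    split; [exact: comb_continuous|exact: dcomb_continuous|].
    by move=> x _; exact: comb_is_derive.
  apply: nice_eq (niceM N (nice_cst 0 1 (comb l' y))) => x //.
  by rewrite mulr0 add0r mulrC.
have P := by_parts unit_mesh z bbeta bt1 bt2 pwH (fun _ _ => conj erefl erefl).
have {}P : I2 (fun p => primX beta p * tens (dcomb l) (comb l') p) =
    - I2 (fun p => beta p * tens (comb l) (comb l') p).
  by rewrite -P; apply: I2_eq => p _; rewrite add0r.
have Q : I2 (fun p => D p * tens (dcomb l) (comb l') p) =
  I2 (fun p => b p * tens (dcomb l) (comb l') p) - I2 (fun p => primX beta p * tens (dcomb l) (comb l') p).
  rewrite -I2B; [by apply: I2_eq => p _; rewrite /D mulrBl|exact: bmeasM|].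
  by apply: bmeasM => //; exact: bm_primX.
have W' : I2 (fun p => b p * tens (dcomb l) (comb l') p) =
    - I2 (fun p => beta p * tens (comb l) (comb l') p).
  by rewrite -W; apply: I2_eq => p _; rewrite dxE.
by rewrite Q P W' subrr.
Qed.


Let G a c e f := I2 (fun p => D p * tens (ind a c) (ind e f) p).

Lemma comb_bounded l e : 0 < e ->
  (forall t, t <= e -> comb l t = 0) -> (forall t, 1 - e <= t -> comb l t = 0) ->
  exists M, forall t, `|comb l t| <= M.
Proof.
move=> e0 h0 h1.
have [M [_ hM]] : bounded_set (comb l @` `[0, 1]).
  apply: compact_bounded; apply: continuous_compact; last exact: segment_compact.
  exact/continuous_subspaceT/comb_continuous.
exists (`|M| + 1) => t.
have [t0|t0] := leP t e; first by rewrite h0// normr0 addr_ge0.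
have [t1|t1] := leP (1 - e) t; first by rewrite h1// normr0 addr_ge0.
apply: hM; first by rewrite (le_lt_trans (ler_norm M))// ltrDl.
by exists t => //=; rewrite in_itv/=; apply/andP; split; lra.
Qed.

(** The integral of [D] over a rectangle is proportional to its width, that is, [D] does not depend
    on x. The indicators are limits of [hat] and [plateau], and the identity for them is an instance
    of [weak_comb]. *)
Lemma rect_id a c e f : 0 <= a -> a < c -> c <= 1 -> 0 <= e -> e < f -> f <= 1 ->
  1 / 2 * G a c e f = (c - a) * G (1 / 4) (3 / 4) e f.
Proof.
move=> a0 ac c1 e0 ef f1.
pose Fn a c n := I2 (fun p => D p * tens (dcomb (hat a c n.+1%:R^-1)) (comb (plateau e f n.+1%:R^-1)) p).
have cvF a' c' : a' < c' -> Fn a' c' n @[n --> \oo] --> G a' c' e f.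
  move=> ac'; have [M hM] := bD.2.
  have M0 : 0 <= M.
    have O : Omega (1 / 2 : R, 1 / 2 : R) by split; rewrite /= in_itv/=; apply/andP; split; lra.
    by rewrite (le_trans _ (hM _ O)).
  have n0 n : 0 < (n.+1%:R^-1 : R) by rewrite invr_gt0 ltr0n.
  have [] // := @I2_dct _ (fun n p => D p * tens (dcomb (hat a' c' n.+1%:R^-1)) (comb (plateau e f n.+1%:R^-1)) p)
    (fun p => D p * tens (ind a' c') (ind e f) p) (M * (2 * 1)).
  - move=> n; apply: bmeasM => //; apply: bm_tens.
      apply: (@bm1_continuous _ 2); first exact: dcomb_continuous.
      by move=> t; exact: hat_bound.
    apply: (@bm1_continuous _ 1); first exact: comb_continuous.
    by move=> t; exact: plateau_bound.
  - move=> n p Op; rewrite normrM ler_pM// ?hM//.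
    by rewrite /tens normrM ler_pM// ?hat_bound ?plateau_bound.
  - move=> p _; have [d1 d10 hd1] := hat_plateau_ind p.1 ac'.
    have [d2 d20 hd2] := hat_plateau_ind p.2 ef.
    apply: (@near_small _ (fun r => D p * tens (dcomb (hat a' c' r)) (comb (plateau e f r)) p =
      D p * tens (ind a' c') (ind e f) p)).
    exists (Num.min d1 d2); first by rewrite lt_min d10.
    move=> r r0; rewrite lt_min => /andP[r1 r2]; rewrite /tens.
    by have [-> _] := hd1 r r0 r1; have [_ ->] := hd2 r r0 r2.
have ac4 : (1 / 4 : R) < 3 / 4 by lra.
have cv1 : n.+1%:R^-1 @[n --> \oo] --> (0 : R).
  exact: cvg_harmonic.
have L1 : (1 / 2 - 3 * n.+1%:R^-1) * Fn a c n @[n --> \oo] --> (1 / 2 - 3 * 0) * G a c e f.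
  apply: cvgM; last exact: cvF.
  by apply: cvgB; [exact: cvg_cst|apply: cvgM; [exact: cvg_cst|]].
have L2 : (c - a - 3 * n.+1%:R^-1) * Fn (1 / 4) (3 / 4) n @[n --> \oo] -->
    (c - a - 3 * 0) * G (1 / 4) (3 / 4) e f.
  apply: cvgM; last exact: cvF.
  by apply: cvgB; [exact: cvg_cst|apply: cvgM; [exact: cvg_cst|]].
rewrite !mulr0 !subr0 in L1 L2.
suff nE : \forall n \near \oo, (c - a - 3 * n.+1%:R^-1) * Fn (1 / 4) (3 / 4) n =
    (1 / 2 - 3 * n.+1%:R^-1) * Fn a c n.
  have L3 : (1 / 2 - 3 * n.+1%:R^-1) * Fn a c n @[n --> \oo] --> (c - a) * G (1 / 4) (3 / 4) e f.
    by apply: cvg_trans L2; exact: near_eq_cvg.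
  exact: (cvg_unique (@norm_hausdorff _ _) L1 L3).
apply: (@near_small _ (fun r => (c - a - 3 * r) * I2 (fun p => D p * tens (dcomb (hat (1/4) (3/4) r)) (comb (plateau e f r)) p) =
  (1 / 2 - 3 * r) * I2 (fun p => D p * tens (dcomb (hat a c r)) (comb (plateau e f r)) p))).
exists (Num.min (1 / 12) (Num.min ((c - a) / 6) ((f - e) / 6))).
  by rewrite !lt_min; apply/and3P; split; lra.
move=> r r0; rewrite !lt_min => /and3P[r1 r2 r3].
(* To the right of its support [comb (hat a c r)] has the value [c - a - 3 * r]; the weights make
   the two final values cancel, so that [comb l] has compact support. *)
pose l := scl (1 / 2 - 3 * r) (hat a c r) ++ scl (- (c - a - 3 * r)) (hat (1 / 4) (3 / 4) r).
have acr : a + 6 * r <= c by lra.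
have hr : 1 / 4 + 6 * r <= 3 / 4 by lra.
have efr : e + 6 * r <= f by lra.
have h0 t : t <= r -> comb l t = 0 /\ comb (plateau e f r) t = 0.
  move=> tr; rewrite comb_cat !comb_scl.
  have [|-> _] := @hat_left _ a c r t r0 acr; first by lra.
  have [|-> _] := @hat_left _ (1 / 4) (3 / 4) r t r0 hr; first by lra.
  by rewrite (plateau_left r0 efr) ?mulr0 ?addr0//; lra.
have h1 t : 1 - r <= t -> comb l t = 0 /\ comb (plateau e f r) t = 0.
  move=> tr; rewrite comb_cat !comb_scl.
  have [|-> _] := @hat_right _ a c r t r0 acr; first by lra.
  have [|-> _] := @hat_right _ (1 / 4) (3 / 4) r t r0 hr; first by lra.
  by rewrite (plateau_right r0 efr); [split=> //; lra|lra].
have [M1 hM1] : exists M, forall t, `|comb l t| <= M.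
  by apply: (comb_bounded r0) => t tr; [have [] := h0 t tr|have [] := h1 t tr].
pose M2 := `|1 / 2 - 3 * r| * 2 + `|- (c - a - 3 * r)| * 2.
have hM2 t : `|dcomb l t| <= M2.
  rewrite dcomb_cat !dcomb_scl (le_trans (ler_normD _ _))// !normrM.
  by rewrite lerD// ler_wpM2l// hat_bound.
have := @weak_comb l (plateau e f r) r (Num.max M1 (Num.max M2 1)) r0 h0 h1.
have hM t : `|comb l t| <= Num.max M1 (Num.max M2 1) /\
    `|dcomb l t| <= Num.max M1 (Num.max M2 1) /\ `|comb (plateau e f r) t| <= Num.max M1 (Num.max M2 1).
  by rewrite !le_max hM1 hM2 (plateau_bound _ _ _ r0) !orbT.
move=> /(_ hM) H.
have bt a' c' : bm (fun p => D p * tens (dcomb (hat a' c' r)) (comb (plateau e f r)) p).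
  apply: bmeasM => //; apply: bm_tens.
    apply: (@bm1_continuous _ 2); first exact: dcomb_continuous.
    by move=> t; exact: hat_bound.
  apply: (@bm1_continuous _ 1); first exact: comb_continuous.
  by move=> t; exact: plateau_bound.
have btk k a' c' : bm (fun p => k * (D p * tens (dcomb (hat a' c' r)) (comb (plateau e f r)) p)).
  by apply: bmeasM; [exact: bmeas_cst|exact: bt].
apply/eqP; rewrite eq_sym -subr_eq0; apply/eqP; rewrite -[RHS]H -!I2Z// -I2B//.
by apply: I2_eq => p _; rewrite /tens dcomb_cat !dcomb_scl; ring.
Qed.

(** The mean of [D] in x over the reference interval (1/4, 3/4), whose length 1/2 gives the factor
    2. *)
Let d y := 2 * I1 (fun x => D (x, y) * ind (1 / 4) (3 / 4) x).

Lemma weak_primitive0 : exists2 d, bm1 d & ae_Omega (fun p => b p = d p.2 + primX beta p).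
Proof.
have bDi : bm (fun p => D p * ind (1 / 4) (3 / 4) p.1).
  by apply: bmeasM => //; apply: bmeas_of_lineX; exact: bm1_ind.
have bd : bm1 d by apply: bmeasM; [exact: bmeas_cst|exact: (bmeas_I1X bDi)].
exists d => //.
have bd2 := bmeas_of_lineY bd.
have bZ : bm (fun p => D p - d p.2) by exact: bmeasB.
have H := bm_ae_eq0 bZ.
have {}H : ae_Omega (fun p => D p - d p.2 = 0).
  apply: H => -[a e].
  have [a1|a1] := leP 1 a.
    rewrite -[RHS](I2_cst 0); apply: I2_eq => -[x y] [/= + _]; rewrite in_itv/= => /andP[_ x1].
    rewrite indicE memNset ?mulr0// => -[/=]; rewrite in_itv/= andbT; lra.
  have [e1|e1] := leP 1 e.
    rewrite -[RHS](I2_cst 0); apply: I2_eq => -[x y] [/= _]; rewrite in_itv/= => /andP[_ y1].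
    rewrite indicE memNset ?mulr0// => -[/= _]; rewrite in_itv/= andbT; lra.
  (* Inside Omega the quadrant is the rectangle (a', 1) x (e', 1), to which [rect_id] applies. *)
  pose a' := Num.max a 0; pose e' := Num.max e 0.
  have a'0 : 0 <= a' by rewrite le_max lexx orbT.
  have e'0 : 0 <= e' by rewrite le_max lexx orbT.
  have a'1 : a' < 1 by rewrite gt_max a1 ltr01.
  have e'1 : e' < 1 by rewrite gt_max e1 ltr01.
  have bt a1' c1 e2 f2 : bm (fun p => D p * tens (ind a1' c1) (ind e2 f2) p).
    by apply: bmeasM => //; apply: bm_tens; exact: bm1_ind.
  have bt' : bm (fun p => d p.2 * tens (ind a' 1) (ind e' 1) p).
    by apply: bmeasM => //; apply: bm_tens; exact: bm1_ind.
  transitivity (I2 (fun p => D p * tens (ind a' 1) (ind e' 1) p - d p.2 * tens (ind a' 1) (ind e' 1) p)).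
    apply: I2_eq => -[x y] [/=]; rewrite !in_itv/= => /andP[x0 x1] /andP[y0 y1].
    rewrite -mulrBl indicE /tens /ind /= x1 y1 !andbT !gt_max x0 y0 !andbT.
    congr (_ * _); case: (boolP (a < x)) => ax; last first.
      by rewrite mul0r memNset// => -[/=]; rewrite in_itv/= (negbTE ax).
    case: (boolP (e < y)) => ey; last first.
      by rewrite mulr0 memNset// => -[/= _]; rewrite in_itv/= (negbTE ey).
    by rewrite mulr1 mem_set//; split; rewrite /= in_itv/= ?ax ?ey.
  rewrite I2B//.
  have := rect_id a'0 a'1 (lexx _) e'0 e'1 (lexx _).
  rewrite /G => E.
  have E2 : I2 (fun p => d p.2 * tens (ind a' 1) (ind e' 1) p) =
     (1 - a') * (2 * I2 (fun p => D p * tens (ind (1 / 4) (3 / 4)) (ind e' 1) p)).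
    have b1 : bm1 (fun y => d y * ind e' 1 y) by apply: bmeasM => //; exact: bm1_ind.
    rewrite !I2_fubiniX//.
    transitivity (I1 (fun y => (1 - a') * (d y * ind e' 1 y))).
      apply: I1_eq => y Uy.
      transitivity (I1 (fun x => (d y * ind e' 1 y) * ind a' 1 x)).
        by apply: I1_eq => x _; rewrite /tens/=; ring.
      by rewrite I1Z ?I1_ind//; [ring|exact: bm1_ind].
    rewrite I1Z//; congr (_ * _).
    rewrite -(@I1Z _ 2); last exact: (bmeas_I1X (bt (1/4) (3/4) e' 1)).
    apply: I1_eq => y Uy; rewrite /d -mulrA; congr (_ * _).
    rewrite mulrC -(@I1Z _ (ind e' 1 y)); last exact: (bmeas_lineX Uy bDi).
    by apply: I1_eq => x _; rewrite /tens/=; ring.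
  rewrite E2; lra.
by apply: ae_OmegaS H => p _; rewrite /D; lra.
Qed.

End Fix.

(** The representative is [g] set to 0 where it exceeds its essential bound. *)
Lemma in_Lpoo_bm (g : R * R -> R) : in_Lp +oo%E g ->
  exists2 g', bm g' & ae_Omega (fun p => g p = g' p).
Proof.
move=> [mg]; rewrite /finite_norm unlock /=.
have -> : (0 < leb2 setT)%E.
  rewrite (lt_le_trans (y := leb2 Omega))//; first by rewrite leb2_Omega lte01.
  by apply: le_measure; rewrite ?inE//; exact: mOmega.
move=> fin.
have [M hM] : exists M : R, {ae leb2, forall p, Omega p -> `|g p| <= M}.
  have := @ess_sup_ge _ _ _ leb2 (abse \o (EFin \o (g \_ Omega))).
  move: fin; case: (ess_sup _ _) => [M _ h|//|_ h].
    exists M; apply: filterS h => p /= + Op.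
    by rewrite patchE mem_set.
  (* An essential supremum equal to minus infinity bounds an absolute value almost everywhere, which
     is absurd at each such point. *)
  exists 0; apply: filterS h => p /= + Op.
  by rewrite leeNy_eq.
pose g' p := if `|g p| <= M then g p else 0.
exists g'.
  split.
    apply: measurable_fun_if => //.
    - exact: mOmega.
    - apply: measurable_fun_ler; last exact: measurable_cst.
      by apply: measurableT_comp => //; exact: mg.
    - by apply: measurable_funS mg => //; exact: mOmega.
  exists `|M| => p _; rewrite /g'; case: ifP => [h|_]; last by rewrite normr0.
  by rewrite (le_trans h)// ler_norm.
by apply: ae_OmegaS (hM : ae_Omega _) => p Op h; rewrite /g' h.
Qed.

Lemma inner_ae (g1 g1' g2 : R * R -> R) : ae_Omega (fun p => g1 p = g1' p) ->
  inner g1 g2 = inner g1' g2.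
Proof.
move=> h; apply: (@Rintegral_ae_eq _ _ _ leb2).
by apply: (ae_OmegaS _ h) => p Op ->.
Qed.

Lemma weak_primitive (b b_x : R * R -> R) : in_Lp +oo%E b -> in_Lp +oo%E b_x -> weak_dx b b_x ->
  exists d beta, [/\ bm1 d, bm beta, ae_Omega (fun p => b_x p = beta p)
    & ae_Omega (fun p => b p = d p.2 + primX beta p)].
Proof.
move=> /in_Lpoo_bm [b' bb' bE] /in_Lpoo_bm [beta bbeta betaE] w.
have w' : weak_dx b' beta.
  by move=> phi t; rewrite -(inner_ae _ bE) -(inner_ae _ betaE); exact: w.
have [d bd dE] := weak_primitive0 bb' bbeta w'.
exists d, beta; split=> //.
by apply: ae_OmegaS (ae_OmegaI bE dE) => p Op [-> ->].
Qed.

End WeakPrimitive.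

(** * Piecewise bilinear interpolation *)

Section Steps.
Context (R : realType).
Notation T1 := (measurableTypeR R).
Notation T2 := (measurableTypeR R * measurableTypeR R)%type.
Notation U := (`]0, 1[%classic : set R).
Variables (n : nat) (x_ : nat -> R).
Hypothesis m : mesh n x_.

(** Half-open cells partition [0, 1), so every point there has exactly one cell and no node needs
    special treatment. *)
Definition stepf (k : nat) (z : nat -> R) (a : nat -> R) (x : R) : R :=
  \sum_(i < k) a i * ((z i <= x) && (x < z i.+1))%:R.

Lemma mesh_lt i j : (i < j)%N -> (j <= n)%N -> x_ i < x_ j.
Proof.
move=> ij jn; have [_ _ _ inc] := m.
by rewrite (lt_le_trans (inc i _)) ?(mesh_le m)// (leq_trans ij).
Qed.

Lemma stepf_cell a i x : (i < n)%N -> x_ i <= x < x_ i.+1 -> stepf n x_ a x = a i.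
Proof.
move=> ilt /andP[ix xi]; rewrite /stepf (bigD1 (Ordinal ilt))//= ix xi mulr1.
rewrite big1 ?addr0// => j ji; case: (ltngtP j i) => ij.
- rewrite (_ : (x < x_ j.+1) = false) ?andbF ?mulr0//.
  apply/negbTE; rewrite -leNgt (le_trans _ ix)// (mesh_le m)// ltnW//.
- rewrite (_ : (x_ j <= x) = false) ?mulr0//.
  apply/negbTE; rewrite -ltNge (lt_le_trans xi)// (mesh_le m)// ltnW//.
- by move: ji; rewrite -val_eqE /= ij eqxx.
Qed.

Lemma stepf_bm1 a : bm1 (stepf n x_ a).
Proof.
rewrite /stepf; elim: n => [|k IH].
  by under eq_fun do rewrite big_ord0; exact: bmeas_cst.
under eq_fun do rewrite big_ord_recr/=.
apply: bmeasD; first exact: IH.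
apply: bmeasM; first exact: bmeas_cst.
split; last by exists 1 => t _; case: (_ && _); rewrite ?normr1 ?normr0.
rewrite (_ : (fun _ => _) = \1_(`[x_ k, x_ k.+1[%classic : set T1)).
  by apply: measurable_funTS; exact: measurable_indic.
apply/funext => t; rewrite indicE; congr (nat_of_bool _)%:R.
by apply/idP/idP; rewrite inE /= in_itv.
Qed.

Definition lo := stepf n x_ x_.
Definition hi := stepf n x_ (fun i => x_ i.+1).
Definition wd (x : R) := hi x - lo x.
(** The reciprocal of the width as a step function of its own, so that its boundedness and
    measurability come from [stepf_bm1] rather than from a lower bound on [wd]. *)
Definition iw := stepf n x_ (fun i => (x_ i.+1 - x_ i)^-1).

Lemma cellP x : 0 <= x < 1 -> exists2 i, (i < n)%N &
  [/\ x_ i <= x < x_ i.+1, lo x = x_ i, hi x = x_ i.+1, iw x = (wd x)^-1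
    & 0 <= x_ i /\ x_ i.+1 <= 1].
Proof.
move=> x01; have [i ilt ix] := mesh_cell m x01; exists i => //.
rewrite /wd /lo /hi /iw !(stepf_cell _ ilt ix); split=> //.
have /andP[-> _] := mesh_01 m (ltnW ilt).
by have /andP[_ ->] := mesh_01 m ilt.
Qed.

Lemma lohi x : 0 <= x < 1 -> [/\ 0 <= lo x, lo x <= x, x < hi x, hi x <= 1 & 0 < wd x].
Proof.
move=> x01; have [i _ [/andP[ix xi] -> -> _ [i0 i1]]] := cellP x01.
split=> //; rewrite /wd; have [j jlt [/andP[jx xj] -> -> _ _]] := cellP x01.
by rewrite subr_gt0 mesh_lt.
Qed.

Lemma UI x : U x -> 0 <= x < 1.
Proof. by rewrite /= in_itv/= => /andP[/ltW -> ->]. Qed.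

Lemma bm1_lo : bm1 lo. Proof. exact: stepf_bm1. Qed.
Lemma bm1_hi : bm1 hi. Proof. exact: stepf_bm1. Qed.
Lemma bm1_wd : bm1 wd. Proof. by apply: bmeasB; [exact: bm1_hi|exact: bm1_lo]. Qed.
Lemma bm1_iw : bm1 iw. Proof. exact: stepf_bm1. Qed.

End Steps.

Section Square.
Context (R : realType).
Notation T1 := (measurableTypeR R).
Notation T2 := (measurableTypeR R * measurableTypeR R)%type.
Notation U := (`]0, 1[%classic : set R).
Implicit Types (w : R * R -> R) (p : R * R).

Lemma bounded_square w : continuous w ->
  exists M, forall x y, 0 <= x <= 1 -> 0 <= y <= 1 -> `|w (x, y)| <= M.
Proof.
move=> cw.
have [M [_ hM]] : bounded_set (w @` (`[0, 1] `*` `[0, 1])).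
  apply: compact_bounded; apply: continuous_compact.
    exact/continuous_subspaceT.
  by apply: compact_setX; exact: segment_compact.
exists (`|M| + 1) => x y x01 y01.
apply: hM; first by rewrite (le_lt_trans (ler_norm M))// ltrDl.
by exists (x, y) => //; split; rewrite /= in_itv.
Qed.

Lemma bm_comp w (f g : R -> R) : continuous w -> bm1 f -> bm1 g ->
  (forall x, U x -> 0 <= f x <= 1) -> (forall x, U x -> 0 <= g x <= 1) ->
  bm (fun p => w (f p.1, g p.2)).
Proof.
move=> cw bf bg f01 g01; have [M hM] := bounded_square cw.
split; last first.
  by exists M => -[x y] [/= Ux Uy]; apply: hM; [exact: f01|exact: g01].
have mf : @measurable_fun _ _ T2 T1 setT (fun p => (f \_ U) p.1).
  have [/(@measurable_restrictT _ _ _ _ _ _ (measurable_itv _ : measurable (U : set T1))) h _] := bf.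
  exact: (measurableT_comp h).
have mg : @measurable_fun _ _ T2 T1 setT (fun p => (g \_ U) p.2).
  have [/(@measurable_restrictT _ _ _ _ _ _ (measurable_itv _ : measurable (U : set T1))) h _] := bg.
  exact: (measurableT_comp h).
have mw : @measurable_fun _ _ T2 _ setT w.
  exact: (continuous_measurable2 (measurableT : measurable (setT : set T2)) cw).
have H := measurableT_comp mw (measurable_fun_pair mf mg).
apply: (eq_measurable_fun (w \o (fun p : T2 => ((f \_ U) p.1, (g \_ U) p.2)) : T2 -> R)).
  by move=> [x y] /set_mem [/= Ux Uy]; rewrite !patchE !mem_set.
exact: measurable_funTS.
Qed.

Lemma bm1_id : bm1 (fun x : R => x).
Proof.
split; first by apply: measurable_funTS.
exists 1 => x; rewrite /= in_itv/= => /andP[x0 x1].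
by rewrite gtr0_norm// ltW.
Qed.

Lemma U01 (x : R) : U x -> 0 <= x <= 1.
Proof. by rewrite /= in_itv/= => /andP[/ltW -> /ltW ->]. Qed.

Lemma bm_continuous w : continuous w -> bm w.
Proof.
move=> cw; have := bm_comp cw bm1_id bm1_id U01 U01.
by apply: bmeas_eq => -[x y].
Qed.

Variables (n k : nat) (x_ y_ : nat -> R).
Hypotheses (mx : mesh n x_) (my : mesh k y_).

(** Slopes and interpolation act in one variable at a time and are defined for any function; on V^h
    the slopes are the partial derivatives off the mesh lines, and the bilinear interpolant is
    [interp_x] applied to [interp_y]. *)
Definition slope_x w p := (w (hi n x_ p.1, p.2) - w (lo n x_ p.1, p.2)) * iw n x_ p.1.
Definition slope_y w p := (w (p.1, hi k y_ p.2) - w (p.1, lo k y_ p.2)) * iw k y_ p.2.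
Definition interp_x w p := w (lo n x_ p.1, p.2) + (p.1 - lo n x_ p.1) * slope_x w p.
Definition interp_y w p := w (p.1, lo k y_ p.2) + (p.2 - lo k y_ p.2) * slope_y w p.

Lemma loU x : U x -> 0 <= lo n x_ x <= 1.
Proof. by move=> /UI x01; have [? ? ? ? _] := lohi mx x01; apply/andP; split; lra. Qed.
Lemma hiU x : U x -> 0 <= hi n x_ x <= 1.
Proof. by move=> /UI x01; have [? ? ? ? _] := lohi mx x01; apply/andP; split; lra. Qed.

End Square.

Section SquareBm.
Context (R : realType).
Notation U := (`]0, 1[%classic : set R).
Implicit Types (w : R * R -> R) (p : R * R).
Variables (n k : nat) (x_ y_ : nat -> R).
Hypotheses (mx : mesh n x_) (my : mesh k y_).
Local Notation Dx := (slope_x n x_).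
Local Notation Dy := (slope_y k y_).
Local Notation Ix := (interp_x n x_).
Local Notation Iy := (interp_y k y_).

Lemma bm_xlo : bm (fun p : R * R => p.1 - lo n x_ p.1).
Proof. exact: (bmeas_of_lineX (bmeasB (@bm1_id R) (bm1_lo n x_))). Qed.
Lemma bm_ylo : bm (fun p : R * R => p.2 - lo k y_ p.2).
Proof. exact: (bmeas_of_lineY (bmeasB (@bm1_id R) (bm1_lo k y_))). Qed.

Lemma bm_Dx w : continuous w -> bm (Dx w).
Proof.
move=> cw; apply: bmeasM; last by exact: (bmeas_of_lineX (bm1_iw n x_)).
apply: bmeasB.
  by apply: (bm_comp cw (bm1_hi _ _) (@bm1_id R)); [exact: hiU|exact: U01].
by apply: (bm_comp cw (bm1_lo _ _) (@bm1_id R)); [exact: loU|exact: U01].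
Qed.

Lemma bm_Dy w : continuous w -> bm (Dy w).
Proof.
move=> cw; apply: bmeasM; last by exact: (bmeas_of_lineY (bm1_iw k y_)).
apply: bmeasB.
  by apply: (bm_comp cw (@bm1_id R) (bm1_hi _ _)); [exact: U01|exact: hiU].
by apply: (bm_comp cw (@bm1_id R) (bm1_lo _ _)); [exact: U01|exact: loU].
Qed.

Lemma bm_Ix w : continuous w -> bm (Ix w).
Proof.
move=> cw; apply: bmeasD.
  by apply: (bm_comp cw (bm1_lo _ _) (@bm1_id R)); [exact: loU|exact: U01].
apply: bmeasM; last exact: bm_Dx.
exact: bm_xlo.
Qed.

Lemma bm_Dx_Iy w : continuous w -> bm (Dx (Iy w)).
Proof.
move=> cw; apply: bmeasM; last by exact: (bmeas_of_lineX (bm1_iw n x_)).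
have b f : bm1 f -> (forall x, U x -> 0 <= f x <= 1) -> bm (fun p => Iy w (f p.1, p.2)).
  move=> bf f01; apply: bmeasD.
    by apply: (bm_comp cw bf (bm1_lo _ _)) => //; exact: loU.
  apply: bmeasM.
    exact: bm_ylo.
  apply: bmeasM; last by exact: (bmeas_of_lineY (bm1_iw k y_)).
  apply: bmeasB; first by apply: (bm_comp cw bf (bm1_hi _ _)) => //; exact: hiU.
  by apply: (bm_comp cw bf (bm1_lo _ _)) => //; exact: loU.
by apply: bmeasB; apply: b; [exact: bm1_hi|exact: hiU|exact: bm1_lo|exact: loU].
Qed.

Lemma bm_Ix_Iy w : continuous w -> bm (Ix (Iy w)).
Proof.
move=> cw; apply: bmeasD; last first.
  apply: bmeasM; last exact: bm_Dx_Iy.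
  exact: bm_xlo.
apply: bmeasD.
  by apply: (bm_comp cw (bm1_lo _ _) (bm1_lo _ _)); exact: loU.
apply: bmeasM.
  exact: bm_ylo.
apply: bmeasM; last by exact: (bmeas_of_lineY (bm1_iw k y_)).
apply: bmeasB.
  by apply: (bm_comp cw (bm1_lo _ _) (bm1_hi _ _)); [exact: loU|exact: hiU].
by apply: (bm_comp cw (bm1_lo _ _) (bm1_lo _ _)); exact: loU.
Qed.

Lemma DxE w x y : 0 <= x < 1 -> Dx w (x, y) =
  (w (hi n x_ x, y) - w (lo n x_ x, y)) / (hi n x_ x - lo n x_ x).
Proof. by move=> x01; have [i _ [_ _ _ E _]] := cellP mx x01; rewrite /slope_x /= E. Qed.

Lemma DyE w x y : 0 <= y < 1 -> Dy w (x, y) =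
  (w (x, hi k y_ y) - w (x, lo k y_ y)) / (hi k y_ y - lo k y_ y).
Proof. by move=> y01; have [i _ [_ _ _ E _]] := cellP my y01; rewrite /slope_y /= E. Qed.

End SquareBm.

(** * One-dimensional interpolation errors *)

Section Interpolation.
Context (R : realType).
Implicit Types (a b M x y t : R).

Lemma mvt (f df : R -> R) a b : a < b -> continuous f ->
  (forall t, a < t < b -> is_derive t 1 f (df t)) ->
  exists2 c, a < c < b & f b - f a = df c * (b - a).
Proof.
move=> ab cf d; have d' t : t \in `]a, b[ -> is_derive t 1 f (df t) by rewrite in_itv/=; exact: d.
have [c] := MVT ab d' (continuous_subspaceT cf).
by rewrite in_itv/= => cab E; exists c.
Qed.

Lemma mvt_le (f df : R -> R) a b M s t : continuous f ->
  (forall r, a < r < b -> is_derive r 1 f (df r)) ->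
  (forall r, a < r < b -> `|df r| <= M) ->
  a <= s <= b -> a <= t <= b -> `|f t - f s| <= M * `|t - s|.
Proof.
move=> cf d dM; wlog st : s t / s <= t.
  move=> W sab tab; have [st|/ltW ts] := leP s t; first exact: W.
  by rewrite distrC (distrC t); exact: W.
move=> /andP[as_ sb] /andP[at_ tb].
have [->|ne] := eqVneq s t; first by rewrite !subrr normr0 mulr0.
have slt : s < t by rewrite lt_neqAle ne.
have [|c /andP[sc ct] ->] := @mvt f df s t slt cf.
  by move=> r /andP[sr rt]; apply: d; rewrite (le_lt_trans as_ sr) (lt_le_trans rt tb).
by rewrite normrM ler_wpM2r// dM// (le_lt_trans as_ sc) (lt_le_trans ct tb).
Qed.

(** By the mean value theorem on [a, b] and on [a, x] the error is (x - a) times a difference of two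
    values of g'. The constant is not the optimal 1/8, which is immaterial. *)
Lemma interp_err (g g1 g2 : R -> R) a b M x : continuous g -> continuous g1 ->
  (forall t, a < t < b -> is_derive t 1 g (g1 t)) ->
  (forall t, a < t < b -> is_derive t 1 g1 (g2 t)) ->
  (forall t, a < t < b -> `|g2 t| <= M) -> a < b -> a <= x <= b ->
  `|g a + (x - a) * ((g b - g a) / (b - a)) - g x| <= (b - a) ^+ 2 * M.
Proof.
move=> cg cg1 d1 d2 gM ab /andP[ax xb].
have M0 : 0 <= M.
  have h : a < (a + b) / 2 < b by apply/andP; split; lra.
  exact: le_trans (gM _ h).
have ba0 : 0 < b - a by rewrite subr_gt0.
have [<-|ne] := eqVneq a x.
  by rewrite subrr mul0r addr0 subrr normr0 mulr_ge0// sqr_ge0.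
have altx : a < x by rewrite lt_neqAle ne.
have [|c1 /andP[ac1 c1x] E1] := @mvt g g1 a x altx cg.
  by move=> t /andP[h1 h2]; apply: d1; rewrite h1 (lt_le_trans h2).
have [c2 /andP[ac2 c2b] E2] := mvt ab cg d1.
have -> : g a + (x - a) * ((g b - g a) / (b - a)) - g x = (x - a) * (g1 c2 - g1 c1).
  have -> : g x = g a + g1 c1 * (x - a) by rewrite -E1 addrC subrK.
  by rewrite E2; field; rewrite gt_eqF.
have c1b : c1 < b by exact: lt_le_trans xb.
have H : `|g1 c2 - g1 c1| <= M * `|c2 - c1|.
  by apply: (mvt_le cg1 d2 gM); rewrite !ltW.
rewrite normrM expr2 -mulrA; apply: ler_pM => //.
  by rewrite ger0_norm; lra.
rewrite (le_trans H)// mulrC ler_wpM2r// ler_norml; apply/andP; split; lra.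
Qed.

(** The interpolation error of t^2 / 2 is exactly (x - a)(b - x) / 2. Subtracting g''(x) t^2 / 2
    from g leaves a function whose second derivative is at most (b - a) M on the cell, to which
    [interp_err] applies. *)
Lemma interp_err3 (g g1 g2 g3 : R -> R) a b M x :
  continuous g -> continuous g1 -> continuous g2 ->
  (forall t, a < t < b -> is_derive t 1 g (g1 t)) ->
  (forall t, a < t < b -> is_derive t 1 g1 (g2 t)) ->
  (forall t, a < t < b -> is_derive t 1 g2 (g3 t)) ->
  (forall t, a < t < b -> `|g3 t| <= M) -> a < b -> a <= x <= b ->
  `|g a + (x - a) * ((g b - g a) / (b - a)) - g x - g2 x * ((x - a) * (b - x) / 2)|
    <= (b - a) ^+ 3 * M.
Proof.
move=> cg cg1 cg2 d1 d2 d3 gM ab xab.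
have ba0 : 0 < b - a by rewrite subr_gt0.
pose q t := g t - g2 x * (t ^+ 2 / 2).
pose q1 t := g1 t - g2 x * t.
pose q2 t := g2 t - g2 x.
have cid : continuous (fun t : R => t) by move=> t; exact: cvg_id.
have N1 : nice a b (fun t => t * t * 2^-1) (fun t => t).
  apply: nice_eq (niceM (niceM (nice_id a b) (nice_id a b)) (nice_cst a b 2^-1)) => t //.
  by field.
have Nq : nice a b q q1.
  have Ng : nice a b g g1 by [].
  apply: nice_eq (niceB Ng (niceM (nice_cst a b (g2 x)) N1)) => t.
    by rewrite /q expr2.
  by rewrite /q1 mulr0 addr0.
have Nq1 : nice a b q1 q2.
  have Ng : nice a b g1 g2 by [].
  apply: nice_eq (niceB Ng (niceM (nice_cst a b (g2 x)) (nice_id a b))) => t //.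
  by rewrite /q2 mulr0 addr0 mulr1.
have [cq cq1 dq] := Nq; have [_ _ dq1] := Nq1.
have qM t : a < t < b -> `|q2 t| <= (b - a) * M.
  move=> /andP[at_ tb]; rewrite /q2.
  have M0 : 0 <= M by rewrite (le_trans _ (gM t _))// at_ tb.
  apply: (le_trans (mvt_le cg2 d3 gM xab _)); first by rewrite !ltW.
  rewrite mulrC ler_wpM2r// ler_norml; move: xab => /andP[ax xb].
  by apply/andP; split; lra.
have := interp_err cq cq1 dq dq1 qM ab xab.
have -> : q a + (x - a) * ((q b - q a) / (b - a)) - q x =
  g a + (x - a) * ((g b - g a) / (b - a)) - g x - g2 x * ((x - a) * (b - x) / 2).
  by rewrite /q; field; rewrite gt_eqF.
by have -> : (b - a) ^+ 3 * M = (b - a) ^+ 2 * ((b - a) * M) by ring.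
Qed.

(* Derivatives in one variable are available for every value of the other one,
   in particular along the boundary. *)
Definition cjet (F : nat -> nat -> R * R -> R) :=
  [/\ forall i j, (i + j <= 3)%N -> continuous (F i j),
      forall i j, (i + j < 3)%N -> forall x y, 0 < x < 1 ->
        is_derive x 1 (fun t => F i j (t, y)) (F i.+1 j (x, y))
    & forall i j, (i + j < 3)%N -> forall x y, 0 < y < 1 ->
        is_derive y 1 (fun t => F i j (x, t)) (F i j.+1 (x, y))].

Lemma sliceX (w : R * R -> R) y : continuous w -> continuous (fun t => w (t, y)).
Proof.
move=> cw t; apply: (continuous_comp (f := fun t => (t, y))); last exact: cw.
exact: (cvg_pair cvg_id (cvg_cst y)).
Qed.

Lemma sliceY (w : R * R -> R) x : continuous w -> continuous (fun t => w (x, t)).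
Proof.
move=> cw t; apply: (continuous_comp (f := fun t => (x, t))); last exact: cw.
exact: (cvg_pair (cvg_cst x) cvg_id).
Qed.

Lemma cjetD F G : cjet F -> cjet G -> cjet (fun i j p => F i j p + G i j p).
Proof.
move=> [cF xF yF] [cG xG yG]; split=> i j ij.
- by move=> p; apply: cvgD; [exact: cF|exact: cG].
- move=> x y x01; have d1 := xF i j ij x y x01; have d2 := xG i j ij x y x01.
  exact: is_deriveD.
- move=> x y y01; have d1 := yF i j ij x y y01; have d2 := yG i j ij x y y01.
  exact: is_deriveD.
Qed.

Variables (n k : nat) (x_ y_ : nat -> R).
Hypotheses (mx : mesh n x_) (my : mesh k y_).
Local Notation Dx := (slope_x n x_).
Local Notation Dy := (slope_y k y_).
Local Notation Ix := (interp_x n x_).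
Local Notation Iy := (interp_y k y_).
Local Notation lox := (lo n x_).
Local Notation hix := (hi n x_).
Local Notation wdx := (wd n x_).
Local Notation loy := (lo k y_).
Local Notation hiy := (hi k y_).
Local Notation wdy := (wd k y_).
Variable F : nat -> nat -> R * R -> R.
Hypothesis jF : cjet F.

Lemma IxE w x y : 0 <= x < 1 -> Ix w (x, y) =
  w (lox x, y) + (x - lox x) * ((w (hix x, y) - w (lox x, y)) / (hix x - lox x)).
Proof. by move=> x01; rewrite /interp_x (DxE mx)//=. Qed.

Lemma IyE w x y : 0 <= y < 1 -> Iy w (x, y) =
  w (x, loy y) + (y - loy y) * ((w (x, hiy y) - w (x, loy y)) / (hiy y - loy y)).
Proof. by move=> y01; rewrite /interp_y (DyE my)//=. Qed.

Lemma Ix_err i j x y M : (i + j < 2)%N -> 0 <= x < 1 ->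
  (forall xi, lox x < xi < hix x -> `|F i.+2 j (xi, y)| <= M) ->
  `|Ix (F i j) (x, y) - F i j (x, y)| <= wdx x ^+ 2 * M.
Proof.
move=> ij x01 hM; have [cF xF _] := jF.
have [l0 lx xh h1 w0] := lohi mx x01.
have i01 t : lox x < t < hix x -> 0 < t < 1 by move=> /andP[? ?]; apply/andP; split; lra.
rewrite IxE//.
apply: (@interp_err (fun t => F i j (t, y)) (fun t => F i.+1 j (t, y)) (fun t => F i.+2 j (t, y))).
- by apply: sliceX; apply: cF; rewrite (leq_trans (ltnW ij)).
- by apply: sliceX; apply: cF; rewrite addSn (leq_trans ij).
- by move=> t /i01 t01; apply: xF => //; rewrite (leq_trans ij).
- by move=> t /i01 t01; apply: xF => //; rewrite addSn ltnS.
- exact: hM.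
- by rewrite -subr_gt0.
- by rewrite lx ltW.
Qed.

Lemma Iy_err i j x y M : (i + j < 2)%N -> 0 <= y < 1 ->
  (forall yi, loy y < yi < hiy y -> `|F i j.+2 (x, yi)| <= M) ->
  `|Iy (F i j) (x, y) - F i j (x, y)| <= wdy y ^+ 2 * M.
Proof.
move=> ij y01 hM; have [cF _ yF] := jF.
have [l0 lx xh h1 w0] := lohi my y01.
have i01 t : loy y < t < hiy y -> 0 < t < 1 by move=> /andP[? ?]; apply/andP; split; lra.
rewrite IyE//.
apply: (@interp_err (fun t => F i j (x, t)) (fun t => F i j.+1 (x, t)) (fun t => F i j.+2 (x, t))).
- by apply: sliceY; apply: cF; rewrite (leq_trans (ltnW ij)).
- by apply: sliceY; apply: cF; rewrite addnS (leq_trans ij).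
- by move=> t /i01 t01; apply: yF => //; rewrite (leq_trans ij).
- by move=> t /i01 t01; apply: yF => //; rewrite addnS ltnS.
- exact: hM.
- by rewrite -subr_gt0.
- by rewrite lx ltW.
Qed.

Lemma Ix_err3 x y M : 0 <= x < 1 ->
  (forall xi, lox x < xi < hix x -> `|F 3%N 0%N (xi, y)| <= M) ->
  `|Ix (F 0%N 0%N) (x, y) - F 0%N 0%N (x, y)
    - F 2%N 0%N (x, y) * ((x - lox x) * (hix x - x) / 2)| <= wdx x ^+ 3 * M.
Proof.
move=> x01 hM; have [cF xF _] := jF.
have [l0 lx xh h1 w0] := lohi mx x01.
have i01 t : lox x < t < hix x -> 0 < t < 1 by move=> /andP[? ?]; apply/andP; split; lra.
rewrite IxE//.
apply: (@interp_err3 (fun t => F 0%N 0%N (t, y)) (fun t => F 1%N 0%N (t, y))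
  (fun t => F 2%N 0%N (t, y)) (fun t => F 3%N 0%N (t, y))).
- by apply: sliceX; exact: cF.
- by apply: sliceX; exact: cF.
- by apply: sliceX; exact: cF.
- by move=> t /i01 t01; exact: xF.
- by move=> t /i01 t01; exact: xF.
- by move=> t /i01 t01; exact: xF.
- exact: hM.
- by rewrite -subr_gt0.
- by rewrite lx ltW.
Qed.

(** The slope in x of the error of interpolation in y is, by the mean value theorem, bounded by the
    error of interpolating F_x in y; hence only F_xyy enters. *)
Lemma Dx_Iy_err x y M : 0 <= x < 1 -> 0 <= y < 1 ->
  (forall xi yi, lox x < xi < hix x -> loy y < yi < hiy y -> `|F 1%N 2%N (xi, yi)| <= M) ->
  `|Dx (fun p => Iy (F 0%N 0%N) p - F 0%N 0%N p) (x, y)| <= wdy y ^+ 2 * M.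
Proof.
move=> x01 y01 hM; have [cF xF _] := jF.
have [l0 lx xh h1 w0] := lohi mx x01.
have i01 t : lox x < t < hix x -> 0 < t < 1 by move=> /andP[? ?]; apply/andP; split; lra.
pose z t := Iy (F 0%N 0%N) (t, y) - F 0%N 0%N (t, y).
pose z1 t := Iy (F 1%N 0%N) (t, y) - F 1%N 0%N (t, y).
have N (c : R) : nice (lox x) (hix x) (fun t => F 0%N 0%N (t, c)) (fun t => F 1%N 0%N (t, c)).
  split; [by apply: sliceX; exact: cF|by apply: sliceX; exact: cF|].
  by move=> t /i01 t01; exact: xF.
have [cz _ dz] : nice (lox x) (hix x) z z1.
  pose cc := nice_cst (lox x) (hix x) (y - loy y).
  pose ci := nice_cst (lox x) (hix x) (iw k y_ y).
  apply: nice_eq (niceB (niceD (N (loy y)) (niceM cc (niceM (niceB (N (hiy y)) (N (loy y))) ci))) (N y)) => t.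
    by rewrite /z /interp_y /slope_y.
  by rewrite /z1 /interp_y /slope_y/= !mulr0 !addr0 add0r (mulrC (iw _ _ _)).
rewrite (DxE mx)// -/(z _) -/(z _).
have zM t : lox x < t < hix x -> `|z1 t| <= wdy y ^+ 2 * M.
  by move=> tx; apply: Iy_err => // yi yih; exact: hM.
have lh : lox x < hix x by rewrite -subr_gt0.
have := mvt_le cz dz zM; move=> /(_ (lox x) (hix x)).
rewrite !lexx !(ltW lh) => /(_ isT isT).
rewrite normrM normfV -ler_pdivrMr//.
by rewrite normr_gt0 gt_eqF.
Qed.

Lemma Dy_Ix_err x y M : 0 <= x < 1 -> 0 <= y < 1 ->
  (forall xi yi, lox x < xi < hix x -> loy y < yi < hiy y -> `|F 2%N 1%N (xi, yi)| <= M) ->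
  `|Dy (fun p => Ix (F 0%N 0%N) p - F 0%N 0%N p) (x, y)| <= wdx x ^+ 2 * M.
Proof.
move=> x01 y01 hM; have [cF _ yF] := jF.
have [l0 lx xh h1 w0] := lohi my y01.
have i01 t : loy y < t < hiy y -> 0 < t < 1 by move=> /andP[? ?]; apply/andP; split; lra.
pose z t := Ix (F 0%N 0%N) (x, t) - F 0%N 0%N (x, t).
pose z1 t := Ix (F 0%N 1%N) (x, t) - F 0%N 1%N (x, t).
have N (c : R) : nice (loy y) (hiy y) (fun t => F 0%N 0%N (c, t)) (fun t => F 0%N 1%N (c, t)).
  split; [by apply: sliceY; exact: cF|by apply: sliceY; exact: cF|].
  by move=> t /i01 t01; exact: yF.
have [cz _ dz] : nice (loy y) (hiy y) z z1.
  pose cc := nice_cst (loy y) (hiy y) (x - lox x).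
  pose ci := nice_cst (loy y) (hiy y) (iw n x_ x).
  apply: nice_eq (niceB (niceD (N (lox x)) (niceM cc (niceM (niceB (N (hix x)) (N (lox x))) ci))) (N x)) => t.
    by rewrite /z /interp_x /slope_x.
  by rewrite /z1 /interp_x /slope_x/= !mulr0 !addr0 add0r (mulrC (iw _ _ _)).
rewrite (DyE my)// -/(z _) -/(z _).
have zM t : loy y < t < hiy y -> `|z1 t| <= wdx x ^+ 2 * M.
  by move=> tx; apply: Ix_err => // yi yih; exact: hM.
have lh : loy y < hiy y by rewrite -subr_gt0.
have := mvt_le cz dz zM; move=> /(_ (loy y) (hiy y)).
rewrite !lexx !(ltW lh) => /(_ isT isT).
rewrite normrM normfV -ler_pdivrMr//.
by rewrite normr_gt0 gt_eqF.
Qed.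

End Interpolation.

(** * Consistency error *)

Section Pairs.
Context (R : realType).
Notation U := (`]0, 1[%classic : set R).
Variables (n k : nat) (x_ y_ : nat -> R).
Hypotheses (mx : mesh n x_) (my : mesh k y_).
Local Notation Dx := (slope_x n x_).
Local Notation Dy := (slope_y k y_).
Local Notation Ix := (interp_x n x_).
Local Notation Iy := (interp_y k y_).
Local Notation lox := (lo n x_).
Local Notation hix := (hi n x_).
Local Notation wdx := (wd n x_).

(** The space V^h in operator form: a function fixed by both one-dimensional interpolations is
    bilinear on each cell. *)
Definition vh (phi : R * R -> R) :=
  [/\ continuous phi,
      forall x y, 0 <= x < 1 -> 0 <= y <= 1 -> Ix phi (x, y) = phi (x, y),
      forall x y, 0 <= x <= 1 -> 0 <= y < 1 -> Iy phi (x, y) = phi (x, y),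
      forall y, 0 <= y <= 1 -> phi (0, y) = 0 /\ phi (1, y) = 0
    & forall x, 0 <= x <= 1 -> phi (x, 0) = 0 /\ phi (x, 1) = 0].

Lemma DxU i x y w : (i < n)%N -> x_ i <= x < x_ i.+1 ->
  Dx w (x, y) = (w (x_ i.+1, y) - w (x_ i, y)) * (x_ i.+1 - x_ i)^-1.
Proof. by move=> ilt ix; rewrite /slope_x /lo /hi /iw /= !(stepf_cell mx _ ilt ix). Qed.

Lemma IxU i x y w : (i < n)%N -> x_ i <= x < x_ i.+1 ->
  Ix w (x, y) = w (x_ i, y) + (x - x_ i) * ((w (x_ i.+1, y) - w (x_ i, y)) * (x_ i.+1 - x_ i)^-1).
Proof. by move=> ilt ix; rewrite /interp_x (DxU _ _ ilt ix) /lo /= (stepf_cell mx _ ilt ix). Qed.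

Lemma DyU j x y w : (j < k)%N -> y_ j <= y < y_ j.+1 ->
  Dy w (x, y) = (w (x, y_ j.+1) - w (x, y_ j)) * (y_ j.+1 - y_ j)^-1.
Proof. by move=> ilt ix; rewrite /slope_y /lo /hi /iw /= !(stepf_cell my _ ilt ix). Qed.

Lemma IyU j x y w : (j < k)%N -> y_ j <= y < y_ j.+1 ->
  Iy w (x, y) = w (x, y_ j) + (y - y_ j) * ((w (x, y_ j.+1) - w (x, y_ j)) * (y_ j.+1 - y_ j)^-1).
Proof. by move=> ilt ix; rewrite /interp_y (DyU _ _ ilt ix) /lo /= (stepf_cell my _ ilt ix). Qed.

Lemma cell_itv i x : (i < n)%N -> x_ i <= x < x_ i.+1 -> 0 <= x < 1.
Proof.
move=> ilt /andP[h1 h2]; have /andP[p0 _] := mesh_01 mx (ltnW ilt).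
by have /andP[_ p1] := mesh_01 mx ilt; apply/andP; split; lra.
Qed.

Lemma vhU phi i x y : vh phi -> (i < n)%N -> x_ i <= x < x_ i.+1 -> 0 <= y <= 1 ->
  phi (x, y) = phi (x_ i, y) + (x - x_ i) * ((phi (x_ i.+1, y) - phi (x_ i, y)) * (x_ i.+1 - x_ i)^-1).
Proof.
move=> [_ v _ _ _] ilt ix y01; rewrite -(IxU _ _ ilt ix) v//.
exact: cell_itv ix.
Qed.

Definition in_last (x : R) := stepf n x_ (fun i => (i.+1 == n)%:R) x.

Lemma niceX (F : nat -> nat -> R * R -> R) i j y a b : cjet F -> (i + j < 3)%N -> 0 <= a -> b <= 1 ->
  nice a b (fun x => F i j (x, y)) (fun x => F i.+1 j (x, y)).
Proof.
move=> [cF xF _] ij a0 b1; split.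
- by apply: sliceX; apply: cF; exact: ltnW.
- by apply: sliceX; exact: cF.
- by move=> x /andP[ax xb]; apply: xF => //; apply/andP; split; lra.
Qed.

Lemma niceY (F : nat -> nat -> R * R -> R) i j x a b : cjet F -> (i + j < 3)%N -> 0 <= a -> b <= 1 ->
  nice a b (fun y => F i j (x, y)) (fun y => F i j.+1 (x, y)).
Proof.
move=> [cF _ yF] ij a0 b1; split.
- by apply: sliceY; apply: cF; exact: ltnW.
- by apply: sliceY; apply: cF; rewrite addnS.
- by move=> y /andP[ay yb]; apply: yF => //; apply/andP; split; lra.
Qed.

Variables (S L : nat -> nat -> R * R -> R) (h : R) (phi : R * R -> R).
Hypotheses (jS : cjet S) (jL : cjet L) (vphi : vh phi).
Local Notation S00 := (S 0%N 0%N).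
Local Notation S10 := (S 1%N 0%N).
Local Notation S20 := (S 2%N 0%N).
Local Notation S30 := (S 3%N 0%N).
Local Notation L00 := (L 0%N 0%N).
Local Notation L10 := (L 1%N 0%N).

(* The leading term of the interpolation error of S on a cell is S_xx q with
   q = (x - lo)(hi - x)/2.  Q1 is q minus its mean wd^2/12, and Q3 is the primitive
   of Q1 vanishing at both ends of the cell; om is the price of replacing wd by h x
   in that mean.  Q2, with derivative Q2', acts in the last cell, where
   phi = - (1 - x) phi_x. *)
Definition om (x : R) := (wdx x ^+ 2 - h ^+ 2 * x ^+ 2) / 12.
Definition Q3 (x : R) := (x - lox x) * (hix x - x) * (2 * x - lox x - hix x) / 12.
Definition Q1 (x : R) := ((x - lox x) * (hix x - x) / 2 - wdx x ^+ 2 / 12).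
Definition Q2 (x : R) := (1 - x) * (x - lox x) * iw n x_ x.
Definition Q2' (x : R) := (1 + lox x - 2 * x) * iw n x_ x.

(** Chosen so that adding [B * part_dens + beta * part_prim], whose integral is 0 by [by_parts],
    leaves convection terms of size h^2 times quantities controlled by the energy norm, apart from
    J. The summands move, in turn, the derivative of the error of S onto phi, the oscillation [Q1],
    the mean with h x in place of the width, the defect of that replacement in the last column, and
    the error of L. *)
Definition part_prim (p : R * R) : R :=
  (Ix S00 p - S00 p) * phi p - Q3 p.1 * S20 p * Dx phi p
  - h ^+ 2 * p.1 ^+ 2 / 12 * S20 p * phi p
  + in_last p.1 * (om p.1 * S20 p * Q2 p.1 * Dx phi p)
  + (Ix (Iy L00) p - L00 p) * phi p.

Definition part_dens (p : R * R) : R :=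
  (Dx S00 p - S10 p) * phi p + (Ix S00 p - S00 p) * Dx phi p
  - Q1 p.1 * S20 p * Dx phi p - Q3 p.1 * S30 p * Dx phi p
  - h ^+ 2 / 12 * (2 * p.1 * S20 p + p.1 ^+ 2 * S30 p) * phi p
  - h ^+ 2 * p.1 ^+ 2 / 12 * S20 p * Dx phi p
  + in_last p.1 * ((- (h ^+ 2 * p.1 / 6) * S20 p + om p.1 * S30 p) * Q2 p.1
       + om p.1 * S20 p * Q2' p.1) * Dx phi p
  + (Dx (Iy L00) p - L10 p) * phi p + (Ix (Iy L00) p - L00 p) * Dx phi p.

(** The values of [part_prim] at the nodes, where the error of S and the factors [Q2], [Q3] drop
    out. *)
Definition vnode (y : R) (i : nat) : R :=
  - (h ^+ 2 * x_ i ^+ 2 / 12) * S20 (x_ i, y) * phi (x_ i, y)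
  + (Iy L00 (x_ i, y) - L00 (x_ i, y)) * phi (x_ i, y).

Lemma pw_part y : U y -> pw n x_ (fun x => part_prim (x, y)) (fun x => part_dens (x, y)) (vnode y).
Proof.
move=> Uy i ilt; have [n0 x0 x1 inc] := mx.
have y01 := U01 Uy.
pose a := x_ i; pose b := x_ i.+1; pose H := b - a.
have H0 : H != 0 by rewrite gt_eqF// subr_gt0 inc.
have a0 : 0 <= a by have /andP[] := mesh_01 mx (ltnW ilt).
have b1 : b <= 1 by have /andP[] := mesh_01 mx ilt.
pose s := (phi (b, y) - phi (a, y)) * H^-1.
pose DS := (S00 (b, y) - S00 (a, y)) * H^-1.
pose DL := (Iy L00 (b, y) - Iy L00 (a, y)) * H^-1.
pose l : R := (i.+1 == n)%:R.
pose c := nice_cst a b; pose X := nice_id a b.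
have NS : nice a b (fun x => S00 (x, y)) (fun x => S10 (x, y)) by exact: niceX.
have NS2 : nice a b (fun x => S20 (x, y)) (fun x => S30 (x, y)) by exact: niceX.
have NL : nice a b (fun x => L00 (x, y)) (fun x => L10 (x, y)) by exact: niceX.
have Nxa := niceB X (c a).
have Nphi := niceD (c (phi (a, y))) (niceM Nxa (c s)).
have N1 := niceM (niceB (niceD (c (S00 (a, y))) (niceM Nxa (c DS))) NS) Nphi.
have NQ := niceM (niceM (niceM Nxa (niceB (c b) X)) (niceB (niceM (c 2) X) (c (a + b)))) (c (s / 12)).
have N2 := niceM NQ NS2.
have N3 := niceM (niceM (c (h ^+ 2 / 12)) (niceM X X)) (niceM NS2 Nphi).
have Nom := niceM (niceB (c (H ^+ 2)) (niceM (c (h ^+ 2)) (niceM X X))) (c (l / 12)).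
have N4 := niceM (niceM Nom NS2) (niceM (niceM (niceB (c 1) X) Nxa) (c (H^-1 * s))).
have N5 := niceM (niceB (niceD (c (Iy L00 (a, y))) (niceM Nxa (c DL))) NL) Nphi.
have N := niceD (niceD (niceB (niceB N1 N2) N3) N4) N5.
eexists; eexists; split.
- exact: N.
- rewrite /= /vnode -/a; ring.
- rewrite /= /vnode -/b.
  (* The last-column term is continuous at the right end since [Q2] has the factor 1 - x and the
     flag [l] is nonzero only when b = 1; at the left end the factor x - a does the same. *)
  have lb : l * (1 - b) = 0.
    rewrite /l /b; case: eqP => [->|_]; last by rewrite mul0r.
    by rewrite x1 subrr mulr0.
  have -> : (b - a) * DS = S00 (b, y) - S00 (a, y) by rewrite /DS mulrC mulfVK.
  have -> : (b - a) * DL = Iy L00 (b, y) - Iy L00 (a, y) by rewrite /DL mulrC mulfVK.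
  have -> : (b - a) * s = phi (b, y) - phi (a, y) by rewrite /s mulrC mulfVK.
  rewrite subrr.
  have -> : (H ^+ 2 - h ^+ 2 * (b * b)) * (l / 12) * S20 (b, y) *
     ((1 - b) * (b - a) * (H^-1 * s)) = (l * (1 - b)) * ((H ^+ 2 - h ^+ 2 * (b * b)) / 12 * S20 (b, y) * ((b - a) * (H^-1 * s))) by ring.
  by rewrite lb; field.
- move=> x ix; rewrite /part_prim (vhU vphi ilt ix y01) !(DxU _ _ ilt ix) !(IxU _ _ ilt ix).
  rewrite /om /Q3 /Q2 /in_last /wd /lo /hi /iw /= !(stepf_cell mx _ ilt ix).
  rewrite -/a -/b -/H -/s -/DS -/DL -/l; field.
  exact: H0.
- move=> x ix; have ix' : x_ i <= x < x_ i.+1 by case/andP: ix => /ltW -> ->.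
  rewrite /part_dens (vhU vphi ilt ix' y01) !(DxU _ _ ilt ix') !(IxU _ _ ilt ix').
  rewrite /om /Q3 /Q2 /Q1 /Q2' /in_last /wd /lo /hi /iw /= !(stepf_cell mx _ ilt ix').
  rewrite -/a -/b -/H -/s -/DS -/DL -/l; rewrite /H; field.
  exact: H0.
Qed.

Lemma vnode0 y : U y -> vnode y 0 = 0 /\ vnode y n = 0.
Proof.
move=> Uy; have [n0 x0 x1 inc] := mx; have [_ _ _ z _] := vphi.
have [p0 p1] := z y (U01 Uy).
by rewrite /vnode x0 x1 p0 p1 !mulr0 addr0.
Qed.

(** The slope of phi is constant in x on a cell and the interpolation error vanishes at both ends.
    The integral of this derivative is therefore 0, which removes one-dimensional errors from the
    diffusion term. *)
Lemma pw_slope (w w1 : R * R -> R) y : U y ->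
  (forall a b, 0 <= a -> b <= 1 -> nice a b (fun x => w (x, y)) (fun x => w1 (x, y))) ->
  pw n x_ (fun x => (Ix w (x, y) - w (x, y)) * Dx phi (x, y))
    (fun x => (Dx w (x, y) - w1 (x, y)) * Dx phi (x, y)) (fun _ => 0).
Proof.
move=> Uy nw i ilt; have [n0 x0 x1 inc] := mx.
pose a := x_ i; pose b := x_ i.+1; pose H := b - a.
have H0 : H != 0 by rewrite gt_eqF// subr_gt0 inc.
have a0 : 0 <= a by have /andP[] := mesh_01 mx (ltnW ilt).
have b1 : b <= 1 by have /andP[] := mesh_01 mx ilt.
pose s := (phi (b, y) - phi (a, y)) * H^-1.
pose DS := (w (b, y) - w (a, y)) * H^-1.
pose c := nice_cst a b; pose X := nice_id a b.
have N := niceM (niceB (niceD (c (w (a, y))) (niceM (niceB X (c a)) (c DS))) (nw a b a0 b1)) (c s).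
eexists; eexists; split.
- exact: N.
- by rewrite /= -/a; ring.
- by rewrite /= -/b (_ : (b - a) * DS = w (b, y) - w (a, y)); [ring|rewrite /DS mulrC mulfVK].
- by move=> x ix; rewrite !(DxU _ _ ilt ix) !(IxU _ _ ilt ix).
- move=> x ix; have ix' : x_ i <= x < x_ i.+1 by case/andP: ix => /ltW -> ->.
  by rewrite !(DxU _ _ ilt ix') -/a -/b -/H -/s -/DS; ring.
Qed.

Lemma pw_slopeY (w w2 : R * R -> R) x : U x ->
  (forall a b, 0 <= a -> b <= 1 -> nice a b (fun y => w (x, y)) (fun y => w2 (x, y))) ->
  pw k y_ (fun y => (Iy w (x, y) - w (x, y)) * Dy phi (x, y))
    (fun y => (Dy w (x, y) - w2 (x, y)) * Dy phi (x, y)) (fun _ => 0).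
Proof.
move=> Ux nw i ilt; have [n0 y0 y1 inc] := my.
pose a := y_ i; pose b := y_ i.+1; pose H := b - a.
have H0 : H != 0 by rewrite gt_eqF// subr_gt0 inc.
have a0 : 0 <= a by have /andP[] := mesh_01 my (ltnW ilt).
have b1 : b <= 1 by have /andP[] := mesh_01 my ilt.
pose s := (phi (x, b) - phi (x, a)) * H^-1.
pose DS := (w (x, b) - w (x, a)) * H^-1.
pose c := nice_cst a b; pose X := nice_id a b.
have N := niceM (niceB (niceD (c (w (x, a))) (niceM (niceB X (c a)) (c DS))) (nw a b a0 b1)) (c s).
eexists; eexists; split.
- exact: N.
- by rewrite /= -/a; ring.
- by rewrite /= -/b (_ : (b - a) * DS = w (x, b) - w (x, a)); [ring|rewrite /DS mulrC mulfVK].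
- by move=> y iy; rewrite !(DyU _ _ ilt iy) !(IyU _ _ ilt iy).
- move=> y iy; have iy' : y_ i <= y < y_ i.+1 by case/andP: iy => /ltW -> ->.
  by rewrite !(DyU _ _ ilt iy') -/a -/b -/H -/s -/DS; ring.
Qed.

End Pairs.

Section Norms.
Context (R : realType).
Notation U := (`]0, 1[%classic : set R).
Implicit Types (f g : R * R -> R).

Definition nn f := Num.sqrt (I2 (fun p => f p ^+ 2)).

Lemma nn_ge0 f : 0 <= nn f. Proof. exact: sqrtr_ge0. Qed.

Lemma nn_sqr f : nn f ^+ 2 = I2 (fun p => f p ^+ 2).
Proof. exact: nrm_sqr. Qed.

Lemma I2_cs f g : bm f -> bm g -> I2 (fun p => `|f p * g p|) <= nn f * nn g.
Proof.
move=> bf bg; have := bint_cauchy_schwarz (@mOmega R) (@fOmega R) (bmeas_norm bf) (bmeas_norm bg).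
rewrite -/(I2 _) -/(nn f); move=> /(le_trans (ler_norm _)) H.
have E k : nrm (lebm2 R) Omega (fun x => `|k x|) = nn k.
  rewrite /nn /nrm; congr Num.sqrt; apply: I2_eq => p _.
  by rewrite real_normK ?num_real.
rewrite !E in H; rewrite (le_trans _ H)//.
by rewrite le_eqVlt; apply/orP; left; apply/eqP; apply: I2_eq => p _; rewrite normrM.
Qed.

Lemma nn_one : nn (fun _ => 1) = 1.
Proof. by rewrite /nn (I2_eq (g := fun _ => 1)) ?I2_cst ?sqrtr1// => p _; rewrite expr1n. Qed.

Lemma I2_abs_nn f : bm f -> I2 (fun p => `|f p|) <= nn f.
Proof.
move=> bf; have b1 : bm (fun _ : R * R => 1) by exact: bmeas_cst.
have := I2_cs bf b1; rewrite nn_one mulr1.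
by rewrite (I2_eq (g := fun p => `|f p|))// => p _; rewrite mulr1.
Qed.

Lemma nn_le f M : 0 <= M -> I2 (fun p => f p ^+ 2) <= M ^+ 2 -> nn f <= M.
Proof. by move=> M0 h; rewrite -(ger0_norm M0) -sqrtr_sqr ler_wsqrtr. Qed.

End Norms.

(** * Inverse inequality in x *)

Section Inverse.
Context (R : realType).
Notation U := (`]0, 1[%classic : set R).
Variables (n k : nat) (x_ y_ : nat -> R).
Hypotheses (mx : mesh n x_) (my : mesh k y_).
Local Notation Dx := (slope_x n x_).
Local Notation lox := (lo n x_).
Local Notation hix := (hi n x_).
Local Notation wdx := (wd n x_).
Variable phi : R * R -> R.
Hypothesis vphi : vh n k x_ y_ phi.

Lemma bm_wdDx : bm (fun p => wdx p.1 * Dx phi p).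
Proof.
have [cphi _ _ _ _] := vphi.
by apply: bmeasM; [exact: (bmeas_of_lineX (bm1_wd n x_))|exact: bm_Dx].
Qed.

(** For phi linear in x on a cell of width H, the mean of 12 phi^2 equals (H phi_x)^2 plus 3 times
    the square of the sum of the end values. The identity is expressed through a primitive [Phi]
    that vanishes at the nodes. *)
Lemma inverse_ineq : I2 (fun p => (wdx p.1 * Dx phi p) ^+ 2) <= 12 * I2 (fun p => phi p ^+ 2).
Proof.
have [cphi _ _ _ _] := vphi; have bphi := bm_continuous cphi.
pose s p := phi (lox p.1, p.2) + phi (hix p.1, p.2).
have bs : bm s.
  apply: bmeasD.
    by apply: (bm_comp cphi (bm1_lo n x_) (@bm1_id R)); [exact: loU|exact: U01].
  by apply: (bm_comp cphi (bm1_hi n x_) (@bm1_id R)); [exact: hiU|exact: U01].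
pose Psi p := 12 * phi p ^+ 2 - (wdx p.1 * Dx phi p) ^+ 2 - 3 * s p ^+ 2.
have b1 : bm (fun p => 12 * phi p ^+ 2) by apply: bmeasM; [exact: bmeas_cst|exact: bmeasX].
have b2 : bm (fun p => (wdx p.1 * Dx phi p) ^+ 2) by apply: bmeasX; exact: bm_wdDx.
have b3 : bm (fun p => 3 * s p ^+ 2) by apply: bmeasM; [exact: bmeas_cst|exact: bmeasX].
have bP : bm Psi by apply: bmeasB => //; exact: bmeasB.
pose Phi (p : R * R) := - ((p.1 - lox p.1) * (hix p.1 - p.1)) *
  (6 * s p * Dx phi p + 2 * Dx phi p ^+ 2 * (2 * p.1 - lox p.1 - hix p.1)).
have pwP y : U y -> pw n x_ (fun x => Phi (x, y)) (fun x => Psi (x, y)) (fun _ => 0).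
  move=> Uy i ilt; have [n0 x0 x1 inc] := mx; have y01 := U01 Uy.
  pose a := x_ i; pose b := x_ i.+1; pose H := b - a.
  have H0 : H != 0 by rewrite gt_eqF// subr_gt0 inc.
  pose sl := (phi (b, y) - phi (a, y)) * H^-1.
  pose c := nice_cst a b; pose X := nice_id a b.
  have N := niceN (niceM (niceM (niceB X (c a)) (niceB (c b) X))
    (niceD (c (6 * (phi (a, y) + phi (b, y)) * sl)) (niceM (c (2 * sl ^+ 2)) (niceB (niceM (c 2) X) (c (a + b)))))).
  eexists; eexists; split.
  - exact: N.
  - by rewrite /= -/a subrr !mul0r oppr0.
  - by rewrite /= -/b subrr mulr0 mul0r oppr0.
  - move=> x ix; rewrite /Phi /s /= !(DxU mx _ _ ilt ix).
    rewrite /lo /hi /= !(stepf_cell mx _ ilt ix) -/a -/b -/H -/sl; ring.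
  - move=> x ix; have ix' : x_ i <= x < x_ i.+1 by case/andP: ix => /ltW -> ->.
    rewrite /Psi /s /= (vhU mx vphi ilt ix' y01) !(DxU mx _ _ ilt ix').
    rewrite /wd /lo /hi /= !(stepf_cell mx _ ilt ix') -/a -/b -/H -/sl.
    have -> : phi (b, y) = phi (a, y) + H * sl.
      by rewrite /sl mulrC mulfVK// addrC subrK.
    rewrite /H; ring.
have := I2_pw0 mx bP pwP (fun _ _ => conj erefl erefl).
rewrite /Psi I2B//; last exact: bmeasB.
rewrite I2B// I2Z; last exact: bmeasX.
have : 0 <= I2 (fun p => 3 * s p ^+ 2).
  by apply: Rintegral_ge0 => p _; rewrite mulr_ge0// sqr_ge0.
lra.
Qed.

Lemma inverse_nn : nn (fun p => wdx p.1 * Dx phi p) <= 4 * nn phi.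
Proof.
apply: nn_le; first by rewrite mulr_ge0// nn_ge0.
rewrite (le_trans inverse_ineq)// exprMn nn_sqr.
have : 0 <= I2 (fun p => phi p ^+ 2) by apply: Rintegral_ge0 => p _; rewrite sqr_ge0.
by move=> h; rewrite ler_wpM2r//; lra.
Qed.

End Inverse.

Lemma lerM2 (R : realType) (a b A B' : R) : `|a| <= A -> `|b| <= B' -> `|a * b| <= A * B'.
Proof. by move=> ha hb; rewrite normrM; apply: ler_pM. Qed.

Lemma lerD2' (R : realType) (a b A B' : R) : `|a| <= A -> `|b| <= B' -> `|a + b| <= A + B'.
Proof. by move=> ha hb; apply: le_trans (ler_normD _ _) _; exact: lerD. Qed.

(** The pointwise estimate of the remainder with all function values replaced by reals: D and I
    stand for slopes and interpolants of S and L, a suffix 2 on a slope for the y direction, f, f1,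
    f2 for phi and its slopes, q for [Q3], o for [om], l for [in_last]. The five groups of terms
    contribute 1, 2, 4, 6 and 9 times MB K^3 W at most, which 25 covers. *)
Lemma rem_est (R : realType) (K MB eps SE h H G B' be c' DIS DIL DIS2 DIL2 DS DL DS2 DL2 s00 l00 s20 s30 IS IIS IIL
    f f1 f2 x a b iH l q o : R) :
  1 <= K -> 1 <= MB -> 0 < eps -> eps <= 1 -> 0 <= SE -> eps = SE * SE -> 0 < h -> h < 1 ->
  0 < H -> H <= K * h -> 0 <= G -> G <= 1 -> `|B'| <= MB -> `|be| <= MB -> `|c'| <= MB ->
  `|DIS - DS| <= K * h ^+ 2 -> eps * `|DIL - DL| <= K * h ^+ 2 * G ->
  SE * `|DIS2 - DS2| <= K * h ^+ 2 -> SE * `|DIL2 - DL2| <= K * h ^+ 2 ->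
  `|IS - s00| <= H ^+ 2 * K ->
  `|IS - s00 - s20 * ((x - a) * (b - x) / 2)| <= H ^+ 3 * K ->
  `|IIS - IS| <= K * h ^+ 2 -> `|IIL - l00| <= 2 * K * h ^+ 2 * G ->
  `|s20| <= K -> `|s30| <= K -> 0 <= x <= 1 -> a <= x -> x <= b -> H = b - a -> iH = H^-1 ->
  q = (x - a) * (b - x) * (2 * x - a - b) / 12 ->
  o = (H ^+ 2 - h ^+ 2 * x ^+ 2) / 12 ->
  l = 0 \/ l = 1 /\ b = 1 -> (l = 0 -> `|o| <= K * (h * H ^+ 2 + h ^+ 2 * eps ^+ 2)) ->
  `| (eps * (DIS - DS) + eps * (DIL - DL)) * f1 + eps * ((DIS2 - DS2) + (DIL2 - DL2)) * f2
  + c' * ((IIS - s00) + (IIL - l00)) * f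
  + be * ((IS - s00) * f - q * s20 * f1 - h ^+ 2 * x ^+ 2 / 12 * s20 * f
    + l * (o * s20 * ((1 - x) * (x - a) * iH) * f1) + (IIL - l00) * f)
  + B' * (- (DIS - DS) * f + (IS - s00 - s20 * ((x - a) * (b - x) / 2)) * f1
     + (1 - l) * o * s20 * f1 - q * s30 * f1
     - h ^+ 2 / 12 * (2 * x * s20 + x ^+ 2 * s30) * f
     + l * (- (h ^+ 2 * x / 6) * s20 + o * s30) * ((1 - x) * (x - a) * iH) * f1
     + (IIL - l00) * f1) | <=
  25 * MB * K ^+ 3 * (h ^+ 2 * (`|f| + H * `|f1| + (eps + G) * `|f1| + SE * `|f2|)).
Proof.
move=> K1 MB1 e0 e1 SE0 SE2 h0 h1 H0 Hh G0 G1 bB bbe bc d1 d2 d3 d4 i1 i2 i3 i4 s2 s3 x01 ax xb HE iE qE oE lP o0.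
have K0 : 0 <= K := le_trans ler01 K1.
set W := h ^+ 2 * (_ + _).
have F0 := normr_ge0 f; have F10 := normr_ge0 f1; have F20 := normr_ge0 f2.
have hh : 0 <= h ^+ 2 by rewrite sqr_ge0.
have p1 : 0 <= H * `|f1| by rewrite mulr_ge0 ?(ltW H0).
have p2 : 0 <= (eps + G) * `|f1| by rewrite mulr_ge0// addr_ge0// ltW.
have p2' : 0 <= G * `|f1| by rewrite mulr_ge0.
have p2'' : 0 <= eps * `|f1| by rewrite mulr_ge0 ?(ltW e0).
have p3 : 0 <= SE * `|f2| by rewrite mulr_ge0.
have wP z : z <= `|f| + H * `|f1| + (eps * `|f1| + G * `|f1|) + SE * `|f2| -> h ^+ 2 * z <= W.
  by move=> hz; rewrite /W mulrDl; apply: ler_wpM2l.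
rewrite mulrDl in p2.
have wF : h ^+ 2 * `|f| <= W by apply: wP; clear -F0 p1 p2 p3 p2' p2''; lra.
have wH : h ^+ 2 * (H * `|f1|) <= W by apply: wP; clear -F0 p1 p2 p3 p2' p2''; lra.
have wG : h ^+ 2 * (G * `|f1|) <= W by apply: wP; clear -F0 p1 p2 p3 p2' p2''; lra.
have wEG : h ^+ 2 * ((eps + G) * `|f1|) <= W by apply: wP; rewrite mulrDl; clear -F0 p1 p2 p3; lra.
have wHe : h ^+ 2 * (H * `|f1| + eps * `|f1|) <= W by apply: wP; clear -F0 p1 p2 p3 p2' p2''; lra.
have wE : h ^+ 2 * (SE * `|f2|) <= W by apply: wP; clear -F0 p1 p2 p3 p2' p2''; lra.
have W0 : 0 <= W by rewrite (le_trans _ wF)// mulr_ge0.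
clearbody W.
have K13 : K <= K ^+ 3 by rewrite -{1}(expr1 K) ler_weXn2l.
have K3 : 0 <= K ^+ 3 by rewrite exprn_ge0.
have KW : K * W <= K ^+ 3 * W by rewrite ler_wpM2r.
have H2 : H ^+ 2 <= K ^+ 2 * h ^+ 2 by rewrite -exprMn ler_pXn2r ?nnegrE ?mulr_ge0// ltW.
have K2 : 1 <= K ^+ 2 by rewrite exprn_ege1.
have H2K : H ^+ 2 * K <= K ^+ 3 * h ^+ 2.
  have -> : K ^+ 3 * h ^+ 2 = K ^+ 2 * h ^+ 2 * K by ring.
  by rewrite ler_wpM2r.
have H3K : H ^+ 3 * K <= K ^+ 3 * h ^+ 2 * H.
  have -> : H ^+ 3 * K = H * (H ^+ 2 * K) by ring.
  by rewrite [leRHS]mulrC ler_wpM2l ?(ltW H0).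
have /andP[x0 x1] := x01.
have x2 : x ^+ 2 <= 1 by rewrite exprn_ile1.
have hx2 : h ^+ 2 * x ^+ 2 <= h ^+ 2 by rewrite ler_piMr.
have hx20 : 0 <= h ^+ 2 * x ^+ 2 by rewrite mulr_ge0 ?sqr_ge0.
have o1 : `|o| <= K ^+ 2 * h ^+ 2.
  have : h ^+ 2 <= K ^+ 2 * h ^+ 2 by rewrite ler_peMl.
  by have := sqr_ge0 H; clear -hx2 hx20 H2 oE; rewrite ler_norml oE => ? ?; apply/andP; split; lra.
have q1 : `|q| <= H ^+ 3.
  have A1 : `|x - a| <= H by clear -ax xb HE; rewrite HE ler_norml; apply/andP; split; lra.
  have A2 : `|b - x| <= H by clear -ax xb HE; rewrite HE ler_norml; apply/andP; split; lra.
  have A3 : `|(2 * x - a - b) / 12| <= H by clear -ax xb HE; rewrite HE ler_norml; apply/andP; split; lra.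
  have -> : q = (x - a) * (b - x) * ((2 * x - a - b) / 12) by rewrite qE; ring.
  have -> : H ^+ 3 = H * H * H by ring.
  by apply: lerM2 => //; exact: lerM2.
have m4 (p' q' r z : R) : p' * (q' * (r * z)) = p' * q' * r * z by rewrite !mulrA.
have qK s : `|s| <= K -> `|q * s * f1| <= K ^+ 3 * W.
  move=> hs; apply: (@le_trans _ _ (H ^+ 3 * K * `|f1|)).
    by apply: lerM2 => //; exact: lerM2.
  apply: (@le_trans _ _ (K ^+ 3 * (h ^+ 2 * (H * `|f1|)))); last by rewrite ler_wpM2l.
  by rewrite m4 ler_wpM2r.
have two z : z <= W -> 2 * K * z <= 2 * K ^+ 3 * W.
  move=> hz; rewrite -(mulrA 2 K) -(mulrA 2 (K ^+ 3)); apply: ler_wpM2l => //.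
  by apply: le_trans KW; apply: ler_wpM2l.
have il : `|(IIL - l00) * f| <= 2 * K ^+ 3 * W.
  apply: (@le_trans _ _ (2 * K * (h ^+ 2 * `|f|))); last exact: two wF.
  rewrite normrM mulrA ler_wpM2r// (le_trans i4)// ler_piMr// mulr_ge0// mulr_ge0//.
have il1 : `|(IIL - l00) * f1| <= 2 * K ^+ 3 * W.
  apply: (@le_trans _ _ (2 * K * (h ^+ 2 * (G * `|f1|)))); last exact: two wG.
  by rewrite normrM m4 ler_wpM2r.
(* In the last column b = 1, so 1 - x is at most H and (x - a) / H at most 1. *)
have q2 : `|l * ((1 - x) * (x - a) * iH)| <= H.
  case: lP => [->|[-> b1]]; first by rewrite mul0r normr0 ltW.
  rewrite mul1r -mulrA; apply: (@le_trans _ _ (H * 1)); last by rewrite mulr1.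
  apply: lerM2; first by clear -ax xb x0 x1 b1 HE; rewrite HE ler_norml; apply/andP; split; lra.
  rewrite iE ger0_norm; last by rewrite divr_ge0 ?(ltW H0)// subr_ge0.
  by rewrite ler_pdivrMr// mul1r HE; clear -xb; lra.
have T1 : `|(eps * (DIS - DS) + eps * (DIL - DL)) * f1| <= K ^+ 3 * W.
  apply: (@le_trans _ _ (K * (h ^+ 2 * ((eps + G) * `|f1|)))); last first.
    by apply: le_trans KW; rewrite ler_wpM2l.
  rewrite normrM mulrA mulrA ler_wpM2r//.
  rewrite (mulrDr (K * h ^+ 2)) (mulrC (K * h ^+ 2) eps); apply: lerD2'.
    by rewrite normrM gtr0_norm// ler_wpM2l// ltW.
  by rewrite normrM gtr0_norm.
have T2 : `|eps * ((DIS2 - DS2) + (DIL2 - DL2)) * f2| <= 2 * K ^+ 3 * W.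
  apply: (@le_trans _ _ (2 * K * (h ^+ 2 * (SE * `|f2|)))); last exact: two wE.
  rewrite normrM m4 ler_wpM2r// SE2 -mulrA normrM (ger0_norm SE0) mulrC ler_wpM2r//.
  rewrite normrM (ger0_norm SE0).
  apply: (le_trans (ler_wpM2l SE0 (ler_normD (DIS2 - DS2) (DIL2 - DL2)))); rewrite mulrDr.
  have -> : 2 * K * h ^+ 2 = K * h ^+ 2 + K * h ^+ 2 by ring.
  exact: lerD.
have T3 : `|c' * ((IIS - s00) + (IIL - l00)) * f| <= MB * (4 * K ^+ 3 * W).
  rewrite -mulrA; apply: lerM2 => //.
  have -> : ((IIS - s00) + (IIL - l00)) * f = (IIS - IS) * f + (IS - s00) * f + (IIL - l00) * f by ring.
  have -> : 4 * K ^+ 3 * W = K ^+ 3 * W + K ^+ 3 * W + 2 * K ^+ 3 * W by ring.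
  apply: lerD2'; last exact: il.
  apply: lerD2'.
    apply: (@le_trans _ _ (K * (h ^+ 2 * `|f|))); first by rewrite normrM mulrA ler_wpM2r.
    by apply: le_trans KW; rewrite ler_wpM2l.
  apply: (@le_trans _ _ (K ^+ 3 * (h ^+ 2 * `|f|))); last by rewrite ler_wpM2l.
  by rewrite normrM mulrA ler_wpM2r// (le_trans i1).
have T4 : `|be * ((IS - s00) * f - q * s20 * f1 - h ^+ 2 * x ^+ 2 / 12 * s20 * f
    + l * (o * s20 * ((1 - x) * (x - a) * iH) * f1) + (IIL - l00) * f)| <= MB * (6 * K ^+ 3 * W).
  apply: lerM2 => //.
  have -> : 6 * K ^+ 3 * W = K ^+ 3 * W + K ^+ 3 * W + K ^+ 3 * W + K ^+ 3 * W + 2 * K ^+ 3 * W by ring.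
  apply: lerD2'; last exact: il.
  apply: lerD2'; [apply: lerD2'; [apply: lerD2'|]|].
  - apply: (@le_trans _ _ (K ^+ 3 * (h ^+ 2 * `|f|))); last by rewrite ler_wpM2l.
    by rewrite normrM mulrA ler_wpM2r// (le_trans i1).
  - by rewrite normrN; exact: qK.
  - rewrite normrN; apply: (@le_trans _ _ (h ^+ 2 * K * `|f|)).
      apply: lerM2 => //; apply: lerM2 => //.
      by clear -hx2 hx20; rewrite ger0_norm; lra.
    rewrite (mulrC (h ^+ 2)) -mulrA; apply: le_trans KW; exact: ler_wpM2l.
  - have -> : l * (o * s20 * ((1 - x) * (x - a) * iH) * f1) =
      o * s20 * (l * ((1 - x) * (x - a) * iH)) * f1 by ring.
    apply: (@le_trans _ _ (K ^+ 2 * h ^+ 2 * K * H * `|f1|)).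
      by apply: lerM2 => //; apply: lerM2 => //; apply: lerM2.
    have -> : K ^+ 2 * h ^+ 2 * K * H * `|f1| = K ^+ 3 * (h ^+ 2 * (H * `|f1|)) by ring.
    by rewrite ler_wpM2l.
have T5 : `|B' * (- (DIS - DS) * f + (IS - s00 - s20 * ((x - a) * (b - x) / 2)) * f1
     + (1 - l) * o * s20 * f1 - q * s30 * f1
     - h ^+ 2 / 12 * (2 * x * s20 + x ^+ 2 * s30) * f
     + l * (- (h ^+ 2 * x / 6) * s20 + o * s30) * ((1 - x) * (x - a) * iH) * f1
     + (IIL - l00) * f1)| <= MB * (9 * K ^+ 3 * W).
  apply: lerM2 => //.
  have -> : 9 * K ^+ 3 * W = K ^+ 3 * W + K ^+ 3 * W + K ^+ 3 * W + K ^+ 3 * W + K ^+ 3 * W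
     + 2 * K ^+ 3 * W + 2 * K ^+ 3 * W by ring.
  apply: lerD2'; last exact: il1.
  apply: lerD2'; [apply: lerD2'; [apply: lerD2'; [apply: lerD2'; [apply: lerD2'|]|]|]|].
  - apply: (@le_trans _ _ (K * (h ^+ 2 * `|f|))); first by rewrite normrM normrN mulrA ler_wpM2r.
    by apply: le_trans KW; rewrite ler_wpM2l.
  - apply: (@le_trans _ _ (K ^+ 3 * (h ^+ 2 * (H * `|f1|)))); last by rewrite ler_wpM2l.
    by rewrite normrM m4 ler_wpM2r// (le_trans i2).
  - case: lP o0 => [->|[-> _]] o0; last by rewrite subrr !mul0r normr0 mulr_ge0.
    rewrite subr0 mul1r; apply: (@le_trans _ _ (K ^+ 3 * (h ^+ 2 * (H * `|f1| + eps * `|f1|)))).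
      apply: (@le_trans _ _ (K * (h * H ^+ 2 + h ^+ 2 * eps ^+ 2) * K * `|f1|)).
        by apply: lerM2 => //; apply: lerM2 => //; exact: o0.
      have -> : K ^+ 3 * (h ^+ 2 * (H * `|f1| + eps * `|f1|)) =
         K * (K * h ^+ 2 * (H + eps)) * K * `|f1| by ring.
      rewrite ler_wpM2r// ler_wpM2r// ler_wpM2l// mulrDr lerD//.
        have -> : h * H ^+ 2 = h * H * H by ring.
        have -> : K * h ^+ 2 * H = h * (K * h) * H by ring.
        by rewrite ler_wpM2r ?(ltW H0)// ler_wpM2l// ltW.
      rewrite (expr2 eps) mulrA ler_wpM2r ?(ltW e0)//.
      apply: (@le_trans _ _ (h ^+ 2)); first by rewrite ler_piMr.
      by rewrite ler_peMl.
    by rewrite ler_wpM2l.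
  - by rewrite normrN; exact: qK.
  - rewrite normrN; apply: (@le_trans _ _ (h ^+ 2 * K * `|f|)).
      apply: lerM2 => //; have -> : h ^+ 2 * K = h ^+ 2 / 12 * (12 * K) by field.
      apply: lerM2; first by rewrite ger0_norm ?divr_ge0.
      apply: (@le_trans _ _ (2 * K + 1 * K)); last by clear -K0; lra.
      apply: lerD2'; apply: lerM2 => //; rewrite ger0_norm ?sqr_ge0//; clear -x0 x1; lra.
    rewrite (mulrC (h ^+ 2)) -mulrA; apply: le_trans KW; exact: ler_wpM2l.
  - have -> : l * (- (h ^+ 2 * x / 6) * s20 + o * s30) * ((1 - x) * (x - a) * iH) * f1 =
      (- (h ^+ 2 * x / 6) * s20 + o * s30) * (l * ((1 - x) * (x - a) * iH)) * f1 by ring.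
    apply: (@le_trans _ _ ((K ^+ 2 * h ^+ 2 * K + K ^+ 2 * h ^+ 2 * K) * H * `|f1|)).
      apply: lerM2 => //; apply: lerM2 => //; apply: lerD2'; apply: lerM2 => //.
      have hx : 0 <= h ^+ 2 * x <= h ^+ 2 by rewrite mulr_ge0//= ler_piMr.
      have : h ^+ 2 <= K ^+ 2 * h ^+ 2 by rewrite ler_peMl.
      by clear -hx hh; move/andP: hx => [? ?] ?; rewrite normrN ger0_norm; lra.
    have -> : (K ^+ 2 * h ^+ 2 * K + K ^+ 2 * h ^+ 2 * K) * H * `|f1| = 2 * K ^+ 3 * (h ^+ 2 * (H * `|f1|)) by ring.
    by rewrite ler_wpM2l// mulr_ge0.
have KK : 3 * K ^+ 3 * W <= MB * (3 * K ^+ 3 * W).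
  by rewrite ler_peMl// mulr_ge0// mulr_ge0//.
have := lerD2' (lerD2' (lerD2' (lerD2' T1 T2) T3) T4) T5.
move/le_trans; apply; clear -KK MB1 K3 W0 ; have := mulr_ge0 (le_trans ler01 MB1) (mulr_ge0 K3 W0); lra.
Qed.

(** * The consistency error up to the term J *)

Section Main.
Context (R : realType).
Implicit Types (x y xi yi t : R).
Notation U := (`]0, 1[%classic : set R).
Variables (n k : nat) (x_ y_ : nat -> R).
Hypotheses (mx : mesh n x_) (my : mesh k y_).
Local Notation Dx := (slope_x n x_).
Local Notation Dy := (slope_y k y_).
Local Notation Ix := (interp_x n x_).
Local Notation Iy := (interp_y k y_).
Local Notation lox := (lo n x_).
Local Notation hix := (hi n x_).
Local Notation wdx := (wd n x_).
Local Notation loy := (lo k y_).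
Local Notation hiy := (hi k y_).
Local Notation wdy := (wd k y_).
Local Notation last := (in_last n x_).
Local Notation iwx := (iw n x_).

Variables (eps h K : R) (G : R -> R).
Hypotheses (e0 : 0 < eps) (e1 : eps <= 1) (h0 : 0 < h) (h1 : h < 1) (K1 : 1 <= K).
Hypotheses (bG : bm1 G) (G01 : forall x, 0 <= x < 1 -> 0 <= G x <= 1)
  (GI : I1 (fun x => G x ^+ 2) <= K * eps).

Lemma K0 : 0 <= K. Proof. exact: le_trans ler01 K1. Qed.
Lemma K20 : 0 <= 2 * K. Proof. by rewrite mulr_ge0// K0. Qed.

Definition Nrm (phi : R * R -> R) :=
  Num.sqrt (eps * nn (Dx phi) ^+ 2 + eps * nn (Dy phi) ^+ 2 + nn phi ^+ 2).

Lemma Nrm_ge0 phi : 0 <= Nrm phi. Proof. exact: sqrtr_ge0. Qed.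

Lemma epsnn (f : R * R -> R) : 0 <= eps * nn f ^+ 2.
Proof. by rewrite mulr_ge0 ?sqr_ge0// ltW. Qed.

Lemma Nrm_sqr phi : Nrm phi ^+ 2 = eps * nn (Dx phi) ^+ 2 + eps * nn (Dy phi) ^+ 2 + nn phi ^+ 2.
Proof. by rewrite sqr_sqrtr//; do ?apply: addr_ge0; rewrite ?epsnn ?sqr_ge0. Qed.

Lemma nn_le_Nrm phi : nn phi <= Nrm phi.
Proof.
rewrite -(ler_pXn2r (n := 2))// ?nnegrE ?nn_ge0 ?Nrm_ge0// Nrm_sqr.
by rewrite lerDr addr_ge0// epsnn.
Qed.

Lemma nnDx_le_Nrm phi : Num.sqrt eps * nn (Dx phi) <= Nrm phi.
Proof.
rewrite -(ler_pXn2r (n := 2))// ?nnegrE ?mulr_ge0 ?sqrtr_ge0 ?nn_ge0 ?Nrm_ge0// Nrm_sqr.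
by rewrite exprMn sqr_sqrtr ?(ltW e0)// -addrA lerDl addr_ge0 ?epsnn ?sqr_ge0.
Qed.

Lemma nnDy_le_Nrm phi : Num.sqrt eps * nn (Dy phi) <= Nrm phi.
Proof.
rewrite -(ler_pXn2r (n := 2))// ?nnegrE ?mulr_ge0 ?sqrtr_ge0 ?nn_ge0 ?Nrm_ge0// Nrm_sqr.
by rewrite exprMn sqr_sqrtr ?(ltW e0)// addrAC lerDr addr_ge0 ?epsnn ?sqr_ge0.
Qed.

(** A density whose integral the energy norm bounds uniformly in eps: the inverse inequality absorbs
    the width times phi_x, and the weight eps + G, of L^2 norm O(eps^(1/2)), pays for phi_x
    itself. *)
Definition gw (phi : R * R -> R) (p : R * R) := `|phi p| + wdx p.1 * `|Dx phi p|
  + (eps + G p.1) * `|Dx phi p| + Num.sqrt eps * `|Dy phi p|.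

Lemma I2_lineX (f : R -> R) : bm1 f -> I2 (fun p : R * R => f p.1) = I1 f.
Proof.
move=> bf; rewrite I2_fubiniX; last exact: bmeas_of_lineX.
by rewrite /= I1_cst.
Qed.

Lemma nn_weight : nn (fun p : R * R => eps + G p.1) <= 2 * K * Num.sqrt eps.
Proof.
apply: nn_le; first by rewrite mulr_ge0 ?K20 ?sqrtr_ge0.
have bG2 : bm1 (fun x => 2 * eps ^+ 2 + 2 * G x ^+ 2).
  by apply: bmeasD; [exact: bmeas_cst|apply: bmeasM; [exact: bmeas_cst|exact: bmeasX]].
have bG2' : bm1 (fun x => 2 * G x ^+ 2) by apply: bmeasM; [exact: bmeas_cst|exact: bmeasX].
apply: (@le_trans _ _ (I2 (fun p : R * R => 2 * eps ^+ 2 + 2 * G p.1 ^+ 2))).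
  apply: I2_le.
  - apply: bmeasX; apply: bmeasD; [exact: bmeas_cst|exact: (bmeas_of_lineX bG)].
  - exact: (bmeas_of_lineX bG2).
  - by move=> p _; have := sqr_ge0 (eps - G p.1); nra.
rewrite (I2_lineX bG2) I1D//; last exact: bmeas_cst.
rewrite I1_cst I1Z; last exact: bmeasX.
rewrite !exprMn sqr_sqrtr ?(ltW e0)//.
have q1 : eps ^+ 2 <= eps by rewrite expr2 ler_piMr// ltW.
have q2 : eps <= K ^+ 2 * eps by rewrite ler_peMl ?(ltW e0)// exprn_ege1.
have q3 : K * eps <= K ^+ 2 * eps by rewrite ler_wpM2r ?(ltW e0)// expr2 ler_peMr ?K0.
move: GI; set z := I1 _ => GI'.
have -> : 2 ^+ 2 * K ^+ 2 * eps = 4 * (K ^+ 2 * eps) by ring.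
lra.
Qed.

Lemma bm_gw phi : continuous phi -> bm (gw phi).
Proof.
move=> cphi; have b1 := bmeas_norm (bm_continuous cphi).
have b2 := bmeas_norm (bm_Dx mx cphi); have b3 := bmeas_norm (bm_Dy my cphi).
apply: bmeasD; last by apply: bmeasM => //; exact: bmeas_cst.
apply: bmeasD; last first.
  by apply: bmeasM => //; apply: bmeasD; [exact: bmeas_cst|exact: (bmeas_of_lineX bG)].
by apply: bmeasD => //; apply: bmeasM => //; exact: (bmeas_of_lineX (bm1_wd n x_)).
Qed.

Lemma gw_le phi : vh n k x_ y_ phi -> I2 (gw phi) <= (6 + 2 * K) * Nrm phi.
Proof.
move=> vphi; have [cphi _ _ _ _] := vphi.
have bp := bm_continuous cphi; have bx := bm_Dx mx cphi; have by_ := bm_Dy my cphi.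
have b1 := bmeas_norm bp; have b2 := bmeas_norm bx; have b3 := bmeas_norm by_.
have bw := bmeas_of_lineX (bm1_wd n x_).
have beG : bm (fun p : R * R => eps + G p.1).
  by apply: bmeasD; [exact: bmeas_cst|exact: (bmeas_of_lineX bG)].
have t1 : bm (fun p => wdx p.1 * `|Dx phi p|) by exact: bmeasM.
have t2 : bm (fun p => (eps + G p.1) * `|Dx phi p|) by exact: bmeasM.
have t3 : bm (fun p => Num.sqrt eps * `|Dy phi p|) by apply: bmeasM => //; exact: bmeas_cst.
have s1 : bm (fun p => `|phi p| + wdx p.1 * `|Dx phi p|) by exact: bmeasD.
have s2 : bm (fun p => `|phi p| + wdx p.1 * `|Dx phi p| + (eps + G p.1) * `|Dx phi p|) by exact: bmeasD.
rewrite /gw I2D// I2D// I2D// I2Z//.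
have B1 : I2 (fun p => `|phi p|) <= Nrm phi := le_trans (I2_abs_nn bp) (nn_le_Nrm phi).
have B2 : I2 (fun p => wdx p.1 * `|Dx phi p|) <= 4 * Nrm phi.
  have := le_trans (I2_abs_nn (bm_wdDx mx vphi)) (inverse_nn mx vphi).
  move=> H; apply: (@le_trans _ _ (4 * nn phi)); last by rewrite ler_wpM2l// nn_le_Nrm.
  rewrite (le_trans _ H)// le_eqVlt; apply/orP; left; apply/eqP; apply: I2_eq => -[x y] [/= Ux _].
  have [_ _ _ _ w0] := lohi mx (UI Ux).
  by rewrite [in RHS]normrM (gtr0_norm w0).
have B3 : I2 (fun p => (eps + G p.1) * `|Dx phi p|) <= 2 * K * Nrm phi.
  have H := I2_cs beG bx.
  apply: (@le_trans _ _ (nn (fun p : R * R => eps + G p.1) * nn (Dx phi))).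
    rewrite (le_trans _ H)// le_eqVlt; apply/orP; left; apply/eqP; apply: I2_eq => -[x y] [/= Ux _].
    have /andP[g0 _] := G01 (UI Ux).
    by rewrite [in RHS]normrM (ger0_norm (addr_ge0 (ltW e0) g0)).
  apply: (@le_trans _ _ (2 * K * Num.sqrt eps * nn (Dx phi))).
    by rewrite ler_wpM2r ?nn_ge0// nn_weight.
  by rewrite -mulrA ler_wpM2l ?nnDx_le_Nrm ?K20.
have B4 : Num.sqrt eps * I2 (fun p => `|Dy phi p|) <= Nrm phi.
  apply: le_trans (nnDy_le_Nrm phi); rewrite ler_wpM2l ?sqrtr_ge0//.
  exact: I2_abs_nn.
have -> : (6 + 2 * K) * Nrm phi = Nrm phi + 4 * Nrm phi + 2 * K * Nrm phi + Nrm phi by ring.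
by rewrite !lerD.
Qed.

Hypotheses (hHx : forall x, 0 <= x < 1 -> wdx x <= K * h)
  (hom : forall x, 0 <= x < 1 -> last x = 0 -> `|om n x_ h x| <= K * (h * wdx x ^+ 2 + h ^+ 2 * eps ^+ 2)).

Variables (S L : nat -> nat -> R * R -> R).
Hypotheses (jS : cjet S) (jL : cjet L).
Local Notation S00 := (S 0%N 0%N).
Local Notation S10 := (S 1%N 0%N).
Local Notation S01 := (S 0%N 1%N).
Local Notation S20 := (S 2%N 0%N).
Local Notation S30 := (S 3%N 0%N).
Local Notation L00 := (L 0%N 0%N).
Local Notation L10 := (L 1%N 0%N).
Local Notation L01 := (L 0%N 1%N).

Hypotheses
  (hS20 : forall x y, 0 <= x <= 1 -> 0 <= y <= 1 -> `|S20 (x, y)| <= K)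
  (hS30 : forall x y, 0 <= x <= 1 -> 0 <= y <= 1 -> `|S30 (x, y)| <= K)
  (hS12 : forall y xi yi, 0 <= y < 1 -> 0 < xi < 1 -> loy y < yi < hiy y ->
     wdy y ^+ 2 * `|S 1%N 2%N (xi, yi)| <= K * h ^+ 2)
  (hS02 : forall y xi yi, 0 <= y < 1 -> 0 <= xi <= 1 -> loy y < yi < hiy y ->
     wdy y ^+ 2 * `|S 0%N 2%N (xi, yi)| <= K * h ^+ 2)
  (hS21 : forall x xi yi, 0 <= x < 1 -> lox x < xi < hix x -> 0 < yi < 1 ->
     wdx x ^+ 2 * `|S 2%N 1%N (xi, yi)| * Num.sqrt eps <= K * h ^+ 2)
  (hL20 : forall x xi yi, 0 <= x < 1 -> lox x < xi < hix x -> 0 <= yi <= 1 ->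
     wdx x ^+ 2 * `|L 2%N 0%N (xi, yi)| <= K * h ^+ 2 * G x)
  (hL02 : forall x y xi yi, 0 <= x < 1 -> 0 <= y < 1 -> lox x <= xi <= hix x -> loy y < yi < hiy y ->
     wdy y ^+ 2 * `|L 0%N 2%N (xi, yi)| <= K * h ^+ 2 * G x)
  (hL12 : forall x y xi yi, 0 <= x < 1 -> 0 <= y < 1 -> lox x < xi < hix x -> loy y < yi < hiy y ->
     eps * (wdy y ^+ 2 * `|L 1%N 2%N (xi, yi)|) <= K * h ^+ 2 * G x)
  (hL21 : forall x xi yi, 0 <= x < 1 -> lox x < xi < hix x -> 0 < yi < 1 ->
     wdx x ^+ 2 * `|L 2%N 1%N (xi, yi)| * Num.sqrt eps <= K * h ^+ 2).

(** The mesh enters through products of a squared width and a derivative. Dividing gives the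
    supremum bound on the cell that the interpolation lemmas take, and [from_sup] undoes the
    division. *)
Lemma div_bound (w m N : R) : 0 < w -> w * m <= N -> m <= N / w.
Proof. by move=> w0; rewrite ler_pdivlMr// mulrC. Qed.

Lemma from_sup (w z N : R) : 0 < w -> z <= w * (N / w) -> z <= N.
Proof. by move=> w0; rewrite mulrC divfK// gt_eqF. Qed.

Section Point.
Variables (x y : R).
Hypotheses (x01 : 0 <= x < 1) (y01 : 0 <= y < 1).

Let wx0 : 0 < wdx x. Proof. by have [] := lohi mx x01. Qed.
Let wy0 : 0 < wdy y. Proof. by have [] := lohi my y01. Qed.
Let wx2 : 0 < wdx x ^+ 2. Proof. by rewrite exprn_gt0. Qed.
Let wy2 : 0 < wdy y ^+ 2. Proof. by rewrite exprn_gt0. Qed.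
Let y01' : 0 <= y <= 1. Proof. by move/andP: y01 => [-> /ltW ->]. Qed.
Let x01' : 0 <= x <= 1. Proof. by move/andP: x01 => [-> /ltW ->]. Qed.
Let xin xi : lox x < xi < hix x -> 0 < xi < 1.
Proof. by have [? ? ? ? _] := lohi mx x01; move=> /andP[? ?]; apply/andP; split; lra. Qed.
Let yin yi : loy y < yi < hiy y -> 0 < yi < 1.
Proof. by have [? ? ? ? _] := lohi my y01; move=> /andP[? ?]; apply/andP; split; lra. Qed.
Let oc t : 0 < t < 1 -> 0 <= t <= 1.
Proof. by move=> /andP[/ltW -> /ltW ->]. Qed.

Lemma ptA1S : `|Dx (fun p => Iy S00 p - S00 p) (x, y)| <= K * h ^+ 2.
Proof.
apply: (from_sup wy2); apply: (Dx_Iy_err mx my jS x01 y01) => xi yi hxi hyi.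
by apply: div_bound => //; apply: hS12 => //; exact: xin.
Qed.

Lemma ptA1L : eps * `|Dx (fun p => Iy L00 p - L00 p) (x, y)| <= K * h ^+ 2 * G x.
Proof.
rewrite mulrC -ler_pdivlMr//.
apply: (from_sup wy2); apply: (Dx_Iy_err mx my jL x01 y01) => xi yi hxi hyi.
by apply: div_bound => //; rewrite ler_pdivlMr// mulrC; exact: hL12.
Qed.

Lemma sqe0 : 0 < Num.sqrt eps. Proof. by rewrite sqrtr_gt0. Qed.

Lemma ptA2S : Num.sqrt eps * `|Dy (fun p => Ix S00 p - S00 p) (x, y)| <= K * h ^+ 2.
Proof.
rewrite mulrC -ler_pdivlMr ?sqe0//.
apply: (from_sup wx2); apply: (Dy_Ix_err mx my jS x01 y01) => xi yi hxi hyi.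
by apply: div_bound => //; rewrite ler_pdivlMr ?sqe0//; apply: hS21 => //; exact: yin.
Qed.

Lemma ptA2L : Num.sqrt eps * `|Dy (fun p => Ix L00 p - L00 p) (x, y)| <= K * h ^+ 2.
Proof.
rewrite mulrC -ler_pdivlMr ?sqe0//.
apply: (from_sup wx2); apply: (Dy_Ix_err mx my jL x01 y01) => xi yi hxi hyi.
by apply: div_bound => //; rewrite ler_pdivlMr ?sqe0//; apply: hL21 => //; exact: yin.
Qed.

Lemma ptIxS : `|Ix S00 (x, y) - S00 (x, y)| <= wdx x ^+ 2 * K.
Proof. by apply: (Ix_err mx jS) => // xi /xin/oc hxi; exact: hS20. Qed.

Lemma ptIxS3 : `|Ix S00 (x, y) - S00 (x, y) - S20 (x, y) * ((x - lox x) * (hix x - x) / 2)|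
   <= wdx x ^+ 3 * K.
Proof. by apply: (Ix_err3 mx jS) => // xi /xin/oc hxi; exact: hS30. Qed.

Lemma ptIyS xi : 0 <= xi <= 1 -> `|Iy S00 (xi, y) - S00 (xi, y)| <= K * h ^+ 2.
Proof.
move=> hxi; apply: (from_sup wy2); apply: (Iy_err my jS) => // yi hyi.
by apply: div_bound => //; exact: hS02.
Qed.

Lemma ptIxL : `|Ix L00 (x, y) - L00 (x, y)| <= K * h ^+ 2 * G x.
Proof.
apply: (from_sup wx2); apply: (Ix_err mx jL) => // xi hxi.
by apply: div_bound => //; exact: hL20.
Qed.

Lemma ptIyL xi : lox x <= xi <= hix x -> `|Iy L00 (xi, y) - L00 (xi, y)| <= K * h ^+ 2 * G x.
Proof.
move=> hxi; apply: (from_sup wy2); apply: (Iy_err my jL) => // yi hyi.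
by apply: div_bound => //; exact: hL02.
Qed.

Lemma Ix_sup w M : (forall xi, lox x <= xi <= hix x -> `|w (xi, y)| <= M) -> `|Ix w (x, y)| <= M.
Proof.
move=> hM; rewrite (IxE mx)//; have [l0 lx xh h1' w0] := lohi mx x01.
have lh : lox x <= hix x by rewrite -subr_ge0 ltW.
have := hM (lox x); have := hM (hix x); rewrite !lexx lh => /(_ isT) h2 /(_ isT) h3.
have -> : w (lox x, y) + (x - lox x) * ((w (hix x, y) - w (lox x, y)) / (hix x - lox x)) =
  (1 - (x - lox x) / wdx x) * w (lox x, y) + (x - lox x) / wdx x * w (hix x, y).
  by rewrite /wd; field; rewrite gt_eqF.
set t := (x - lox x) / wdx x.
have xl : 0 <= x - lox x by rewrite subr_ge0.
have t0 : 0 <= t by rewrite divr_ge0// ltW.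
have t1 : t <= 1 by rewrite ler_pdivrMr// mul1r /wd; lra.
have t1' : 0 <= 1 - t by lra.
clearbody t.
apply: le_trans (ler_normD _ _) _; rewrite !normrM (ger0_norm t0) (ger0_norm t1').
nra.
Qed.

Lemma ptIxIyS : `|Ix (fun p => Iy S00 p - S00 p) (x, y)| <= K * h ^+ 2.
Proof.
apply: Ix_sup => xi /andP[h2 h3]; apply: ptIyS; have [? ? ? ? _] := lohi mx x01.
by apply/andP; split; lra.
Qed.

Lemma ptIxIyL : `|Ix (Iy L00) (x, y) - L00 (x, y)| <= 2 * K * h ^+ 2 * G x.
Proof.
have -> : Ix (Iy L00) (x, y) - L00 (x, y) =
   Ix (fun p => Iy L00 p - L00 p) (x, y) + (Ix L00 (x, y) - L00 (x, y)).
  by rewrite /interp_x /slope_x /=; ring.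
have -> : 2 * K * h ^+ 2 * G x = K * h ^+ 2 * G x + K * h ^+ 2 * G x by ring.
rewrite (le_trans (ler_normD _ _))// lerD//; last exact: ptIxL.
by apply: Ix_sup => xi hxi; exact: ptIyL.
Qed.

End Point.

Variables (B beta c uI : R * R -> R) (d : R -> R) (MB : R).
Hypotheses (bd : bm1 d) (bbeta : bm beta) (bc : bm c) (MB1 : 1 <= MB)
  (hB : forall p, B p = d p.2 + primX beta p)
  (hMB : forall p, Omega p -> `|B p| <= MB)
  (hMbeta : forall p, Omega p -> `|beta p| <= MB)
  (hMc : forall p, Omega p -> `|c p| <= MB).
Local Notation u := (fun i j p => S i j p + L i j p).
Local Notation u00 := (fun p => S00 p + L00 p).
Local Notation u10 := (fun p => S10 p + L10 p).
Local Notation u01 := (fun p => S01 p + L01 p).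
Hypotheses (cuI : continuous uI)
  (hDxI : forall p, Omega p -> Dx uI p = Dx (Iy u00) p)
  (hDyI : forall p, Omega p -> Dy uI p = Dy (Ix u00) p)
  (hI : forall p, Omega p -> uI p = Ix (Iy u00) p).
Local Notation omx := (om n x_ h).
Local Notation PhiF := (part_prim n k x_ y_ S L h).
Local Notation PsiF := (part_dens n k x_ y_ S L h).

(** The density of a(u^I - u, phi). *)
Definition aeta phi p := eps * ((Dx uI p - u10 p) * Dx phi p + (Dy uI p - u01 p) * Dy phi p)
  + (- B p * (Dx uI p - u10 p) + c p * (uI p - u00 p)) * phi p.

(** The density of J; [iwx] is the reciprocal width, so this is an average in x over the last
    column. *)
Definition last_int (s20 : R * R -> R) phi p := - B p * (last p.1 * (2 * iwx p.1) * omx p.1 * s20 p) * phi p.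

(** Differs from [aeta - last_int] by terms of integral 0 only: the two diffusion terms treated by
    [pw_slope] and [pw_slopeY], and the pair supplied by [by_parts]. *)
Definition rem phi p := aeta phi p - eps * ((Dx u00 p - u10 p) * Dx phi p)
  - eps * ((Dy u00 p - u01 p) * Dy phi p) + (B p * PsiF phi p + beta p * PhiF phi p)
  - last_int S20 phi p.

Lemma rem_alg (B' be c' DIS DIL DIS2 DIL2 DS DL DS2 DL2 s10 l10 s01 l01 s00 l00 s20 s30 IS IIS IIL
    f f1 f2 x a b H iH l q o hh : R) :
  o = (H ^+ 2 - hh ^+ 2 * x ^+ 2) / 12 ->
  l * ((1 + (1 + a - 2 * x) * iH) * f1 + 2 * iH * f) = 0 ->
  let Phi := (IS - s00) * f - q * s20 * f1 - hh ^+ 2 * x ^+ 2 / 12 * s20 * f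
    + l * (o * s20 * ((1 - x) * (x - a) * iH) * f1) + (IIL - l00) * f in
  let Psi := (DS - s10) * f + (IS - s00) * f1
    - ((x - a) * (b - x) / 2 - H ^+ 2 / 12) * s20 * f1 - q * s30 * f1
    - hh ^+ 2 / 12 * (2 * x * s20 + x ^+ 2 * s30) * f - hh ^+ 2 * x ^+ 2 / 12 * s20 * f1
    + l * ((- (hh ^+ 2 * x / 6) * s20 + o * s30) * ((1 - x) * (x - a) * iH)
      + o * s20 * ((1 + a - 2 * x) * iH)) * f1 + (DIL - l10) * f + (IIL - l00) * f1 in
  eps * ((DIS + DIL - (s10 + l10)) * f1 + (DIS2 + DIL2 - (s01 + l01)) * f2)
  + (- B' * (DIS + DIL - (s10 + l10)) + c' * (IIS + IIL - (s00 + l00))) * f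
  - eps * ((DS + DL - (s10 + l10)) * f1) - eps * ((DS2 + DL2 - (s01 + l01)) * f2)
  + (B' * Psi + be * Phi) - (- B' * (l * (2 * iH) * o * s20) * f) =
  (eps * (DIS - DS) + eps * (DIL - DL)) * f1 + eps * ((DIS2 - DS2) + (DIL2 - DL2)) * f2
  + c' * ((IIS - s00) + (IIL - l00)) * f
  + be * Phi
  + B' * (- (DIS - DS) * f + (IS - s00 - s20 * ((x - a) * (b - x) / 2)) * f1
     + (1 - l) * o * s20 * f1 - q * s30 * f1
     - hh ^+ 2 / 12 * (2 * x * s20 + x ^+ 2 * s30) * f
     + l * (- (hh ^+ 2 * x / 6) * s20 + o * s30) * ((1 - x) * (x - a) * iH) * f1
     + (IIL - l00) * f1).
Proof.
move=> oE lE /=.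
(* Both sides agree as polynomials up to this multiple of the relation [lE], which expresses that
   phi is linear in the last column and vanishes at x = 1. *)
have tr (P Q : R) : P = Q + B' * o * s20 * (l * ((1 + (1 + a - 2 * x) * iH) * f1 + 2 * iH * f))
   -> P = Q by move=> ->; rewrite lE mulr0 addr0.
by apply: tr; rewrite oE; field.
Qed.

Lemma lastP x : 0 <= x < 1 -> last x = 0 \/ (last x = 1 /\ hix x = 1).
Proof.
move=> x01; have [i ilt ix] := mesh_cell mx x01.
rewrite /last /hi !(stepf_cell mx _ ilt ix); case: eqP => [e|_]; last by left.
by right; split=> //; rewrite e; have [] := mx.
Qed.

(** With H = 1 - a the coefficient of phi_x is 2 (1 - x) / H, and phi = - (1 - x) phi_x in the last
    column. *)
Lemma vh_last phi x y : vh n k x_ y_ phi -> 0 <= x < 1 -> 0 <= y <= 1 ->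
  last x * ((1 + (1 + lox x - 2 * x) * iwx x) * Dx phi (x, y) + 2 * iwx x * phi (x, y)) = 0.
Proof.
move=> [cphi vx vy zx zy] x01 y01; have [->|[_ hE]] := lastP x01; first by rewrite mul0r.
have [i ilt [ix loE _ iE _]] := cellP mx x01.
have [_ _ _ _ w0] := lohi mx x01.
have [_ z1] := zx y y01.
rewrite -(vx x y x01 y01) /interp_x /slope_x /= hE z1.
have wE : wdx x = 1 - lox x by rewrite /wd hE.
have iwE : iwx x * (1 - lox x) = 1 by rewrite iE -wE mulVf// gt_eqF.
set a := lox x in iwE *; set iH := iwx x in iwE *; set pa := phi (a, y).
have -> : (1 + (1 + a - 2 * x) * iH) * ((0 - pa) * iH) + 2 * iH * (pa + (x - a) * ((0 - pa) * iH))
  = pa * iH * (1 - iH * (1 - a)) by ring.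
by rewrite iwE subrr !mulr0.
Qed.

Lemma rem_bound phi p : vh n k x_ y_ phi -> Omega p ->
  `|rem phi p| <= 25 * MB * K ^+ 3 * (h ^+ 2 * gw phi p).
Proof.
move=> vphi Op; case: p Op => x y Op; have [Ux Uy] := Op.
have x01 := UI Ux; have y01 := UI Uy; have x01' := U01 Ux; have y01' := U01 Uy.
rewrite /= in x01 y01 x01' y01'.
have [l0 lx xh hi1 w0] := lohi mx x01.
have a1s := ptA1S x01 y01; have a1l := ptA1L x01 y01.
have a2s := ptA2S x01 y01; have a2l := ptA2L x01 y01.
have ixs := ptIxS x01 y01; have ixs3 := ptIxS3 x01 y01.
have ixiys := ptIxIyS x01 y01; have ixiyl := ptIxIyL x01 y01.
have Hh := hHx x01; have K0 := K0.
have s20 := hS20 x01' y01'; have s30 := hS30 x01' y01'.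
have /andP[G0 G1] := G01 x01.
have lst := vh_last vphi x01 y01'.
have E1 w : Dx (fun p => Iy w p - w p) (x, y) = Dx (Iy w) (x, y) - Dx w (x, y).
  by rewrite /slope_x /=; ring.
have E2 w : Dy (fun p => Ix w p - w p) (x, y) = Dy (Ix w) (x, y) - Dy w (x, y).
  by rewrite /slope_y /=; ring.
have E3 w : Ix (fun p => Iy w p - w p) (x, y) = Ix (Iy w) (x, y) - Ix w (x, y).
  by rewrite /interp_x /slope_x /=; ring.
have E4 : Dx (Iy u00) (x, y) = Dx (Iy S00) (x, y) + Dx (Iy L00) (x, y).
  by rewrite /slope_x /interp_y /slope_y /=; ring.
have E5 : Dy (Ix u00) (x, y) = Dy (Ix S00) (x, y) + Dy (Ix L00) (x, y).
  by rewrite /slope_y /interp_x /slope_x /=; ring.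
have E6 : Ix (Iy u00) (x, y) = Ix (Iy S00) (x, y) + Ix (Iy L00) (x, y).
  by rewrite /interp_x /slope_x /interp_y /slope_y /=; ring.
have E7 : Dx u00 (x, y) = Dx S00 (x, y) + Dx L00 (x, y) by rewrite /slope_x /=; ring.
have E8 : Dy u00 (x, y) = Dy S00 (x, y) + Dy L00 (x, y) by rewrite /slope_y /=; ring.
rewrite E1 in a1s; rewrite E2 in a2s; rewrite E3 in ixiys.
rewrite E1 in a1l; rewrite E2 in a2l.
have bB := hMB Op; have bbe := hMbeta Op; have bcc := hMc Op.
have om0 := hom x01.
have oE : omx x = (wdx x ^+ 2 - h ^+ 2 * x ^+ 2) / 12 by [].
rewrite /rem /aeta /last_int (hDxI Op) (hDyI Op) (hI Op) E4 E5 E6 E7 E8 /part_prim /part_dens /Q1 /Q2 /Q2' /=.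
rewrite (rem_alg _ _ _ _ _ _ _ _ _ _ _ _ _ _ _ _ _ _ _ _ _ _ _ _ _ oE lst).
have lP := lastP x01.
rewrite /gw /=.
have SQ2 : eps = Num.sqrt eps * Num.sqrt eps by rewrite -expr2 sqr_sqrtr// ltW.
have SQ0 := sqrtr_ge0 eps.
have iE : iwx x = (wdx x)^-1 by have [i _ []] := cellP mx x01.
have wE : wdx x = hix x - lox x by [].
have Q3E : Q3 n x_ x = (x - lox x) * (hix x - x) * (2 * x - lox x - hix x) / 12 by [].
have l0' : last x = 0 -> `|omx x| <= K * (h * wdx x ^+ 2 + h ^+ 2 * eps ^+ 2) := om0.
apply: rem_est => //; try lra.
Qed.


Lemma I2_lin6 e (f g1 g2 g3 g4 g5 : R * R -> R) : bm f -> bm g1 -> bm g2 -> bm g3 -> bm g4 -> bm g5 ->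
  I2 (fun p => f p - e * g1 p - e * g2 p + (g3 p + g4 p) - g5 p) =
  I2 f - e * I2 g1 - e * I2 g2 + (I2 g3 + I2 g4) - I2 g5.
Proof.
move=> bf b1 b2 b3 b4 b5.
have b12 : bm (fun p => f p - e * g1 p - e * g2 p + (g3 p + g4 p)) by bmt.
have b11 : bm (fun p => f p - e * g1 p - e * g2 p) by bmt.
have b10 : bm (fun p => f p - e * g1 p) by bmt.
have e1' : bm (fun p => e * g1 p) by bmt.
have e2' : bm (fun p => e * g2 p) by bmt.
have b34 : bm (fun p => g3 p + g4 p) by bmt.
by rewrite (I2B b12 b5) (I2D b11 b34) (I2B b10 e2') (I2B bf e1') (I2D b3 b4) !I2Z.
Qed.

Lemma aeta_est phi : vh n k x_ y_ phi ->
  `|I2 (aeta phi) - I2 (last_int S20 phi)| <= 25 * MB * K ^+ 3 * (6 + 2 * K) * (h ^+ 2 * Nrm phi).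
Proof.
move=> vphi; have [cphi _ _ zx zy] := vphi.
have [cS xS yS] := jS; have [cL xL yL] := jL.
have b1 := bm_continuous cphi; have b2 := bm_Dx mx cphi; have b3 := bm_Dy my cphi.
have b4 := bm_continuous cuI; have b5 := bm_Dx mx cuI; have b6 := bm_Dy my cuI.
have s00 := bm_continuous (cS 0%N 0%N isT); have s10 := bm_continuous (cS 1%N 0%N isT).
have s01 := bm_continuous (cS 0%N 1%N isT); have s20 := bm_continuous (cS 2%N 0%N isT).
have s30 := bm_continuous (cS 3%N 0%N isT).
have l00 := bm_continuous (cL 0%N 0%N isT); have l10 := bm_continuous (cL 1%N 0%N isT).
have l01 := bm_continuous (cL 0%N 1%N isT).
have u00c : continuous u00 by move=> p; apply: cvgD; [exact: cS|exact: cL].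
have d1 := bm_Dx mx u00c; have d2 := bm_Dy my u00c.
have d3 := bm_Dx mx (cS 0%N 0%N isT); have d4 := bm_Ix mx (cS 0%N 0%N isT).
have d5 := bm_Dx_Iy mx my (cL 0%N 0%N isT); have d6 := bm_Ix_Iy mx my (cL 0%N 0%N isT).
have bB : bm B.
  apply: (bmeas_eq (f := fun p => d p.2 + primX beta p)); first by move=> p _; rewrite hB.
  by apply: bmeasD; [exact: (bmeas_of_lineY bd)|exact: bm_primX].
have xx := bmeas_of_lineX (@bm1_id R).
have bl := bmeas_of_lineX (stepf_bm1 n x_ (fun i => (i.+1 == n)%:R)).
have blo := bmeas_of_lineX (bm1_lo n x_); have bhi := bmeas_of_lineX (bm1_hi n x_).
have bw := bmeas_of_lineX (bm1_wd n x_); have biw := bmeas_of_lineX (bm1_iw n x_).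
have bom : bm (fun p => omx p.1) by rewrite /om; bmt.
have bQ1 : bm (fun p => Q1 n x_ p.1) by rewrite /Q1; bmt.
have bQ2 : bm (fun p => Q2 n x_ p.1) by rewrite /Q2; bmt.
have bQ2' : bm (fun p => Q2' n x_ p.1) by rewrite /Q2'; bmt.
have bQ3 : bm (fun p => Q3 n x_ p.1) by rewrite /Q3; bmt.
have bPhi : bm (PhiF phi) by rewrite /part_prim; bmt.
have bPsi : bm (PsiF phi) by rewrite /part_dens; bmt.
have ba : bm (aeta phi) by rewrite /aeta; bmt.
have bj : bm (last_int S20 phi) by rewrite /last_int; bmt.
have t1 : bm (fun p => (Dx u00 p - u10 p) * Dx phi p) by bmt.
have t2 : bm (fun p => (Dy u00 p - u01 p) * Dy phi p) by bmt.
have t3 : bm (fun p => B p * PsiF phi p) by bmt.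
have t4 : bm (fun p => beta p * PhiF phi p) by bmt.
have z1 : I2 (fun p => (Dx u00 p - u10 p) * Dx phi p) = 0.
  apply: (I2_pw0 (Phi := fun p => (Ix u00 p - u00 p) * Dx phi p) (v := fun _ _ => 0) mx t1) => // y Uy.
  apply: (@pw_slope R n x_ mx phi u00 u10 y Uy) => a b a0 b1'.
  by apply: niceD; [exact: (niceX (i := 0) y jS)|exact: (niceX (i := 0) y jL)].
have z2 : I2 (fun p => (Dy u00 p - u01 p) * Dy phi p) = 0.
  apply: (I2_pw0Y (Phi := fun p => (Iy u00 p - u00 p) * Dy phi p) (v := fun _ _ => 0) my t2) => // x Ux.
  apply: (@pw_slopeY R k y_ my phi u00 u01 x Ux) => a b a0 b1'.
  by apply: niceD; [exact: (niceY (j := 0) x jS)|exact: (niceY (j := 0) x jL)].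
have z3 : I2 (fun p => B p * PsiF phi p) = - I2 (fun p => beta p * PhiF phi p).
  rewrite -(by_parts mx bd bbeta bPhi bPsi (pw_part mx h jS jL vphi) (vnode0 mx S L h vphi)).
  by apply: I2_eq => p _; rewrite hB.
have br : bm (rem phi) by rewrite /rem; bmt.
have -> : I2 (aeta phi) - I2 (last_int S20 phi) = I2 (rem phi).
  by rewrite (I2_lin6 eps ba t1 t2 t3 t4 bj) z1 z2 z3; ring.
apply: (le_trans (I2_abs br)); have bg := bm_gw cphi.
set c0 := 25 * MB * K ^+ 3.
have c00 : 0 <= c0 by rewrite mulr_ge0 ?exprn_ge0 ?K0// mulr_ge0// (le_trans ler01).
apply: (@le_trans _ _ (I2 (fun p => c0 * (h ^+ 2 * gw phi p)))).
  by apply: I2_le => [||p Op]; [bmt|bmt|exact: rem_bound].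
rewrite I2Z; last by bmt.
rewrite I2Z//; have hg := gw_le vphi.
have -> : c0 * (6 + 2 * K) * (h ^+ 2 * Nrm phi) = c0 * (h ^+ 2 * ((6 + 2 * K) * Nrm phi)) by ring.
by apply: ler_wpM2l => //; apply: ler_wpM2l => //; exact: sqr_ge0.
Qed.

End Main.

(** * The last column of cells *)

Section MinMax.
Context (R : realType) (T : topologicalType).

Lemma cont_max (f g : T -> R) : continuous f -> continuous g -> continuous (fun t => Num.max (f t) (g t)).
Proof. by move=> cf cg x; exact: (@continuous_max R T f g x (cf x) (cg x)). Qed.

Lemma cont_min (f g : T -> R) : continuous f -> continuous g -> continuous (fun t => Num.min (f t) (g t)).
Proof. by move=> cf cg x; exact: (@continuous_min R T f g x (cf x) (cg x)). Qed.

End MinMax.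

Section Spline.
Context (R : realType).
Implicit Types (x y t : R).
Variables (k : nat) (y_ : nat -> R).
Hypothesis my : mesh k y_.

(** The piecewise linear interpolant as a sum of slopes times the part of each cell below y. This
    makes it continuous on the whole line; it starts from 0, hence the condition on [v 0] in
    [splE]. *)
Definition spl (v : nat -> R) y := \sum_(0 <= j < k)
  (v j.+1 - v j) / (y_ j.+1 - y_ j) * Num.max 0 (Num.min (y - y_ j) (y_ j.+1 - y_ j)).

Lemma spl_cont v : continuous (spl v).
Proof.
rewrite /spl => y; elim: k => [|m IH].
  rewrite (_ : (fun _ => _) = fun _ => 0); first exact: cvg_cst.
  by apply/funext => z; rewrite big_nil.
rewrite (_ : (fun _ => _) = fun z => \sum_(0 <= j < m)
  (v j.+1 - v j) / (y_ j.+1 - y_ j) * Num.max 0 (Num.min (z - y_ j) (y_ j.+1 - y_ j)) +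
  (v m.+1 - v m) / (y_ m.+1 - y_ m) * Num.max 0 (Num.min (z - y_ m) (y_ m.+1 - y_ m))).
  2: by apply/funext => z; rewrite big_nat_recr.
apply: cvgD; first exact: IH.
apply: cvgM; first exact: cvg_cst.
have C : continuous (fun z => Num.max 0 (Num.min (z - y_ m) (y_ m.+1 - y_ m))).
  apply: cont_max => [z|]; first exact: cvg_cst.
  apply: cont_min => z; last exact: cvg_cst.
  by apply: cvgB; [exact: cvg_id|exact: cvg_cst].
exact: C.
Qed.

Lemma splE v i y : v 0%N = 0 -> (i < k)%N -> y_ i <= y <= y_ i.+1 ->
  spl v y = v i + (y - y_ i) * ((v i.+1 - v i) * (y_ i.+1 - y_ i)^-1).
Proof.
move=> v0 ik /andP[iy yi]; rewrite /spl.
rewrite (@big_cat_nat _ _ _ i)//=; last exact: ltnW.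
rewrite (@big_ltn _ _ _ i k)//=.
have st j : (j < k)%N -> 0 < y_ j.+1 - y_ j.
  by move=> jk; rewrite subr_gt0; have [_ _ _ ->] := my.
rewrite [X in X + _](eq_big_nat _ _ (F2 := fun j => v j.+1 - v j)); last first.
  move=> j /andP[_ ji]; have jk := ltn_trans ji ik.
  have h1 : y_ j.+1 <= y_ i by apply: (mesh_le my) => //; exact: ltnW.
  rewrite min_r; last by rewrite lerB// (le_trans h1).
  by rewrite max_r ?divfK ?gt_eqF ?st// ltW// st.
rewrite telescope_sumr// v0 subr0 [X in _ + (_ + X)]big1_seq ?addr0; last first.
  move=> j; rewrite mem_index_iota => /andP[_ /andP[ij jk]].
  have h1 : y_ i.+1 <= y_ j by apply: (mesh_le my) => //; exact: ltnW.
  rewrite max_l ?mulr0// ge_min subr_le0 (le_trans yi h1)//.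
rewrite min_l ?lerB// max_r ?subr_ge0//.
by rewrite [X in _ + X = _]mulrC.
Qed.

End Spline.

Section Cut.
Context (R : realType).
Implicit Types (x y t s : R).

(** Used with s = eps^(1/2): the slope 1 / s then contributes only eps / s^2 = 1 to the squared
    energy norm, while 1 - [cut] stays below a multiple of the layer function. *)
Definition cut s t := Num.min 1 (Num.min (t / s) ((1 - t) / s)).

Lemma cut01 s t : 0 < s -> 0 <= t <= 1 -> 0 <= cut s t <= 1.
Proof.
move=> s0 /andP[t0 t1]; rewrite /cut ge_min lexx/= andbT !le_min ler01/=.
by rewrite !divr_ge0 ?subr_ge0// ltW.
Qed.

Lemma cut0 s : 0 < s -> cut s 0 = 0.
Proof. by move=> s0; rewrite /cut mul0r subr0 (min_l (x := 0)) ?divr_ge0 ?(ltW s0)// min_r. Qed.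

Lemma cut1 s : 0 < s -> cut s 1 = 0.
Proof. by move=> s0; rewrite /cut subrr mul0r (min_r (y := 0)) ?divr_ge0 ?(ltW s0)// min_r. Qed.

Lemma min_lip (a b a' b' D : R) : `|a - a'| <= D -> `|b - b'| <= D -> `|Num.min a b - Num.min a' b'| <= D.
Proof.
rewrite !ler_norml => /andP[? ?] /andP[? ?]; apply/andP.
by rewrite /Num.min; case: ifPn; case: ifPn; rewrite -?leNgt => ? ?; split; lra.
Qed.

Lemma cut_lip s t t' : 0 < s -> `|cut s t - cut s t'| <= `|t - t'| / s.
Proof.
move=> s0; apply: min_lip; first by rewrite subrr normr0 divr_ge0// ltW.
have i0 : 0 <= s^-1 by rewrite invr_ge0 ltW.
apply: min_lip; rewrite -mulrBl normrM (ger0_norm i0)//.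
by rewrite (_ : 1 - t - (1 - t') = t' - t) ?(distrC t')//; ring.
Qed.

End Cut.

Section Last.
Context (R : realType).
Implicit Types (x y t : R).
Notation U := (`]0, 1[%classic : set R).
Variables (n k : nat) (x_ y_ : nat -> R).
Hypotheses (mx : mesh n x_) (my : mesh k y_).
Local Notation Dx := (slope_x n x_).
Local Notation last := (in_last n x_).
Local Notation iwx := (iw n x_).
Definition last_node := x_ n.-1.
Definition last_width := 1 - last_node.

Lemma pred_mesh : n.-1.+1 = n. Proof. by have [] := mx; case: n. Qed.

Lemma pred_mesh_lt : (n.-1 < n)%N. Proof. by rewrite -{2}pred_mesh. Qed.

Lemma Hl0 : 0 < last_width.
Proof. by rewrite subr_gt0 /last_node; have [_ _ <- _] := mx; rewrite -{2}pred_mesh ; have [_ _ _ ->] := mx; rewrite ?pred_mesh_lt. Qed.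

Lemma lastP' x : 0 <= x < 1 -> (last x = 0 /\ x < last_node) \/
  [/\ last x = 1, last_node <= x, lo n x_ x = last_node, hi n x_ x = 1 & iwx x = last_width^-1].
Proof.
move=> x01; have [i ilt ix] := mesh_cell mx x01.
rewrite /in_last /lo /hi /iw !(stepf_cell mx _ ilt ix); case: eqP => [e|ne]; [right|left].
  have ei : i = n.-1 by rewrite -e.
  rewrite e /last_width /last_node -ei; have [_ _ -> _] := mx; split=> //.
  by case/andP: ix.
split=> //; case/andP: ix => _ xi; apply: (lt_le_trans xi).
apply: (mesh_le mx); last by rewrite leq_pred.
by move/eqP: ne; rewrite -ltnS pred_mesh ltn_neqAle => ->.
Qed.

Lemma bm1_last : bm1 last. Proof. exact: stepf_bm1. Qed.

Lemma last_iw : I1 (fun x => last x * iwx x) = 1.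
Proof.
have b : bm1 (fun x => last x * iwx x) by apply: bmeasM; [exact: bm1_last|exact: bm1_iw].
have P : pw n x_ (fun x => last x * iwx x * (x - lo n x_ x)) (fun x => last x * iwx x)
    (fun i => (i == n)%:R).
  move=> i ilt; have [n0 x0 x1 inc] := mx.
  have H0 : x_ i.+1 - x_ i != 0 by rewrite gt_eqF// subr_gt0 inc.
  pose X := nice_id (x_ i) (x_ i.+1); pose c := nice_cst (x_ i) (x_ i.+1).
  have N := niceM (c ((i.+1 == n)%:R * (x_ i.+1 - x_ i)^-1)) (niceB X (c (x_ i))).
  eexists; eexists; split.
  - exact: N.
  - by rewrite /= subrr mulr0 (ltn_eqF ilt).
  - by rewrite /= -mulrA mulVf// mulr1.
  - by move=> x ix; rewrite /in_last /iw /lo !(stepf_cell mx _ ilt ix).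
  - move=> x ix; have ix' : x_ i <= x < x_ i.+1 by case/andP: ix => /ltW -> ->.
    by rewrite /in_last /iw !(stepf_cell mx _ ilt ix') /= subr0 mulr1 mulr0 addr0.
have [_ ->] := pw_int mx b P; have [n0 _ _ _] := mx.
by rewrite eqxx eq_sym (gtn_eqF n0) subr0.
Qed.

Variable phi : R * R -> R.
Hypothesis vphi : vh n k x_ y_ phi.

Lemma last_lin x y : 0 <= x < 1 -> 0 <= y <= 1 -> last x = 1 ->
  phi (x, y) = - (1 - x) * Dx phi (x, y).
Proof.
move=> x01 y01 l1; have [cphi vx vy zx zy] := vphi.
have [[l0 _]|[_ _ loE hiE iwE]] := lastP' x01; first by move: l0; rewrite l1 => /eqP; rewrite oner_eq0.
rewrite -(vx x y x01 y01) /interp_x /slope_x /= loE hiE iwE; have [_ ->] := zx y y01.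
rewrite /last_width; field; exact: (lt0r_neq0 Hl0).
Qed.

(** In the last column phi = - (1 - x) phi_x with phi_x constant in x, so on each line the two
    integrals are H^2 phi_x^2 / 3 and - H^2 phi_x^2 / 2. This is the core of the trace
    inequality. *)
Lemma last_sq : I2 (fun p => last p.1 * (iwx p.1 * phi p ^+ 2)) =
  - (2 / 3) * I2 (fun p => last p.1 * (phi p * Dx phi p)).
Proof.
have [cphi _ _ _ _] := vphi; have bp := bm_continuous cphi; have bx := bm_Dx mx cphi.
have bl := bmeas_of_lineX bm1_last; have bi := bmeas_of_lineX (bm1_iw n x_).
have bX := bmeas_of_lineX (@bm1_id R).
have b1 : bm (fun p => last p.1 * (iwx p.1 * phi p ^+ 2)) by bmt.
have b2 : bm (fun p => last p.1 * (phi p * Dx phi p)) by bmt.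
have b2' : bm (fun p => 2 / 3 * (last p.1 * (phi p * Dx phi p))) by bmt.
pose Psi p := last p.1 * (iwx p.1 * phi p ^+ 2) + 2 / 3 * (last p.1 * (phi p * Dx phi p)).
have bP : bm Psi by rewrite /Psi; bmt.
suff : I2 Psi = 0.
  by rewrite /Psi I2D// I2Z// => /eqP; rewrite addrC addr_eq0 => /eqP h; rewrite mulNr h opprK.
pose Phi (p : R * R) := last p.1 / 3 * ((1 - p.1) ^+ 2 * Dx phi p ^+ 2 - iwx p.1 * (1 - p.1) ^+ 3 * Dx phi p ^+ 2).
apply: (I2_pw0 (Phi := Phi) (v := fun _ _ => 0) mx bP) => // y Uy i ilt.
have [n0 x0 x1 inc] := mx; have y01 := U01 Uy.
pose a := x_ i; pose b := x_ i.+1; pose H := b - a.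
have H0 : H != 0 by rewrite gt_eqF// subr_gt0 inc.
pose s := (phi (b, y) - phi (a, y)) * H^-1.
pose l : R := (i.+1 == n)%:R.
have l0 : l = 0 \/ (l = 1 /\ b = 1).
  by rewrite /l /b; case: eqP => [->|_]; [right|left].
pose c := nice_cst a b; pose X := nice_id a b; pose X1 := niceB (c 1) X.
have N := niceM (c (l / 3 * s ^+ 2)) (niceB (niceM X1 X1) (niceM (c H^-1) (niceM X1 (niceM X1 X1)))).
eexists; eexists; split.
- exact: N.
- rewrite /= -/a; case: l0 => [->|[-> b1']]; first by rewrite !mul0r.
  by rewrite /H b1'; field; rewrite -b1'.
- by rewrite /= -/b; case: l0 => [->|[-> ->]]; rewrite ?mul0r// subrr; ring.
- move=> x ix; rewrite /Phi /= !(DxU mx _ _ ilt ix) /in_last /iw /= !(stepf_cell mx _ ilt ix) -/a -/b -/H -/s -/l.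
  ring.
- move=> x ix; have ix' : x_ i <= x < x_ i.+1 by case/andP: ix => /ltW -> ->.
  have x01 := cell_itv mx ilt ix'.
  have lE : last x = l by rewrite /in_last (stepf_cell mx _ ilt ix').
  have lphi : l * phi (x, y) = l * (- (1 - x) * s).
    rewrite /s /H -(DxU mx y phi ilt ix').
    case: l0 => [->|[l1 _]]; first by rewrite !mul0r.
    by rewrite (last_lin x01 y01) ?lE.
  have -> : Psi (x, y) = H^-1 * (l * phi (x, y) * phi (x, y)) + 2 / 3 * (l * phi (x, y) * s).
    rewrite /Psi /= lE (DxU mx _ _ ilt ix') -/a -/b -/H -/s /iw (stepf_cell mx _ ilt ix') -/a -/b -/H; ring.
  rewrite lphi.
  have -> : H^-1 * (l * (- (1 - x) * s) * phi (x, y)) = H^-1 * (- (1 - x) * s * (l * phi (x, y))) by ring.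
  by rewrite lphi; field.
Qed.

End Last.

Section Product.
Context (R : realType).
Implicit Types (x y t : R).
Notation U := (`]0, 1[%classic : set R).
Variables (n k : nat) (x_ y_ : nat -> R).
Hypotheses (mx : mesh n x_) (my : mesh k y_).
Local Notation Dx := (slope_x n x_).

Lemma pw_prod f g y : vh n k x_ y_ f -> vh n k x_ y_ g -> U y ->
  pw n x_ (fun x => f (x, y) * g (x, y)) (fun x => Dx f (x, y) * g (x, y) + f (x, y) * Dx g (x, y))
    (fun i => f (x_ i, y) * g (x_ i, y)).
Proof.
move=> vf vg Uy i ilt; have [n0 x0 x1 inc] := mx; have y01 := U01 Uy.
have H0 : x_ i.+1 - x_ i != 0 by rewrite gt_eqF// subr_gt0 inc.
pose X := nice_id (x_ i) (x_ i.+1); pose c := nice_cst (x_ i) (x_ i.+1).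
pose N phi := niceD (c (phi (x_ i, y))) (niceM (niceB X (c (x_ i)))
  (c ((phi (x_ i.+1, y) - phi (x_ i, y)) * (x_ i.+1 - x_ i)^-1))).
eexists; eexists; split.
- exact: (niceM (N f) (N g)).
- by rewrite /= subrr !mul0r !addr0.
- rewrite /=; have E (phi : R * R -> R) : phi (x_ i, y) + (x_ i.+1 - x_ i) * ((phi (x_ i.+1, y) - phi (x_ i, y)) * (x_ i.+1 - x_ i)^-1)
    = phi (x_ i.+1, y) by field.
  by rewrite !E.
- by move=> x ix; rewrite (vhU mx vf ilt ix y01) (vhU mx vg ilt ix y01).
- move=> x ix; have ix' : x_ i <= x < x_ i.+1 by case/andP: ix => /ltW -> ->.
  by rewrite (vhU mx vf ilt ix' y01) (vhU mx vg ilt ix' y01) !(DxU mx _ _ ilt ix') /=; ring.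
Qed.

Lemma vh_by_parts (d : R -> R) beta f g : bm1 d -> bm beta ->
  vh n k x_ y_ f -> vh n k x_ y_ g ->
  I2 (fun p => (d p.2 + primX beta p) * (Dx f p * g p + f p * Dx g p)) = - I2 (fun p => beta p * (f p * g p)).
Proof.
move=> bd bb vf vg; have [cf _ _ zf _] := vf; have [cg _ _ zg _] := vg.
have bf := bm_continuous cf; have bg := bm_continuous cg.
have dxf := bm_Dx mx cf; have dxg := bm_Dx mx cg.
have [n0 x0 x1 _] := mx.
apply: (by_parts (v := fun y i => f (x_ i, y) * g (x_ i, y)) mx) => //; [by bmt|by bmt|by move=> y; exact: pw_prod|].
move=> y Uy; have [f0 f1] := zf y (U01 Uy).
by rewrite x0 x1 f0 f1 !mul0r.
Qed.

End Product.

(** * The trial function of the duality argument *)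

Section Trial.
Context (R : realType).
Implicit Types (x y t : R).
Notation U := (`]0, 1[%classic : set R).
Variables (n k : nat) (x_ y_ : nat -> R).
Hypotheses (mx : mesh n x_) (my : mesh k y_).
Local Notation Dx := (slope_x n x_).
Local Notation Dy := (slope_y k y_).
Local Notation sig := (last_node n x_).
Local Notation Hl := (last_width n x_).
Local Notation last := (in_last n x_).
Local Notation iwx := (iw n x_).

Definition theta x := Num.min x (sig * (1 - x) / Hl).

Lemma theta_cont : continuous theta.
Proof.
apply: cont_min => z; first exact: cvg_id.
apply: cvgM; last exact: cvg_cst.
apply: cvgM; first exact: cvg_cst.
by apply: cvgB; [exact: cvg_cst|exact: cvg_id].
Qed.

Lemma theta_lo x : x <= sig -> theta x = x.
Proof.
by move=> xs; rewrite /theta min_l// ler_pdivlMr ?(Hl0 mx)// /last_width; lra.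
Qed.

Lemma theta_hi x : sig <= x -> theta x = sig * (1 - x) / Hl.
Proof.
by move=> xs; rewrite /theta min_r// ler_pdivrMr ?(Hl0 mx)// /last_width; lra.
Qed.

Lemma sig0 : 0 <= sig.
Proof. by have [_ <- _ _] := mx; apply: (mesh_le mx) => //; rewrite leq_pred. Qed.

Lemma theta01 x : 0 <= x <= 1 -> 0 <= theta x <= 1.
Proof.
move=> /andP[x0 x1]; rewrite /theta le_min x0 ge_min x1/= andbT.
by rewrite divr_ge0 ?(ltW (Hl0 mx))// mulr_ge0 ?subr_ge0// sig0.
Qed.

Lemma theta_slope i : (i < n)%N -> (theta (x_ i.+1) - theta (x_ i)) * (x_ i.+1 - x_ i)^-1 =
  (1 - (i.+1 == n)%:R) - (i.+1 == n)%:R * sig / Hl.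
Proof.
move=> ilt; have [n0 x0 x1 inc] := mx.
have H0 : x_ i.+1 - x_ i != 0 by rewrite gt_eqF// subr_gt0 inc.
case: eqP => [e|ne].
  have sE : sig = x_ i by rewrite /last_node -e.
  rewrite theta_hi; last by rewrite sE ltW// inc.
  rewrite theta_lo ?sE// e x1 subrr mulr0 mul0r mul1r /last_width sE; field.
  by rewrite -x1 -e.
have h1 : x_ i.+1 <= sig.
  apply: (mesh_le mx); last by rewrite leq_pred.
  by move/eqP: ne => ne; rewrite -ltnS (pred_mesh mx) ltn_neqAle ne.
by rewrite !theta_lo// ?(le_trans (ltW (inc i ilt)))// divff// !mul0r !subr0.
Qed.

Lemma theta_cell i x : (i < n)%N -> x_ i <= x < x_ i.+1 ->
  theta x = theta (x_ i) + (x - x_ i) * ((theta (x_ i.+1) - theta (x_ i)) * (x_ i.+1 - x_ i)^-1).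
Proof.
move=> ilt ix; rewrite theta_slope//; have /andP[ix1 ix2] := ix.
case: eqP => [e|ne].
  have sE : sig = x_ i by rewrite /last_node -e.
  rewrite theta_hi ?sE// theta_lo ?sE//.
  by have H0 := lt0r_neq0 (Hl0 mx); rewrite /= -sE /last_width in H0 *; field.
have h1 : x_ i.+1 <= sig.
  have [n0 _ _ _] := mx.
  apply: (mesh_le mx); last by rewrite leq_pred.
  by move/eqP: ne => ne; rewrite -ltnS (pred_mesh mx) ltn_neqAle ne.
by rewrite !theta_lo ?(le_trans (ltW ix2))// ?(le_trans ix1 (le_trans (ltW ix2) h1))///=; ring.
Qed.

Variable (w : R -> R).
Hypotheses (w0 : w 0 = 0) (w1 : w 1 = 0).

Definition ky := spl k y_ (fun j => w (y_ j)).
Definition trial (p : R * R) := theta p.1 * ky p.2.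

Lemma wv0 : w (y_ 0%N) = 0. Proof. by have [_ -> _ _] := my. Qed.

Lemma ky_node j : (j <= k)%N -> ky (y_ j) = w (y_ j).
Proof.
have [k0 y0 y1 inc] := my; case: j => [_|j jk].
  rewrite /ky (splE my wv0 k0); last by rewrite lexx ltW// inc.
  by rewrite subrr mul0r addr0.
rewrite /ky (splE my wv0 jk); last by rewrite lexx andbT ltW// inc.
by field; rewrite gt_eqF// subr_gt0 inc.
Qed.

Lemma ky_cell j y : (j < k)%N -> y_ j <= y < y_ j.+1 ->
  ky y = ky (y_ j) + (y - y_ j) * ((ky (y_ j.+1) - ky (y_ j)) * (y_ j.+1 - y_ j)^-1).
Proof.
move=> jk /andP[h1 h2]; rewrite !ky_node//; last exact: ltnW.
by rewrite /ky (splE my wv0 jk)// h1 ltW.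
Qed.

Lemma psi_cont : continuous trial.
Proof.
move=> p; rewrite /trial; apply: cvgM.
  apply: (@continuous_comp _ _ _ fst theta); [exact: cvg_fst|exact: theta_cont].
apply: (@continuous_comp _ _ _ snd ky); [exact: cvg_snd|exact: spl_cont].
Qed.

Lemma psi_vh : vh n k x_ y_ trial.
Proof.
have [k0 y0 y1 _] := my; have [n0 x0 x1 _] := mx.
split; first exact: psi_cont.
- move=> x y x01 y01; have [i ilt ix] := mesh_cell mx x01.
  rewrite (IxU mx _ _ ilt ix) /trial/= [in RHS](theta_cell ilt ix); ring.
- move=> x y x01 y01; have [j jlt jy] := mesh_cell my y01.
  rewrite (IyU my _ _ jlt jy) /trial/= [in RHS](ky_cell jlt jy); ring.
- move=> y y01; rewrite /trial/= theta_lo ?sig0// theta_hi; last first.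
    by rewrite -subr_ge0 ltW// (Hl0 mx).
  by rewrite subrr mulr0 !mul0r.
- move=> x x01; rewrite /trial/=.
  by rewrite -{1}y0 -y1 !ky_node// y0 y1 w0 w1 mulr0.
Qed.

(** In the last column the slope is - sig / H times [ky], the same average in x as in J; elsewhere
    it is just [ky], of size O(1). *)
Lemma Dx_psi x y : 0 <= x < 1 -> Dx trial (x, y) = ((1 - last x) - last x * sig * iwx x) * ky y.
Proof.
move=> x01; have [i ilt ix] := mesh_cell mx x01.
rewrite (DxU mx _ _ ilt ix) /trial/= -mulrBl mulrAC theta_slope//.
have -> : last x = (i.+1 == n)%:R by rewrite /in_last (stepf_cell mx _ ilt ix).
have [[l0 _]|[l1 _ _ _ ->]] := lastP' mx x01; last by [].
move: l0; rewrite /in_last (stepf_cell mx _ ilt ix) => ->; rewrite !mul0r//.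
Qed.

Lemma Dy_psi x j y : (j < k)%N -> y_ j <= y < y_ j.+1 ->
  Dy trial (x, y) = theta x * ((w (y_ j.+1) - w (y_ j)) * (y_ j.+1 - y_ j)^-1).
Proof.
move=> jk jy; rewrite (DyU my _ _ jk jy) /trial/= !ky_node//; last exact: ltnW.
by rewrite -mulrBr mulrA.
Qed.

Lemma ky_near y v M : 0 <= y < 1 -> (forall t, lo k y_ y <= t <= hi k y_ y -> `|w t - v| <= M) ->
  `|ky y - v| <= M.
Proof.
move=> y01 hM; have [j jk [jy loE hiE _ _]] := cellP my y01.
have [_ ly yh _ w0'] := lohi my y01.
have lh : lo k y_ y <= hi k y_ y by rewrite -subr_ge0 ltW.
have := hM (lo k y_ y); have := hM (hi k y_ y); rewrite !lexx lh => /(_ isT) h2 /(_ isT) h3.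
rewrite (ky_cell jk jy) !ky_node//; last exact: ltnW.
have inc : 0 < y_ j.+1 - y_ j by rewrite -loE -hiE.
rewrite loE hiE in h2 h3 ly yh.
have -> : w (y_ j) + (y - y_ j) * ((w (y_ j.+1) - w (y_ j)) * (y_ j.+1 - y_ j)^-1) - v =
  (1 - (y - y_ j) / (y_ j.+1 - y_ j)) * (w (y_ j) - v) + (y - y_ j) / (y_ j.+1 - y_ j) * (w (y_ j.+1) - v).
  by field; rewrite gt_eqF.
set t := (y - y_ j) / _.
have t0 : 0 <= t by rewrite divr_ge0 ?(ltW inc)// subr_ge0.
have t1 : t <= 1 by rewrite ler_pdivrMr// mul1r; lra.
have t1' : 0 <= 1 - t by lra.
clearbody t.
apply: le_trans (ler_normD _ _) _; rewrite !normrM (ger0_norm t0) (ger0_norm t1').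
nra.
Qed.

End Trial.

(** * Bounds for J and the energy estimate *)

Section LastCell.
Context (R : realType).
Implicit Types (x y t : R).
Notation U := (`]0, 1[%classic : set R).
Variables (n k : nat) (x_ y_ : nat -> R).
Hypotheses (mx : mesh n x_) (my : mesh k y_).
Local Notation Dx := (slope_x n x_).
Local Notation Dy := (slope_y k y_).
Local Notation sig := (last_node n x_).
Local Notation Hl := (last_width n x_).
Local Notation last := (in_last n x_).
Local Notation iwx := (iw n x_).
Variables (eps h K MB : R).
Hypotheses (e0 : 0 < eps) (e1 : eps <= 1) (h0 : 0 < h) (h1 : h < 1) (K1 : 1 <= K) (MB1 : 1 <= MB).
Hypotheses (hH : Hl <= K * h) (hH' : h <= K * Hl) (hsig : 1 / 4 <= sig).
Local Notation Nrm := (Nrm n k x_ y_ eps).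
Local Notation omx := (om n x_ h).
Local Notation omc := ((Hl ^+ 2 - h ^+ 2) / 12).

Let K0 : 0 <= K. Proof. exact: le_trans K1. Qed.
Let MB0 : 0 <= MB. Proof. exact: le_trans MB1. Qed.
Let Hl0 : 0 < Hl. Proof. exact: Hl0. Qed.
Let h20 : 0 <= h ^+ 2. Proof. exact: sqr_ge0. Qed.
Let bl : bm (fun p => last p.1). Proof. exact: (bmeas_of_lineX (bm1_last n x_)). Qed.
Let bi : bm (fun p => iwx p.1). Proof. exact: (bmeas_of_lineX (bm1_iw n x_)). Qed.

Lemma last01 x : 0 <= x < 1 -> 0 <= last x.
Proof. by case/(lastP' mx) => [[-> _]|[-> _]]. Qed.

Lemma last_iwE x : 0 <= x < 1 -> last x * iwx x = last x / Hl.
Proof. by case/(lastP' mx) => [[-> _]|[-> _ _ _ ->]]; rewrite ?mul0r. Qed.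

Lemma last_iw_ge0 x : 0 <= x < 1 -> 0 <= last x * iwx x.
Proof. by move=> x01; rewrite last_iwE// divr_ge0 ?last01// ltW. Qed.

Lemma I2_last_iwY (E : R -> R) : bm1 E -> I2 (fun p => last p.1 * iwx p.1 * E p.2) = I1 E.
Proof.
move=> bE; have bE2 := bmeas_of_lineY bE.
rewrite I2_fubiniX; last by bmt.
apply: eq_Rintegral => y /set_mem Uy /=.
have -> : (fun x => last x * iwx x * E y) = (fun x => E y * (last x * iwx x)).
  by apply/funext => x; rewrite mulrC.
rewrite -/(I1 _) I1Z; last by apply: bmeasM; [exact: bm1_last|exact: bm1_iw].
by rewrite last_iw// mulr1.
Qed.

Lemma I2_last_iw : I2 (fun p => last p.1 * iwx p.1) = 1.
Proof.
rewrite -[RHS](I1_cst 1) -(I2_last_iwY (E := fun _ => 1)); last exact: bmeas_cst.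
by apply: I2_eq => p _; rewrite mulr1.
Qed.

Lemma I2_last : I2 (fun p => last p.1) = Hl.
Proof.
rewrite (I2_eq (g := fun p => Hl * (last p.1 * iwx p.1))).
  by rewrite I2Z ?I2_last_iw ?mulr1//; bmt.
move=> [x y] [/= Ux _]; rewrite last_iwE; last exact: UI.
by rewrite mulrC divfK// gt_eqF.
Qed.

Lemma lastK (l z : R) : l * z = Hl * (l / Hl * z).
Proof. by field; exact: lt0r_neq0. Qed.

Section OneFun.
Variable phi : R * R -> R.
Hypothesis vphi : vh n k x_ y_ phi.
Let cphi : continuous phi. Proof. by case: vphi. Qed.
Let bp : bm phi. Proof. exact: bm_continuous. Qed.
Let bx : bm (Dx phi). Proof. exact: bm_Dx. Qed.

(** By [last_sq] the average of phi^2 over the last column is controlled by phi phi_x, and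
    Cauchy-Schwarz in the energy norm costs eps^(-1/2). *)
Lemma last_trace : Num.sqrt eps * I2 (fun p => last p.1 * (iwx p.1 * phi p ^+ 2)) <= Nrm phi ^+ 2.
Proof.
rewrite (last_sq mx vphi).
have b1 : bm (fun p => last p.1 * (phi p * Dx phi p)) by bmt.
have h2 : `|I2 (fun p => last p.1 * (phi p * Dx phi p))| <= nn phi * nn (Dx phi).
  apply: le_trans (I2_cs bp bx); apply: (le_trans (I2_abs b1)).
  apply: I2_le => [||[x y] [/= Ux _]]; [by bmt|by bmt|].
  rewrite normrM ler_piMl//; case: (lastP' mx (UI Ux)) => [[-> _]|[-> _ _ _ _]];
    by rewrite ?normr0 ?normr1.
move: h2; set z := I2 _ => hz.
have h3 : - (2 / 3) * z <= nn phi * nn (Dx phi).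
  have : `|- (2/3) * z| <= 1 * (nn phi * nn (Dx phi)).
    by apply: lerM2 => //; rewrite normrN ger0_norm; lra.
  by rewrite mul1r; apply: le_trans; exact: ler_norm.
apply: (@le_trans _ _ (Num.sqrt eps * (nn phi * nn (Dx phi)))); first by rewrite ler_wpM2l ?sqrtr_ge0.
rewrite mulrCA expr2; apply: ler_pM; rewrite ?nn_ge0 ?mulr_ge0 ?sqrtr_ge0 ?nn_ge0//.
  exact: nn_le_Nrm.
exact: nnDx_le_Nrm.
Qed.

Lemma I2_last_abs : h * I2 (fun p => last p.1 * iwx p.1 * `|phi p|) <= K * Nrm phi.
Proof.
rewrite -I2Z; last by bmt.
apply: (@le_trans _ _ (K * I2 (fun p => `|phi p|))); last first.
  rewrite ler_wpM2l//; apply: le_trans (nn_le_Nrm _ _ _ _ e0 _); exact: I2_abs_nn.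
rewrite -I2Z; last by bmt.
apply: I2_le => [||[x y] [/= Ux _]]; [by bmt|by bmt|].
rewrite last_iwE ?(UI Ux)// mulrA ler_wpM2r//.
case: (lastP' mx (UI Ux)) => [[-> _]|[-> _ _ _ _]]; first by rewrite mul0r mulr0.
by rewrite mul1r ler_pdivrMr.
Qed.

(** The factor eps^(1/4) in the L^2 norm of E exactly offsets the eps^(-1/4) lost in
    [last_trace]. *)
Lemma I2_last_layer (E : R -> R) : bm1 E -> (forall y, 0 < y < 1 -> 0 <= E y) ->
  I1 (fun y => E y ^+ 2) <= K * Num.sqrt eps ->
  I2 (fun p => last p.1 * iwx p.1 * (E p.2 * `|phi p|)) <= K * Nrm phi.
Proof.
move=> bE E0 EI; have bE2 := bmeas_of_lineY bE.
have b1 : bm (fun p => last p.1 * E p.2) by bmt.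
have b2 : bm (fun p => last p.1 * phi p) by bmt.
have S0 : 0 < Num.sqrt eps by rewrite sqrtr_gt0.
have -> : I2 (fun p => last p.1 * iwx p.1 * (E p.2 * `|phi p|)) =
   Hl^-1 * I2 (fun p => `|(last p.1 * E p.2) * (last p.1 * phi p)|).
  rewrite -I2Z; last by bmt.
  apply: I2_eq => -[x y] [/= Ux Uy].
  have y0 : 0 < y < 1 by move: Uy; rewrite /= in_itv.
  rewrite last_iwE ?(UI Ux)// !normrM (ger0_norm (E0 _ y0)) (ger0_norm (last01 (UI Ux))).
  case: (lastP' mx (UI Ux)) => [[-> _]|[-> _ _ _ _]]; first by rewrite !mul0r mulr0.
  by rewrite !mul1r.
rewrite mulrC ler_pdivrMr// (le_trans (I2_cs b1 b2))//.
rewrite -(ler_pXn2r (n := 2))// ?nnegrE ?mulr_ge0 ?nn_ge0 ?Nrm_ge0 ?(ltW Hl0)//.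
have q1 : nn (fun p => last p.1 * E p.2) ^+ 2 <= Hl * (K * Num.sqrt eps).
  rewrite nn_sqr (I2_eq (g := fun p => Hl * (last p.1 * iwx p.1 * E p.2 ^+ 2))).
    rewrite I2Z; last by bmt.
    rewrite (I2_last_iwY (E := fun y => E y ^+ 2)); last exact: bmeasX.
    by rewrite ler_wpM2l// ltW.
  move=> [x y] [/= Ux _]; rewrite last_iwE ?(UI Ux)// exprMn -(lastK (last x)).
  by case: (lastP' mx (UI Ux)) => [[-> _]|[-> _ _ _ _]]; rewrite ?expr0n ?expr1n.
have q2 : nn (fun p => last p.1 * phi p) ^+ 2 <= Hl * (Nrm phi ^+ 2 / Num.sqrt eps).
  rewrite nn_sqr (I2_eq (g := fun p => Hl * (last p.1 * (iwx p.1 * phi p ^+ 2)))).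
    rewrite I2Z; last by bmt.
    rewrite ler_wpM2l ?(ltW Hl0)// ler_pdivlMr// mulrC; exact: last_trace.
  move=> [x y] [/= Ux _]; rewrite (mulrA (last x)) last_iwE ?(UI Ux)// exprMn -(lastK (last x)).
  by case: (lastP' mx (UI Ux)) => [[-> _]|[-> _ _ _ _]]; rewrite ?expr0n ?expr1n.
rewrite exprMn; apply: (@le_trans _ _ (Hl * (K * Num.sqrt eps) * (Hl * (Nrm phi ^+ 2 / Num.sqrt eps)))).
  by apply: ler_pM => //; exact: sqr_ge0.
have -> : Hl * (K * Num.sqrt eps) * (Hl * (Nrm phi ^+ 2 / Num.sqrt eps)) = K * (Hl ^+ 2 * Nrm phi ^+ 2).
  by field; exact: lt0r_neq0.
have -> : (K * Nrm phi * Hl) ^+ 2 = K ^+ 2 * (Hl ^+ 2 * Nrm phi ^+ 2) by ring.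
apply: ler_wpM2r; first by rewrite mulr_ge0// sqr_ge0.
by rewrite -{1}(expr1 K) ler_weXn2l.
Qed.

End OneFun.

(** In the last column 1 - x is O(h), so replacing x^2 by 1 changes h^2 x^2 by O(h^3); [om] itself
    is only O(h^2) there. *)
Lemma om_last x : 0 <= x < 1 -> last x = 1 -> `|omx x| <= K ^+ 2 * h ^+ 2 /\ `|omx x - omc| <= K * h ^+ 3.
Proof.
move=> x01 l1; case: (lastP' mx x01) => [[l0 _]|[_ sx loE hiE iwE]].
  by move: l0; rewrite l1 => /eqP; rewrite oner_eq0.
rewrite /om /wd loE hiE -/Hl; have /andP[x0 x1] := x01.
have H2 : Hl ^+ 2 <= K ^+ 2 * h ^+ 2 by rewrite -exprMn ler_pXn2r ?nnegrE ?mulr_ge0// ltW.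
have K2 : 1 <= K ^+ 2 by rewrite exprn_ege1.
have hK : h ^+ 2 <= K ^+ 2 * h ^+ 2 by rewrite ler_peMl.
have x2 : x ^+ 2 <= 1 by rewrite exprn_ile1// ltW.
have hx2 : h ^+ 2 * x ^+ 2 <= h ^+ 2 by rewrite ler_piMr.
have hx20 : 0 <= h ^+ 2 * x ^+ 2 by rewrite mulr_ge0 ?sqr_ge0.
split.
  have := sqr_ge0 Hl; rewrite ler_norml => ?; apply/andP; split; lra.
have -> : (Hl ^+ 2 - h ^+ 2 * x ^+ 2) / 12 - omc = h ^+ 2 * ((1 - x) * ((1 + x) / 12)) by field.
have -> : K * h ^+ 3 = h ^+ 2 * (K * h * 1) by ring.
apply: lerM2; first by rewrite ger0_norm.
apply: lerM2; last by rewrite ger0_norm; lra.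
rewrite ger0_norm; last by lra.
apply: (le_trans _ hH); rewrite /last_width; lra.
Qed.

Lemma omc_le : `|omc| <= K ^+ 2 * h ^+ 2.
Proof.
have H2 : Hl ^+ 2 <= K ^+ 2 * h ^+ 2 by rewrite -exprMn ler_pXn2r ?nnegrE ?mulr_ge0// ltW.
have K2 : 1 <= K ^+ 2 by rewrite exprn_ege1.
have hK : h ^+ 2 <= K ^+ 2 * h ^+ 2 by rewrite ler_peMl.
have hl := sqr_ge0 Hl; have h2 := sqr_ge0 h.
by clear K2; rewrite ler_norml; apply/andP; split; lra.
Qed.

Variables (s20 : R * R -> R).
Hypotheses (bs : bm s20) (hs20 : forall p, Omega p -> `|s20 p| <= K).
Variables (B beta c : R * R -> R) (d : R -> R).
Hypotheses (bd : bm1 d) (bbeta : bm beta) (bc : bm c)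
  (hB : forall p, B p = d p.2 + primX beta p)
  (hMB : forall p, Omega p -> `|B p| <= MB)
  (hMbeta : forall p, Omega p -> `|beta p| <= MB)
  (hMc : forall p, Omega p -> `|c p| <= MB).
Local Notation jint := (last_int n x_ h B s20).

Let bB : bm B.
Proof.
apply: (bmeas_eq (f := fun p => d p.2 + primX beta p)); first by move=> p _; rewrite hB.
by apply: bmeasD; [exact: (bmeas_of_lineY bd)|exact: bm_primX].
Qed.

Let bom : bm (fun p => omx p.1).
Proof.
have xx := bmeas_of_lineX (@bm1_id R); have bw := bmeas_of_lineX (bm1_wd n x_).
by rewrite /om; bmt.
Qed.

Lemma bm_jint phi : bm phi -> bm (jint phi).
Proof. by move=> bp; rewrite /last_int; bmt. Qed.

Lemma jint_le phi x y : Omega (x, y) -> `|jint phi (x, y)| <=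
  2 * MB * K ^+ 3 * h ^+ 2 * (last x * iwx x * `|phi (x, y)|).
Proof.
move=> Op; have [/= Ux Uy] := Op; have x01 := UI Ux.
rewrite /last_int /=; have l0 := last_iw_ge0 x01.
case: (lastP' mx x01) => [[l0' _]|[l1 _ _ _ _]]; first by rewrite l0' !(mul0r,mulr0) normr0.
have -> : - B (x, y) * (last x * (2 * iwx x) * omx x * s20 (x, y)) * phi (x, y) =
  - B (x, y) * (2 * (last x * iwx x)) * (omx x * s20 (x, y)) * phi (x, y) by ring.
have -> : 2 * MB * K ^+ 3 * h ^+ 2 * (last x * iwx x * `|phi (x, y)|) =
  MB * (2 * (last x * iwx x)) * (K ^+ 2 * h ^+ 2 * K) * `|phi (x, y)| by ring.
apply: lerM2 => //; apply: lerM2.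
  by apply: lerM2; rewrite ?normrN ?hMB// ger0_norm// mulr_ge0.
by apply: lerM2; [have [] := om_last x01 l1|exact: hs20].
Qed.

(** In the last column |phi| / H is at most |phi_x|, and the indicator of the column has L^2 norm
    H^(1/2), which is O(eps^(1/2)) when h <= eps: exactly the factor needed by phi_x. *)
Lemma J_big phi : vh n k x_ y_ phi -> h <= eps ->
  `|I2 (jint phi)| <= 2 * MB * K ^+ 4 * h ^+ 2 * Nrm phi.
Proof.
move=> vphi heps; have [cphi _ _ _ _] := vphi.
have bp := bm_continuous cphi; have bx := bm_Dx mx cphi.
apply: (le_trans (I2_abs (bm_jint bp))); have bj := bm_jint bp.
set c0 := 2 * MB * K ^+ 3 * h ^+ 2.
have c00 : 0 <= c0 by apply: mulr_ge0 (sqr_ge0 h); apply: mulr_ge0 (exprn_ge0 3 K0); exact: mulr_ge0.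
apply: (@le_trans _ _ (I2 (fun p => c0 * (`|last p.1 * Dx phi p|)))).
  apply: I2_le => [||[x y] Op]; [by bmt|by bmt|].
  apply: (le_trans (jint_le phi Op)); rewrite ler_wpM2l//; have [/= Ux Uy] := Op.
  have x01 := UI Ux; case: (lastP' mx x01) => [[-> _]|[l1 sx _ _ ->]].
    by rewrite !mul0r.
  rewrite (last_lin mx vphi x01 (U01 Uy) l1) l1 !mul1r normrM normrN mulrA ler_piMl//.
  have /andP[x0 x1] := x01.
  rewrite ger0_norm; last by rewrite subr_ge0 ltW.
  by rewrite mulrC ler_pdivrMr// mul1r /last_width lerB.
rewrite I2Z; last by bmt.
have -> : 2 * MB * K ^+ 4 * h ^+ 2 * Nrm phi = c0 * (K * Nrm phi) by rewrite /c0; ring.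
rewrite ler_wpM2l// (le_trans (I2_cs bl bx))//.
apply: (@le_trans _ _ (K * Num.sqrt eps * nn (Dx phi))); last by rewrite -mulrA ler_wpM2l// nnDx_le_Nrm.
rewrite ler_wpM2r ?nn_ge0//; apply: nn_le; first by rewrite mulr_ge0// sqrtr_ge0.
rewrite exprMn sqr_sqrtr ?(ltW e0)//.
rewrite (I2_eq (g := fun p => last p.1)) ?I2_last; last first.
  by move=> [x y] [/= Ux _]; case: (lastP' mx (UI Ux)) => [[-> _]|[-> _ _ _ _]]; rewrite ?expr0n ?expr1n.
apply: (le_trans hH); apply: (@le_trans _ _ (K * eps)); first by rewrite ler_wpM2l.
by rewrite ler_wpM2r ?(ltW e0)// -{1}(expr1 K) ler_weXn2l.
Qed.


Variables (E kap : R -> R).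
Hypotheses (bE : bm1 E) (E0 : forall y, 0 <= y <= 1 -> 0 <= E y)
  (EI : I1 (fun y => E y ^+ 2) <= K * Num.sqrt eps).
Hypotheses (hHy : forall y, 0 <= y < 1 -> wd k y_ y <= K * h)
  (hcut : forall y t, 0 <= y < 1 -> lo k y_ y <= t <= hi k y_ y -> 1 - cut (Num.sqrt eps) t <= K * E y).
Hypotheses (ckap : continuous kap) (kapK : forall y, 0 <= y <= 1 -> `|kap y| <= K)
  (kapL : forall y t, 0 <= y <= 1 -> 0 <= t <= 1 -> `|kap y - kap t| <= K * `|y - t|)
  (hs : forall x y, 0 < x < 1 -> 0 < y < 1 -> `|s20 (x, y) - kap y| <= K * ((1 - x) + E y)).
Local Notation s := (Num.sqrt eps).
(** [kap] approximates S_xx at x = 1 up to the layer; the cut-off makes the trial function vanish at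
    y = 0 and y = 1. *)
Let w y := kap y * cut s y.
Local Notation ky := (ky k y_ w).
Local Notation psi := (trial n k x_ y_ w).

Let s0 : 0 < s. Proof. by rewrite sqrtr_gt0. Qed.
Let s1 : s <= 1. Proof. by rewrite -sqrtr1 ler_wsqrtr. Qed.
Let ss : s * s = eps. Proof. by rewrite -expr2 sqr_sqrtr// ltW. Qed.

Let w_0 : w 0 = 0. Proof. by rewrite /w cut0// mulr0. Qed.
Let w_1 : w 1 = 0. Proof. by rewrite /w cut1// mulr0. Qed.

Let y01cell y t : 0 <= y < 1 -> lo k y_ y <= t <= hi k y_ y -> 0 <= t <= 1.
Proof. by move=> y01 /andP[? ?]; have [? ? ? ? _] := lohi my y01; apply/andP; split; lra. Qed.

Lemma ky_le y : 0 <= y < 1 -> `|ky y| <= K.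
Proof.
move=> y01; rewrite -(subr0 (ky y)); apply: (ky_near my) => // t ht.
have t01 := y01cell y01 ht; rewrite subr0 /w -[K]mulr1; apply: lerM2; first exact: kapK.
by have /andP[c0 c1] := cut01 s0 t01; rewrite ger0_norm.
Qed.

Lemma ky_kap y : 0 <= y < 1 -> `|ky y - kap y| <= K ^+ 2 * (h + E y).
Proof.
move=> y01; have y01' : 0 <= y <= 1 by move/andP: y01 => [-> /ltW ->].
apply: (ky_near my) => // t ht; have t01 := y01cell y01 ht.
have -> : w t - kap y = (kap t - kap y) * cut s t - kap y * (1 - cut s t) by rewrite /w; ring.
have -> : K ^+ 2 * (h + E y) = K * (K * h) * 1 + K * (K * E y) by ring.
have /andP[c0 c1] := cut01 s0 t01.
apply: lerD2'; first apply: lerM2.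
- apply: (le_trans (kapL t01 y01')); rewrite ler_wpM2l//.
  have [? ly yh ? _] := lohi my y01; have := hHy y01; rewrite /wd => ?.
  by move/andP: ht => [? ?]; rewrite ler_norml; apply/andP; split; lra.
- by rewrite ger0_norm.
- rewrite normrN; apply: lerM2; first exact: kapK.
  by rewrite ger0_norm ?subr_ge0//; exact: hcut.
Qed.

Lemma psi_le x y : 0 <= x < 1 -> 0 <= y < 1 -> `|psi (x, y)| <= K.
Proof.
move=> x01 y01; rewrite /trial /= -[K]mul1r; apply: lerM2; last exact: ky_le.
have /andP[t0 t1] : 0 <= theta n x_ x <= 1.
  by apply: (theta01 mx); move/andP: x01 => [-> /ltW ->].
by rewrite ger0_norm.
Qed.

(** The Lipschitz bound of [kap] gives s K, the slope 1 / s of the cut-off gives K. *)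
Lemma Dy_psi_le x y : 0 <= x < 1 -> 0 <= y < 1 -> s * `|Dy psi (x, y)| <= 2 * K.
Proof.
move=> x01 y01; have [j jk [jy loE hiE _ [j0 j1]]] := cellP my y01.
rewrite (Dy_psi n x_ my w_0 x jk jy).
have inc : 0 < y_ j.+1 - y_ j by have [_ _ _ ic] := my; rewrite subr_gt0 ic.
have h2 : 0 <= y_ j.+1 <= 1 by rewrite j1 andbT (le_trans j0)// -subr_ge0 ltW.
have h3 : 0 <= y_ j <= 1 by rewrite j0/= (le_trans _ j1)// -subr_ge0 ltW.
have /andP[t0 t1] : 0 <= theta n x_ x <= 1.
  by apply: (theta01 mx); move/andP: x01 => [-> /ltW ->].
rewrite normrM (ger0_norm t0) mulrCA; apply: (@le_trans _ _ (1 * (2 * K))); last by rewrite mul1r.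
apply: ler_pM => //.
rewrite normrM [`|(_ - _)^-1|]gtr0_norm ?invr_gt0// mulrA ler_pdivrMr//.
have -> : w (y_ j.+1) - w (y_ j) = (kap (y_ j.+1) - kap (y_ j)) * cut s (y_ j.+1) +
   kap (y_ j) * (cut s (y_ j.+1) - cut s (y_ j)) by rewrite /w; ring.
set D := y_ j.+1 - y_ j in inc *.
have b1 : `|(kap (y_ j.+1) - kap (y_ j)) * cut s (y_ j.+1) +
   kap (y_ j) * (cut s (y_ j.+1) - cut s (y_ j))| <= K * D * 1 + K * (D / s).
  apply: lerD2'; apply: lerM2.
  - by apply: (le_trans (kapL h2 h3)); rewrite gtr0_norm.
  - by have /andP[c0 c1] := cut01 s0 h2; rewrite ger0_norm.
  - exact: kapK.
  - by apply: (le_trans (cut_lip _ _ s0)); rewrite gtr0_norm.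
apply: (le_trans (ler_wpM2l (ltW s0) b1)).
have -> : s * (K * D * 1 + K * (D / s)) = s * (K * D) + K * D by field; exact: lt0r_neq0.
have : s * (K * D) <= K * D by rewrite ler_piMl// mulr_ge0// ltW.
have -> : 2 * K * D = K * D + K * D by ring.
lra.
Qed.

(** In the last column the squared slope is at most K^2 / H^2. One factor eps / H is bounded because
    eps <= h <= K H; the other 1 / H is kept as [last * iw], whose integral is 1. *)
Lemma Dx_psi_le x y : eps <= h -> 0 <= x < 1 -> 0 <= y < 1 ->
  eps * Dx psi (x, y) ^+ 2 <= K ^+ 2 * (1 + K * (last x * iwx x)).
Proof.
move=> eh x01 y01; rewrite (Dx_psi k y_ mx w y x01).
have k2 : ky y ^+ 2 <= K ^+ 2 by rewrite -(real_normK (num_real (ky y))) ler_pXn2r ?nnegrE//; exact: ky_le.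
set a := (1 - last x) - _.
have -> : eps * (a * ky y) ^+ 2 = ky y ^+ 2 * (eps * a ^+ 2) by ring.
apply: ler_pM => //; [exact: sqr_ge0|by apply: mulr_ge0 (sqr_ge0 a); exact: ltW|rewrite /a].
case: (lastP' mx x01) => [[-> _]|[-> _ _ _ ->]].
  by rewrite !mul0r !subr0 mulr0 addr0 expr1n mulr1.
rewrite subrr sub0r !mul1r sqrrN.
have sg1 : sig <= 1 by rewrite -subr_ge0 ltW// Hl0.
have sg : (sig / Hl) ^+ 2 <= (Hl^-1) ^+ 2.
  rewrite ler_pXn2r ?nnegrE ?divr_ge0 ?invr_ge0 ?(ltW Hl0) ?sig0//.
  by rewrite ler_piMl// invr_ge0 ltW.
have i0 : 0 <= Hl^-1 by rewrite invr_ge0 ltW.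
have : eps * Hl^-1 <= K by rewrite ler_pdivrMr//; exact: le_trans hH'.
move/(ler_wpM2r i0) => q.
apply: (le_trans (ler_wpM2l (ltW e0) sg)); rewrite expr2 mulrA; lra.
Qed.

Let vpsi : vh n k x_ y_ psi. Proof. exact: (psi_vh mx my w_0 w_1). Qed.

Lemma Nrm_psi : eps <= h -> Nrm psi <= 3 * K ^+ 2.
Proof.
move=> eh; have [cpsi _ _ _ _] := vpsi.
have b1 := bm_continuous cpsi; have b2 := bm_Dx mx cpsi; have b3 := bm_Dy my cpsi.
have K2 : 1 <= K ^+ 2 by rewrite exprn_ege1.
have q1 : eps * nn (Dx psi) ^+ 2 <= 2 * K ^+ 3.
  rewrite nn_sqr -I2Z; last by bmt.
  apply: (@le_trans _ _ (I2 (fun p => K ^+ 2 + K ^+ 3 * (last p.1 * iwx p.1)))).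
    apply: I2_le => [||[x y] [/= Ux Uy]]; [by bmt|by bmt|].
    apply: (le_trans (Dx_psi_le eh (UI Ux) (UI Uy))).
    by rewrite le_eqVlt; apply/orP; left; apply/eqP; ring.
  rewrite I2D; [|by bmt|by bmt]; rewrite I2Z; last by bmt.
  rewrite I2_last_iw I2_cst mulr1.
  have : K ^+ 2 <= K ^+ 3 by rewrite ler_weXn2l.
  lra.
have q2 : eps * nn (Dy psi) ^+ 2 <= 4 * K ^+ 2.
  rewrite nn_sqr -I2Z; last by bmt.
  apply: (@le_trans _ _ (I2 (fun p : R * R => 4 * K ^+ 2))); last by rewrite I2_cst.
  apply: I2_le => [||[x y] [/= Ux Uy]]; [by bmt|by bmt|].
  move: (Dy psi (x, y)) (Dy_psi_le (UI Ux) (UI Uy)) => D q.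
  have -> : eps * D ^+ 2 = (s * `|D|) ^+ 2 by rewrite exprMn sqr_sqrtr ?(ltW e0)// real_normK ?num_real.
  have -> : 4 * K ^+ 2 = (2 * K) ^+ 2 by ring.
  by rewrite ler_pXn2r// nnegrE mulr_ge0// ltW.
have q3 : nn psi ^+ 2 <= K ^+ 2.
  rewrite nn_sqr; apply: (@le_trans _ _ (I2 (fun p : R * R => K ^+ 2))); last by rewrite I2_cst.
  apply: I2_le => [||[x y] [/= Ux Uy]]; [by bmt|by bmt|].
  rewrite -(real_normK (num_real (psi _))) ler_pXn2r ?nnegrE//; exact: (psi_le (UI Ux) (UI Uy)).
rewrite -(ler_pXn2r (n := 2))// ?nnegrE ?Nrm_ge0 ?mulr_ge0 ?exprn_ge0// Nrm_sqr//.
have K34 : K ^+ 3 <= K ^+ 4 by rewrite ler_weXn2l.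
have K24 : K ^+ 2 <= K ^+ 4 by rewrite ler_weXn2l.
have -> : (3 * K ^+ 2) ^+ 2 = 9 * K ^+ 4 by ring.
lra.
Qed.

Lemma J_psi : `|I2 (jint psi)| <= 2 * MB * K ^+ 4 * h ^+ 2.
Proof.
have [cpsi _ _ _ _] := vpsi; have bp := bm_continuous cpsi.
apply: (le_trans (I2_abs (bm_jint bp))); have bj := bm_jint bp.
apply: (@le_trans _ _ (I2 (fun p => 2 * MB * K ^+ 4 * h ^+ 2 * (last p.1 * iwx p.1)))); last first.
  by rewrite I2Z ?I2_last_iw ?mulr1//; bmt.
apply: I2_le => [||[x y] Op]; [by bmt|by bmt|].
have [/= Ux Uy] := Op.
apply: (le_trans (jint_le psi Op)); rewrite /=.
have -> : 2 * MB * K ^+ 4 * h ^+ 2 * (last x * iwx x) = 2 * MB * K ^+ 3 * h ^+ 2 * (last x * iwx x * K) by ring.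
apply: ler_wpM2l; first by apply: mulr_ge0 (sqr_ge0 h); apply: mulr_ge0 (exprn_ge0 3 K0); exact: mulr_ge0.
apply: ler_wpM2l; first exact: (last_iw_ge0 (UI Ux)).
exact: (psi_le (UI Ux) (UI Uy)).
Qed.

Let bky : bm (fun p => ky p.2).
Proof. by apply: bm_continuous => p; apply: (@continuous_comp _ _ _ snd ky); [exact: cvg_snd|exact: spl_cont]. Qed.

(** The density of J with [om] frozen to [omc] and S_xx replaced by [ky], the form that the trial
    function can reproduce. *)
Let jk phi p := -2 * omc * (B p * (last p.1 * iwx p.1) * ky p.2 * phi p).

(** Every replacement error is O(h^2 (h + E)). The part with h cancels the 1 / H of the average, by
    [I2_last_abs], and the part with E is bounded by [I2_last_layer]. *)
Lemma J_diff phi : vh n k x_ y_ phi ->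
  `|I2 (jint phi) - I2 (jk phi)| <= 12 * MB * K ^+ 5 * h ^+ 2 * Nrm phi.
Proof.
move=> vphi; have [cphi _ _ _ _] := vphi; have bp := bm_continuous cphi.
have bE2 := bmeas_of_lineY bE.
have bj := bm_jint bp; have bk : bm (jk phi) by rewrite /jk; bmt.
rewrite -I2B//; apply: (le_trans (I2_abs (bmeasB bj bk))).
set c0 := 6 * MB * K ^+ 4 * h ^+ 2.
have c00 : 0 <= c0 by apply: mulr_ge0 (sqr_ge0 h); apply: mulr_ge0 (exprn_ge0 4 K0); exact: mulr_ge0.
apply: (@le_trans _ _ (I2 (fun p => c0 * (h * (last p.1 * iwx p.1 * `|phi p|) + last p.1 * iwx p.1 * (E p.2 * `|phi p|))))).
  apply: I2_le => [||[x y] Op]; [by bmt|by bmt|].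
  have [/= Ux Uy] := Op; have x01 := UI Ux; have y01 := UI Uy.
  have yy : 0 < y < 1 by move: Uy; rewrite /= in_itv.
  have xx : 0 < x < 1 by move: Ux; rewrite /= in_itv.
  have E0y := E0 (U01 Uy).
  rewrite /jk /last_int /=; have l0 := last_iw_ge0 x01.
  have -> : - B (x, y) * (last x * (2 * iwx x) * omx x * s20 (x, y)) * phi (x, y) -
     - 2 * omc * (B (x, y) * (last x * iwx x) * ky y * phi (x, y)) =
     - (2 * B (x, y)) * (last x * iwx x) * (omx x * s20 (x, y) - omc * ky y) * phi (x, y) by ring.
  have -> : c0 * (h * (last x * iwx x * `|phi (x, y)|) + last x * iwx x * (E y * `|phi (x, y)|)) =
     2 * MB * (last x * iwx x) * (3 * K ^+ 4 * h ^+ 2 * (h + E y)) * `|phi (x, y)| by rewrite /c0; ring.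
  apply: lerM2 => //.
  case: (lastP' mx x01) => [[l0' _]|[l1 sx _ _ _]].
    by rewrite l0' !(mul0r, mulr0) normr0.
  apply: lerM2; first apply: lerM2.
  - by rewrite normrN; apply: lerM2; [rewrite ger0_norm|exact: hMB].
  - by rewrite ger0_norm.
  case: (om_last x01 l1) => o1 o2.
  have -> : omx x * s20 (x, y) - omc * ky y = (omx x - omc) * s20 (x, y)
     + omc * (s20 (x, y) - kap y) - omc * (ky y - kap y) by ring.
  have omcl := omc_le.
  have x1 : 1 - x <= K * h by apply: (le_trans _ hH); rewrite /last_width lerB.
  apply: (@le_trans _ _ (K * h ^+ 3 * K + K ^+ 2 * h ^+ 2 * (K * (K * h + E y)) + K ^+ 2 * h ^+ 2 * (K ^+ 2 * (h + E y)))).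
    apply: lerD2'; first apply: lerD2'.
    - by apply: lerM2 => //; exact: hs20.
    - apply: lerM2 => //; apply: (le_trans (hs xx yy)); rewrite ler_wpM2l//; lra.
    - by rewrite normrN; apply: lerM2 => //; exact: ky_kap.
  have -> : K * h ^+ 3 * K + K ^+ 2 * h ^+ 2 * (K * (K * h + E y)) + K ^+ 2 * h ^+ 2 * (K ^+ 2 * (h + E y)) =
    h ^+ 2 * ((K ^+ 2 + 2 * K ^+ 4) * h + (K ^+ 3 + K ^+ 4) * E y) by ring.
  have -> : 3 * K ^+ 4 * h ^+ 2 * (h + E y) = h ^+ 2 * (3 * K ^+ 4 * h + 3 * K ^+ 4 * E y) by ring.
  have K34 : K ^+ 3 <= K ^+ 4 by rewrite ler_weXn2l.
  have K24 : K ^+ 2 <= K ^+ 4 by rewrite ler_weXn2l.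
  have K40 : 0 <= K ^+ 4 by rewrite exprn_ge0.
  by rewrite ler_wpM2l//; apply: lerD; [rewrite ler_wpM2r ?(ltW h0)//; lra|rewrite ler_wpM2r//; lra].
rewrite I2Z; last by bmt.
rewrite I2D; [|by bmt|by bmt]; rewrite I2Z; last by bmt.
have -> : 12 * MB * K ^+ 5 * h ^+ 2 * Nrm phi = c0 * (K * Nrm phi + K * Nrm phi) by rewrite /c0; ring.
rewrite ler_wpM2l//; apply: lerD; first exact: I2_last_abs.
by apply: I2_last_layer => // y /andP[y0 y1]; apply: E0; rewrite !ltW.
Qed.

Variables (chi : R * R -> R) (A : (R * R -> R) -> R) (C0 gam : R).
Hypotheses (vchi : vh n k x_ y_ chi) (C00 : 0 <= C0).
Hypothesis hA : forall phi, vh n k x_ y_ phi -> `|A phi - I2 (jint phi)| <= C0 * (h ^+ 2 * Nrm phi).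
(** The density of a(chi, phi). *)
Definition ach phi p := eps * (Dx chi p * Dx phi p + Dy chi p * Dy phi p)
  + (- B p * Dx chi p + c p * chi p) * phi p.
Hypothesis hG : forall phi, vh n k x_ y_ phi -> I2 (ach phi) = A phi.

Let cchi : continuous chi. Proof. by case: vchi. Qed.
Let bchi : bm chi. Proof. exact: bm_continuous. Qed.
Let bxchi : bm (Dx chi). Proof. exact: bm_Dx. Qed.
Let bychi : bm (Dy chi). Proof. exact: bm_Dy. Qed.

(** Integration by parts of chi psi turns the convection term of a(chi, psi) into B chi psi_x, whose
    last-column part is - sig times the integral sought. The rest, [Rm], is bounded by the norm of
    chi, and a(chi, psi) = a(eta, psi) is O(h^2). The factor 4 comes from sig >= 1/4. *)
Lemma Z_le : eps <= h -> `|I2 (fun p => B p * (last p.1 * iwx p.1) * ky p.2 * chi p)| <=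
  4 * (9 * MB * K ^+ 2 * Nrm chi + (2 * MB * K ^+ 4 + 3 * C0 * K ^+ 2) * h ^+ 2).
Proof.
move=> eh; set Z := I2 _.
have [cpsi _ _ _ _] := vpsi; have bpsi := bm_continuous cpsi.
have bxpsi := bm_Dx mx cpsi; have bypsi := bm_Dy my cpsi.
have ba : bm (ach psi) by rewrite /ach; bmt.
have bZ : bm (fun p => B p * (last p.1 * iwx p.1) * ky p.2 * chi p) by bmt.
pose Rm p := eps * (Dx chi p * Dx psi p + Dy chi p * Dy psi p) + (c p + beta p) * (chi p * psi p)
   + B p * (chi p * (ky p.2 * (1 - last p.1))).
have bRm : bm Rm by rewrite /Rm; bmt.
have bP : bm (fun p => B p * (Dx chi p * psi p + chi p * Dx psi p)) by bmt.
have bQ : bm (fun p => beta p * (chi p * psi p)) by bmt.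
have byp : I2 (fun p => B p * (Dx chi p * psi p + chi p * Dx psi p)) = - I2 (fun p => beta p * (chi p * psi p)).
  rewrite -(vh_by_parts mx bd bbeta vchi vpsi).
  by apply: I2_eq => p _; rewrite hB.
have eq : I2 (ach psi) = I2 Rm - sig * Z.
  have -> : I2 (ach psi) = I2 (ach psi) + (I2 (fun p => B p * (Dx chi p * psi p + chi p * Dx psi p)) + I2 (fun p => beta p * (chi p * psi p))).
    by rewrite byp addNr addr0.
  rewrite /Z -I2Z// -(I2D bP bQ) -I2D; [|by bmt|by bmt].
  rewrite -I2B//; last by bmt.
  apply: I2_eq => -[x y] [/= Ux Uy].
  by rewrite /ach /Rm (Dx_psi k y_ mx w y (UI Ux)) /trial /=; ring.
have ha : `|I2 (ach psi)| <= (2 * MB * K ^+ 4 + 3 * C0 * K ^+ 2) * h ^+ 2.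
  rewrite hG//; have -> : A psi = (A psi - I2 (jint psi)) + I2 (jint psi) by rewrite subrK.
  have -> : (2 * MB * K ^+ 4 + 3 * C0 * K ^+ 2) * h ^+ 2 = C0 * (h ^+ 2 * (3 * K ^+ 2)) + 2 * MB * K ^+ 4 * h ^+ 2 by ring.
  apply: lerD2'; last exact: J_psi.
  apply: (le_trans (hA vpsi)); apply: ler_wpM2l => //; apply: ler_wpM2l => //.
  exact: Nrm_psi.
have hR : `|I2 Rm| <= 9 * MB * K ^+ 2 * Nrm chi.
  apply: (le_trans (I2_abs bRm)).
  have bx : bm (fun p => `|Dx chi p * Dx psi p|) by bmt.
  have by_ : bm (fun p => `|Dy chi p * Dy psi p|) by bmt.
  have bc' : bm (fun p => `|chi p|) by bmt.
  apply: (@le_trans _ _ (I2 (fun p => eps * (`|Dx chi p * Dx psi p| + `|Dy chi p * Dy psi p|) + 3 * MB * K * `|chi p|))).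
    apply: I2_le => [||[x y] Op]; [by bmt|by bmt|]; have [/= Ux Uy] := Op.
    have -> : 3 * MB * K * `|chi (x, y)| = (MB + MB) * (`|chi (x, y)| * K) + MB * (`|chi (x, y)| * (K * 1)) by ring.
    rewrite /Rm addrA; apply: lerD2'; first apply: lerD2'.
    - rewrite normrM gtr0_norm// ler_wpM2l ?(ltW e0)//; exact: ler_normD.
    - apply: lerM2; first by apply: lerD2'; [exact: hMc|exact: hMbeta].
      by apply: lerM2 => //; exact: (psi_le (UI Ux) (UI Uy)).
    - apply: lerM2; first exact: hMB.
      apply: lerM2 => //; apply: lerM2; first exact: (ky_le (UI Uy)).
      by case: (lastP' mx (UI Ux)) => [[-> _]|[-> _ _ _ _]]; rewrite /= ?subr0 ?subrr ?normr1 ?normr0.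
  rewrite I2D; [|by bmt|by bmt]; rewrite I2Z; last by bmt.
  rewrite I2D// I2Z//.
  have N0 := Nrm_ge0 n k x_ y_ eps chi.
  have se z1 z2 : eps * (z1 * z2) = s * z1 * (s * z2).
    rewrite -{1}ss; ring.
  have p1 : eps * I2 (fun p => `|Dx chi p * Dx psi p|) <= Nrm chi * (3 * K ^+ 2).
    apply: (@le_trans _ _ (eps * (nn (Dx chi) * nn (Dx psi)))); first by rewrite ler_wpM2l ?(ltW e0)// I2_cs.
    rewrite se.
    apply: ler_pM; rewrite ?mulr_ge0 ?nn_ge0 ?(ltW s0)// ?nnDx_le_Nrm//.
    by apply: le_trans (Nrm_psi eh); exact: nnDx_le_Nrm.
  have p2 : eps * I2 (fun p => `|Dy chi p * Dy psi p|) <= Nrm chi * (3 * K ^+ 2).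
    apply: (@le_trans _ _ (eps * (nn (Dy chi) * nn (Dy psi)))); first by rewrite ler_wpM2l ?(ltW e0)// I2_cs.
    rewrite se.
    apply: ler_pM; rewrite ?mulr_ge0 ?nn_ge0 ?(ltW s0)// ?nnDy_le_Nrm//.
    by apply: le_trans (Nrm_psi eh); exact: nnDy_le_Nrm.
  have p3 : I2 (fun p => `|chi p|) <= Nrm chi.
    by apply: (le_trans (I2_abs_nn bchi)); exact: nn_le_Nrm.
  have MK : 0 <= 3 * MB * K by do 2 apply: mulr_ge0 => //.
  have p4 := ler_wpM2l MK p3.
  have KK : K * Nrm chi <= K ^+ 2 * Nrm chi by rewrite ler_wpM2r// -{1}(expr1 K) ler_weXn2l.
  have p5 : 3 * MB * K * Nrm chi <= 3 * MB * (K ^+ 2 * Nrm chi).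
    by rewrite -mulrA ler_wpM2l// mulr_ge0.
  have p6 : K ^+ 2 * Nrm chi <= MB * (K ^+ 2 * Nrm chi) by rewrite ler_peMl// mulr_ge0// sqr_ge0.
  rewrite mulrDr; lra.
have hZ : `|sig * Z| <= 9 * MB * K ^+ 2 * Nrm chi + (2 * MB * K ^+ 4 + 3 * C0 * K ^+ 2) * h ^+ 2.
  have -> : sig * Z = I2 Rm - I2 (ach psi) by rewrite eq; ring.
  by apply: lerD2' => //; rewrite normrN.
move: hZ; rewrite normrM ger0_norm ?sig0// => hZ.
have : 1 / 4 * `|Z| <= sig * `|Z| by rewrite ler_wpM2r.
lra.
Qed.

Lemma J_le : `|I2 (jint chi)| <= h ^+ 2 * (84 * MB * K ^+ 5 * Nrm chi
    + 8 * K ^+ 2 * (2 * MB * K ^+ 4 + 3 * C0 * K ^+ 2) * h ^+ 2).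
Proof.
have N0 := Nrm_ge0 n k x_ y_ eps chi.
have K45 : K ^+ 4 <= K ^+ 5 by rewrite ler_weXn2l.
have M0 : 0 <= MB * Nrm chi * h ^+ 2 by rewrite mulr_ge0// mulr_ge0.
have P4 : 0 <= K ^+ 4 * (MB * Nrm chi * h ^+ 2) by rewrite mulr_ge0// exprn_ge0.
have P5 := ler_wpM2r M0 K45.
have P6 : 0 <= 8 * K ^+ 2 * (2 * MB * K ^+ 4 + 3 * C0 * K ^+ 2) * h ^+ 2 * h ^+ 2.
  apply: mulr_ge0 (sqr_ge0 h); apply: mulr_ge0 (sqr_ge0 h); apply: mulr_ge0.
    by rewrite mulr_ge0// sqr_ge0.
  by apply: addr_ge0; apply: mulr_ge0; rewrite ?exprn_ge0// mulr_ge0.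
(* A last column narrower than a multiple of eps is handled directly; otherwise eps <= h makes the
   energy norm of the trial function bounded. *)
have [he|/ltW eh] := lerP h eps.
  apply: (le_trans (J_big vchi he)).
  lra.
have bk : bm (jk chi) by rewrite /jk; bmt.
have -> : I2 (jint chi) = (I2 (jint chi) - I2 (jk chi)) + I2 (jk chi) by rewrite subrK.
apply: (le_trans (lerD2' (J_diff vchi) (lexx `|I2 (jk chi)|))).
have bZ : bm (fun p => B p * (last p.1 * iwx p.1) * ky p.2 * chi p) by bmt.
have : `|I2 (jk chi)| <= (2 * (K ^+ 2 * h ^+ 2)) * (4 * (9 * MB * K ^+ 2 * Nrm chi + (2 * MB * K ^+ 4 + 3 * C0 * K ^+ 2) * h ^+ 2)).
  rewrite /jk I2Z//; apply: lerM2; last exact: Z_le.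
  by apply: lerM2; [rewrite normrN ger0_norm|exact: omc_le].
set T := 2 * MB * K ^+ 4 + 3 * C0 * K ^+ 2 in P6 *.
move=> hh.
lra.
Qed.

Hypotheses (gam0 : 0 < gam) (gam1 : gam <= 1) (hcb : forall p, Omega p -> gam <= c p + 1 / 2 * beta p).

Lemma coercive : gam * Nrm chi ^+ 2 <= I2 (ach chi).
Proof.
have b1 : bm (fun p => eps * Dx chi p ^+ 2) by bmt.
have b2 : bm (fun p => eps * Dy chi p ^+ 2) by bmt.
have b3 : bm (fun p => (c p + 1 / 2 * beta p) * chi p ^+ 2) by bmt.
have b4 : bm (fun p => 1 / 2 * (B p * (Dx chi p * chi p + chi p * Dx chi p) + beta p * (chi p * chi p))) by bmt.
have b5 : bm (fun p => B p * (Dx chi p * chi p + chi p * Dx chi p)) by bmt.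
have b6 : bm (fun p => beta p * (chi p * chi p)) by bmt.
have z : I2 (fun p => 1 / 2 * (B p * (Dx chi p * chi p + chi p * Dx chi p) + beta p * (chi p * chi p))) = 0.
  rewrite I2Z; last by bmt.
  rewrite I2D// (_ : I2 (fun p => B p * _) = - I2 (fun p => beta p * (chi p * chi p))) ?addNr ?mulr0//.
  rewrite -(vh_by_parts mx bd bbeta vchi vchi); by apply: I2_eq => p _; rewrite hB.
have -> : I2 (ach chi) = I2 (fun p => eps * Dx chi p ^+ 2 + eps * Dy chi p ^+ 2 + (c p + 1 / 2 * beta p) * chi p ^+ 2)
   - I2 (fun p => 1 / 2 * (B p * (Dx chi p * chi p + chi p * Dx chi p) + beta p * (chi p * chi p))).
  rewrite -I2B//; last by bmt.
  by apply: I2_eq => p _; rewrite /ach; field.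
rewrite z subr0 I2D//; last by bmt.
rewrite I2D// I2Z; last by bmt.
rewrite I2Z; last by bmt.
rewrite Nrm_sqr// !nn_sqr !mulrDr.
have s1' : 0 <= I2 (fun p => Dx chi p ^+ 2) by apply: Rintegral_ge0 => p _; rewrite sqr_ge0.
have s2' : 0 <= I2 (fun p => Dy chi p ^+ 2) by apply: Rintegral_ge0 => p _; rewrite sqr_ge0.
apply: lerD; first by apply: lerD; rewrite ler_piMl// mulr_ge0// ltW.
rewrite -I2Z; last by bmt.
by apply: I2_le => [||p Op]; [by bmt|by bmt|rewrite ler_wpM2r ?sqr_ge0// hcb].
Qed.

(** The numerator collects the constants of [J_le] and [hA], the division comes from coercivity, and
    the 1 covers the case where the norm is already below h^2. *)
Definition energy_cst := (84 * MB * K ^+ 5 + C0 + 8 * K ^+ 2 * (2 * MB * K ^+ 4 + 3 * C0 * K ^+ 2)) / gam + 1.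

Lemma Nrm_chi_le : Nrm chi <= energy_cst * h ^+ 2.
Proof.
have N0 := Nrm_ge0 n k x_ y_ eps chi.
have co := coercive; rewrite hG// in co.
have hJ := J_le; have hA' := hA vchi.
set A1 := 84 * MB * K ^+ 5 in hJ *; set A2 := 8 * K ^+ 2 * _ in hJ *.
have A10 : 0 <= A1 by apply: mulr_ge0 (exprn_ge0 5 K0); exact: mulr_ge0.
have A20 : 0 <= A2.
  apply: mulr_ge0; first by rewrite mulr_ge0// sqr_ge0.
  by apply: addr_ge0; apply: mulr_ge0; rewrite ?exprn_ge0// mulr_ge0.
have CE1 : 1 <= energy_cst by rewrite /energy_cst lerDr divr_ge0 ?(ltW gam0)// addr_ge0// addr_ge0.
(* If the norm exceeds h^2, then h^4 is at most h^2 times the norm and the quadratic inequality can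
   be divided by the norm. *)
have [small|big] := lerP (Nrm chi) (h ^+ 2).
  by apply: (le_trans small); rewrite ler_peMl.
have NN : 0 < Nrm chi by apply: le_lt_trans big; exact: sqr_ge0.
rewrite -(ler_pM2r NN) -(ler_pM2l gam0).
have -> : gam * (Nrm chi * Nrm chi) = gam * Nrm chi ^+ 2 by ring.
apply: (le_trans co); apply: (@le_trans _ _ (h ^+ 2 * (A1 * Nrm chi + A2 * h ^+ 2) + C0 * (h ^+ 2 * Nrm chi))).
  have -> : A chi = I2 (jint chi) + (A chi - I2 (jint chi)) by ring.
  apply: (le_trans (ler_norm _)); exact: lerD2'.
have -> : gam * (energy_cst * h ^+ 2 * Nrm chi) = (A1 + C0 + A2) * (h ^+ 2 * Nrm chi) + gam * (h ^+ 2 * Nrm chi).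
  by rewrite /energy_cst -/A1 -/A2; field; exact: lt0r_neq0.
have q1 : 0 <= gam * (h ^+ 2 * Nrm chi) by rewrite mulr_ge0 ?(ltW gam0)// mulr_ge0.
have q2 : A2 * (h ^+ 2 * h ^+ 2) <= A2 * (h ^+ 2 * Nrm chi) by rewrite ler_wpM2l// ler_wpM2l// ltW.
lra.
Qed.

End LastCell.

(** * The graded meshes *)

Section Graded.
Context (R : realType).
Implicit Types (x y t : R).
Variables (h s L rho : R) (m : nat).
Hypotheses (h0 : 0 < h) (h1 : h < 1) (s0 : 0 < s) (rho0 : 0 < rho).
Hypotheses (idx : dl_index h s L m) (sL : 4 * s < L) (L1 : L <= 1).
Local Notation N := (dl_K h).
Local Notation node := (dl_node h s).

Lemma dl_K_itv : 1 <= N%:R * h /\ N%:R * h < 1 + h.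
Proof.
have lh0 := h0.
have p : 0 < 1 / h by rewrite divr_gt0.
have E : (N%:R : R) = (Num.ceil (1 / h))%:~R.
  by rewrite /dl_K natr_absz ger0_norm// Num.Theory.ceil_ge0; apply: lt_trans p; lra.
have /andP[a b] := Num.Theory.ceil_itv (1 / h).
rewrite E; split; first by rewrite -ler_pdivrMr.
rewrite -ltr_pdivlMr//; move: a; rewrite intrB ltrBlDr => a.
by rewrite mulrDl divff ?gt_eqF//; move: a; rewrite !mul1r.
Qed.

Lemma dl_K_gt0 : (0 < N)%N.
Proof.
have lh0 := h0. by rewrite lt0n; apply/eqP => E; have [] := dl_K_itv; rewrite E mul0r; lra. Qed.

Lemma node_unif i : (i <= N)%N -> node i = i%:R * h * s.
Proof. by case: i => [|i] iN; rewrite ?mul0r//= iN. Qed.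

Lemma node_succ i : (N <= i)%N -> node i.+1 = (1 + h) * node i.
Proof. by move=> Ni /=; rewrite ltnNge Ni /=; ring. Qed.

Lemma node_exp i : node (N + i) = (1 + h) ^+ i * (N%:R * h * s).
Proof.
elim: i => [|i IH]; first by rewrite addn0 mul1r node_unif.
by rewrite addnS node_succ ?leq_addr// IH exprS mulrA.
Qed.

Lemma node_ges i : (N <= i)%N -> s <= node i.
Proof.
move=> Ni; rewrite -(subnKC Ni) node_exp.
have [a _] := dl_K_itv.
rewrite -[leLHS]mul1r; apply: ler_pM => //; first exact: ltW.
  by apply: exprn_ege1; rewrite lerDl ltW.
by rewrite -[leLHS]mul1r ler_wpM2r// ltW.
Qed.

Lemma node_N : node N < 2 * s.
Proof.
have lh1 := h1.
rewrite node_unif//; have [_ b] := dl_K_itv.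
by rewrite ltr_pM2r//; lra.
Qed.

Lemma node_step i :
  ((i < N)%N /\ node i.+1 = node i + h * s) \/ ((N <= i)%N /\ node i.+1 = node i + h * node i).
Proof.
case: (ltnP i N) => iN; [left|right]; split=> //; last by rewrite node_succ//; ring.
by rewrite node_unif// node_unif ?(ltnW iN)// -natr1; ring.
Qed.

Lemma node_inc i : node i < node i.+1.
Proof.
have hs : 0 < h * s by rewrite mulr_gt0.
case: (node_step i) => -[iN ->]; rewrite ltrDl// mulr_gt0//.
exact: lt_le_trans s0 (node_ges iN).
Qed.

Lemma node_mono i j : (i <= j)%N -> node i <= node j.
Proof.
move=> ij; rewrite -(subnKC ij); elim: (_ - _)%N => [|d IH]; first by rewrite addn0.
by rewrite addnS (le_trans IH)// ltW// node_inc.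
Qed.

(** The uniform part ends below 2 s, whereas L > 4 s, so a single step of ratio 1 + h < 2 cannot
    reach L from there. Hence the node before the last is in the geometric part even when one node
    is dropped. *)
Lemma dl_index_ge : (N <= m.-2)%N /\ m = m.-2.+2.
Proof.
have lh0 := h0.
have lh1 := h1.
have lsL := sL.
have [Nm m0 nL Ln] := idx; have N0 := dl_K_gt0.
have sN : m.-1 <> N.
  move=> E; move: Ln; rewrite E => Ln; have nN := node_N.
  have : (1 + h) * node N <= 2 * (2 * s).
    have : 0 <= node N by apply: le_trans (node_ges (leqnn _)); exact: ltW.
    nra.
  lra.
have : (N < m.-1)%N by rewrite ltn_neqAle Nm andbT; apply/eqP => E; apply: sN.
case: m m0 => [|[|p]]//= _ ?; split => //; exact: leq_ltn_trans N0 _.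
Qed.

Local Notation kap := (dl_kept h s L rho m).
Local Notation z i := ((dl_graded h s L rho m)`_i).

Lemma kap_cases : (kap = m /\ rho * (node m.-1 - node m.-2) <= L - node m.-1) \/
  (kap = m.-1 /\ L - node m.-1 < rho * (node m.-1 - node m.-2)).
Proof. by rewrite /dl_kept; case: lerP => H; [left|right]. Qed.

Lemma size_graded : size (dl_graded h s L rho m) = kap.+1.
Proof. by rewrite size_rcons size_mkseq. Qed.

Lemma gradedL : z kap = L.
Proof. by rewrite nth_rcons size_mkseq ltnn eqxx. Qed.

Lemma graded_node i : (i < kap)%N -> z i = node i.
Proof. by move=> ik; rewrite nth_rcons size_mkseq ik nth_mkseq. Qed.

Lemma N_lt_kap : (N < kap)%N.
Proof.
have [Nm Em] := dl_index_ge; case: kap_cases => -[-> _]; rewrite Em /=; last by rewrite ltnS.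
by rewrite ltnS (leq_trans Nm).
Qed.

Lemma graded0 : z 0 = 0.
Proof. by rewrite graded_node//; exact: leq_ltn_trans N_lt_kap. Qed.

(* The last cell may be the union of the two cells before L. *)
Lemma graded_last : [/\ s <= z kap.-1, L / 4 <= z kap.-1,
  Num.min rho 1 * h * L / 4 <= L - z kap.-1 & L - z kap.-1 <= 3 * h * z kap.-1].
Proof.
have lh0 := h0.
have lh1 := h1.
have lsL := sL.
have ls0 := s0.
have [Nm Em] := dl_index_ge; have [_ _ nL Ln] := idx.
have Lpos : 0 < L by lra.
have kp : (kap.-1 < kap)%N by rewrite prednK// (leq_ltn_trans _ N_lt_kap).
rewrite graded_node//.
set a := node m.-2.
have E1 : node m.-1 = (1 + h) * a by rewrite Em /= -node_succ.
have as_ : s <= a by exact: node_ges.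
have a0 : 0 < a by exact: lt_le_trans as_.
rewrite E1 in nL Ln.
have ha : 0 < h * a by exact: mulr_gt0.
have hha : 0 <= h * (h * a) by rewrite mulr_ge0// ltW.
have hha' : h * (h * a) <= h * a by rewrite ler_piMl ?ltW.
have ha1 : h * a <= a by rewrite ler_piMl ?ltW.
(* Here L is at most (1 + h)^2 a with h < 1. *)
have aL : L <= 4 * a by lra.
have haL : h * L <= 4 * (h * a) by rewrite mulrCA ler_wpM2l ?(ltW h0).
have hL : 0 < h * L by exact: mulr_gt0.
have mn : Num.min rho 1 <= rho by rewrite ge_min lexx.
have mn1 : Num.min rho 1 <= 1 by rewrite ge_min lexx orbT.
have mn0 : 0 < Num.min rho 1 by rewrite lt_min rho0 ltr01.
have r1 : Num.min rho 1 * (h * L) <= rho * (4 * (h * a)).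
  by apply: ler_pM => //; exact: ltW.
have r2 : Num.min rho 1 * (h * L) <= 1 * (4 * (h * a)).
  by apply: ler_pM => //; exact: ltW.
rewrite -[_ * h * L]mulrA.
case: kap_cases => -[-> H].
  rewrite E1; rewrite E1 -/a in H.
  have H' : rho * (h * a) <= L - (1 + h) * a.
    by apply: le_trans H; rewrite ler_wpM2l ?(ltW rho0)//; lra.
  split; lra.
rewrite -/a; split; lra.
Qed.

Lemma graded_cell i : (i.+1 < kap)%N ->
  (z i.+1 = z i + h * s /\ z i.+1 <= 2 * s) \/ (s <= z i /\ z i.+1 = z i + h * z i).
Proof.
move=> ik; rewrite !graded_node//; last exact: ltnW.
case: (node_step i) => -[iN E]; [left|right]; split=> //; last exact: node_ges.
by apply: le_trans (ltW node_N); exact: node_mono.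
Qed.

Lemma graded_inc i : (i < kap)%N -> z i < z i.+1.
Proof.
have lsL := sL.
have ls0 := s0.
move=> ik; case: (ltnP i.+1 kap) => ik'; first by rewrite !graded_node//; exact: node_inc.
have E : kap = i.+1 by apply/eqP; rewrite eqn_leq ik'.
have -> : z i.+1 = L by rewrite -E gradedL.
have -> : z i = z kap.-1 by rewrite E.
have [s1 _ a b] := graded_last; rewrite -subr_gt0; apply: lt_le_trans a.
by rewrite !divr_gt0// !mulr_gt0// ?lt_min ?rho0 ?ltr01//; lra.
Qed.

(** The j geometric steps multiply s by at least (1 + h)^j >= exp(j h / 2) and stay below 1, so j h
    < 2 |ln s|. The uniform part has N h < 1 + h, and one more node adds h; together these are below
    3. *)
Lemma kap_le : kap%:R * h <= 3 + 2 * `|ln s|.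
Proof.
have lh0 := h0.
have lh1 := h1.
have lsL := sL.
have ls0 := s0.
have lL1 := L1.
have [Nm Em] := dl_index_ge; have [Nm' m0 nL Ln] := idx.
have [a b] := dl_K_itv.
have s1 : s < 1 by lra.
have ls : ln s < 0 by rewrite ln_lt0// s0.
pose j := (m.-1 - N)%N.
have Ej : m.-1 = (N + j)%N by rewrite subnKC.
have kj : (kap <= N + j + 1)%N.
  by rewrite -Ej addn1 prednK//; case: kap_cases => -[-> _]//; rewrite leq_pred.
(* Follows from exp(- h / 2) >= 1 - h / 2 and (1 + h)(1 - h / 2) >= 1, the latter because h < 1. *)
have e2 : expR (h / 2) <= 1 + h.
  have h2 := expR_ge1Dx (- (h / 2)).
  have : expR (h / 2) * expR (- (h / 2)) = 1 by rewrite -expRD subrr expR0.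
  have := expR_gt0 (h / 2).
  set A := expR (h / 2) in h2 *; set B := expR (- (h / 2)) in h2 *; move=> A0 AB.
  have : A * (1 + - (h / 2)) <= 1 by rewrite -[leRHS]AB ler_wpM2l// ltW.
  nra.
have ej : expR (j%:R * (h / 2)) * s < 1.
  have : (1 + h) ^+ j * (N%:R * h * s) < 1 by rewrite -node_exp -Ej; apply: lt_le_trans nL L1.
  apply: le_lt_trans; apply: ler_pM; rewrite ?expR_ge0 ?(ltW s0)//.
    by rewrite expRM_natl; apply: lerXn2r; rewrite ?nnegrE ?expR_ge0// addr_ge0 // ltW.
  by rewrite -[leLHS]mul1r ler_wpM2r// ltW.
have jl : j%:R * (h / 2) < - ln s.
  have : ln (expR (j%:R * (h / 2)) * s) < 0.
    by apply: ln_lt0; rewrite mulr_gt0 ?expR_gt0.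
  by rewrite lnM ?posrE ?expR_gt0// expRK; lra.
have : (kap%:R : R) <= N%:R + j%:R + 1 by rewrite -natrD natr1 ler_nat -addn1.
move/(ler_wpM2r (ltW h0)); rewrite ltr0_norm//.
move: (kap%:R : R) (N%:R : R) (j%:R : R) a b jl => k' N' j' a b jl hk; lra.
Qed.

End Graded.

Section Exponentials.
Context (R : realType).
Implicit Types (a x y t : R).

Lemma bm1_cont (f : R -> R) : continuous f -> bm1 f.
Proof.
move=> cf; split; first exact: (measurable_funTS (continuous_measurable_fun cf)).
have cw : continuous (fun p : R * R => f p.1).
  by move=> p; apply: (@continuous_comp _ _ _ fst f); [exact: cvg_fst|exact: cf].
have [M hM] := bounded_square cw; exists M => x /U01 x01.
by apply: (hM x 0) => //; rewrite lexx ler01.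
Qed.

Lemma expR_quad t : 0 <= t -> t ^+ 2 / 4 <= expR t.
Proof.
move=> t0; have := expR_ge1Dx (t / 2).
have E : expR t = expR (t / 2) ^+ 2 by rewrite expr2 -expRD; congr expR; field.
move=> h; have : (1 + t / 2) ^+ 2 <= expR (t / 2) ^+ 2.
  by rewrite ler_pXn2r// nnegrE ?expR_ge0//; lra.
by rewrite -E; nra.
Qed.

Lemma quad_expN a t : 0 < a -> 0 <= t -> t ^+ 2 * expR (- (a * t)) <= 4 / a ^+ 2.
Proof.
move=> a0 t0; have at0 : 0 <= a * t by rewrite mulr_ge0// ltW.
rewrite expRN -ler_pdivlMr ?invr_gt0 ?expR_gt0// invrK.
rewrite mulrAC ler_pdivlMr ?exprn_gt0//.
have := expR_quad at0; rewrite exprMn; lra.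
Qed.

Lemma expRN_le1 t : 0 <= t -> expR (- t) <= 1.
Proof. by move=> t0; rewrite -expR0 ler_expR oppr_le0. Qed.

Lemma expR_cont a c : continuous (fun x : R => expR (a * x + c)).
Proof.
move=> x; apply: (@continuous_comp _ _ _ (fun x => a * x + c) (@expR R)); last exact: continuous_expR.
by apply: cvgD; [apply: cvgM; [exact: cvg_cst|exact: cvg_id]|exact: cvg_cst].
Qed.

Lemma nice_exp a c (u v : R) : nice u v (fun x => expR (a * x + c)) (fun x => a * expR (a * x + c)).
Proof.
split=> [x|x|x _]; first exact: expR_cont.
  by apply: cvgM; [exact: cvg_cst|exact: expR_cont].
have d1 : is_derive x 1 (fun x => a * x + c) a.
  have := is_deriveD (is_deriveZ a (is_derive_id x 1)) (is_derive_cst c x 1).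
  by rewrite addr0 /GRing.scale /= mulr1.
have := @is_derive1_comp R (@expR R) (fun x => a * x + c) x _ _ (is_derive_expR (a * x + c)) d1.
by rewrite mulrC.
Qed.

Lemma I1_exp a c : a != 0 -> I1 (fun x => expR (a * x + c)) = (expR (a + c) - expR c) / a.
Proof.
move=> a0; have b1 : bm1 (fun x : R => expR (a * x + c)) by apply: bm1_cont; exact: expR_cont.
have := nice_ftc ltr01 (nice_exp a c 0 1).
rewrite mulr1 mulr0 add0r -/(I1 _) I1Z// => <-.
by rewrite mulrC mulKf.
Qed.

End Exponentials.

(** * The mesh in x and the exponential layer at x = 0 *)

Section XMesh.
Context (R : realType).
Implicit Types (x y t xi : R).
Variables (h eps rho beta : R) (m : nat).
Hypotheses (h0 : 0 < h) (h1 : h < 1) (e0 : 0 < eps) (e4 : 4 * eps < 1) (rho0 : 0 < rho) (beta0 : 0 < beta).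
Hypotheses (idx : dl_index h eps 1 m).
Definition xn := dl_kept h eps 1 rho m.
Definition xx (i : nat) := (dl_x h eps rho m)`_i.
Local Notation lox := (lo xn xx).
Local Notation hix := (hi xn xx).
Local Notation wdx := (wd xn xx).

Lemma xmesh : mesh xn xx.
Proof.
have z := graded0 rho h0 h1 e0 idx e4; have L := gradedL h eps 1 rho m.
have nk := N_lt_kap rho h0 h1 e0 idx e4.
split=> //; first by apply: leq_ltn_trans nk.
move=> i ik; exact: (graded_inc h0 h1 e0 rho0 idx e4).
Qed.

Lemma x_size : size (dl_x h eps rho m) = xn.+1. Proof. exact: size_graded. Qed.

Lemma x_cell x : 0 <= x < 1 ->
  [\/ wdx x = h * eps /\ hix x <= 2 * eps, eps <= lox x /\ wdx x = h * lox x
    | [/\ in_last xn xx x = 1, eps <= lox x & wdx x <= 3 * h * lox x]].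
Proof.
move=> x01; have [i ilt ix] := mesh_cell xmesh x01.
rewrite /in_last /wd /hi /lo !(stepf_cell xmesh _ ilt ix).
case: (ltnP i.+1 xn) => ik.
  case: (graded_cell h0 h1 e0 ik) => -[a b]; [apply: Or31|apply: Or32]; split=> //.
    by rewrite /xx /dl_x a addrAC subrr add0r.
  by rewrite /xx /dl_x b addrAC subrr add0r.
have E : i.+1 = xn by apply/eqP; rewrite eqn_leq ik ilt.
rewrite E eqxx; apply: Or33; have [a _ _ b] := graded_last h0 h1 e0 rho0 idx e4.
have Ei : i = xn.-1 by rewrite -E.
have zE : xx xn = 1 by exact: gradedL.
by rewrite zE Ei; split.
Qed.

Lemma x_sig : [/\ 1 / 4 <= last_node xn xx, Num.min rho 1 * h / 4 <= last_width xn xx & last_width xn xx <= 3 * h].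
Proof.
have [_ a b c] := graded_last h0 h1 e0 rho0 idx e4.
have s1 : last_node xn xx <= 1 by rewrite -subr_ge0; exact: ltW (Hl0 xmesh).
split; [exact: a| by move: b; rewrite mulr1|].
apply: (le_trans c); have h3 : 0 <= 3 * h by rewrite mulr_ge0// ltW.
by have := ler_wpM2l h3 s1; rewrite mulr1.
Qed.

Lemma x_wd x : 0 <= x < 1 -> wdx x <= 3 * h * Num.max eps (lox x).
Proof.
move=> x01; have [l0 _ _ _ w0] := lohi xmesh x01; have lh0 := h0; have le0 := e0.
have hp : 0 <= 3 * h by lra.
have lM : eps <= Num.max eps (lox x) by rewrite le_max lexx.
have rM : lox x <= Num.max eps (lox x) by rewrite le_max lexx orbT.
have m1 := ler_wpM2l hp lM; have m2 := ler_wpM2l hp rM.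
have p1 : 0 <= h * eps by rewrite mulr_ge0 ?ltW.
have p2 : 0 <= h * lox x by rewrite mulr_ge0 ?(ltW h0).
by case: (x_cell x01) => [[-> _]|[_ ->]|[_ _ b]]; lra.
Qed.

Lemma x_wd1 x : 0 <= x < 1 -> wdx x <= 3 * h.
Proof.
move=> x01; apply: (le_trans (x_wd x01)); rewrite -[leRHS]mulr1 ler_wpM2l//.
  by rewrite mulr_ge0// ltW.
have le4 := e4; have le0 := e0.
have [l0 lx xh hi1 _] := lohi xmesh x01; rewrite ge_max; apply/andP; split; lra.
Qed.

(** In the uniform part x <= 2 eps, so both squares are O(h^2 eps^2). In the geometric part the
    width is h times the left end, and H^2 - h^2 x^2 factors as - h (x - lo) times h (x + lo), each
    factor at most a multiple of H up to the extra h. *)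
Lemma x_om x : 0 <= x < 1 -> in_last xn xx x = 0 ->
  `|om xn xx h x| <= h * wdx x ^+ 2 + h ^+ 2 * eps ^+ 2.
Proof.
move=> x01 l0; have [lo0 lx xh hi1 w0] := lohi xmesh x01; have /andP[x0 x1] := x01.
have lh0 := h0; have lh1 := h1; have le0 := e0.
have wE : wdx x = hix x - lox x by [].
case: (x_cell x01) => [[w hh]|[ae w]|[l1 _ _]]; last by move: l0; rewrite l1 => /eqP; rewrite oner_eq0.
- have x2 : x ^+ 2 <= 4 * eps ^+ 2.
    by rewrite (_ : 4 * eps ^+ 2 = (2 * eps) ^+ 2) ?ler_pXn2r ?nnegrE//; [lra|lra|ring].
  have xx0 := sqr_ge0 x.
  rewrite /om w.
  have -> : ((h * eps) ^+ 2 - h ^+ 2 * x ^+ 2) / 12 = h ^+ 2 * ((eps ^+ 2 - x ^+ 2) / 12) by field.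
  rewrite normrM ger0_norm ?sqr_ge0//.
  have p : 0 <= h * (h * eps) ^+ 2 by rewrite mulr_ge0 ?sqr_ge0// ltW.
  apply: (@le_trans _ _ (h ^+ 2 * eps ^+ 2)); last by rewrite lerDr.
  rewrite ler_wpM2l ?sqr_ge0// ler_norml; have := sqr_ge0 eps => q; apply/andP; split; lra.
- have -> : om xn xx h x = - (h * ((x - lox x) * (h * (x + lox x) / 12))).
    have -> : om xn xx h x = (wdx x ^+ 2 - h ^+ 2 * x ^+ 2) / 12 by [].
    by rewrite w; field.
  rewrite normrN normrM gtr0_norm//.
  apply: (@le_trans _ _ (h * wdx x ^+ 2)); last by rewrite lerDl mulr_ge0 ?sqr_ge0.
  rewrite ler_wpM2l ?(ltW h0)// expr2; apply: lerM2; first by rewrite ger0_norm; lra.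
  have q1 : h * (x + lox x) <= h * (3 * lox x).
    rewrite ler_wpM2l ?(ltW h0)//.
    have : h * lox x <= lox x by rewrite ler_piMl ?(ltW h1).
    lra.
  have q2 : 0 <= h * (x + lox x) by rewrite mulr_ge0 ?addr_ge0 ?(ltW h0).
  have q3 : h * (3 * lox x) = 3 * wdx x by rewrite w; ring.
  by rewrite ger0_norm; lra.
Qed.

(** Why the rate falls from beta to beta / 8: with t = lo / eps, half of the exponent absorbs the
    growth 1 + t^2 of the squared width, and the other half is passed from the left end to x through
    x / eps <= 4 t + 3, which also produces the exponential in [decay_cst]. *)
Definition decay x := expR (- (beta / 8 * (x / eps))).
Definition decay_cst := 9 * (1 + 64 / beta ^+ 2) * expR (3 * (beta / 8)).

Lemma decay01 x : 0 <= x -> 0 <= decay x <= 1.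
Proof.
move=> x0; rewrite expR_ge0 expRN_le1//.
by rewrite mulr_ge0 ?divr_ge0// ltW.
Qed.

Lemma decayE : decay = (fun x => expR (- (beta / 8 / eps) * x + 0)).
Proof. by apply/funext => x; rewrite /decay; congr expR; field; exact: lt0r_neq0. Qed.

Lemma bm1_decay : bm1 decay.
Proof. by rewrite decayE; apply: bm1_cont; exact: expR_cont. Qed.

Lemma I1_decay2 : I1 (fun x => decay x ^+ 2) <= 4 / beta * eps.
Proof.
pose a := beta / 4 / eps; have a0 : 0 < a by rewrite !divr_gt0.
have -> : (fun x => decay x ^+ 2) = (fun x => expR (- a * x + 0)).
  apply/funext => x; rewrite /decay expr2 -expRD; congr expR; rewrite /a; field; exact: lt0r_neq0.
rewrite I1_exp ?oppr_eq0 ?gt_eqF// !addr0 expR0 invrN mulrN -mulNr opprB.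
have -> : 4 / beta * eps = 1 / a by rewrite /a; field; rewrite !gt_eqF.
by rewrite ler_wpM2r ?invr_ge0 ?(ltW a0)// gerBl expR_ge0.
Qed.

Lemma x_decay x xi : 0 <= x < 1 -> lox x <= xi <= hix x ->
  wdx x ^+ 2 * expR (- (beta * xi / eps)) <= decay_cst * (h ^+ 2 * eps ^+ 2) * decay x /\
  expR (- (beta * xi / eps)) <= decay_cst * decay x.
Proof.
move=> x01 /andP[x1 _]; have [l0 lx xh hi1 w0] := lohi xmesh x01.
have lh1 := h1; have lh0 := h0; have le0 := e0; have lb0 := beta0.
pose t := lox x / eps; have t0 : 0 <= t by rewrite divr_ge0// ltW.
have lE : lox x = t * eps by rewrite /t divfK ?gt_eqF.
have e1 : expR (- (beta * xi / eps)) <= expR (- (beta * t)).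
  rewrite ler_expR lerN2 -mulrA ler_wpM2l ?(ltW beta0)//.
  by rewrite ler_wpM2r ?invr_ge0 ?(ltW e0)//.
have w1 := x_wd x01; have le1 : eps <= Num.max eps (lox x) by rewrite le_max lexx.
have mx1 : Num.max eps (lox x) <= eps * (1 + t).
  rewrite ge_max mulrDr mulr1 lE [eps * t]mulrC.
  have : 0 <= t * eps by rewrite mulr_ge0 ?(ltW e0).
  move=> ?; apply/andP; split; lra.
have mx0 : 0 < Num.max eps (lox x) by rewrite lt_max e0.
have mx2 : Num.max eps (lox x) ^+ 2 <= eps ^+ 2 * (1 + t ^+ 2).
  rewrite /Num.max; case: ifP => _; [rewrite lE exprMn|]; have := sqr_ge0 eps;
    have : 0 <= eps ^+ 2 * t ^+ 2 by [rewrite mulr_ge0 ?sqr_ge0|rewrite mulr_ge0 ?sqr_ge0]; lra.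
have w2 : wdx x ^+ 2 <= 9 * h ^+ 2 * (eps ^+ 2 * (1 + t ^+ 2)).
  apply: (@le_trans _ _ ((3 * h * Num.max eps (lox x)) ^+ 2)).
    by rewrite ler_pXn2r ?nnegrE ?(ltW w0)// !mulr_ge0 ?(ltW h0) ?(ltW mx0).
  rewrite exprMn (_ : (3 * h) ^+ 2 = 9 * h ^+ 2); last by ring.
  by rewrite ler_wpM2l// mulr_ge0// sqr_ge0.
have xt : x / eps <= 4 * t + 3.
  rewrite ler_pdivrMr// mulrDl -mulrA -lE.
  have w3 : wdx x <= 3 * Num.max eps (lox x).
    by apply: (le_trans w1); rewrite ler_wpM2r ?(ltW mx0)//; lra.
  have : x < lox x + wdx x by rewrite /wd addrC subrK.
  have : Num.max eps (lox x) <= eps + lox x by rewrite ge_max; apply/andP; split; lra.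
  lra.
have g1 : expR (- (beta / 2 * t)) <= expR (3 * (beta / 8)) * decay x.
  rewrite /decay -expRD ler_expR.
  have b8 : 0 <= beta / 8 by rewrite divr_ge0 ?(ltW beta0).
  have := ler_wpM2l b8 xt; lra.
have q0 : t ^+ 2 * expR (- (beta / 2 * t)) <= 64 / beta ^+ 2.
  have b2 : 0 < beta / 2 by rewrite divr_gt0.
  apply: (le_trans (quad_expN b2 t0)); rewrite expr_div_n invf_div.
  have : 0 <= (beta ^+ 2)^-1 by rewrite invr_ge0 sqr_ge0.
  lra.
have E : expR (- (beta * t)) = expR (- (beta / 2 * t)) * expR (- (beta / 2 * t)).
  by rewrite -expRD; congr expR; field.
have b1 : expR (- (beta / 2 * t)) <= 1 by rewrite expRN_le1// mulr_ge0// divr_ge0// ltW.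
have ex0 := expR_ge0 (- (beta / 2 * t)).
have c0 : 0 <= 64 / beta ^+ 2 by rewrite divr_ge0 ?sqr_ge0.
have q1 : (1 + t ^+ 2) * expR (- (beta * t)) <= (1 + 64 / beta ^+ 2) * (expR (3 * (beta / 8)) * decay x).
  rewrite E mulrA; apply: ler_pM => //; last by rewrite mulrDl mul1r; lra.
  by rewrite mulr_ge0// addr_ge0 ?sqr_ge0//.
have h2 : 0 <= h ^+ 2 * eps ^+ 2 by rewrite mulr_ge0 ?sqr_ge0.
split.
  apply: (@le_trans _ _ (9 * h ^+ 2 * (eps ^+ 2 * (1 + t ^+ 2)) * expR (- (beta * t)))).
    by apply: ler_pM => //; exact: sqr_ge0.
  have -> : 9 * h ^+ 2 * (eps ^+ 2 * (1 + t ^+ 2)) * expR (- (beta * t)) =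
    9 * (h ^+ 2 * eps ^+ 2) * ((1 + t ^+ 2) * expR (- (beta * t))) by ring.
  have -> : decay_cst * (h ^+ 2 * eps ^+ 2) * decay x = 9 * (h ^+ 2 * eps ^+ 2) * ((1 + 64 / beta ^+ 2) * (expR (3 * (beta / 8)) * decay x)).
    by rewrite /decay_cst; ring.
  by rewrite ler_wpM2l// mulr_ge0.
apply: (le_trans e1); apply: (@le_trans _ _ (1 * ((1 + t ^+ 2) * expR (- (beta * t))))).
  by rewrite mul1r ler_peMl ?expR_ge0// lerDl sqr_ge0.
have -> : decay_cst * decay x = 9 * ((1 + 64 / beta ^+ 2) * (expR (3 * (beta / 8)) * decay x)) by rewrite /decay_cst; ring.
apply: ler_pM => //; [by rewrite mulr_ge0 ?expR_ge0// addr_ge0 ?sqr_ge0|by lra].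
Qed.

End XMesh.

Lemma half_lt (a j : nat) : (a <= j)%N -> (j < a + a)%N -> (a + a - j.+1 < a)%N.
Proof. lia. Qed.

(** * The mesh in y and the parabolic layers *)

Section YMesh.
Context (R : realType).
Implicit Types (x y t : R).
Variables (h eps rho delta : R) (m : nat).
Local Notation s := (Num.sqrt eps).
Hypotheses (h0 : 0 < h) (h1 : h < 1) (e0 : 0 < eps) (e4 : 4 * s < 1 / 2) (rho0 : 0 < rho) (delta0 : 0 < delta).
Hypotheses (idx : dl_index h s (1 / 2) m).
Local Notation kap := (dl_kept h s (1 / 2) rho m).
Local Notation z i := ((dl_graded h s (1 / 2) rho m)`_i).
Definition yn := (kap + kap)%N.
Definition yy (i : nat) := (dl_y h eps rho m)`_i.
Local Notation loy := (lo yn yy).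
Local Notation hiy := (hi yn yy).
Local Notation wdy := (wd yn yy).

Let s0 : 0 < s. Proof. by rewrite sqrtr_gt0. Qed.
Let kap0 : (0 < kap)%N. Proof. exact: leq_ltn_trans (N_lt_kap rho h0 h1 s0 idx e4). Qed.

Lemma y_size : size (dl_y h eps rho m) = yn.+1.
Proof.
rewrite /dl_y size_cat size_map size_behead size_rev size_graded /yn.
by rewrite addSn.
Qed.

Lemma y_lo j : (j <= kap)%N -> yy j = z j.
Proof. by move=> jk; rewrite /yy /dl_y nth_cat size_graded ltnS jk. Qed.

Lemma y_hi j : (kap <= j)%N -> (j <= yn)%N -> yy j = 1 - z (yn - j)%N.
Proof.
rewrite leq_eqVlt => /predU1P[<- _|kj jy].
  by rewrite y_lo// /yn addnK gradedL; lra.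
rewrite /yy /dl_y nth_cat size_graded ltnNge kj /=.
rewrite (nth_map 0); last first.
  by rewrite size_behead size_rev size_graded /=; move: jy kj; rewrite /yn; lia.
rewrite nth_behead nth_rev ?size_graded; last by move: jy kj; rewrite /yn; lia.
congr (1 - nth _ _ _); move: jy kj; rewrite /yn; lia.
Qed.

Lemma y_inc j : (j < yn)%N -> yy j < yy j.+1.
Proof.
move=> jy; have inc := graded_inc h0 h1 s0 rho0 idx e4.
case: (ltnP j kap) => jk; first by rewrite !y_lo ?(ltnW jk)// inc.
rewrite !y_hi ?(ltnW jy) ?(leqW jk)//.
rewrite -(subnSK (m := j) (n := yn))//.
by rewrite ltrD2l ltrN2 inc// half_lt.
Qed.

Lemma ymesh : mesh yn yy.
Proof.
split; [|by rewrite y_lo// (graded0 rho h0 h1 s0 idx e4)| |exact: y_inc].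
  by rewrite /yn addn_gt0 kap0.
by rewrite y_hi ?leqnn ?leq_addr// subnn (graded0 rho h0 h1 s0 idx e4) subr0.
Qed.

Lemma z_bound i : (i < kap)%N -> [/\ 0 <= z i, z i.+1 <= 1 / 2 & z i.+1 - z i <= 3 * h * Num.max s (z i)].
Proof.
move=> ik; have zi : 0 <= z i.
  by have := mesh_01 ymesh (i := i); rewrite y_lo ?(ltnW ik)// => /(_ _)/andP[]//; rewrite /yn; lia.
split=> //.
  have kn : (kap <= yn)%N by rewrite /yn leq_addr.
  by have := mesh_le ymesh ik kn; rewrite !y_lo// gradedL.
have lh0 := h0; have ls0 := s0.
have hp : 0 <= 3 * h by lra.
have lM : s <= Num.max s (z i) by rewrite le_max lexx.
have rM : z i <= Num.max s (z i) by rewrite le_max lexx orbT.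
have m1 := ler_wpM2l hp lM; have m2 := ler_wpM2l hp rM.
have p1 : 0 <= h * s by rewrite mulr_ge0 ?ltW.
have p2 : 0 <= h * z i by rewrite mulr_ge0 ?(ltW h0).
case: (ltnP i.+1 kap) => ik'.
  by case: (graded_cell h0 h1 s0 ik') => -[]; lra.
have E : kap = i.+1 by apply/eqP; rewrite eqn_leq ik'.
have [_ _ _ b] := graded_last h0 h1 s0 rho0 idx e4.
have -> : z i.+1 = 1 / 2 by rewrite -E gradedL.
by move: b; rewrite (_ : kap.-1 = i) ?E//; lra.
Qed.

(** Since 1/2 is a node no cell straddles it, so the width is governed by the distance of the cell
    from the nearer of the two sides. *)
Lemma y_cell y : 0 <= y < 1 ->
  (hiy y <= 1 / 2 /\ wdy y <= 3 * h * Num.max s (loy y)) \/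
  (1 / 2 <= loy y /\ wdy y <= 3 * h * Num.max s (1 - hiy y)).
Proof.
move=> y01; have [j jlt jy] := mesh_cell ymesh y01.
rewrite /wd /hi /lo !(stepf_cell ymesh _ jlt jy).
case: (ltnP j kap) => jk; [left|right].
  by rewrite !y_lo ?(ltnW jk)//; have [] := z_bound jk.
have i' : (yn - j.+1 < kap)%N := half_lt jk jlt.
rewrite !y_hi ?(ltnW jlt) ?(leqW jk)//.
rewrite -(subnSK (m := j) (n := yn))//.
have [a b c] := z_bound i'.
split; first by lra.
move: (z (yn - j.+1)) (z (yn - j.+1).+1) c => A B c.
have -> : 1 - A - (1 - B) = B - A by ring.
by have -> : 1 - (1 - A) = A by ring.
Qed.

Local Notation E := (layerE delta eps).

Lemma layerE_ge0 y : 0 <= E y.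
Proof. by rewrite addr_ge0 ?expR_ge0. Qed.

Lemma layerE_le2 y : 0 <= y <= 1 -> E y <= 2.
Proof.
move=> /andP[y0 y1]; rewrite (_ : 2 = 1 + 1)//; apply: lerD; apply: expRN_le1.
  by rewrite divr_ge0 ?mulr_ge0// ltW.
by rewrite divr_ge0 ?mulr_ge0 ?subr_ge0// ltW.
Qed.

Lemma y_wd y : 0 <= y < 1 -> wdy y <= 3 * h.
Proof.
move=> y01; have h3 : 0 <= 3 * h by rewrite mulr_ge0// ltW.
have [l0 ly yh hi1 w0] := lohi ymesh y01; have le4 := e4; have ls := s0.
case: (y_cell y01) => -[a b]; apply: (le_trans b); rewrite -[leRHS]mulr1 ler_wpM2l// ge_max;
  apply/andP; split; lra.
Qed.

Lemma quad_layer a : 0 <= a -> Num.max s a ^+ 2 * expR (- (a * delta / s)) <= eps * (1 + 4 / delta ^+ 2).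
Proof.
move=> a0; set t := a / s; have t0 : 0 <= t by rewrite divr_ge0// ltW.
have aE : a = t * s by rewrite /t divfK ?gt_eqF.
have -> : a * delta / s = delta * t by rewrite /t; field; exact: lt0r_neq0.
have ss : s ^+ 2 = eps by rewrite sqr_sqrtr// ltW.
have mx2 : Num.max s a ^+ 2 <= eps * (1 + t ^+ 2).
  apply: (@le_trans _ _ (s ^+ 2 * (1 + t ^+ 2))); last by rewrite ss.
  have q1 := sqr_ge0 s; have q2 := mulr_ge0 q1 (sqr_ge0 t).
  by rewrite /Num.max; case: ifP => _; [rewrite aE; lra|lra].
apply: (le_trans (ler_wpM2r (expR_ge0 _) mx2)).
rewrite -mulrA ler_wpM2l ?(ltW e0)// mulrDl mul1r; apply: lerD; last exact: quad_expN.
by apply: expRN_le1; rewrite mulr_ge0// ltW.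
Qed.

(** The first summand serves [y_layer], with 9 from the squared width and 2 from the two
    exponentials; the second serves [y_cut]. *)
Definition layer_cst := 18 * (1 + 4 / delta ^+ 2) + expR (4 * delta).

Lemma y_layer y t : 0 <= y < 1 -> loy y <= t <= hiy y ->
  wdy y ^+ 2 * E t <= layer_cst * (h ^+ 2 * eps).
Proof.
move=> y01 /andP[lt th]; have [l0 ly yh hi1 w0] := lohi ymesh y01.
have ld := delta0; have ls := s0; have is0 : 0 < s^-1 by rewrite invr_gt0.
have main a : 0 <= a -> a <= t -> a <= 1 - t -> wdy y <= 3 * h * Num.max s a ->
    wdy y ^+ 2 * E t <= 18 * (1 + 4 / delta ^+ 2) * (h ^+ 2 * eps).
  move=> a0 at_ at' w.
  have e2 : E t <= 2 * expR (- (a * delta / s)).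
    rewrite /layerE (_ : 2 * _ = expR (- (a * delta / s)) + expR (- (a * delta / s))); last by ring.
    by apply: lerD; rewrite ler_expR lerN2 ler_wpM2r ?(ltW is0)// ler_wpM2r// ltW.
  have M0 : 0 < Num.max s a by rewrite lt_max s0.
  have w2 : wdy y ^+ 2 <= 9 * h ^+ 2 * Num.max s a ^+ 2.
    have -> : 9 * h ^+ 2 * Num.max s a ^+ 2 = (3 * h * Num.max s a) ^+ 2 by ring.
    by rewrite ler_pXn2r ?nnegrE ?(ltW w0)// !mulr_ge0 ?(ltW h0) ?(ltW M0).
  apply: (@le_trans _ _ (9 * h ^+ 2 * Num.max s a ^+ 2 * (2 * expR (- (a * delta / s))))).
    by apply: ler_pM => //; [exact: sqr_ge0|exact: layerE_ge0].
  have -> : 9 * h ^+ 2 * Num.max s a ^+ 2 * (2 * expR (- (a * delta / s))) =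
    18 * h ^+ 2 * (Num.max s a ^+ 2 * expR (- (a * delta / s))) by ring.
  have -> : 18 * (1 + 4 / delta ^+ 2) * (h ^+ 2 * eps) = 18 * h ^+ 2 * (eps * (1 + 4 / delta ^+ 2)) by ring.
  by rewrite ler_wpM2l ?quad_layer// mulr_ge0 ?sqr_ge0.
have he0 : 0 <= h ^+ 2 * eps by rewrite mulr_ge0 ?sqr_ge0// ltW.
have KK : 18 * (1 + 4 / delta ^+ 2) * (h ^+ 2 * eps) <= layer_cst * (h ^+ 2 * eps).
  by rewrite ler_wpM2r// lerDl expR_ge0.
apply: le_trans KK; case: (y_cell y01) => -[a b]; first by apply: (main (loy y)) => //; lra.
by apply: (main (1 - hiy y)) => //; lra.
Qed.

(** Where the cut-off is below 1, t is within s of a side; its cell then has width at most 3 s, so y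
    is within 4 s of that side and E y >= exp(- 4 delta). *)
Lemma y_cut y t : 0 <= y < 1 -> loy y <= t <= hiy y -> 1 - cut s t <= layer_cst * E y.
Proof.
move=> y01 /andP[lt th]; have [l0 ly yh hi1 w0] := lohi ymesh y01.
have ls := s0; have is0 : 0 <= s^-1 by rewrite invr_ge0 ltW.
have lh0 := h0; have lh1 := h1; have ld := delta0; have le4 := e4.
have t01 : 0 <= t <= 1 by apply/andP; split; lra.
have Ky : expR (4 * delta) * E y <= layer_cst * E y.
  rewrite ler_wpM2r ?layerE_ge0// lerDr; apply: mulr_ge0 => //.
  by rewrite addr_ge0// divr_ge0 ?sqr_ge0.
apply: le_trans Ky.
have [tc|tc] := lerP s (Num.min t (1 - t)).
  have -> : cut s t = 1.
    move: tc; rewrite /cut le_min => /andP[t1 t2].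
    by rewrite min_l// le_min !ler_pdivlMr// !mul1r t1.
  by rewrite subrr mulr_ge0 ?expR_ge0 ?layerE_ge0.
have /andP[c0 _] := cut01 s0 t01.
apply: (@le_trans _ _ 1); first by lra.
have main a : a <= 4 * s -> expR (- (a * delta / s)) <= E y -> 1 <= expR (4 * delta) * E y.
  move=> a4 aE; apply: (@le_trans _ _ (expR (4 * delta) * expR (- (a * delta / s)))).
    rewrite -expRD -[leLHS]expR0 ler_expR subr_ge0.
    rewrite ler_pdivrMr//; have := ler_wpM2r (ltW ld) a4; lra.
  by rewrite ler_wpM2l ?expR_ge0.
have mxs a : a < s -> Num.max s a = s by move=> /ltW h'; rewrite max_l.
have hs3 : 3 * h * s <= 3 * s by rewrite -!mulrA ler_wpM2l// ler_piMl ?(ltW ls) ?(ltW lh1).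
rewrite gt_min in tc.
case: (y_cell y01) => -[a b].
  have ts : t < s by case/orP: tc; lra.
  have w3 : wdy y <= 3 * h * s by apply: le_trans b _; rewrite mxs//; lra.
  apply: (main y); first by have wE : wdy y = hiy y - loy y by []; lra.
  by rewrite lerDl expR_ge0.
have ts : 1 - t < s by case/orP: tc; lra.
have w3 : wdy y <= 3 * h * s by apply: le_trans b _; rewrite mxs//; lra.
apply: (main (1 - y)); first by have wE : wdy y = hiy y - loy y by []; lra.
by rewrite lerDr expR_ge0.
Qed.

Lemma bm1_layerE : bm1 E.
Proof.
have -> : E = (fun y => expR (- (delta / s) * y + 0) + expR (delta / s * y + - (delta / s))).
  by apply/funext => y; rewrite /layerE; congr (expR _ + expR _); field; exact: lt0r_neq0.
by apply: bmeasD; apply: bm1_cont; exact: expR_cont.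
Qed.

Lemma I1_layerE2 : I1 (fun y => E y ^+ 2) <= 2 / delta * s.
Proof.
pose a := 2 * delta / s; have a0 : 0 < a by rewrite divr_gt0// mulr_gt0.
have a1 : a != 0 by rewrite gt_eqF.
have b1 : bm1 (fun y : R => expR (- a * y + 0)) by apply: bm1_cont; exact: expR_cont.
have b2 : bm1 (fun y : R => expR (a * y + - a)) by apply: bm1_cont; exact: expR_cont.
have b3 : bm1 (fun y => expR (- a * y + 0) + expR (a * y + - a)) by exact: bmeasD.
apply: (@le_trans _ _ (I1 (fun y => 2 * (expR (- a * y + 0) + expR (a * y + - a))))).
  apply: I1_le => [||y _]; [by apply: bmeasX; exact: bm1_layerE|by apply: bmeasM => //; exact: bmeas_cst|].
  rewrite /layerE.
  have -> : expR (- a * y + 0) = expR (- (y * delta / s)) ^+ 2.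
    by rewrite expr2 -expRD; congr expR; rewrite /a; field; exact: lt0r_neq0.
  have -> : expR (a * y + - a) = expR (- ((1 - y) * delta / s)) ^+ 2.
    by rewrite expr2 -expRD; congr expR; rewrite /a; field; exact: lt0r_neq0.
  set A := expR _; set B := expR _; have := sqr_ge0 (A - B); nra.
rewrite I1Z// I1D// !I1_exp ?oppr_eq0// addr0 subrr expR0.
have e1 : 0 <= expR (- a) by exact: expR_ge0.
have -> : 2 * ((expR (- a) - 1) / - a + (1 - expR (- a)) / a) = 4 / a * (1 - expR (- a)) by field.
have -> : 2 / delta * s = 4 / a by rewrite /a; field; rewrite !gt_eqF.
by apply: ler_piMr; [apply: divr_ge0 => //; exact: ltW|lra].
Qed.

End YMesh.

(** * Bounds on the solution components *)

Section Clamp.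
Context (R : realType).
Implicit Types (x y t : R).

(** The projection onto [0, 1]. Composition with it extends a function continuous on the closed
    square to the plane, so that relative continuity and derivatives along the boundary need no
    separate treatment. *)
Definition cl t := Num.max 0 (Num.min 1 t).
Definition clp (p : R * R) := (cl p.1, cl p.2).
Definition clamped (w : R * R -> R) p := w (clp p).

Lemma cl01 t : 0 <= cl t <= 1.
Proof. by rewrite /cl le_max lexx/= ge_max ler01 ge_min lexx. Qed.

Lemma cl_id t : 0 <= t <= 1 -> cl t = t.
Proof. by move=> /andP[t0 t1]; rewrite /cl min_r// max_r. Qed.

Lemma cl_cont : continuous cl.
Proof.
apply: cont_max => [z|]; first exact: cvg_cst.
by apply: cont_min => z; [exact: cvg_cst|exact: cvg_id].
Qed.

Lemma clp_cont : continuous clp.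
Proof.
move=> p; apply: (@cvg_pair _ _ _ _ (nbhs (cl p.1)) (nbhs (cl p.2))).
  by apply: (@continuous_comp _ _ _ fst cl); [exact: cvg_fst|exact: cl_cont].
by apply: (@continuous_comp _ _ _ snd cl); [exact: cvg_snd|exact: cl_cont].
Qed.

Lemma clp_bar p : Omegabar (clp p).
Proof. by split; rewrite /= in_itv/= cl01. Qed.

Lemma clamped_cont w : {within Omegabar, continuous w} -> continuous (clamped w).
Proof.
move/subspace_continuousP => cw p.
apply: cvg_trans (cw _ (clp_bar p)).
move=> A wA; have nA : nbhs (clp p) (fun q => Omegabar q -> A (w q)) := wA.
have nb : nbhs p (fun q => Omegabar (clp q) -> A (w (clp q))) := clp_cont nA.
by apply: filterS nb => q; apply; exact: clp_bar.
Qed.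

Lemma clamped_id w x y : 0 <= x <= 1 -> 0 <= y <= 1 -> clamped w (x, y) = w (x, y).
Proof. by move=> x01 y01; rewrite /clamped /clp /= !cl_id. Qed.

Lemma bdry_le (phi : R -> R) c r eta : continuous phi -> 0 < r -> 0 <= eta <= 1 ->
  (forall t, 0 < t < 1 -> `|t - eta| < r -> phi t <= c) -> phi eta <= c.
Proof.
move=> cphi r0 /andP[e0 e1] hphi; rewrite leNgt; apply/negP => lt.
have /cvgrPdist_lt/(_ (phi eta - c)) : phi t @[t --> eta] --> phi eta by exact: cphi.
rewrite subr_gt0 => /(_ lt)/nbhs_ballP[d /= d0 hd].
pose l := Num.min 1 (Num.min r d).
have l0 : 0 < l by rewrite !lt_min ltr01 r0 d0.
have l1 : l <= 1 by rewrite ge_min lexx.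
have lr : l <= r by rewrite !ge_min lexx orbT.
have ld : l <= d by rewrite !ge_min lexx !orbT.
clearbody l.
(* Moving towards 1/2 stays inside (0, 1) even when eta is an end point. *)
pose t := eta + l * (1 / 2 - eta).
have tE : `|t - eta| < l.
  rewrite /t addrC addKr normrM gtr0_norm// -[ltRHS]mulr1 ltr_pM2l// ltr_norml.
  by apply/andP; split; lra.
have t01 : 0 < t < 1.
  by rewrite /t; apply/andP; split; nra.
have h1 := hphi t t01 (lt_le_trans tE lr).
have /hd : ball eta d t by rewrite /ball /= distrC; exact: lt_le_trans tE ld.
rewrite /= ltr_norml => /andP[_]; lra.
Qed.

(** On interior lines near height y the mean value theorem and the continuity of D bound the
    remainder of the difference quotient uniformly; the bound passes to the boundary line by
    continuity. *)
Lemma deriv_bdry (F D : R * R -> R) : continuous F -> continuous D ->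
  (forall t s, 0 < t < 1 -> 0 < s < 1 -> is_derive t 1 (fun t => F (t, s)) (D (t, s))) ->
  forall x y, 0 < x < 1 -> 0 <= y <= 1 -> is_derive x 1 (fun t => F (t, y)) (D (x, y)).
Proof.
move=> cF cD d x y x01 y01; apply: is_derive_remainder => del del0.
have /cvgrPdist_le/(_ _ del0) : D p @[p --> (x, y)] --> D (x, y) by exact: cD.
move=> /nbhs_ballP[r /= r0 hr].
have /andP[x0 x1] := x01.
pose q := Num.min r (Num.min x (1 - x)).
have q0 : 0 < q by rewrite !lt_min r0 x0 subr_gt0.
have qr : q <= r by rewrite ge_min lexx.
have qx : q <= x by rewrite !ge_min lexx !orbT.
have q1 : q <= 1 - x by rewrite !ge_min lexx !orbT.
exists q => // s sx.
pose phi (z : R) := `|F (s, z) - F (x, z) - D (x, y) * (s - x)|.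
have cphi : continuous phi.
  have c1 : continuous (fun z => F (s, z))  by apply: sliceY.
  have c2 : continuous (fun z => F (x, z))  by apply: sliceY.
  move=> z; apply: cvg_norm; apply: cvgB; last exact: cvg_cst.
  by apply: cvgB; [exact: c1|exact: c2].
apply: (bdry_le (phi := phi) cphi r0 y01) => z z01 zy.
pose g (t : R) := F (t, z) - D (x, y) * t.
have -> : phi z = `|g s - g x| by rewrite /phi /g; congr `|_|; ring.
have cg : continuous g.
  by move=> t; apply: cvgB; [by apply: sliceX|apply: cvgM; [exact: cvg_cst|exact: cvg_id]].
move: sx; rewrite ltr_norml => /andP[s1 s2].
apply: (@mvt_le R g (fun t => D (t, z) - D (x, y)) (x - q) (x + q) del x s) => //.
- move=> t /andP[t1 t2]; have t01 : 0 < t < 1 by apply/andP; split; lra.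
  have d1 := d t z t01 z01.
  have d2 : is_derive t 1 (fun t : R => D (x, y) * t) (D (x, y)).
    by have := is_deriveZ (D (x, y)) (is_derive_id t 1); rewrite /GRing.scale /= mulr1.
  exact: is_deriveB.
- move=> t /andP[t1 t2]; rewrite distrC; apply: (hr (t, z)).
  split; rewrite /ball /= ?(distrC y)//; rewrite distrC ltr_norml; apply/andP; split; lra.
- by apply/andP; split; lra.
- by apply/andP; split; lra.
Qed.

Lemma cont_swap (w : R * R -> R) : continuous w -> continuous (fun p : R * R => w (p.2, p.1)).
Proof.
have sc : continuous (fun q : R * R => (q.2, q.1)) by move=> q; exact: (cvg_pair cvg_snd cvg_fst).
by move=> cw p; exact: (cvg_comp _ _ (sc p) (cw _)).
Qed.

Lemma deriv_bdryY (F D : R * R -> R) : continuous F -> continuous D ->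
  (forall t s, 0 < t < 1 -> 0 < s < 1 -> is_derive t 1 (fun t => F (s, t)) (D (s, t))) ->
  forall x y, 0 < y < 1 -> 0 <= x <= 1 -> is_derive y 1 (fun t => F (x, t)) (D (x, y)).
Proof.
move=> cF cD d x y y01 x01.
exact: (deriv_bdry (cont_swap cF) (cont_swap cD) d y01 x01).
Qed.

Lemma is_derive_near (f g : R -> R) x a b k : a < x < b -> (forall t, a < t < b -> f t = g t) ->
  is_derive x 1 f k -> is_derive x 1 g k.
Proof.
move=> /andP[ax xb] fg; apply: near_eq_is_derive.
near=> t; apply/fg/andP; split; near: t; [exact: lt_nbhsr|exact: lt_nbhsl].
Unshelve. all: by end_near.
Qed.

Lemma clamp_jet F : jet 3 F -> cjet (fun i j => clamped (F i j)).
Proof.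
move=> [cF dF _ _]; split=> i j ij; first by apply: clamped_cont; exact: cF.
- have ij1 : (i.+1 + j <= 3)%N by [].
  move=> x y x01; have x01' : 0 <= x <= 1 by move/andP: x01 => [/ltW -> /ltW ->].
  have -> : (fun t => clamped (F i j) (t, y)) = (fun t => clamped (F i j) (t, cl y)).
    by apply/funext => t; rewrite /clamped /clp /= (cl_id (cl01 y)).
  have -> : clamped (F i.+1 j) (x, y) = clamped (F i.+1 j) (x, cl y) by rewrite /clamped /clp /= (cl_id (cl01 y)).
  apply: (deriv_bdry (clamped_cont (cF i j (ltnW ij))) (clamped_cont (cF i.+1 j ij1))) => //; last exact: cl01.
  move=> t s t01 s01; have [s0 s1] : 0 <= s <= 1 /\ 0 <= t <= 1.
    by move/andP: s01 => [/ltW -> /ltW ->]; move/andP: t01 => [/ltW -> /ltW ->].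
  have O : Omega (t, s) by split; rewrite /= in_itv.
  have [d1 _] := dF i j ij _ O.
  rewrite clamped_id//; apply: (is_derive_near t01 _ d1) => r /andP[r0 r1] /=.
  by rewrite clamped_id// (ltW r0) (ltW r1).
- have ij1 : (i + j.+1 <= 3)%N by rewrite addnS.
  move=> x y y01; have y01' : 0 <= y <= 1 by move/andP: y01 => [/ltW -> /ltW ->].
  have -> : (fun t => clamped (F i j) (x, t)) = (fun t => clamped (F i j) (cl x, t)).
    by apply/funext => t; rewrite /clamped /clp /= (cl_id (cl01 x)).
  have -> : clamped (F i j.+1) (x, y) = clamped (F i j.+1) (cl x, y) by rewrite /clamped /clp /= (cl_id (cl01 x)).
  apply: (deriv_bdryY (clamped_cont (cF i j (ltnW ij))) (clamped_cont (cF i j.+1 ij1))) => //; last exact: cl01.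
  move=> t s t01 s01; have [s0 s1] : 0 <= s <= 1 /\ 0 <= t <= 1.
    by move/andP: s01 => [/ltW -> /ltW ->]; move/andP: t01 => [/ltW -> /ltW ->].
  have O : Omega (s, t) by split; rewrite /= in_itv.
  have [_ d1] := dF i j ij _ O.
  rewrite clamped_id//; apply: (is_derive_near t01 _ d1) => r /andP[r0 r1] /=.
  by rewrite clamped_id// (ltW r0) (ltW r1).
Qed.

End Clamp.

Section Powers.
Context (R : realType) (eps : R).
Hypotheses (e0 : 0 < eps).
Local Notation s := (Num.sqrt eps).

Lemma powNn i : eps `^ (- i%:R) = (eps ^+ i)^-1.
Proof. by rewrite powRN powR_mulrn// ltW. Qed.

Lemma powNhalf j : eps `^ (- (j%:R / 2)) = (s ^+ j)^-1.
Proof. by rewrite powRN mulrC powRrM powR_mulrn ?powR_ge0// powR12_sqrt// ltW. Qed.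

Lemma powNmix i j : eps `^ (- (i%:R + j%:R / 2)) = (eps ^+ i)^-1 * (s ^+ j)^-1.
Proof. rewrite opprD powRD ?powNn ?powNhalf//; by apply/implyP => _; rewrite gt_eqF. Qed.

End Powers.

(** * Derivative bounds weighted by the mesh widths *)

Section Bounds.
Context (R : realType).
Implicit Types (x y xi yi : R).
Variables (h eps rho beta delta CD : R) (mX mY : nat).
Local Notation s := (Num.sqrt eps).
Hypotheses (h0 : 0 < h) (h1 : h < 1) (e0 : 0 < eps) (e4 : 4 * eps < 1) (e4' : 4 * s < 1 / 2)
  (rho0 : 0 < rho) (beta0 : 0 < beta) (delta0 : 0 < delta).
Hypotheses (idX : dl_index h eps 1 mX) (idY : dl_index h s (1 / 2) mY).
Local Notation n := (xn h eps rho mX).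
Local Notation x_ := (xx h eps rho mX).
Local Notation k := (yn h eps rho mY).
Local Notation y_ := (yy h eps rho mY).
Local Notation lox := (lo n x_).
Local Notation hix := (hi n x_).
Local Notation wdx := (wd n x_).
Local Notation loy := (lo k y_).
Local Notation hiy := (hi k y_).
Local Notation wdy := (wd k y_).
Local Notation E := (layerE delta eps).
Local Notation G := (decay eps beta).
Local Notation a := (decay_cst beta).
Local Notation b := (layer_cst delta).
(** [CD] is an arbitrary real; this dominates it and is at least 1. *)
Definition cst := `|CD| + 1.
(** One constant K for all hypotheses of the estimates. The product dominates the combinations
    listed in [mesh_cst_lin]; the other summands come from the L^2 norms of the two layer weights
    and from the lower bound on the last width. *)
Definition mesh_cst := 27 * cst * (1 + a) * (9 + b) + 4 / beta + 2 / delta + 4 / Num.min rho 1.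

Let mx : mesh n x_ := xmesh h0 h1 e0 e4 rho0 idX.
Let my : mesh k y_ := ymesh h0 h1 e0 e4' rho0 delta0 idY.

Variables (V W1 W2 W12 : nat -> nat -> R * R -> R).
Hypotheses
  (hV : component 3 CD V (fun _ _ _ => 1) (fun _ _ => 1))
  (hW1 : component 3 CD W1 (fun i _ p => eps `^ (- i%:R) * expR (- (beta * p.1 / eps)))
        (fun i _ => eps `^ (- i%:R - 1 / 2)))
  (hW2 : component 3 CD W2 (fun _ j p => eps `^ (- (j%:R / 2)) * layerE delta eps p.2)
        (fun _ j => eps `^ (- (j%:R / 2) + 1 / 4)))
  (hW12 : component 3 CD W12 (fun i j p => eps `^ (- (i%:R + j%:R / 2))
                      * expR (- (beta * p.1 / eps)) * layerE delta eps p.2)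
        (fun i j => eps `^ (- i%:R - j%:R / 2 + 1 / 4))).

Definition smooth_part i j p := clamped (V i j) p + clamped (W2 i j) p.
Definition layer_part i j p := clamped (W1 i j) p + clamped (W12 i j) p.

Lemma jS : cjet smooth_part.
Proof. by case: hV => jV _ _; case: hW2 => j2 _ _; apply: cjetD; exact: clamp_jet. Qed.
Lemma jL : cjet layer_part.
Proof. by case: hW1 => j1 _ _; case: hW12 => j2 _ _; apply: cjetD; exact: clamp_jet. Qed.

Lemma D1 : 1 <= cst. Proof. by rewrite /cst lerDr. Qed.

Lemma cD (z c : R) : `|z| <= CD * c -> 0 <= c -> `|z| <= cst * c.
Proof.
move=> hz c0; apply: (le_trans hz); rewrite ler_wpM2r//.
by apply: (le_trans (ler_norm _)); rewrite /cst lerDl.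
Qed.

Lemma in_bar x y : 0 <= x <= 1 -> 0 <= y <= 1 -> Omegabar (x, y).
Proof. by move=> ? ?; split; rewrite /= in_itv. Qed.

Section Comp.
Variables (x y : R).
Hypotheses (x01 : 0 <= x <= 1) (y01 : 0 <= y <= 1).
Let ex := expR (- (beta * x / eps)).
Let E0 : 0 <= E y := layerE_ge0 eps delta y.
Let ex0 : 0 <= ex := expR_ge0 _.

Lemma bV i j : (i + j <= 3)%N -> `|clamped (V i j) (x, y)| <= cst.
Proof.
move=> ij; rewrite clamped_id// -[leRHS]mulr1; apply: cD => //.
by case: hV => _ hb _; exact: (hb i j ij _ (in_bar x01 y01)).
Qed.

Lemma bW2 i j : (i + j <= 3)%N -> `|clamped (W2 i j) (x, y)| <= cst * ((s ^+ j)^-1 * E y).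
Proof.
move=> ij; rewrite clamped_id//; case: hW2 => _ hb _.
apply: cD; first by have := hb i j ij _ (in_bar x01 y01); rewrite powNhalf.
by rewrite mulr_ge0// invr_ge0 exprn_ge0// sqrtr_ge0.
Qed.

Lemma bW1 i j : (i + j <= 3)%N -> `|clamped (W1 i j) (x, y)| <= cst * ((eps ^+ i)^-1 * ex).
Proof.
move=> ij; rewrite clamped_id//; case: hW1 => _ hb _.
apply: cD; first by have := hb i j ij _ (in_bar x01 y01); rewrite powNn.
by rewrite mulr_ge0// invr_ge0 exprn_ge0// ltW.
Qed.

Lemma bW12 i j : (i + j <= 3)%N -> `|clamped (W12 i j) (x, y)| <= cst * ((eps ^+ i)^-1 * (s ^+ j)^-1 * ex * E y).
Proof.
move=> ij; rewrite clamped_id//; case: hW12 => _ hb _.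
apply: cD; first by have := hb i j ij _ (in_bar x01 y01); rewrite powNmix.
by rewrite !mulr_ge0// ?invr_ge0 exprn_ge0// ?sqrtr_ge0// ltW.
Qed.

End Comp.

Let a0 : 0 <= a.
Proof. by rewrite !mulr_ge0// ?expR_ge0// addr_ge0// divr_ge0 ?sqr_ge0. Qed.
Let b0 : 0 <= b.
Proof. by rewrite addr_ge0 ?expR_ge0// mulr_ge0// addr_ge0// divr_ge0 ?sqr_ge0. Qed.
Let D0 : 0 <= cst := le_trans ler01 D1.
Let mr0 : 0 < Num.min rho 1. Proof. by rewrite lt_min rho0 ltr01. Qed.
Let h20 : 0 <= h ^+ 2 := sqr_ge0 h.

Lemma mesh_cst_ge (z : R) : z <= 27 * cst * (1 + a) * (9 + b) -> z <= mesh_cst.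
Proof.
move=> hz; rewrite /mesh_cst.
have p1 : 0 <= 4 / beta by rewrite divr_ge0// ltW.
have p2 : 0 <= 2 / delta by rewrite divr_ge0// ltW.
have p3 : 0 <= 4 / Num.min rho 1 by rewrite divr_ge0// ltW.
lra.
Qed.

Let Da : 0 <= cst * a. Proof. exact: mulr_ge0. Qed.
Let Db : 0 <= cst * b. Proof. exact: mulr_ge0. Qed.
Let Dab : 0 <= cst * a * b. Proof. exact: mulr_ge0. Qed.

Lemma mesh_cst_lin (c1 c2 c3 c4 : R) : c1 <= 243 -> c2 <= 243 -> c3 <= 27 -> c4 <= 27 ->
  c1 * cst + c2 * (cst * a) + c3 * (cst * b) + c4 * (cst * a * b) <= mesh_cst.
Proof.
move=> h1' h2 h3 h4; apply: mesh_cst_ge.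
have -> : 27 * cst * (1 + a) * (9 + b) = 243 * cst + 243 * (cst * a) + 27 * (cst * b) + 27 * (cst * a * b) by ring.
by rewrite !lerD// ler_wpM2r.
Qed.

Lemma mesh_cst_ge1 : 1 <= mesh_cst.
Proof. by apply: le_trans D1 _; have := @mesh_cst_lin 1 0 0 0; rewrite !mul0r !addr0 mul1r; apply; lra. Qed.

Let E0 y : 0 <= E y := layerE_ge0 eps delta y.
Let oo (t : R) : 0 < t < 1 -> 0 <= t <= 1.
Proof. by move=> /andP[/ltW -> /ltW ->]. Qed.
Let xin x xi : 0 <= x < 1 -> lox x <= xi <= hix x -> 0 <= xi <= 1.
Proof. by move=> x01 /andP[? ?]; have [? ? ? ? _] := lohi mx x01; apply/andP; split; lra. Qed.
Let yin y yi : 0 <= y < 1 -> loy y <= yi <= hiy y -> 0 <= yi <= 1.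
Proof. by move=> y01 /andP[? ?]; have [? ? ? ? _] := lohi my y01; apply/andP; split; lra. Qed.
Let lts (u v w : R) : u < v < w -> u <= v <= w.
Proof. by move=> /andP[/ltW -> /ltW ->]. Qed.

Let s0 : 0 < s. Proof. by rewrite sqrtr_gt0. Qed.
Let s1 : s <= 1. Proof. by have := e4'; lra. Qed.
Let ss : s ^+ 2 = eps. Proof. by rewrite sqr_sqrtr// ltW. Qed.
Let e1 : eps <= 1. Proof. by have := e4; have := e0; lra. Qed.

Lemma S_le i x y : (i <= 3)%N -> 0 <= x <= 1 -> 0 <= y <= 1 -> `|smooth_part i 0 (x, y)| <= mesh_cst.
Proof.
move=> i3 x01 y01; have ij : (i + 0 <= 3)%N by rewrite addn0.
apply: (@le_trans _ _ (cst + cst * 2)).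
  apply: lerD2'; first exact: bV.
  apply: (le_trans (bW2 x01 y01 ij)); rewrite expr0 invr1 mul1r ler_wpM2l//.
  exact: layerE_le2.
by have := @mesh_cst_lin 3 0 0 0; rewrite !mul0r !addr0 => K; apply: le_trans (K _ _ _ _); lra.
Qed.

Let wdy2 y : 0 <= y < 1 -> wdy y ^+ 2 <= 9 * h ^+ 2.
Proof.
move=> y01; have -> : 9 * h ^+ 2 = (3 * h) ^+ 2 by ring.
have [_ _ _ _ w0] := lohi my y01.
rewrite ler_pXn2r ?nnegrE ?(ltW w0) ?mulr_ge0 ?(ltW h0)//; exact: (y_wd h0 h1 e0 e4' rho0 delta0 idY).
Qed.

Let wdx2 x : 0 <= x < 1 -> wdx x ^+ 2 <= 9 * h ^+ 2.
Proof.
move=> x01; have -> : 9 * h ^+ 2 = (3 * h) ^+ 2 by ring.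
have [_ _ _ _ w0] := lohi mx x01.
rewrite ler_pXn2r ?nnegrE ?(ltW w0) ?mulr_ge0 ?(ltW h0)//; exact: (x_wd1 h0 h1 e0 e4 rho0 idX).
Qed.

Lemma S_y2 i y xi yi : (i <= 1)%N -> 0 <= y < 1 -> 0 <= xi <= 1 -> loy y < yi < hiy y ->
  wdy y ^+ 2 * `|smooth_part i 2 (xi, yi)| <= mesh_cst * h ^+ 2.
Proof.
move=> i1 y01 x01 /lts hy; have yi01 := yin y01 hy.
have ij : (i + 2 <= 3)%N by rewrite addn2.
have q1 := bV x01 yi01 ij; have q2 := bW2 x01 yi01 ij.
have q3 := y_layer h0 h1 e0 e4' rho0 delta0 idY y01 hy.
have w2 := wdy2 y01; have w0 := sqr_ge0 (wdy y).
apply: (@le_trans _ _ ((9 * cst + b * cst) * h ^+ 2)); last first.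
  apply: ler_wpM2r => //; have := @mesh_cst_lin 9 0 1 0; rewrite !mul0r !addr0 mul1r [cst * b]mulrC => K.
  by apply: K; lra.
rewrite ss in q2.
apply: (le_trans (ler_wpM2l w0 (ler_normD _ _))); rewrite mulrDr mulrDl; apply: lerD.
  have -> : 9 * cst * h ^+ 2 = 9 * h ^+ 2 * cst by ring.
  exact: ler_pM.
apply: (le_trans (ler_wpM2l w0 q2)).
have -> : wdy y ^+ 2 * (cst * (eps^-1 * E yi)) = cst * (wdy y ^+ 2 * E yi) / eps by field; exact: lt0r_neq0.
rewrite ler_pdivrMr//; have -> : b * cst * h ^+ 2 * eps = cst * (b * (h ^+ 2 * eps)) by ring.
exact: ler_wpM2l.
Qed.

Lemma S_21 x xi yi : 0 <= x < 1 -> lox x < xi < hix x -> 0 < yi < 1 ->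
  wdx x ^+ 2 * `|smooth_part 2 1 (xi, yi)| * s <= mesh_cst * h ^+ 2.
Proof.
move=> x01 /lts/(xin x01) xi01 /oo y01; have w2 := wdx2 x01; have w0 := sqr_ge0 (wdx x).
have q1 := bV xi01 y01 (isT : (2 + 1 <= 3)%N); have q2 := bW2 xi01 y01 (isT : (2 + 1 <= 3)%N).
have q3 : `|smooth_part 2 1 (xi, yi)| * s <= cst + cst * 2.
  apply: (le_trans (ler_wpM2r (ltW s0) (ler_normD _ _))); rewrite mulrDl; apply: lerD.
    by apply: le_trans q1; rewrite ler_piMr.
  apply: (le_trans (ler_wpM2r (ltW s0) q2)).
  have -> : cst * ((s ^+ 1)^-1 * E yi) * s = cst * E yi by rewrite expr1; field; exact: lt0r_neq0.
  by rewrite ler_wpM2l// layerE_le2.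
apply: (@le_trans _ _ (9 * h ^+ 2 * (cst + cst * 2))).
  by rewrite -mulrA; apply: ler_pM => //; rewrite mulr_ge0// ltW.
have -> : 9 * h ^+ 2 * (cst + cst * 2) = 27 * cst * h ^+ 2 by ring.
apply: ler_wpM2r => //; have := @mesh_cst_lin 27 0 0 0; rewrite !mul0r !addr0; apply; lra.
Qed.

Lemma L_20 x xi yi : 0 <= x < 1 -> lox x < xi < hix x -> 0 <= yi <= 1 ->
  wdx x ^+ 2 * `|layer_part 2 0 (xi, yi)| <= mesh_cst * h ^+ 2 * G x.
Proof.
move=> x01 /lts hx y01; have xi01 := xin x01 hx; have w0 := sqr_ge0 (wdx x).
have [q _] := x_decay h0 h1 e0 e4 rho0 beta0 idX x01 hx.
have G0 : 0 <= G x by rewrite expR_ge0.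
have q1 := bW1 xi01 y01 (isT : (2 + 0 <= 3)%N); have q2 := bW12 xi01 y01 (isT : (2 + 0 <= 3)%N).
set ex := expR (- (beta * xi / eps)) in q q1 q2.
have e20 : 0 < eps ^+ 2 by rewrite exprn_gt0.
have ex0 : 0 <= ex by exact: expR_ge0.
have q3 : `|layer_part 2 0 (xi, yi)| <= 3 * cst * (ex / eps ^+ 2).
  apply: (le_trans (ler_normD _ _)).
  have -> : 3 * cst * (ex / eps ^+ 2) = cst * ((eps ^+ 2)^-1 * ex) + cst * ((eps ^+ 2)^-1 * ex * 2) by ring.
  apply: lerD => //; apply: (le_trans q2); rewrite expr0 invr1 mulr1.
  by rewrite !ler_wpM2l ?layerE_le2// mulr_ge0// invr_ge0 ltW.
apply: (le_trans (ler_wpM2l w0 q3)).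
have -> : wdx x ^+ 2 * (3 * cst * (ex / eps ^+ 2)) = 3 * cst * (wdx x ^+ 2 * ex) / eps ^+ 2.
  by field; exact: lt0r_neq0.
rewrite ler_pdivrMr//; apply: (@le_trans _ _ (3 * cst * (a * (h ^+ 2 * eps ^+ 2) * G x))).
  by rewrite ler_wpM2l// mulr_ge0.
have -> : 3 * cst * (a * (h ^+ 2 * eps ^+ 2) * G x) = 3 * (cst * a) * (h ^+ 2 * G x * eps ^+ 2) by ring.
have -> : mesh_cst * h ^+ 2 * G x * eps ^+ 2 = mesh_cst * (h ^+ 2 * G x * eps ^+ 2) by ring.
apply: ler_wpM2r; first by rewrite !mulr_ge0// ltW.
have := @mesh_cst_lin 0 3 0 0; rewrite !mul0r !addr0 add0r; apply; lra.
Qed.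

Let layer_prod x y xi yi : 0 <= x < 1 -> 0 <= y < 1 -> lox x <= xi <= hix x -> loy y < yi < hiy y ->
  wdy y ^+ 2 * (cst * expR (- (beta * xi / eps)) + cst * (eps^-1 * expR (- (beta * xi / eps)) * E yi)) <=
  mesh_cst * h ^+ 2 * G x.
Proof.
move=> x01 y01 hx /lts hy; have xi01 := xin x01 hx; have yi01 := yin y01 hy.
have [_ q] := x_decay h0 h1 e0 e4 rho0 beta0 idX x01 hx.
have G0 : 0 <= G x by rewrite expR_ge0.
have w2 := wdy2 y01; have w0 := sqr_ge0 (wdy y).
have q3 := y_layer h0 h1 e0 e4' rho0 delta0 idY y01 hy.
set ex := expR _ in q *; have ex0 : 0 <= ex by exact: expR_ge0.
have p1 : wdy y ^+ 2 * (cst * ex) <= 9 * h ^+ 2 * (cst * (a * G x)).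
  by apply: ler_pM => //; [exact: mulr_ge0|exact: ler_wpM2l].
have p2 : wdy y ^+ 2 * (cst * (eps^-1 * ex * E yi)) <= cst * b * h ^+ 2 * (a * G x).
  have -> : wdy y ^+ 2 * (cst * (eps^-1 * ex * E yi)) = cst * ((wdy y ^+ 2 * E yi) / eps) * ex.
    by field; exact: lt0r_neq0.
  have p : (wdy y ^+ 2 * E yi) / eps <= b * h ^+ 2 by rewrite ler_pdivrMr// -(mulrA b).
  rewrite -(mulrA cst b); apply: ler_pM => //; last exact: ler_wpM2l.
  by apply: mulr_ge0 => //; apply: divr_ge0; [exact: mulr_ge0|exact: ltW].
rewrite mulrDr; apply: (le_trans (lerD p1 p2)).
have -> : 9 * h ^+ 2 * (cst * (a * G x)) + cst * b * h ^+ 2 * (a * G x) = (9 * (cst * a) + cst * a * b) * (h ^+ 2 * G x) by ring.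
rewrite -(mulrA mesh_cst); apply: ler_wpM2r; first exact: mulr_ge0.
have := @mesh_cst_lin 0 9 0 1; rewrite !mul0r !addr0 add0r mul1r; apply; lra.
Qed.

Lemma L_02 x y xi yi : 0 <= x < 1 -> 0 <= y < 1 -> lox x <= xi <= hix x -> loy y < yi < hiy y ->
  wdy y ^+ 2 * `|layer_part 0 2 (xi, yi)| <= mesh_cst * h ^+ 2 * G x.
Proof.
move=> x01 y01 hx hy; apply: le_trans (layer_prod x01 y01 hx hy).
have xi01 := xin x01 hx; have yi01 := yin y01 (lts hy).
rewrite ler_wpM2l ?sqr_ge0//; apply: lerD2'.
  by have := bW1 xi01 yi01 (isT : (0 + 2 <= 3)%N); rewrite expr0 invr1 mul1r.
by have := bW12 xi01 yi01 (isT : (0 + 2 <= 3)%N); rewrite expr0 invr1 mul1r ss.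
Qed.

Lemma L_12 x y xi yi : 0 <= x < 1 -> 0 <= y < 1 -> lox x < xi < hix x -> loy y < yi < hiy y ->
  eps * (wdy y ^+ 2 * `|layer_part 1 2 (xi, yi)|) <= mesh_cst * h ^+ 2 * G x.
Proof.
move=> x01 y01 /lts hx hy; apply: le_trans (layer_prod x01 y01 hx hy).
have xi01 := xin x01 hx; have yi01 := yin y01 (lts hy).
rewrite mulrCA ler_wpM2l ?sqr_ge0//.
apply: (le_trans (ler_wpM2l (ltW e0) (ler_normD _ _))); rewrite mulrDr; apply: lerD.
  apply: (le_trans (ler_wpM2l (ltW e0) (bW1 xi01 yi01 (isT : (1 + 2 <= 3)%N)))).
  by rewrite expr1 mulrCA mulVKf// gt_eqF.
apply: (le_trans (ler_wpM2l (ltW e0) (bW12 xi01 yi01 (isT : (1 + 2 <= 3)%N)))).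
rewrite ss expr1 mulrCA ler_wpM2l// !mulrA divff ?gt_eqF// mul1r.
exact: lexx.
Qed.

Lemma L_21 x xi yi : 0 <= x < 1 -> lox x < xi < hix x -> 0 < yi < 1 ->
  wdx x ^+ 2 * `|layer_part 2 1 (xi, yi)| * s <= mesh_cst * h ^+ 2.
Proof.
move=> x01 /lts hx /oo y01; have xi01 := xin x01 hx; have w0 := sqr_ge0 (wdx x).
have [q _] := x_decay h0 h1 e0 e4 rho0 beta0 idX x01 hx.
have G1 : G x <= 1 by have /andP[] := decay01 e0 beta0 (proj1 (andP x01)).
have G0 : 0 <= G x by rewrite expR_ge0.
have q1 := bW1 xi01 y01 (isT : (2 + 1 <= 3)%N); have q2 := bW12 xi01 y01 (isT : (2 + 1 <= 3)%N).
set ex := expR (- (beta * xi / eps)) in q q1 q2.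
have e20 : 0 < eps ^+ 2 by rewrite exprn_gt0.
have ex0 : 0 <= ex by exact: expR_ge0.
have q3 : `|layer_part 2 1 (xi, yi)| * s <= 3 * cst * (ex / eps ^+ 2).
  apply: (le_trans (ler_wpM2r (ltW s0) (ler_normD _ _))); rewrite mulrDl.
  have -> : 3 * cst * (ex / eps ^+ 2) = cst * ((eps ^+ 2)^-1 * ex) + cst * ((eps ^+ 2)^-1 * ex * 2) by ring.
  have p0 : 0 <= (eps ^+ 2)^-1 * ex by rewrite mulr_ge0// invr_ge0 ltW.
  apply: lerD.
    by apply: le_trans q1; rewrite ler_piMr.
  apply: (le_trans (ler_wpM2r (ltW s0) q2)).
  have -> : cst * ((eps ^+ 2)^-1 * (s ^+ 1)^-1 * ex * E yi) * s = cst * ((eps ^+ 2)^-1 * ex * E yi).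
    by rewrite expr1; field; rewrite !gt_eqF.
  by rewrite ler_wpM2l// ler_wpM2l// layerE_le2.
rewrite -mulrA; apply: (le_trans (ler_wpM2l w0 q3)).
have -> : wdx x ^+ 2 * (3 * cst * (ex / eps ^+ 2)) = 3 * cst * (wdx x ^+ 2 * ex) / eps ^+ 2.
  by field; exact: lt0r_neq0.
rewrite ler_pdivrMr//; apply: (@le_trans _ _ (3 * cst * (a * (h ^+ 2 * eps ^+ 2) * 1))).
  apply: ler_wpM2l; first exact: mulr_ge0.
  apply: (le_trans q); apply: ler_wpM2l => //.
  by apply: mulr_ge0 => //; apply: mulr_ge0 => //; exact: ltW.
have -> : 3 * cst * (a * (h ^+ 2 * eps ^+ 2) * 1) = 3 * (cst * a) * (h ^+ 2 * eps ^+ 2) by ring.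
rewrite -(mulrA mesh_cst); apply: ler_wpM2r; first by rewrite mulr_ge0// ltW.
have := @mesh_cst_lin 0 3 0 0; rewrite !mul0r !addr0 add0r; apply; lra.
Qed.

(** Only v_xx is traced to x = 1: it is Lipschitz uniformly in eps, while the [W2] part of S_xx is
    dominated by E. *)
Definition kp y := clamped (V 2 0) (1, y).

Lemma kp_cont : continuous kp.
Proof.
have [jV _ _] := hV; have [cV _ _] := clamp_jet jV; have c2 := cV 2%N 0%N isT.
by apply: sliceY.
Qed.

Let o1 : 0 <= (1 : R) <= 1. Proof. by rewrite ler01 lexx. Qed.

Lemma kp_le y : 0 <= y <= 1 -> `|kp y| <= mesh_cst.
Proof.
move=> y01; apply: (le_trans (bV o1 y01 (isT : (2 + 0 <= 3)%N))).
by have := @mesh_cst_lin 1 0 0 0; rewrite !mul0r !addr0 mul1r; apply; lra.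
Qed.

Let DK : cst <= mesh_cst.
Proof. by have := @mesh_cst_lin 1 0 0 0; rewrite !mul0r !addr0 mul1r; apply; lra. Qed.

Lemma kp_lip y t : 0 <= y <= 1 -> 0 <= t <= 1 -> `|kp y - kp t| <= mesh_cst * `|y - t|.
Proof.
move=> y01 t01; apply: (@le_trans _ _ (cst * `|y - t|)); last exact: ler_wpM2r.
have [jV _ _] := hV; have [_ _ dV] := clamp_jet jV.
apply: (@mvt_le R kp (fun r => clamped (V 2 1) (1, r)) 0 1 cst) => //; first exact: kp_cont.
  by move=> r r01; exact: dV.
by move=> r /oo r01; exact: (bV o1 r01 (isT : (2 + 1 <= 3)%N)).
Qed.

Lemma S20_kp x y : 0 < x < 1 -> 0 < y < 1 -> `|smooth_part 2 0 (x, y) - kp y| <= mesh_cst * ((1 - x) + E y).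
Proof.
move=> /oo x01 /oo y01; have [jV _ _] := hV; have [cV dV _] := clamp_jet jV.
have -> : smooth_part 2 0 (x, y) - kp y = (clamped (V 2 0) (x, y) - clamped (V 2 0) (1, y)) + clamped (W2 2 0) (x, y).
  by rewrite /smooth_part /kp; ring.
apply: (@le_trans _ _ (cst * ((1 - x) + E y))); last by rewrite ler_wpM2r// addr_ge0// subr_ge0; case/andP: x01.
rewrite mulrDr; apply: lerD2'.
  have /andP[x0 x1] := x01.
  have -> : 1 - x = `|x - 1| by rewrite distrC ger0_norm// subr_ge0.
  apply: (@mvt_le R (fun r => clamped (V 2 0) (r, y)) (fun r => clamped (V 3 0) (r, y)) 0 1 cst) => //.
  - by have c2 := cV 2%N 0%N isT; apply: sliceX.
  - by move=> r r01; exact: dV.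
  - by move=> r /oo r01; exact: (bV r01 y01 (isT : (3 + 0 <= 3)%N)).
by have := bW2 x01 y01 (isT : (2 + 0 <= 3)%N); rewrite expr0 invr1 mul1r.
Qed.

Lemma mesh_cst_misc : [/\ 4 / beta <= mesh_cst, 2 / delta <= mesh_cst, b <= mesh_cst & 4 / Num.min rho 1 <= mesh_cst].
Proof.
have p : 0 <= 27 * cst * (1 + a) * (9 + b) by rewrite !mulr_ge0// addr_ge0.
have p1 : 0 <= 4 / beta by rewrite divr_ge0// ltW.
have p2 : 0 <= 2 / delta by rewrite divr_ge0// ltW.
have p3 : 0 <= 4 / Num.min rho 1 by rewrite divr_ge0// ltW.
have hb : b <= mesh_cst.
  apply: (@le_trans _ _ (cst * b)); first by rewrite ler_peMl// D1.
  by have := @mesh_cst_lin 0 0 1 0; rewrite !mul0r !addr0 !add0r mul1r; apply; lra.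
split=> //; rewrite /mesh_cst; lra.
Qed.

Lemma mesh_cst_ge3 : 3 <= mesh_cst.
Proof.
apply: (@le_trans _ _ (3 * cst)); first by have := D1; lra.
by have := @mesh_cst_lin 3 0 0 0; rewrite !mul0r !addr0; apply; lra.
Qed.

End Bounds.

(** * The discrete problem *)

Section Norm.
Context (R : realType).

Lemma L2norm_ae (g g' : R * R -> R) : bm g' -> ae_Omega (fun p => g p = g' p) -> L2norm g = (nn g')%:E.
Proof.
move=> bg' [N [mN N0 sub]]; rewrite /L2norm unlock /=.
have b2 : bm (fun p => g' p ^+ 2) by apply: bmeasX.
have -> : (\int[@leb2 R]_x (`|(g \_ Omega) x| `^ 2)%:E = \int[@leb2 R]_(x in Omega) (g' x ^+ 2)%:E)%E.
  rewrite [RHS]integral_mkcond.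
  apply: (@ge0_integral_null_eq _ _ _ (lebm2 R) N) => // [x|x Nx].
  - by rewrite patchE; case: ifP => // _; rewrite lee_fin sqr_ge0.
  have := contra_not (sub x) Nx => /contrapT /= H.
  rewrite !patchE; case: ifPn => [/set_mem Ox|_]; last first.
    by rewrite normr0 powR0.
  by rewrite H// powR_mulrn// real_normK ?num_real.
have -> : (\int[@leb2 R]_(x in Omega) (g' x ^+ 2)%:E = (I2 (fun p => g' p ^+ 2))%:E)%E.
  by rewrite /I2 EFin_bint//; [exact: mOmega|exact: fOmega].
rewrite poweR_EFin /nn; congr EFin.
rewrite powR12_sqrt//; apply: Rintegral_ge0 => p _; exact: sqr_ge0.
Qed.

Lemma ae_lines n (x_ : nat -> R) : ae_Omega (fun p : R * R => forall i, (i <= n)%N -> p.1 <> x_ i).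
Proof.
have H : {ae lebm2 R, forall p : R * R, forall i : nat, p.1 <> x_ i}.
  apply: ae_foralln => i; exists ([set x_ i] `*` setT); split.
  - exact: measurableX.
  - transitivity ((@lebesgue_measure R [set x_ i]) * (@lebesgue_measure R setT))%E.
      exact: product_measure1E.
    by rewrite lebesgue_measure_set1 mul0e.
  - by move=> p /= /contrapT.
case: H => N [mN N0 sub]; exists N; split=> //.
by apply: subset_trans sub => p /= h1 h2; apply: h1 => _ i _; exact: h2.
Qed.

Lemma ae_linesY n (y_ : nat -> R) : ae_Omega (fun p : R * R => forall i, (i <= n)%N -> p.2 <> y_ i).
Proof.
have H : {ae lebm2 R, forall p : R * R, forall i : nat, p.2 <> y_ i}.
  apply: ae_foralln => i; exists (setT `*` [set y_ i]); split.
  - exact: measurableX.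
  - transitivity ((@lebesgue_measure R setT) * (@lebesgue_measure R [set y_ i]))%E.
      exact: product_measure1E.
    by rewrite lebesgue_measure_set1 mule0.
  - by move=> p /= /contrapT.
case: H => N [mN N0 sub]; exists N; split=> //.
by apply: subset_trans sub => p /= h1 h2; apply: h1 => _ i _; exact: h2.
Qed.

End Norm.

(** * The space V^h and nodal interpolation *)

Section Space.
Context (R : realType).
Implicit Types (x y : R) (w : R * R -> R).
Variables (X Y : seq R) (n k : nat).
Hypotheses (sX : size X = n.+1) (sY : size Y = k.+1).
Local Notation x_ := (fun i => X`_i).
Local Notation y_ := (fun i => Y`_i).
Hypotheses (mx : mesh n x_) (my : mesh k y_).

Lemma mesh_cell1 m (z : nat -> R) t : mesh m z -> 0 <= t <= 1 ->
  exists2 i, (i < m)%N & z i <= t <= z i.+1.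
Proof.
move=> mz /andP[t0 t1]; have [m0 z0 z1 inc] := mz.
have [e|ne] := eqVneq t 1.
  exists m.-1; first by rewrite prednK.
  by rewrite prednK// z1 e lexx andbT -z1 (mesh_le mz)// leq_pred.
have [|i ilt /andP[a b]] := mesh_cell (x := t) mz; first by rewrite t0 lt_neqAle ne t1.
by exists i => //; rewrite a ltW.
Qed.

Lemma node01X i : (i <= n)%N -> 0 <= X`_i <= 1. Proof. exact: (mesh_01 mx). Qed.
Lemma node01Y i : (i <= k)%N -> 0 <= Y`_i <= 1. Proof. exact: (mesh_01 my). Qed.

(** A member of [Vh] is constrained on the closed square only, whereas [vh] asks for continuity on
    the plane; hence the clamping. *)
Lemma Vh_vh w : Vh X Y w -> vh n k x_ y_ (clamped w).
Proof.
move=> [cw bil zw].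
have bil' i j : (i < n)%N -> (j < k)%N -> exists a0 a1 a2 a3 : R, forall x y, x_ i <= x <= x_ i.+1 ->
    y_ j <= y <= y_ j.+1 -> clamped w (x, y) = a0 + a1 * x + a2 * y + a3 * (x * y).
  move=> ilt jlt; have [|| a0 [a1 [a2 [a3 H]]]] := bil i j; [by rewrite sX|by rewrite sY|].
  exists a0, a1, a2, a3 => x y /andP[ix xi] /andP[jy yj].
  have /andP[i0 _] := node01X (ltnW ilt); have /andP[_ i1] := node01X ilt.
  have /andP[j0 _] := node01Y (ltnW jlt); have /andP[_ j1] := node01Y jlt.
  rewrite clamped_id; [|by apply/andP; split; lra|by apply/andP; split; lra].
  by rewrite H//; split; rewrite /= in_itv/= ?ix ?xi ?jy ?yj.
have bd x y : 0 <= x <= 1 -> 0 <= y <= 1 -> x = 0 \/ x = 1 \/ y = 0 \/ y = 1 -> clamped w (x, y) = 0.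
  move=> x01 y01 h; rewrite clamped_id// zw//; split; first by split; rewrite /= in_itv.
  move=> [/=]; rewrite !in_itv/= => /andP[a b] /andP[c d].
  by case: h => [e|[e|[e|e]]]; subst; rewrite ?ltxx in a b c d.
have o0 : 0 <= (0 : R) <= 1 by rewrite lexx ler01.
have o1 : 0 <= (1 : R) <= 1 by rewrite lexx ler01.
split; first exact: clamped_cont.
- move=> x y x01 y01; have [i ilt ix] := mesh_cell mx x01.
  have [j jlt jy] := mesh_cell1 my y01; have [_ _ _ inc] := mx.
  have [a0 [a1 [a2 [a3 H]]]] := bil' i j ilt jlt.
  have ix' : x_ i <= x <= x_ i.+1 by case/andP: ix => -> /ltW ->.
  have lt := inc i ilt.
  rewrite (IxU mx _ _ ilt ix) !H ?lexx ?(ltW lt)//; field.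
  by rewrite gt_eqF// subr_gt0.
- move=> x y x01 y01; have [j jlt jy] := mesh_cell my y01.
  have [i ilt ix] := mesh_cell1 mx x01; have [_ _ _ inc] := my.
  have [a0 [a1 [a2 [a3 H]]]] := bil' i j ilt jlt.
  have jy' : y_ j <= y <= y_ j.+1 by case/andP: jy => -> /ltW ->.
  have lt := inc j jlt.
  rewrite (IyU my _ _ jlt jy) !H ?lexx ?(ltW lt)//; field.
  by rewrite gt_eqF// subr_gt0.
- by move=> y y01; split; apply: bd => //; [left|right; left].
- by move=> x x01; split; apply: bd => //; right; right; [left|right].
Qed.

Lemma vh_cellX w i x y : vh n k x_ y_ w -> (i < n)%N -> x_ i <= x <= x_ i.+1 -> 0 <= y <= 1 ->
  w (x, y) = w (x_ i, y) + (x - x_ i) * ((w (x_ i.+1, y) - w (x_ i, y)) * (x_ i.+1 - x_ i)^-1).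
Proof.
move=> vw ilt /andP[ix]; rewrite le_eqVlt => /predU1P[->|xi] y01.
  by have [_ _ _ inc] := mx; field; rewrite gt_eqF// subr_gt0; exact: inc.
by apply: (vhU mx vw ilt) => //; rewrite ix.
Qed.

Lemma vh_cellY w j x y : vh n k x_ y_ w -> (j < k)%N -> y_ j <= y <= y_ j.+1 -> 0 <= x <= 1 ->
  w (x, y) = w (x, y_ j) + (y - y_ j) * ((w (x, y_ j.+1) - w (x, y_ j)) * (y_ j.+1 - y_ j)^-1).
Proof.
move=> vw jlt /andP[jy]; rewrite le_eqVlt => /predU1P[->|yj] x01.
  by have [_ _ _ inc] := my; field; rewrite gt_eqF// subr_gt0; exact: inc.
have jy' : y_ j <= y < y_ j.+1 by rewrite jy.
have [_ _ v _ _] := vw; rewrite -(IyU my x w jlt jy') v//.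
exact: (cell_itv my jlt jy').
Qed.

Lemma vh_Vh w : vh n k x_ y_ w -> Vh X Y w.
Proof.
move=> vw; have [cw vx vy zx zy] := vw; split.
- exact: continuous_subspaceT.
- move=> i j; rewrite sX sY !ltnS => ilt jlt.
  pose a := X`_i; pose H := (X`_i.+1 - X`_i)^-1; pose b := Y`_j; pose K := (Y`_j.+1 - Y`_j)^-1.
  pose w00 := w (X`_i, Y`_j); pose w10 := w (X`_i.+1, Y`_j).
  pose w01 := w (X`_i, Y`_j.+1); pose w11 := w (X`_i.+1, Y`_j.+1).
  pose p := (w10 - w00) * H; pose q := (w01 - w00) * K; pose r := ((w11 - w01) * H - (w10 - w00) * H) * K.
  exists (w00 - a * p - b * q + a * b * r), (p - b * r), (q - a * r), r => -[x y] [/=].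
  rewrite !in_itv/= => ix jy.
  have /andP[j0 _] := node01Y (ltnW jlt); have /andP[_ j1] := node01Y jlt.
  have y01 : 0 <= y <= 1 by case/andP: jy => ? ?; apply/andP; split; lra.
  rewrite (vh_cellX vw ilt ix y01).
  rewrite (vh_cellY vw jlt jy (node01X (ltnW ilt))) (vh_cellY vw jlt jy (node01X ilt)).
  rewrite -/w00 -/w10 -/w01 -/w11 -/a -/b -/H -/K /p /q /r; ring.
- move=> [x y] [[/=]]; rewrite !in_itv/= => x01 y01 nO.
  have [x0|x0] := eqVneq x 0; first by rewrite x0; have [] := zx y y01.
  have [x1|x1] := eqVneq x 1; first by rewrite x1; have [] := zx y y01.
  have [y0|y0] := eqVneq y 0; first by rewrite y0; have [] := zy x x01.
  have [y1|y1] := eqVneq y 1; first by rewrite y1; have [] := zy x x01.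
  exfalso; apply: nO; split; rewrite /= in_itv/= !lt_neqAle; move: x01 y01 => /andP[? ?] /andP[? ?].
    by rewrite eq_sym x0 x1; apply/andP.
  by rewrite eq_sym y0 y1; apply/andP.
Qed.

Lemma VhB w w' : Vh X Y w -> Vh X Y w' -> Vh X Y (fun p => w p - w' p).
Proof.
move=> [cw bw zw] [cw' bw' zw']; split.
- by move=> p; apply: cvgB; [exact: cw|exact: cw'].
- move=> i j hi hj; have [a0 [a1 [a2 [a3 H]]]] := bw i j hi hj.
  have [b0 [b1 [b2 [b3 H']]]] := bw' i j hi hj.
  exists (a0 - b0), (a1 - b1), (a2 - b2), (a3 - b3) => p hp; rewrite H// H'//; ring.
- by move=> p bp; rewrite zw// zw'// subr0.
Qed.

Lemma is_derive_affine (c d x : R) : is_derive x 1 (fun t : R => c + t * d) d.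
Proof.
apply: is_derive_remainder => del del0; exists 1 => // s _.
have -> : c + s * d - (c + x * d) - d * (s - x) = 0 by ring.
by rewrite normr0 mulr_ge0// ltW.
Qed.

Lemma dx_Dx w : Vh X Y w -> ae_Omega (fun p => dx w p = slope_x n x_ (clamped w) p).
Proof.
move=> Vw; have vw := Vh_vh Vw; apply: (ae_OmegaS _ (ae_lines n x_)) => -[x y] [/= Ux Uy] hx.
have [i ilt ix] := mesh_cell mx (UI Ux); have y01 := U01 Uy.
rewrite (DxU mx _ _ ilt ix) /dx /=; have /andP[ix1 xi] := ix.
have xi1 : X`_i < x by rewrite lt_neqAle ix1 andbT eq_sym; apply/eqP => e; exact: (hx i (ltnW ilt)).
have /andP[i0 _] := node01X (ltnW ilt); have /andP[_ i1] := node01X ilt.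
set sl := _ * _.
rewrite derive1E; apply: (@derive_val _ _ _ _ _ _ _ (_ : is_derive x 1 _ sl)).
have xin : X`_i < x < X`_i.+1 by rewrite xi1.
apply: (is_derive_near xin _ (is_derive_affine (clamped w (X`_i, y) - X`_i * sl) sl x)) => t /andP[ti it].
rewrite -(clamped_id w (x := t))//; last by apply/andP; split; lra.
rewrite (vh_cellX (x := t) vw ilt _ y01) ?(ltW ti) ?(ltW it)// -/sl; ring.
Qed.

Lemma dy_Dy w : Vh X Y w -> ae_Omega (fun p => dy w p = slope_y k y_ (clamped w) p).
Proof.
move=> Vw; have vw := Vh_vh Vw; apply: (ae_OmegaS _ (ae_linesY k y_)) => -[x y] [/= Ux Uy] hy.
have [j jlt jy] := mesh_cell my (UI Uy); have x01 := U01 Ux.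
rewrite (DyU my _ _ jlt jy) /dy /=; have /andP[jy1 yj] := jy.
have yj1 : Y`_j < y by rewrite lt_neqAle jy1 andbT eq_sym; apply/eqP => e; exact: (hy j (ltnW jlt)).
have /andP[j0 _] := node01Y (ltnW jlt); have /andP[_ j1] := node01Y jlt.
set sl := _ * _.
rewrite derive1E; apply: (@derive_val _ _ _ _ _ _ _ (_ : is_derive y 1 _ sl)).
have yin : Y`_j < y < Y`_j.+1 by rewrite yj1.
apply: (is_derive_near yin _ (is_derive_affine (clamped w (x, Y`_j) - Y`_j * sl) sl y)) => t /andP[tj jt].
rewrite -(clamped_id w (y := t))//; last by apply/andP; split; lra.
rewrite (vh_cellY (y := t) vw jlt _ x01) ?(ltW tj) ?(ltW jt)// -/sl; ring.
Qed.

Section Nodal.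
Variables (u uI : R * R -> R).
Hypotheses (vI : vh n k x_ y_ uI) (hu : forall i j, (i <= n)%N -> (j <= k)%N -> uI (x_ i, y_ j) = u (x_ i, y_ j)).

(** On a vertical mesh line u^I is the interpolant of u in y, so the slope of u^I in x, taken
    between two such lines, is that of [interp_y] applied to u. *)
Lemma nodal_y i y : (i <= n)%N -> 0 <= y < 1 -> uI (x_ i, y) = interp_y k y_ u (x_ i, y).
Proof.
move=> ile y01; have [_ _ vy _ _] := vI; rewrite -(vy _ y (node01X ile) y01).
have [j jlt jy] := mesh_cell my y01.
by rewrite !(IyU my _ _ jlt jy) !hu// ltnW.
Qed.

Lemma nodal_x j x : (j <= k)%N -> 0 <= x < 1 -> uI (x, y_ j) = interp_x n x_ u (x, y_ j).
Proof.
move=> jle x01; have [_ vx _ _ _] := vI; rewrite -(vx x _ x01 (node01Y jle)).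
have [i ilt ix] := mesh_cell mx x01.
by rewrite !(IxU mx _ _ ilt ix) !hu// ltnW.
Qed.

Lemma nodal_Dx p : Omega p -> slope_x n x_ uI p = slope_x n x_ (interp_y k y_ u) p.
Proof.
case: p => x y [/= /UI x01 /UI y01]; have [i ilt ix] := mesh_cell mx x01.
by rewrite !(DxU mx _ _ ilt ix) !nodal_y// ltnW.
Qed.

Lemma nodal_Dy p : Omega p -> slope_y k y_ uI p = slope_y k y_ (interp_x n x_ u) p.
Proof.
case: p => x y [/= /UI x01 /UI y01]; have [j jlt jy] := mesh_cell my y01.
by rewrite !(DyU my _ _ jlt jy) !nodal_x// ltnW.
Qed.

Lemma nodal_I p : Omega p -> uI p = interp_x n x_ (interp_y k y_ u) p.
Proof.
case: p => x y [/= Ux Uy]; have x01 := UI Ux; have y01 := UI Uy; have [i ilt ix] := mesh_cell mx x01.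
have [_ vx _ _ _] := vI; rewrite -(vx x y x01 (U01 Uy)).
by rewrite !(IxU mx _ _ ilt ix) !nodal_y// ltnW.
Qed.

End Nodal.

End Space.

(** * Galerkin orthogonality *)

Section Orthogonality.
Context (R : realType).
Implicit Types (x y t : R).
Notation U := (`]0, 1[%classic : set R).
Variables (X Y : seq R) (n k : nat).
Hypotheses (sX : size X = n.+1) (sY : size Y = k.+1).
Local Notation x_ := (fun i => X`_i).
Local Notation y_ := (fun i => Y`_i).
Hypotheses (mx : mesh n x_) (my : mesh k y_).
Local Notation Dx := (slope_x n x_).
Local Notation Dy := (slope_y k y_).
Variables (F : nat -> nat -> R * R -> R) (u : R * R -> R).
Hypotheses (jF : cjet F) (uE : forall p, Omegabar p -> u p = F 0 0 p).

Let UO (p : R * R) : Omega p -> Omegabar p.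
Proof. by case: p => x y [/= /U01 ? /U01 ?]; split; rewrite /= in_itv. Qed.

Let itv t : U t -> 0 < t < 1.
Proof. by rewrite /= in_itv. Qed.

Lemma dx_u p : Omega p -> dx u p = F 1 0 p.
Proof.
case: p => x y [/= Ux Uy]; have x01 := itv Ux; have [_ dF _] := jF.
rewrite /dx /= derive1E; apply: (@derive_val _ _ _ _ _ _ _ (_ : is_derive x 1 _ _)).
apply: (is_derive_near x01 _ (dF 0%N 0%N isT x y x01)) => t t01.
by rewrite uE//; apply: UO; split => //; rewrite /= in_itv.
Qed.

Lemma dy_u p : Omega p -> dy u p = F 0 1 p.
Proof.
case: p => x y [/= Ux Uy]; have y01 := itv Uy; have [_ _ dF] := jF.
rewrite /dy /= derive1E; apply: (@derive_val _ _ _ _ _ _ _ (_ : is_derive y 1 _ _)).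
apply: (is_derive_near y01 _ (dF 0%N 0%N isT x y y01)) => t t01.
by rewrite uE//; apply: UO; split => //; rewrite /= in_itv.
Qed.

Lemma lap_u p : Omega p -> laplacian u p = F 2 0 p + F 0 2 p.
Proof.
case: p => x y [/= Ux Uy]; have x01 := itv Ux; have y01 := itv Uy; have [_ dF dF'] := jF.
rewrite /laplacian; congr (_ + _).
  rewrite [LHS]/dx /= derive1E; apply: (@derive_val _ _ _ _ _ _ _ (_ : is_derive x 1 _ _)).
  apply: (is_derive_near x01 _ (dF 1%N 0%N isT x y x01)) => t t01.
  by rewrite dx_u//; split => //; rewrite /= in_itv.
rewrite [LHS]/dy /= derive1E; apply: (@derive_val _ _ _ _ _ _ _ (_ : is_derive y 1 _ _)).
apply: (is_derive_near y01 _ (dF' 0%N 1%N isT x y y01)) => t t01.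
by rewrite dy_u//; split => //; rewrite /= in_itv.
Qed.

Lemma Dx_clamped w p : Omega p -> Dx (clamped w) p = Dx w p.
Proof.
case: p => x y [/= Ux Uy]; rewrite /slope_x /= !clamped_id//; try exact: U01.
  exact: (loU mx).
exact: (hiU mx).
Qed.

Lemma Dy_clamped w p : Omega p -> Dy (clamped w) p = Dy w p.
Proof.
case: p => x y [/= Ux Uy]; rewrite /slope_y /= !clamped_id//; try exact: U01.
  exact: (loU my).
exact: (hiU my).
Qed.

Variable phi : R * R -> R.
Hypothesis vphi : vh n k x_ y_ phi.
Let cphi : continuous phi. Proof. by case: vphi. Qed.
Let bphi : bm phi. Proof. exact: bm_continuous. Qed.
Let bxphi : bm (Dx phi). Proof. exact: bm_Dx. Qed.
Let byphi : bm (Dy phi). Proof. exact: bm_Dy. Qed.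

Let bF i j : (i + j <= 3)%N -> bm (F i j).
Proof. by move=> ij; apply: bm_continuous; case: jF => cF _ _; exact: cF. Qed.

Lemma ibp_x : I2 (fun p => F 2 0 p * phi p + F 1 0 p * Dx phi p) = 0.
Proof.
have b1 := bF (isT : (2 + 0 <= 3)%N); have b2 := bF (isT : (1 + 0 <= 3)%N).
have bP : bm (fun p => F 2 0 p * phi p + F 1 0 p * Dx phi p) by bmt.
have [n0 x0 x1 inc] := mx; have [_ _ _ zphi _] := vphi.
apply: (I2_pw0 (Phi := fun p => F 1 0 p * phi p) (v := fun y i => F 1 0 (X`_i, y) * phi (X`_i, y)) mx bP).
  move=> y Uy i ilt; have y01 := U01 Uy.
  have /andP[i0 _] := mesh_01 mx (ltnW ilt); have /andP[_ i1] := mesh_01 mx ilt.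
  have H0 : X`_i.+1 - X`_i != 0 by rewrite gt_eqF// subr_gt0; exact: inc.
  have N1 : nice X`_i X`_i.+1 (fun x => F 1 0 (x, y)) (fun x => F 2 0 (x, y)) by exact: niceX.
  pose sl := (phi (X`_i.+1, y) - phi (X`_i, y)) * (X`_i.+1 - X`_i)^-1.
  pose c := nice_cst X`_i X`_i.+1.
  have N2 := niceD (c (phi (X`_i, y))) (niceM (niceB (nice_id X`_i X`_i.+1) (c X`_i)) (c sl)).
  eexists; eexists; split.
  - exact: (niceM N1 N2).
  - by rewrite /= subrr mul0r addr0.
  - by rewrite /= /sl; congr (_ * _); field.
  - by move=> x ix; rewrite (vhU mx vphi ilt ix y01).
  - move=> x ix; have ix' : X`_i <= x < X`_i.+1 by case/andP: ix => /ltW -> ->.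
    by rewrite (vhU mx vphi ilt ix' y01) (DxU mx _ _ ilt ix') -/sl /=; ring.
move=> y Uy; have [p0 p1] := zphi y (U01 Uy).
by rewrite x0 x1 p0 p1 !mulr0.
Qed.

Lemma ibp_y : I2 (fun p => F 0 2 p * phi p + F 0 1 p * Dy phi p) = 0.
Proof.
have b1 := bF (isT : (0 + 2 <= 3)%N); have b2 := bF (isT : (0 + 1 <= 3)%N).
have bP : bm (fun p => F 0 2 p * phi p + F 0 1 p * Dy phi p) by bmt.
have [n0 y0 y1 inc] := my; have [_ _ _ _ zphi] := vphi.
apply: (I2_pw0Y (Phi := fun p => F 0 1 p * phi p) (v := fun x i => F 0 1 (x, Y`_i) * phi (x, Y`_i)) my bP).
  move=> x Ux i ilt; have x01 := U01 Ux.
  have /andP[i0 _] := mesh_01 my (ltnW ilt); have /andP[_ i1] := mesh_01 my ilt.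
  have H0 : Y`_i.+1 - Y`_i != 0 by rewrite gt_eqF// subr_gt0; exact: inc.
  have N1 : nice Y`_i Y`_i.+1 (fun y => F 0 1 (x, y)) (fun y => F 0 2 (x, y)) by exact: niceY.
  pose sl := (phi (x, Y`_i.+1) - phi (x, Y`_i)) * (Y`_i.+1 - Y`_i)^-1.
  pose c := nice_cst Y`_i Y`_i.+1.
  have N2 := niceD (c (phi (x, Y`_i))) (niceM (niceB (nice_id Y`_i Y`_i.+1) (c Y`_i)) (c sl)).
  have cl y : Y`_i <= y < Y`_i.+1 -> Y`_i <= y <= Y`_i.+1 by move=> /andP[-> /ltW ->].
  eexists; eexists; split.
  - exact: (niceM N1 N2).
  - by rewrite /= subrr mul0r addr0.
  - by rewrite /= /sl; congr (_ * _); field.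
  - by move=> y iy; rewrite (vh_cellY my vphi ilt (cl y iy) x01).
  - move=> y iy; have iy' : Y`_i <= y < Y`_i.+1 by case/andP: iy => /ltW -> ->.
    by rewrite (vh_cellY my vphi ilt (cl y iy') x01) (DyU my _ _ ilt iy') -/sl /=; ring.
move=> x Ux; have [p0 p1] := zphi x (U01 Ux).
by rewrite y0 y1 p0 p1 !mulr0.
Qed.

Variables (eps : R) (b c f B c' uh : R * R -> R).
Hypotheses (bB : bm B) (bc' : bm c') (bE : ae_Omega (fun p => b p = B p)) (cE : ae_Omega (fun p => c p = c' p)).
Hypotheses (sol : solution eps b c f u) (gal : galerkin eps b c f X Y uh).

Definition aint (w0 w1 w2 : R * R -> R) p :=
  eps * (w1 p * Dx phi p + w2 p * Dy phi p) + (- B p * w1 p + c' p * w0 p) * phi p.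

(** The discrete equation gives (f, phi) on the left; on the right the differential equation, valid
    almost everywhere, is multiplied by phi and integrated by parts along lines. *)
Lemma galerkin_eq : I2 (aint (clamped uh) (Dx (clamped uh)) (Dy (clamped uh))) = I2 (aint (F 0 0) (F 1 0) (F 0 1)).
Proof.
have [Vuh hgal] := gal; have vuh := Vh_vh sX sY mx my Vuh; have Vphi := vh_Vh sX sY mx my vphi.
have [cuh _ _ _ _] := vuh.
have b0 := bm_continuous cuh; have b1 := bm_Dx mx cuh; have b2 := bm_Dy my cuh.
have f0 := bF (isT : (0 + 0 <= 3)%N); have f1 := bF (isT : (1 + 0 <= 3)%N); have f2 := bF (isT : (0 + 1 <= 3)%N).
have f20 := bF (isT : (2 + 0 <= 3)%N); have f02 := bF (isT : (0 + 2 <= 3)%N).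
have q1 : bm (fun p => Dx (clamped uh) p * Dx phi p) by bmt.
have q2 : bm (fun p => Dy (clamped uh) p * Dy phi p) by bmt.
have q3 : bm (fun p => (- B p * Dx (clamped uh) p + c' p * clamped uh p) * phi p) by bmt.
have q12 : bm (fun p => Dx (clamped uh) p * Dx phi p + Dy (clamped uh) p * Dy phi p) by bmt.
have q12' : bm (fun p => eps * (Dx (clamped uh) p * Dx phi p + Dy (clamped uh) p * Dy phi p)) by bmt.
have -> : I2 (aint (clamped uh) (Dx (clamped uh)) (Dy (clamped uh))) = aG eps b c uh phi.
  rewrite /aint (I2D q12' q3) (I2Z eps q12) (I2D q1 q2) /aG; congr (_ * (_ + _) + _); apply/esym.
  - apply: (@Rintegral_ae_eq _ _ _ (lebm2 R)).
    apply: (ae_OmegaS _ (ae_OmegaI (dx_Dx sX sY mx my Vuh) (dx_Dx sX sY mx my Vphi))) => p Op [-> ->].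
    by rewrite (Dx_clamped phi Op).
  - apply: (@Rintegral_ae_eq _ _ _ (lebm2 R)).
    apply: (ae_OmegaS _ (ae_OmegaI (dy_Dy sX sY mx my Vuh) (dy_Dy sX sY mx my Vphi))) => p Op [-> ->].
    by rewrite (Dy_clamped phi Op).
  - apply: (@Rintegral_ae_eq _ _ _ (lebm2 R)).
    apply: (ae_OmegaS _ (ae_OmegaI (dx_Dx sX sY mx my Vuh) (ae_OmegaI bE cE))) => p Op [-> [-> ->]].
    by case: p Op => x y [/= /U01 ? /U01 ?]; rewrite clamped_id.
rewrite (hgal _ Vphi).
have -> : inner f phi = I2 (fun p => (- eps * (F 2 0 p + F 0 2 p) - B p * F 1 0 p + c' p * F 0 0 p) * phi p).
  apply: (@Rintegral_ae_eq _ _ _ (lebm2 R)); have [solE _] := sol.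
  apply: (ae_OmegaS _ (ae_OmegaI solE (ae_OmegaI bE cE))) => p Op [<- [-> ->]].
  by rewrite dx_u// lap_u// uE//; exact: UO.
have p1 : bm (fun p => F 2 0 p * phi p + F 1 0 p * Dx phi p) by bmt.
have p2 : bm (fun p => F 0 2 p * phi p + F 0 1 p * Dy phi p) by bmt.
have p3 : bm (fun p => (- eps * (F 2 0 p + F 0 2 p) - B p * F 1 0 p + c' p * F 0 0 p) * phi p).
  by bmt; exact: bmeas_cst.
have p12 : bm (fun p => (F 2 0 p * phi p + F 1 0 p * Dx phi p) + (F 0 2 p * phi p + F 0 1 p * Dy phi p)) by bmt.
have p12' : bm (fun p => eps * ((F 2 0 p * phi p + F 1 0 p * Dx phi p) + (F 0 2 p * phi p + F 0 1 p * Dy phi p))) by bmt.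
have z := I2Z eps p12; rewrite (I2D p1 p2) ibp_x ibp_y addr0 mulr0 in z.
rewrite -[LHS]addr0 -[X in _ + X]z -(I2D p3 p12').
by apply: I2_eq => p _; rewrite /aint; ring.
Qed.

End Orthogonality.

(** * Error bound *)

(** The representative of c is the maximum of c and gamma - b_x / 2, written with an absolute value.
    It changes c on a null set only and makes the coercivity condition hold at every point. *)
Lemma coefficients (R : realType) (b b_x b_y c : R * R -> R) (gamma : R) :
  in_W1oo b b_x b_y -> in_Lp +oo%E c ->
  ae_Omega (fun p => gamma <= c p + 1 / 2 * b_x p) ->
  exists d beta c' MB, [/\ bm1 d, bm beta, bm c' & 1 <= MB] /\
  [/\ forall p, Omega p -> `|d p.2 + primX beta p| <= MB, forall p, Omega p -> `|beta p| <= MB,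
    forall p, Omega p -> `|c' p| <= MB & forall p, Omega p -> gamma <= c' p + 1 / 2 * beta p] /\
  ae_Omega (fun p => b p = d p.2 + primX beta p) /\ ae_Omega (fun p => c p = c' p).
Proof.
move=> [hb hbx _ wx _] hc hg; have [d [beta [bd bb bxE bE]]] := weak_primitive hb hbx wx.
have [c0 bc0 cE] := in_Lpoo_bm hc.
pose g p := gamma - 1 / 2 * beta p; pose c' p := (c0 p + g p + `|c0 p - g p|) / 2.
have bg : bm g by rewrite /g; bmt.
have bc' : bm c' by rewrite /c'; bmt.
have bB : bm (fun p => d p.2 + primX beta p) by apply: bmeasD; [exact: (bmeas_of_lineY bd)|exact: bm_primX].
have [_ [M1 h1]] := bB; have [_ [M2 h2]] := bb; have [_ [M3 h3]] := bc'.
exists d, beta, c', (1 + `|M1| + `|M2| + `|M3|).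
have n1 := normr_ge0 M1; have n2 := normr_ge0 M2; have n3 := normr_ge0 M3.
have l1 := ler_norm M1; have l2 := ler_norm M2; have l3 := ler_norm M3.
split; first by split=> //; lra.
split; [split=> p Op|split=> //].
- by apply: (le_trans (h1 p Op)); lra.
- by apply: (le_trans (h2 p Op)); lra.
- by apply: (le_trans (h3 p Op)); lra.
- by rewrite /c' /g; have := ler_norm (g p - c0 p); rewrite distrC /g; lra.
apply: (ae_OmegaS _ (ae_OmegaI cE (ae_OmegaI bxE hg))) => p _ [e1 [e2]].
rewrite e2 e1 => gl; rewrite /c' ger0_norm; last by rewrite /g; lra.
by field.
Qed.

Section Final.
Context (R : realType).
Implicit Types (x y : R).
Variables (b c f u uI uh : R * R -> R) (beta gamma delta CD rho : R).
Hypotheses (beta0 : 0 < beta) (gamma0 : 0 < gamma) (delta0 : 0 < delta) (rho0 : 0 < rho).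
Variables (d : R -> R) (bx c' : R * R -> R) (MB : R).
Hypotheses (bd : bm1 d) (bbx : bm bx) (bc' : bm c') (MB1 : 1 <= MB)
  (hMB : forall p, Omega p -> `|d p.2 + primX bx p| <= MB)
  (hMbx : forall p, Omega p -> `|bx p| <= MB) (hMc : forall p, Omega p -> `|c' p| <= MB)
  (hg : forall p, Omega p -> gamma <= c' p + 1 / 2 * bx p)
  (bE : ae_Omega (fun p => b p = d p.2 + primX bx p)) (cE : ae_Omega (fun p => c p = c' p)).
Local Notation K := (mesh_cst rho beta delta CD).
Local Notation C0 := (25 * MB * K ^+ 3 * (6 + 2 * K)).
Variables (eps h : R) (Mx My : nat).
Local Notation s := (Num.sqrt eps).
Hypotheses (h0 : 0 < h) (h1 : h < 1) (e0 : 0 < eps) (e4 : 4 * eps < 1) (e4' : 4 * s < 1 / 2).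
Hypotheses (idX : dl_index h eps 1 Mx) (idY : dl_index h s (1 / 2) My).
Hypotheses (sol : solution eps b c f u) (dec : decomposition 3 beta delta CD eps u).
Local Notation X := (dl_x h eps rho Mx).
Local Notation Y := (dl_y h eps rho My).
Hypotheses (hI : interpolant X Y u uI) (gal : galerkin eps b c f X Y uh).
Local Notation n := (xn h eps rho Mx).
Local Notation k := (yn h eps rho My).
Local Notation x_ := (fun i : nat => X`_i).
Local Notation y_ := (fun i : nat => Y`_i).
Let w p := uI p - uh p.
Local Notation B := (fun p => d p.2 + primX bx p).

Let mx : mesh n x_ := xmesh h0 h1 e0 e4 rho0 idX.
Let my : mesh k y_ := ymesh h0 h1 e0 e4' rho0 delta0 idY.
Let sX : size X = n.+1 := x_size h eps rho Mx.
Let sY : size Y = k.+1 := y_size h eps rho My.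

Lemma Vw : Vh X Y w.
Proof. by case: hI => vI _; case: gal => vh _; exact: VhB. Qed.

Lemma Nrm_w : Nrm n k x_ y_ eps (clamped w) <= energy_cst K MB C0 (Num.min gamma 1) * h ^+ 2.
Proof.
have [V [W1 [W2 [W12 [uE hV hW1 hW2 hW12]]]]] := dec.
pose SS := smooth_part V W2; pose LL := layer_part W1 W12.
have jSS : cjet SS := jS hV hW2; have jLL : cjet LL := jL hW1 hW12.
pose F i j p := SS i j p + LL i j p.
have jF : cjet F by exact: cjetD.
have uF p : Omegabar p -> u p = F 0 0 p.
  case: p => x y Op; have [/=] := Op; rewrite !in_itv/= => x01 y01.
  by rewrite uE// /F /SS /LL /smooth_part /layer_part !clamped_id//; ring.
have [VI nodes] := hI; have [Vuh _] := gal.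
have vI : vh n k x_ y_ (clamped uI) := Vh_vh sX sY mx my VI.
have vH : vh n k x_ y_ (clamped uh) := Vh_vh sX sY mx my Vuh.
have vw : vh n k x_ y_ (clamped w) := Vh_vh sX sY mx my Vw.
have hu i j : (i <= n)%N -> (j <= k)%N -> clamped uI (X`_i, Y`_j) = F 0 0 (X`_i, Y`_j).
  move=> ilt jlt; have i01 := node01X mx ilt; have j01 := node01Y my jlt.
  rewrite clamped_id// nodes ?mem_nth ?sX ?sY ?ltnS// uF//.
have e1 : eps <= 1 by have := e0; have := e4; lra.
have K1' : 1 <= K := mesh_cst_ge1 CD rho0 beta0 delta0.
have K3' : 3 <= K := mesh_cst_ge3 CD rho0 beta0 delta0.
have Kge0 : 0 <= K by exact: le_trans K1'.
have [k1 k2 k3 k4] := mesh_cst_misc CD rho0 beta0 delta0.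
have [sg1 hl1 hl2] := x_sig h0 h1 e0 e4 rho0 idX.
have mr0 : 0 < Num.min rho 1 by rewrite lt_min rho0 ltr01.
have s0 : 0 < s by rewrite sqrtr_gt0.
have cI : continuous (clamped uI) by case: vI.
have cH : continuous (clamped uh) by case: vH.
pose A phi := I2 (aeta n k x_ y_ eps SS LL B c' (clamped uI) phi).
have bB : bm B by apply: bmeasD; [exact: (bmeas_of_lineY bd)|exact: bm_primX].
have hA phi : vh n k x_ y_ phi -> `|A phi - I2 (last_int n x_ h B (SS 2 0) phi)| <= C0 * (h ^+ 2 * Nrm n k x_ y_ eps phi).
  move=> vphi; apply: (@aeta_est R n k x_ y_ mx my eps h K (decay eps beta) e0 e1 h0 h1 K1' (bm1_decay beta e0) _ _ _ _
    SS LL jSS jLL _ _ _ _ _ _ _ _ _ B bx c' (clamped uI) d MB bd bbx bc' MB1) => //.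
  - by move=> x /andP[x0 _]; exact: decay01.
  - by apply: (le_trans (I1_decay2 e0 beta0)); rewrite ler_wpM2r// ltW.
  - move=> x x01; apply: (le_trans (x_wd1 h0 h1 e0 e4 rho0 idX x01)).
    by rewrite ler_wpM2r// ltW.
  - move=> x x01 l0; apply: (le_trans (x_om h0 h1 e0 e4 rho0 idX x01 l0)).
    by rewrite ler_peMl// addr_ge0// mulr_ge0 ?sqr_ge0// ltW.
  - by move=> x y; exact: (S_le e0 rho0 beta0 delta0 hV hW2).
  - by move=> x y; exact: (S_le e0 rho0 beta0 delta0 hV hW2).
  - move=> y xi yi y01 /andP[/ltW a /ltW a']; apply: (S_y2 h0 h1 e0 e4' rho0 beta0 delta0 idY hV hW2) => //.
    by rewrite a a'.
  - by move=> y xi yi; exact: (S_y2 h0 h1 e0 e4' rho0 beta0 delta0 idY hV hW2).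
  - by move=> x xi yi; exact: (S_21 h0 h1 e0 e4 e4' rho0 beta0 delta0 idX hV hW2).
  - by move=> x xi yi; exact: (L_20 h0 h1 e0 e4 rho0 beta0 delta0 idX hW1 hW12).
  - by move=> x y xi yi; exact: (L_02 h0 h1 e0 e4 e4' rho0 beta0 delta0 idX idY hW1 hW12).
  - by move=> x y xi yi; exact: (L_12 h0 h1 e0 e4 e4' rho0 beta0 delta0 idX idY hW1 hW12).
  - by move=> x xi yi; exact: (L_21 h0 h1 e0 e4 e4' rho0 beta0 delta0 idX hW1 hW12).
  - by move=> p Op; exact: (nodal_Dx mx my vI hu).
  - by move=> p Op; exact: (nodal_Dy mx my vI hu).
  - by move=> p Op; exact: (nodal_I mx my vI hu).
have hG phi : vh n k x_ y_ phi -> I2 (ach n k x_ y_ eps B c' (clamped w) phi) = A phi.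
  move=> vphi; have cphi : continuous phi by case: vphi.
  have ge := galerkin_eq sX sY mx my jF uF vphi bB bc' bE cE sol gal.
  have bp := bm_continuous cphi; have bxp := bm_Dx mx cphi; have byp := bm_Dy my cphi.
  have bI := bm_continuous cI; have bxI := bm_Dx mx cI; have byI := bm_Dy my cI.
  have bH := bm_continuous cH; have bxH := bm_Dx mx cH; have byH := bm_Dy my cH.
  have [cF _ _] := jF.
  have f0 := bm_continuous (cF 0%N 0%N isT); have f1 := bm_continuous (cF 1%N 0%N isT).
  have f2 := bm_continuous (cF 0%N 1%N isT).
  pose ai := aint X Y n k phi eps B c'.
  have ba w0 w1 w2 : bm w0 -> bm w1 -> bm w2 -> bm (ai w0 w1 w2).
    by move=> b0 b1 b2; rewrite /ai /aint; bmt.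
  transitivity (I2 (ai (clamped uI) (slope_x n x_ (clamped uI)) (slope_y k y_ (clamped uI))) - I2 (ai (clamped uh) (slope_x n x_ (clamped uh)) (slope_y k y_ (clamped uh)))).
    rewrite -I2B; [|exact: ba|exact: ba].
    by apply: I2_eq => p _; rewrite /ach /ai /aint /slope_x /slope_y /clamped /w; ring.
  rewrite [X in _ - X]ge -I2B; [|exact: ba|exact: ba].
  by apply: I2_eq => p _; rewrite /ai /aint /aeta /F; ring.
have C00 : 0 <= C0.
  by apply: mulr_ge0; [apply: mulr_ge0 (exprn_ge0 3 Kge0); apply: mulr_ge0 => //; exact: le_trans MB1|rewrite addr_ge0// mulr_ge0].
have [cS _ _] := jSS.
apply: (@Nrm_chi_le R n k x_ y_ mx my eps h K MB e0 e1 h0 K1' MB1 _ _ sg1 (SS 2 0) _ _ B bx c' d bd bbx bc' _ hMB hMbx hMc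
  (layerE delta eps) (kp V) _ _ _ _ _ _ _ _ (clamped w) A C0 (Num.min gamma 1) vw C00 hA hG) => //.
- by apply: (le_trans hl2); rewrite ler_wpM2r// ltW.
- apply: (@le_trans _ _ (4 / Num.min rho 1 * (Num.min rho 1 * h / 4))).
    by rewrite le_eqVlt; apply/orP; left; apply/eqP; field; exact: lt0r_neq0.
  apply: ler_pM => //; first by rewrite divr_ge0// ltW.
  by rewrite divr_ge0// mulr_ge0 ?ltW.
- exact: (bm_continuous (cS 2%N 0%N isT)).
- move=> [x y] [/= /U01 x01 /U01 y01]; exact: (S_le e0 rho0 beta0 delta0 hV hW2).
- exact: bm1_layerE.
- by move=> y _; exact: layerE_ge0.
- by apply: (le_trans (I1_layerE2 e0 delta0)); rewrite ler_wpM2r// ltW.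
- move=> y y01; apply: (le_trans (y_wd h0 h1 e0 e4' rho0 delta0 idY y01)).
  by rewrite ler_wpM2r// ltW.
- move=> y t y01 ht; apply: (le_trans (y_cut h0 h1 e0 e4' rho0 delta0 idY y01 ht)).
  by rewrite ler_wpM2r// layerE_ge0.
- by move=> y; exact: (kp_le rho0 beta0 delta0 hV).
- by move=> y t; exact: (kp_lip rho0 beta0 delta0 hV).
- by move=> x y; exact: (S20_kp e0 rho0 beta0 delta0 hV hW2).
- by rewrite lt_min gamma0 ltr01.
- by rewrite ge_min lexx orbT.
- by move=> p Op; apply: le_trans (hg Op); rewrite ge_min lexx.
Qed.

Lemma energy_normE : energy_norm eps w = (Nrm n k x_ y_ eps (clamped w))%:E.
Proof.
have vw : vh n k x_ y_ (clamped w) := Vh_vh sX sY mx my Vw.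
have cw : continuous (clamped w) by case: vw.
rewrite /energy_norm (L2norm_ae (bm_Dx mx cw) (dx_Dx sX sY mx my Vw)).
rewrite (L2norm_ae (bm_Dy my cw) (dy_Dy sX sY mx my Vw)).
rewrite (@L2norm_ae _ w (clamped w) (bm_continuous cw)); last first.
  have [N [mN N0 sub]] := ae_lines n x_; exists N; split=> //.
  apply: subset_trans sub => p /= h2 h3; apply: h2 => Op; case: p Op h3 => x y [/= /U01 x01 /U01 y01] _.
  by rewrite clamped_id.
rewrite -!EFin_expe.
transitivity ((eps * (nn (slope_x n x_ (clamped w)) ^+ 2 + nn (slope_y k y_ (clamped w)) ^+ 2) + nn (clamped w) ^+ 2)%R%:E `^ (1 / 2))%E.
  by [].
rewrite poweR_EFin div1r powR12_sqrt; last first.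
  by rewrite addr_ge0 ?sqr_ge0// mulr_ge0 ?(ltW e0)// addr_ge0 ?sqr_ge0.
by rewrite /Nrm mulrDr.
Qed.

(** With l = |ln eps| >= 1, the nodes in x number at most 6 l / h; in y each half starts at scale
    eps^(1/2), which halves the logarithm and gives at most 9 l / h in all. *)
Lemma mesh_points : 1 <= `|ln eps| ->
  ((size X * size Y)%:R : R) * h ^+ 2 <= 54 * `|ln eps| ^+ 2.
Proof.
move=> l1; set l := `|ln eps| in l1 *.
have s0 : 0 < s by rewrite sqrtr_gt0.
have e1 : eps < 1 by have := e0; have := e4; lra.
have lh1 := h1; have lh0 := h0.
have half1 : (1 / 2 : R) <= 1 by lra.
have kx := kap_le rho h0 h1 e0 idX e4 (lexx 1).
have ky := kap_le rho h0 h1 s0 idY e4' half1.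
have ls : `|ln s| = l / 2.
  have E : ln eps = ln s * 2.
    rewrite -[in LHS](sqr_sqrtr (ltW e0)) expr2 lnM ?posrE//; ring.
  by rewrite /l E normrM normr_nat; field.
rewrite ls in ky.
have -> : ((size X * size Y)%:R : R) = (n%:R + 1) * ((dl_kept h s (1 / 2) rho My)%:R + (dl_kept h s (1 / 2) rho My)%:R + 1).
  by rewrite sX sY natrM -natr1 -[(yn _ _ _ _).+1%:R]natr1 /yn natrD.
have a0 := ler0n R n; have q0 := ler0n R (dl_kept h s (1 / 2) rho My).
move: kx ky a0 q0; rewrite -/n -/l; clearbody l.
move: (n%:R : R) ((dl_kept h s (1 / 2) rho My)%:R : R) => a q kx ky a0 q0.
have -> : (a + 1) * (q + q + 1) * h ^+ 2 = ((a + 1) * h) * ((q + q + 1) * h) by ring.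
have -> : 54 * l ^+ 2 = (6 * l) * (9 * l) by ring.
apply: ler_pM; [apply: mulr_ge0; lra|apply: mulr_ge0; lra|lra|lra].
Qed.

End Final.

Theorem theorem3 (R : realType)
  (b b_x b_y c : R * R -> R) (beta gamma delta CD rho : R)
  (hbeta : 0 < beta) (hgamma : 0 < gamma) (hdelta : 0 < delta)
  (hrho : 0 < rho)
  (hb : in_W1oo b b_x b_y) (hc : in_Lp +oo%E c)
  (hbbeta : ae_Omega (fun p => beta <= b p))
  (hc0 : ae_Omega (fun p => 0 <= c p))
  (hcb : ae_Omega (fun p => gamma <= c p + 1 / 2 * b_x p)) :
  exists eps0 C : R, [/\ 0 < eps0, eps0 < 1, 0 < C &
    forall (eps : R) (f u : R * R -> R),
      0 < eps -> eps <= eps0 ->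
      in_Lp 2%:E f ->
      solution eps b c f u ->
      decomposition 3 beta delta CD eps u ->
    forall (h : R) (Mx My : nat),
      0 < h -> h < 1 ->
      dl_index h eps 1 Mx ->
      dl_index h (Num.sqrt eps) (1 / 2) My ->
    let X := dl_x h eps rho Mx in
    let Y := dl_y h eps rho My in
    let M := (size X * size Y)%N in
    forall uI uh : R * R -> R,
      interpolant X Y u uI ->
      galerkin eps b c f X Y uh ->
      (energy_norm eps (fun p => uI p - uh p)%R
         <= (C * h ^+ 2 * `|ln eps| `^ (1 / 2))%:E)%E
      /\ h ^+ 2 * `|ln eps| `^ (1 / 2)
         <= C * (1 / M%:R) * `|ln eps| `^ (5 / 2)].
Proof.
have [d [bx [c' [MB [[bd bbx bc' MB1] [[hMB hMbx hMc hg] [bE cE]]]]]]] := coefficients hb hc hcb.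
pose K := mesh_cst rho beta delta CD.
pose CC := energy_cst K MB (25 * MB * K ^+ 3 * (6 + 2 * K)) (Num.min gamma 1).
(* The bound 1/100 makes eps^(1/2) <= 1/10, so that 4 eps^(1/2) < 1/2; the bound exp(-1) makes |ln
   eps| >= 1. The constant is the sum of those for the error and for the count of nodes. *)
exists (Num.min (1 / 100) (expR (- 1))), (`|CC| + 54); split.
- by rewrite lt_min expR_gt0 andbT; lra.
- by rewrite gt_min; apply/orP; left; lra.
- by have := normr_ge0 CC; lra.
move=> eps f u e0; rewrite le_min => /andP[e100 ee] hf sol dec h Mx My h0 h1 idX idY X Y M uI uh hI gal.
have e4 : 4 * eps < 1 by lra.
have e4' : 4 * Num.sqrt eps < 1 / 2.
  have : Num.sqrt eps <= 1 / 10.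
    have -> : 1 / 10 = Num.sqrt ((1 / 10) ^+ 2) :> R by rewrite sqrtr_sqr ger0_norm//; lra.
    by apply: ler_wsqrtr; apply: (le_trans e100); lra.
  lra.
have l1 : 1 <= `|ln eps|.
  have : ln eps <= -1 by rewrite -[leRHS]expRK ler_ln// posrE ?expR_gt0.
  by move=> q; rewrite ler0_norm; lra.
have r1 : 1 <= `|ln eps| `^ (1 / 2) by rewrite div1r powR12_sqrt// -[leLHS]sqrtr1 ler_wsqrtr.
have r0 : 0 <= `|ln eps| `^ (1 / 2) by exact: powR_ge0.
have h20 := sqr_ge0 h.
split.
  rewrite (energy_normE hdelta hrho h0 h1 e0 e4 e4' idX idY hI gal) lee_fin.
  apply: (le_trans (Nrm_w hbeta hgamma hdelta hrho bd bbx bc' MB1 hMB hMbx hMc hg bE cE h0 h1 e0 e4 e4' idX idY sol dec hI gal)).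
  rewrite -/K -/CC; apply: (@le_trans _ _ ((`|CC| + 54) * h ^+ 2)).
    by rewrite ler_wpM2r//; apply: (le_trans (ler_norm _)); rewrite lerDl.
  by rewrite ler_peMr// mulr_ge0// addr_ge0.
have mp := mesh_points rho h0 h1 e0 e4 e4' idX idY l1; rewrite -/X -/Y -/M in mp.
have M0 : 0 < M%:R :> R by rewrite ltr0n muln_gt0 /X /Y x_size y_size.
have -> : `|ln eps| `^ (5 / 2) = `|ln eps| ^+ 2 * `|ln eps| `^ (1 / 2).
  have -> : (5 / 2 : R) = 2%:R + 1 / 2 by field.
  by rewrite powRD ?powR_mulrn//; apply/implyP => _; rewrite gt_eqF//; apply: lt_le_trans l1.
rewrite mulrA; apply: ler_wpM2r => //.
rewrite div1r mulrAC ler_pdivlMr// mulrC; apply: (le_trans mp).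
by rewrite ler_wpM2r ?sqr_ge0// lerDr.
Qed.
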